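(* Let $L\ge 2$ be an integer and let $m$ be an analytic function on $\mathbb{C}\setminus([-\mu_0,\mu_0]\cup i\mathbb{R})$ satisfying: (M.1) $m(z)=\overline{m(\overline z)}$, $\dfrac{\operatorname{Im} m(z)}{\operatorname{Im} z}>0$ on $\mathbb{C}\setminus(\mathbb{R}\cup i\mathbb{R})$, and $\dfrac{m(x)-m(-x)}{x}>0$ for $x\in\mathbb{R}$ with $|x|>\mu_0$; (M.2) there are constants $m_k$ with $m(z)=z+\sum_{1\le k\le L-2}m_kz^{-k}+O(z^{-L+1})$ as $z\to\infty$ in $D_-$. Then the vector symbol $\boldsymbol m(z)=(1,\,m(z)/z)$ belongs to $\boldsymbol A^{inv}_{L,+}(C)$, and its $m$-function is $m_{\boldsymbol m}=m$.
   Context: Curve and Hardy spaces. Fix $\lambda_0<0$, $\mu_0=\sqrt{-\lambda_0}$, an odd integer $n\ge1$, and a smooth even function $\omega:\mathbb{R}\to(0,\infty)$ with $\omega(y)=O(|y|^{-(n-1)})$ as $|y|\to\infty$. Put $C=\{\pm\omega(y)+iy:\ y\in\mathbb{R}\}$, $D_+=\{|\operatorname{Re}z|<\omega(\operatorname{Im}z)\}$, $D_-=\{|\operatorname{Re}z|>\omega(\operatorname{Im}z)\}$; $C$ is oriented anticlockwise as the boundary of $D_+$, and $[-\mu_0,\mu_0]\subset D_+$. Standing regularity assumptions on $C$: $\sup_{z\in C}\int_{\lambda\in C,|\lambda-z|\le1}|d\lambda|<\infty$, and there are a neighbourhood $U$ of $\overline{D_+}$ and $\epsilon>0$ such that for $z,\lambda\in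 C$ with $|z-\lambda|\le\epsilon$ the segment from $\lambda$ to $z$ lies in $U$. $H(D_\pm)$ is the closure in $L^2(C)=L^2(C,|d\lambda|)$ of the rational functions in $L^2(C)$ with no poles in $D_\pm$; its elements extend analytically to $D_\pm$, and $L^2(C)=H(D_+)\oplus H(D_-)$ (not necessarily orthogonal) with projections $\mathfrak p_{\pm}u(z)=\pm\frac1{2\pi i}\int_C\frac{u(\lambda)}{\lambda-z}d\lambda$, $z\in D_\pm$. For an integer $N\ge0$, $H_N(D_+)=(z-b)^NH(D_+)$ with $b\in D_-$ (independent of $b$), normed by $\|u\|_N^2=\int_C|u(\lambda)|^2|\lambda|^{-2N}|d\lambda|$. Toeplitz operators. $A_L(C)$ is the set of bounded functions $a$ on $C$ for which there is a bounded analytic $f$ on $D_+$ with $\lambda^L(a(\lambda)-f(\lambda))$ bounded on $C$. For $a\in A_L(C)$, $0\le N\le L$, $u\in H_N(D_+)$: $T(a)u=fu+\mathfrak p_+((a-f)u)\in H_N(D_+)$ (independent of $f$). For a function $u$, $u_e(z)=\frac12(u(z)+u(-z))$, $u_o(z)=\frac12(u(z)-u(-z))$. $\boldsymbol A_L(C)$ is the set of $\boldsymbol a=(a_1,a_2)$ with $a_1,a_2\in A_L(C)$; $\boldsymbol a u:=a_1u_e+a_2u_o$, $T(\boldsymbol a)u:=T(a_1)u_e+T(a_2)u_o$, and for a scalar function $g$, $g\boldsymbol a=(ga_1,ga_2)$. $\boldsymbol A_L^{inv}(C)=\{\boldsymbol a\in\boldsymbol A_L(C): T(\boldsymbol a)\text{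 is invertible on }H_L(D_+)\}$. $m$-function. For $\boldsymbol a\in\boldsymbol A_L^{inv}(C)$, $L\ge2$, put $u=T(\boldsymbol a)^{-1}1\in H_1(D_+)$, $v=T(\boldsymbol a)^{-1}z\in H_2(D_+)$, $\varphi_{\boldsymbol a}=\boldsymbol a u-1\in H(D_-)$, $\psi_{\boldsymbol a}=\boldsymbol a v-z\in H(D_-)$ (extended analytically to $D_-$). $\kappa_1(\boldsymbol a)$ is the constant such that $\varphi_{\boldsymbol a}(z)=\kappa_1(\boldsymbol a)z^{-1}+z^{-1}\phi_{\boldsymbol a}(z)$ with $\phi_{\boldsymbol a}\in H(D_-)$. The $m$-function of $\boldsymbol a$ is $m_{\boldsymbol a}(z)=\frac{z+\psi_{\boldsymbol a}(z)}{1+\varphi_{\boldsymbol a}(z)}+\kappa_1(\boldsymbol a)$, meromorphic on $D_-$; the identity $m_{\boldsymbol m}=m$ is meant on $D_-$. Positivity class. For a rational function $r$ with the same number of zeros and poles (with multiplicity), all lying in $D_-$, the operator $r^{-1}T(r\boldsymbol a)T(\boldsymbol a)^{-1}-I$ on $H_L(D_+)$ has finite rank, and $\tau_{\boldsymbol a}(r):=\det(r^{-1}T(r\boldsymbol a)T(\boldsymbol a)^{-1})$. $r$ is real if $r(z)=\overline{r(\overline z)}$. $\boldsymbol A^{inv}_{L,+}(C)$ is the set of $\boldsymbol a\in\boldsymbol A_L^{inv}(C)$ with $\boldsymbol a(\lambda)=\overline{\boldsymbol a(\overline\lambda)}$ on $C$ and $\tau_{\boldsymbol a}(r)\ge0$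 for every real such $r$. *)

(* Defs.v *)
From HB Require Import structures.
From mathcomp Require Import all_boot all_order all_algebra.
From mathcomp Require Import complex.
From mathcomp Require Import all_classical all_reals all_analysis.

Set Implicit Arguments.
Unset Strict Implicit.
Unset Printing Implicit Defensive.

Import Order.TTheory GRing.Theory Num.Theory.
Import numFieldNormedType.Exports.

Local Open Scope classical_set_scope.
Local Open Scope ring_scope.
Local Open Scope complex_scope.

Import Normc.

(* Functions on the curve are represented by total functions R[i] -> R[i], of
   which only the values on the curve matter, up to equality almost everywhere
   for arclength.  The regular module R[i]^o carries the topology of R[i], and
   [derivable] on it is complex differentiability. *)

Section Curve.
Context {R : realType}.
Implicit Types (omega : R -> R) (z l : R[i]) (u v w f g h : R[i] -> R[i]).

Definition analytic_on (D : set R[i]) f : Prop :=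
  forall z, D z -> derivable (f : R[i]^o -> R[i]^o) z 1.

Definition smooth (g : R -> R) : Prop :=
  forall (k : nat) (y : R), derivable (derive1n k g) y 1.

Definition curve_pt omega (right : bool) (y : R) : R[i] :=
  (if right then omega y else - omega y) +i* y.

Definition curve omega : set R[i] :=
  [set z | exists (s : bool) (y : R), z = curve_pt omega s y].

Definition Dplus omega : set R[i] :=
  [set z | `|complex.Re z| < omega (complex.Im z)].

Definition Dminus omega : set R[i] :=
  [set z | omega (complex.Im z) < `|complex.Re z|].

Definition arc_speed omega (y : R) : R := Num.sqrt (1 + derive1 omega y ^+ 2).

(* The integral of g against |d lambda|. *)
Definition arc_integral omega (g : R[i] -> R) : \bar R :=
  (\int[@lebesgue_measure R]_y (g (curve_pt omega true y) * arc_speed omega y)%:E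
   + \int[@lebesgue_measure R]_y
       (g (curve_pt omega false y) * arc_speed omega y)%:E)%E.

(* [arc_speed] is at least 1, so arclength-null sets are exactly the images of
   Lebesgue-null sets of parameters. *)
Definition ae_curve omega (P : R[i] -> Prop) : Prop :=
  forall s : bool, {ae @lebesgue_measure R, forall y, P (curve_pt omega s y)}.

Definition eq_curve omega u v : Prop := ae_curve omega (fun l => u l = v l).

Definition measurable_curve omega u : Prop :=
  forall s : bool,
    measurable_fun setT (fun y => complex.Re (u (curve_pt omega s y))) /\
    measurable_fun setT (fun y => complex.Im (u (curve_pt omega s y))).

(* ||u||_N ^ 2; N = 0 is the norm of L^2(C). *)
Definition sqnorm omega (N : nat) u : \bar R :=
  arc_integral omega (fun l => normc (u l) ^+ 2 * normc l ^- (2 * N)%N).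

Definition L2_curve omega u : Prop :=
  measurable_curve omega u /\ (sqnorm omega 0 u < +oo)%E.

Definition ratfun (p q : {poly R[i]}) : R[i] -> R[i] := fun z => p.[z] / q.[z].

(* H(D): the closure in L^2(C) of the rational functions in L^2(C) without
   poles in D. *)
Definition hardy omega (D : set R[i]) u : Prop :=
  L2_curve omega u /\
  forall e : R, 0 < e ->
    exists p q : {poly R[i]},
      [/\ q != 0, coprimep p q, (forall z, D z -> ~~ root q z),
          L2_curve omega (ratfun p q) &
          (sqnorm omega 0 (fun l => (u l - ratfun p q l)%R) < e%:E)%E].

Definition integralC (g : R -> R[i]) : R[i] :=
  (\int[@lebesgue_measure R]_y complex.Re (g y)) +i*
  (\int[@lebesgue_measure R]_y complex.Im (g y)).

(* Anticlockwise around D_+: upwards on the right branch, downwards on the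
   left one. *)
Definition contour_integral omega g : R[i] :=
  integralC (fun y => g (curve_pt omega true y) * (derive1 omega y +i* 1))
  - integralC (fun y => g (curve_pt omega false y) * (- derive1 omega y +i* 1)).

(* The analytic extension to D_- of an element u of H(D_-): since u = p_- u,
   it is given by the Cauchy integral. *)
Definition ext_minus omega u z : R[i] :=
  - ((2 * pi)%:C * 'i)^-1 * contour_integral omega (fun l => u l / (l - z)).

(* L^2(C) = H(D_+) (+) H(D_-), a standing property of the curve: the length and
   segment conditions of [curve_setup] alone do not bound the Cauchy integral on
   L^2(C). *)
Definition hardy_decomposition omega : Prop :=
  (forall u, L2_curve omega u ->
     exists up um, [/\ hardy omega (Dplus omega) up,
                       hardy omega (Dminus omega) um &
                       eq_curve omega u (fun l => up l + um l)]) /\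
  (forall u, hardy omega (Dplus omega) u -> hardy omega (Dminus omega) u ->
     eq_curve omega u (fun=> 0)).

(* h = p_+ u, the projection onto H(D_+) along H(D_-). *)
Definition is_proj_plus omega u h : Prop :=
  hardy omega (Dplus omega) h /\ hardy omega (Dminus omega) (fun l => u l - h l).

Record curve_setup (mu0 : R) (n : nat) omega : Prop := CurveSetup {
  curve_smooth : smooth omega ;
  curve_gt0 : forall y, 0 < omega y ;
  curve_even : forall y, omega (- y) = omega y ;
  curve_decay : exists K r : R,
    forall y, r <= `|y| -> omega y <= K * `|y| ^- (n.-1) ;
  curve_interval : forall x : R, `|x| <= mu0 -> Dplus omega x%:C ;
  curve_length : exists K : R, forall z, curve omega z ->
    (arc_integral omega (fun l => (if normc (l - z) <= 1 then 1 else 0)%R)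
       <= K%:E)%E ;
  curve_segment : exists (U : set R[i]) (e : R),
    [/\ forall z, closure (Dplus omega : set R[i]^o) z ->
          nbhs (z : R[i]^o) U,
        0 < e &
        forall z l, curve omega z -> curve omega l -> normc (z - l) <= e ->
          forall t : R, 0 <= t <= 1 -> U ((1 - t)%:C * l + t%:C * z)]
}.

Definition hardyN omega (N : nat) u : Prop :=
  measurable_curve omega u /\
  exists b h, [/\ Dminus omega b, hardy omega (Dplus omega) h &
                  eq_curve omega u (fun l => (l - b) ^+ N * h l)].

(* Nontangential approach region in D_+ at the point l of the curve. *)
Definition stolz omega (alpha : R) l : set R[i] :=
  [set z | Dplus omega z /\
           forall c, curve omega c -> normc (z - l) <= alpha * normc (z - c)].

(* On the curve, f takes its nontangential boundary values from D_+. *)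
Definition boundary_values omega f : Prop :=
  measurable_curve omega f /\
  ae_curve omega (fun l => forall alpha : R,
    (f : R[i]^o -> R[i]^o) @ within (stolz omega alpha l) (nbhs (l : R[i]^o))
      --> (f l : R[i]^o)).

(* f is an admissible analytic part of the symbol a in the definition of
   A_L(C). *)
Definition analytic_part omega (L : nat) (a f : R[i] -> R[i]) : Prop :=
  [/\ analytic_on (Dplus omega) f,
      exists K : R, forall z, Dplus omega z -> normc (f z) <= K,
      boundary_values omega f &
      exists K : R, forall l, curve omega l ->
        normc (l ^+ L * (a l - f l)) <= K].

Definition symbol_class omega (L : nat) (a : R[i] -> R[i]) : Prop :=
  [/\ measurable_curve omega a,
      exists K : R, forall l, curve omega l -> normc (a l) <= K &
      exists f, analytic_part omega L a f].

(* The graph of u |-> T(a)u = f u + p_+((a - f) u). *)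
Definition toeplitz omega (L : nat) (a u w : R[i] -> R[i]) : Prop :=
  exists f h, [/\ analytic_part omega L a f,
    is_proj_plus omega (fun l => (a l - f l) * u l) h &
    eq_curve omega w (fun l => f l * u l + h l)].

Definition even_part u : R[i] -> R[i] := fun z => (u z + u (- z)) / 2.
Definition odd_part u : R[i] -> R[i] := fun z => (u z - u (- z)) / 2.

Definition vsymbol : Type := ((R[i] -> R[i]) * (R[i] -> R[i]))%type.

Definition vsymbol_act (a : vsymbol) u : R[i] -> R[i] :=
  fun z => a.1 z * even_part u z + a.2 z * odd_part u z.

Definition vsymbol_scale g (a : vsymbol) : vsymbol :=
  ((fun z => g z * a.1 z), (fun z => g z * a.2 z)).

Definition vsymbol_class omega (L : nat) (a : vsymbol) : Prop :=
  symbol_class omega L a.1 /\ symbol_class omega L a.2.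

(* The graph of u |-> T(a)u for a vector symbol. *)
Definition vtoeplitz omega (L : nat) (a : vsymbol) u w : Prop :=
  exists w1 w2, [/\ toeplitz omega L a.1 (even_part u) w1,
    toeplitz omega L a.2 (odd_part u) w2 &
    eq_curve omega w (fun l => w1 l + w2 l)].

(* T(a) is an everywhere defined bijection of H_L(D_+), modulo equality a.e.,
   with bounded inverse. *)
Definition vtoeplitz_invertible omega (L : nat) (a : vsymbol) : Prop :=
  [/\ forall u, hardyN omega L u ->
        exists2 w, hardyN omega L w & vtoeplitz omega L a u w,
      forall w, hardyN omega L w ->
        exists2 u, hardyN omega L u & vtoeplitz omega L a u w,
      forall u1 u2 w1 w2,
        hardyN omega L u1 -> hardyN omega L u2 ->
        hardyN omega L w1 -> hardyN omega L w2 ->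
        vtoeplitz omega L a u1 w1 -> vtoeplitz omega L a u2 w2 ->
        (eq_curve omega u1 u2 <-> eq_curve omega w1 w2) &
      exists K : R, forall u w, hardyN omega L u -> hardyN omega L w ->
        vtoeplitz omega L a u w ->
        (sqnorm omega L u <= K%:E * sqnorm omega L w)%E].

Definition vsymbol_inv omega (L : nat) (a : vsymbol) : Prop :=
  vsymbol_class omega L a /\ vtoeplitz_invertible omega L a.

(* t is the determinant of the operator A on the space H of functions modulo
   equality a.e., where A - I has finite rank: A acts by the matrix M on the
   span of the independent family e, which contains the range of A - I. *)
Definition is_finite_rank_det omega (H : (R[i] -> R[i]) -> Prop)
    (A : (R[i] -> R[i]) -> (R[i] -> R[i]) -> Prop) (t : R[i]) : Prop :=
  exists (k : nat) (e : 'I_k -> R[i] -> R[i]) (M : 'M[R[i]]_k),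
    [/\ forall i, H (e i),
        forall c : 'I_k -> R[i],
          eq_curve omega (fun l => \sum_i c i * e i l) (fun=> 0) ->
          forall i, c i = 0,
        forall w, H w -> exists x, A w x,
        forall w x, H w -> A w x -> exists c : 'I_k -> R[i],
          eq_curve omega (fun l => x l - w l) (fun l => \sum_i c i * e i l) &
        (forall i x, A (e i) x ->
           eq_curve omega x (fun l => \sum_j M i j * e j l)) /\
        t = \det M].

(* The graph of r^-1 T(r a) T(a)^-1 on H_L(D_+). *)
Definition tau_operator omega (L : nat) (a : vsymbol) (r w x : R[i] -> R[i]) :
    Prop :=
  exists u v, [/\ hardyN omega L u, vtoeplitz omega L a u w,
    hardyN omega L v, vtoeplitz omega L (vsymbol_scale r a) u v &
    eq_curve omega x (fun l => (r l)^-1 * v l)].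

Definition is_tau omega (L : nat) (a : vsymbol) r (t : R[i]) : Prop :=
  is_finite_rank_det omega (hardyN omega L) (tau_operator omega L a r) t.

(* p / q is in lowest terms, has as many zeros as poles, and all of them lie in
   D_-. *)
Definition balanced_rat omega (p q : {poly R[i]}) : Prop :=
  [/\ p != 0, q != 0, coprimep p q, size p = size q &
      forall z, root p z || root q z -> Dminus omega z].

(* In the partial order of R[i], 0 <= t says that t is real and nonnegative. *)
Definition vsymbol_inv_plus omega (L : nat) (a : vsymbol) : Prop :=
  [/\ vsymbol_inv omega L a,
      forall l, curve omega l -> a.1 l = (a.1 l^*)^* /\ a.2 l = (a.2 l^*)^* &
      forall p q, balanced_rat omega p q ->
        (forall z, ratfun p q z = (ratfun p q z^*)^*) ->
        exists2 t, is_tau omega L a (ratfun p q) t & 0 <= t].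

(* F coincides on D_- with the m-function of a, a quotient of analytic functions
   on D_- whose denominator vanishes identically on neither component. *)
Definition is_mfunction omega (L : nat) (a : vsymbol) (F : R[i] -> R[i]) :
    Prop :=
  exists u v (kappa : R[i]),
  let phi := fun l => vsymbol_act a u l - 1 in
  let psi := fun l => vsymbol_act a v l - l in
  [/\ hardyN omega 1 u /\ vtoeplitz omega L a u (fun=> 1),
      hardyN omega 2 v /\ vtoeplitz omega L a v (fun l => l),
      hardy omega (Dminus omega) phi /\ hardy omega (Dminus omega) psi,
      exists2 phi1, hardy omega (Dminus omega) phi1 &
        eq_curve omega phi (fun l => kappa * l^-1 + l^-1 * phi1 l) &
      Dminus omega `<=` closure ([set z | Dminus omega z /\
                                    1 + ext_minus omega phi z != 0] : set R[i]^o)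
      /\
      forall z, Dminus omega z -> 1 + ext_minus omega phi z != 0 ->
        F z = (z + ext_minus omega psi z) / (1 + ext_minus omega phi z) + kappa].

Definition m_domain (mu0 : R) : set R[i] :=
  [set z | complex.Re z != 0 /\
           ~ (complex.Im z = 0 /\ `|complex.Re z| <= mu0)].

Record m_positivity (mu0 : R) (m : R[i] -> R[i]) : Prop := MPositivity {
  m_real : forall z, m_domain mu0 z -> m z = (m z^*)^* ;
  m_herglotz : forall z, complex.Re z != 0 -> complex.Im z != 0 ->
    0 < complex.Im (m z) / complex.Im z ;
  m_real_axis : forall x : R, mu0 < `|x| ->
    0 < (m x%:C - m (- x)%:C) / x%:C
}.

Definition m_asymptotics omega (L : nat) (m : R[i] -> R[i]) : Prop :=
  exists (c : nat -> R[i]) (K r : R), forall z, Dminus omega z ->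
    r <= normc z ->
    normc (m z - z - \sum_(1 <= k < L.-1) c k * z ^- k) <= K * normc z ^- L.-1.

Definition m_symbol (m : R[i] -> R[i]) : vsymbol := ((fun=> 1), (fun z => m z / z)).

End Curve.

(* Main.v *)
(* The bilinear pairing (u, v) |-> int_C u v dl vanishes on H(D_+) x H(D_+) and on
   H(D_-) x H(D_-), so each Hardy space is its own annihilator, and T(a) u = w
   just says that a u - w annihilates the test functions of D_-.

   For the symbol (1, m(z)/z) the odd part of this condition is
   q u_o - w_o in H(D_-), up to terms in H(D_-), where q is the even part of m(z)/z.
   Since m is Herglotz, q has no zero on D_-, and 1/q is a symbol of the same
   kind; this inverts T, and the images of 1 and z are explicit enough to
   recognize m in the m-function.

   For r = p/q with p, q of degree k, r^-1 T(r m) T(m)^-1 - I has its range in the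
   functions U / (p(z) p(-z)) with deg U < 2k.  If X_Q denotes the matrix of
   U |-> (U_e + (U_o/z) m) mod Q, where m is replaced by a Hermite interpolant at
   the roots of Q, then tau(r) = det X_{q(z)p(-z)} / det X_{p(z)p(-z)}.

   It remains to see that det X_Q >= 0 for real Q of degree 2k with roots in D_-,
   and for this that det (t + X_Q) <> 0 for t > 0.  A vector in the kernel gives
   real polynomials A, B with A(z^2) + B(z^2) M(z) = Q(z) h(z), M(z) = m(z) + t z
   and h analytic where m is.  In the variable s with s^2 = z^2 - mu0^2, Re s > 0,
   let N_+(s) = M(z), N_-(s) = - M(-z) and integrate
   G(s) = s (A + B N_+) (A - B N_-) / ((N_+ + N_-) Q(z) Q(-z)).
   Along the imaginary axis the Herglotz property makes the imaginary part of
   G ds nonnegative, and positive somewhere unless B = 0.  The path can be moved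
   to a parabola with the zeros of Q(z) Q(-z) on its right, where
   G = s h(z) h(-z) / (N_+ + N_-) is nevertheless analytic and O(s^-2), so that the
   integral is zero.  As N_+ and N_- need not have boundary values, they are
   first composed with s |-> (s + d) / (1 + d s), and d tends to 0 on the
   parabola.  Hence B = 0, and then A = 0 by degree. *)

Require Import Defs.
From HB Require Import structures.
From mathcomp Require Import all_boot all_order all_algebra.
From mathcomp Require Import complex.
From mathcomp Require Import all_classical all_reals all_analysis.
From mathcomp Require Import measurable_realfun.
From mathcomp Require Import zify ring lra.
From mathcomp Require polyrcf.

Set Implicit Arguments.
Unset Strict Implicit.
Unset Printing Implicit Defensive.

Import Order.TTheory GRing.Theory Num.Theory.
Import numFieldNormedType.Exports.
Import Normc.

Local Open Scope classical_set_scope.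
Local Open Scope ring_scope.
Local Open Scope complex_scope.

(** * Complex differentiation and contour integrals *)

(** No boundary-value theory is developed for Hardy functions: test functions are differentiable on
    the closed side of the curve, and each contour integral reduces to Goursat's theorem on a patch
    swept by segments. A bounded inverse of T needs a bounded projection, whereas the decomposition
    of L^2(C) is only algebraic; the bound comes from a gliding hump, using that the transpose of
    the projection for the pairing is its complement. In the positivity, t has two roles: a negative
    determinant gives a positive root of det (t + X), and t z makes m strictly Herglotz, Im M / Im z
    >= t, which bounds the integrand below. The path is a parabola because it must stay left of the
    zeros of Q(z) Q(-z), and yet Re s must tend to infinity along it, since the asymptotics of m are
    known in D_- only. Degrees leave O(s^-3) for the regularized branches, which are bounded,
    against edges of length O(Y^2) between axis and parabola, and O(s^-2) for the true branches. *)

Section ComplexDiff.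
Context {R : realType}.
Local Notation C := R[i].
Implicit Types (z w h d : C) (f g : C -> C).

Lemma normc_ge0 z : 0 <= normc z.
Proof. by case: z => a b /=; exact: sqrtr_ge0. Qed.

Lemma normcE z : `|z| = (normc z)%:C.
Proof. by case: z => a b; rewrite normc_def. Qed.

Lemma normc_eq0 z : (normc z == 0) = (z == 0).
Proof.
apply/eqP/eqP => [/eq0_normc //|->]; exact: normc0.
Qed.

Lemma normc_gt0 z : (0 < normc z) = (z != 0).
Proof. by rewrite lt_neqAle normc_ge0 andbT eq_sym normc_eq0. Qed.

Lemma normcB z w : normc (z - w) <= normc z + normc w.
Proof. by rewrite (le_trans (le_normcD _ _)) // normcN. Qed.

Lemma normc_distC z w : normc (z - w) = normc (w - z).
Proof. by rewrite -normcN opprB. Qed.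

Lemma normc_tri z w : normc z - normc w <= normc (z - w).
Proof.
rewrite lerBlDr; apply: le_trans (le_normcD _ _).
by rewrite subrK.
Qed.

Lemma normc_real (x : R) : normc x%:C = `|x|.
Proof. by rewrite /normc /= expr0n addr0 sqrtr_sqr. Qed.

Lemma normcX z n : normc (z ^+ n) = normc z ^+ n.
Proof.
elim: n => [|n IH]; first by rewrite !expr0 normc1.
by rewrite !exprS normcM IH.
Qed.

Lemma normc_sqr z : normc z ^+ 2 = complex.Re z ^+ 2 + complex.Im z ^+ 2.
Proof.
by case: z => a b /=; rewrite sqr_sqrtr // addr_ge0 // sqr_ge0.
Qed.

Lemma ler_normRe z : `|complex.Re z| <= normc z.
Proof.
case: z => a b /=; rewrite -sqrtr_sqr ler_sqrt ?addr_ge0 ?sqr_ge0 //.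
by rewrite lerDl sqr_ge0.
Qed.

Lemma ler_normIm z : `|complex.Im z| <= normc z.
Proof.
case: z => a b /=; rewrite -sqrtr_sqr ler_sqrt ?addr_ge0 ?sqr_ge0 //.
by rewrite lerDr sqr_ge0.
Qed.

Lemma normc_le_ReIm z : normc z <= `|complex.Re z| + `|complex.Im z|.
Proof.
case: z => a b /=.
rewrite -[leRHS](@ger0_norm _ (`|a| + `|b|)) ?addr_ge0 // -sqrtr_sqr.
rewrite ler_sqrt ?sqr_ge0 // sqrrD !real_normK ?num_real //.
by rewrite -addrA (addrC (_ *+ 2)) addrA lerDl mulrn_wge0 // mulr_ge0.
Qed.

Lemma normcJ z : normc z^* = normc z.
Proof. by case: z => a b /=; rewrite sqrrN. Qed.

Arguments normc : simpl never.

Lemma ReD z w : complex.Re (z + w) = complex.Re z + complex.Re w.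
Proof. by case: z w => [a b] [c e]. Qed.
Lemma ImD z w : complex.Im (z + w) = complex.Im z + complex.Im w.
Proof. by case: z w => [a b] [c e]. Qed.
Lemma ReN z : complex.Re (- z) = - complex.Re z.
Proof. by case: z. Qed.
Lemma ImN z : complex.Im (- z) = - complex.Im z.
Proof. by case: z. Qed.
Lemma ReM z w : complex.Re (z * w) =
  complex.Re z * complex.Re w - complex.Im z * complex.Im w.
Proof. by case: z w => [a b] [c e]. Qed.
Lemma ImM z w : complex.Im (z * w) =
  complex.Re z * complex.Im w + complex.Im z * complex.Re w.
Proof. by case: z w => [a b] [c e]. Qed.
Lemma complexP z w : complex.Re z = complex.Re w ->
  complex.Im z = complex.Im w -> z = w.
Proof. by case: z w => [a b] [c e] /= -> ->. Qed.

(** Real epsilons and [normc] are used because the topology of [R[i]^o] is indexed by epsilons in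
    [R[i]]. The estimate is not divided by [h], so [h = 0] needs no exclusion. *)
Definition cdiff_at f z d := forall e : R, 0 < e -> exists2 r : R, 0 < r &
  forall h, normc h < r -> normc (f (z + h) - f z - d * h) <= e * normc h.

Definition cdiff f z := exists d, cdiff_at f z d.

Definition ccont f z := forall e : R, 0 < e -> exists2 r : R, 0 < r &
  forall h, normc h < r -> normc (f (z + h) - f z) < e.

Lemma cdiff_at_bound f z d : cdiff_at f z d -> exists2 r : R, 0 < r &
  forall h, normc h < r -> normc (f (z + h) - f z) <= (normc d + 1) * normc h.
Proof.
move=> /(_ 1 ltr01)[r r0 H]; exists r => // h hr.
have -> : f (z + h) - f z = (f (z + h) - f z - d * h) + d * h by ring.
rewrite (le_trans (le_normcD _ _)) // normcM.
by have := H h hr; lra.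
Qed.

Lemma cdiff_ccont f z : cdiff f z -> ccont f z.
Proof.
move=> [d /cdiff_at_bound[r r0 H]] e e0.
have D0 : 0 < normc d + 1 by rewrite ltr_wpDl ?normc_ge0.
exists (Num.min r (e / (normc d + 1))).
  by rewrite lt_min r0 divr_gt0.
move=> h; rewrite lt_min => /andP[hr he].
apply: le_lt_trans (H h hr) _.
by rewrite mulrC -ltr_pdivlMr.
Qed.

Lemma cdiff_at_ext f g z d (r : R) : 0 < r ->
  (forall h, normc h < r -> f (z + h) = g (z + h)) ->
  cdiff_at f z d -> cdiff_at g z d.
Proof.
move=> r0 fg Hf e e0; have [r' r'0 H] := Hf e e0.
exists (Num.min r r'); first by rewrite lt_min r0.
move=> h; rewrite lt_min => /andP[hr hr'].
have := fg 0; rewrite normc0 addr0 => /(_ r0) <-.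
by rewrite -fg // H.
Qed.

Lemma cdiff_ext f g z (r : R) : 0 < r ->
  (forall h, normc h < r -> f (z + h) = g (z + h)) ->
  cdiff f z -> cdiff g z.
Proof. by move=> r0 fg [d Hd]; exists d; exact: cdiff_at_ext fg Hd. Qed.

Lemma ccont_ext f g z (r : R) : 0 < r ->
  (forall h, normc h < r -> f (z + h) = g (z + h)) ->
  ccont f z -> ccont g z.
Proof.
move=> r0 fg Hf e e0; have [r' r'0 H] := Hf e e0.
exists (Num.min r r'); first by rewrite lt_min r0.
move=> h; rewrite lt_min => /andP[hr hr'].
have := fg 0; rewrite normc0 addr0 => /(_ r0) <-.
by rewrite -fg // H.
Qed.

Lemma cdiff_at_cst c z : cdiff_at (fun=> c) z 0.
Proof.
by move=> e e0; exists 1 => // h _; rewrite subrr mul0r subrr normc0 mulr_ge0 ?normc_ge0 // ltW.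
Qed.

Lemma cdiff_at_id z : cdiff_at id z 1.
Proof.
move=> e e0; exists 1 => // h _.
have -> : z + h - z - 1 * h = 0 by ring.
by rewrite normc0 mulr_ge0 ?normc_ge0 // ltW.
Qed.

Lemma cdiff_at_add f g z d d' : cdiff_at f z d -> cdiff_at g z d' ->
  cdiff_at (fun w => f w + g w) z (d + d').
Proof.
move=> Hf Hg e e0.
have e2 : 0 < e / 2 by rewrite divr_gt0.
have [r r0 H] := Hf _ e2; have [r' r'0 H'] := Hg _ e2.
exists (Num.min r r'); first by rewrite lt_min r0.
move=> h; rewrite lt_min => /andP[hr hr'].
have -> : f (z + h) + g (z + h) - (f z + g z) - (d + d') * h =
  (f (z + h) - f z - d * h) + (g (z + h) - g z - d' * h) by ring.
rewrite (le_trans (le_normcD _ _)) //.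
by have := H h hr; have := H' h hr'; lra.
Qed.

Lemma cdiff_at_mul f g z d d' : cdiff_at f z d -> cdiff_at g z d' ->
  cdiff_at (fun w => f w * g w) z (d * g z + f z * d').
Proof.
move=> Hf Hg e e0.
have [rb rb0 Hb] := cdiff_at_bound Hf.
set K := normc (g z) + normc (f z) + (normc d + 1) * (normc d' + 1) + 1.
have P : 0 <= (normc d + 1) * (normc d' + 1).
  by rewrite mulr_ge0 // addr_ge0 ?normc_ge0.
have K0 : 0 < K by rewrite ltr_wpDl // !addr_ge0 ?normc_ge0.
have e1 : 0 < e / K by rewrite divr_gt0.
have [r r0 H] := Hf _ e1; have [r' r'0 H'] := Hg _ e1.
have [rc rc0 Hc] := cdiff_at_bound Hg.
exists (Num.min (Num.min r r') (Num.min (Num.min rb rc) (e / K))).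
  by rewrite !lt_min r0 r'0 rb0 rc0 e1.
move=> h; rewrite !lt_min => /andP[/andP[hr hr'] /andP[/andP[hb hc] he]].
have -> : f (z + h) * g (z + h) - f z * g z - (d * g z + f z * d') * h =
  (f (z + h) - f z - d * h) * g z + f z * (g (z + h) - g z - d' * h)
  + (f (z + h) - f z) * (g (z + h) - g z) by ring.
rewrite (le_trans (le_normcD _ _)) //.
apply: (@le_trans _ _ (e / K * normc h * normc (g z) +
   normc (f z) * (e / K * normc h) +
   ((normc d + 1) * normc h) * ((normc d' + 1) * normc h))).
  apply: lerD.
    rewrite (le_trans (le_normcD _ _)) // !normcM.
    by apply: lerD; [rewrite ler_wpM2r ?normc_ge0 ?H|
      rewrite ler_wpM2l ?normc_ge0 ?H'].
  by rewrite normcM ler_pM ?normc_ge0 ?Hb ?Hc.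
apply: (@le_trans _ _ (e / K * normc h * normc (g z) +
   normc (f z) * (e / K * normc h) +
   ((normc d + 1) * (normc d' + 1) * normc h * (e / K)))).
  rewrite lerD2l.
  rewrite mulrACA -[leRHS]mulrA ler_wpM2l // ler_wpM2l ?normc_ge0 //.
  exact: ltW.
have -> : e / K * normc h * normc (g z) + normc (f z) * (e / K * normc h) +
  (normc d + 1) * (normc d' + 1) * normc h * (e / K) =
  (K - 1) * (e / K) * normc h by rewrite /K; ring.
rewrite ler_wpM2r ?normc_ge0 // mulrBl mul1r mulrC divfK ?gt_eqF //.
by rewrite gerBl ltW.
Qed.

Lemma cdiff_at_comp f g z d d' : cdiff_at g z d -> cdiff_at f (g z) d' ->
  cdiff_at (fun w => f (g w)) z (d' * d).
Proof.
move=> Hg Hf e e0.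
set D := normc d + 1; set D' := normc d' + 1.
have D0 : 0 < D by rewrite ltr_wpDl ?normc_ge0.
have D'0 : 0 < D' by rewrite ltr_wpDl ?normc_ge0.
have [rb rb0 Hb] := cdiff_at_bound Hg.
have e1 : 0 < e / 2 / D by rewrite !divr_gt0.
have e2 : 0 < e / 2 / D' by rewrite !divr_gt0.
have [r r0 H] := Hf _ e1; have [r' r'0 H'] := Hg _ e2.
exists (Num.min (Num.min rb r') (r / D)).
  by rewrite !lt_min rb0 r'0 divr_gt0.
move=> h; rewrite !lt_min => /andP[/andP[hb hr'] hr].
set k := g (z + h) - g z.
have kb : normc k <= D * normc h by exact: Hb.
have kr : normc k < r.
  by apply: le_lt_trans kb _; rewrite mulrC -ltr_pdivlMr.
have E : f (g (z + h)) = f (g z + k) by congr f; rewrite /k; ring.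
have -> : f (g (z + h)) - f (g z) - d' * d * h =
  (f (g z + k) - f (g z) - d' * k) + d' * (k - d * h) by rewrite E; ring.
rewrite (le_trans (le_normcD _ _)) // normcM.
have H1 := H k kr.
have H2 : normc (k - d * h) <= e / 2 / D' * normc h by exact: H'.
have H3 : e / 2 / D * normc k <= e / 2 * normc h.
  have -> : e / 2 / D * normc k = e / 2 * (normc k / D) by ring.
  apply: ler_wpM2l; first by rewrite ltW // divr_gt0.
  by rewrite ler_pdivrMr // mulrC.
have H4 : normc d' * normc (k - d * h) <= e / 2 * normc h.
  apply: (@le_trans _ _ (D' * (e / 2 / D' * normc h))).
    by apply: ler_pM => //; rewrite ?normc_ge0 // lerDl.
  by rewrite mulrA mulrCA divff ?gt_eqF // mulr1.
by lra.
Qed.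

Lemma cdiff_at_inv z : z != 0 -> cdiff_at (fun w => w^-1) z (- (z^-1 ^+ 2)).
Proof.
move=> z0 e e0.
have n0 : 0 < normc z by rewrite normc_gt0.
pose r := Num.min (normc z / 2) (e * normc z ^+ 3 / 2).
have r0 : 0 < r by rewrite /r lt_min !divr_gt0 // mulr_gt0 // exprn_gt0.
exists r => // h; rewrite lt_min => /andP[h1 h2].
have zh : normc z / 2 <= normc (z + h).
  have := normc_tri z (- h); rewrite opprK normcN; lra.
have zh0 : z + h != 0 by rewrite -normc_gt0; lra.
have -> : (z + h)^-1 - z^-1 - - z^-1 ^+ 2 * h = h * h * (z^-1 ^+ 2 * (z + h)^-1).
  by field; rewrite z0 zh0.
rewrite normcM [normc (h * h)]normcM [normc (_ / (z + h))]normcM normcX.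
rewrite !normcV mulrAC.
rewrite ler_wpM2r ?normc_ge0 //.
have P3 : 0 < (normc z)^-1 ^+ 2 * (normc z / 2)^-1.
  by rewrite mulr_gt0 ?exprn_gt0 ?invr_gt0 ?divr_gt0.
apply: (@le_trans _ _ (normc h * ((normc z)^-1 ^+ 2 * (normc z / 2)^-1))).
  rewrite ler_wpM2l ?normc_ge0 // ler_wpM2l ?exprn_ge0 ?invr_ge0 ?normc_ge0 //.
  by rewrite lef_pV2 // posrE ?divr_gt0 ?normc_gt0.
apply: (@le_trans _ _ (e * normc z ^+ 3 / 2 *
   ((normc z)^-1 ^+ 2 * (normc z / 2)^-1))).
  by rewrite ler_wpM2r // ltW.
rewrite le_eqVlt; apply/orP; left; apply/eqP.
by field; rewrite gt_eqF.
Qed.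

Lemma ccont_mul f g z : ccont f z -> ccont g z -> ccont (fun w => f w * g w) z.
Proof.
move=> H1 H2 e e0.
have [r0 r00 h0] := H2 _ ltr01.
set K := normc (f z) + normc (g z) + 2.
have K0 : 0 < K by rewrite /K ltr_wpDl // addr_ge0 ?normc_ge0.
have e2 : 0 < e / 2 / K by rewrite !divr_gt0.
have [r1 r10 h1] := H1 _ e2; have [r2 r20 h2] := H2 _ e2.
exists (Num.min r0 (Num.min r1 r2)); first by rewrite !lt_min r10 r20 r00.
move=> t; rewrite !lt_min => /andP[/h0 t0 /andP[/h1 t1 /h2 t2]].
have -> : f (z + t) * g (z + t) - f z * g z =
  (f (z + t) - f z) * g (z + t) + f z * (g (z + t) - g z) by ring.
apply: le_lt_trans (le_normcD _ _) _; rewrite !normcM.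
have ht : normc (g (z + t)) <= K.
  have := normc_tri (g (z + t)) (g z); rewrite /K; have := normc_ge0 (f z); lra.
have gy : normc (f z) <= K by rewrite /K; have := normc_ge0 (g z); lra.
have A : normc (f (z + t) - f z) * normc (g (z + t)) < e / 2.
  apply: (@le_lt_trans _ _ (normc (f (z + t) - f z) * K)).
    by rewrite ler_wpM2l ?normc_ge0.
  by rewrite -ltr_pdivlMr.
have B : normc (f z) * normc (g (z + t) - g z) < e / 2.
  apply: (@le_lt_trans _ _ (K * normc (g (z + t) - g z))).
    by rewrite ler_wpM2r ?normc_ge0.
  by rewrite mulrC -ltr_pdivlMr.
lra.
Qed.

Lemma cdiff_cst c z : cdiff (fun=> c) z.
Proof. by exists 0; exact: cdiff_at_cst. Qed.
Lemma cdiff_id z : cdiff (fun w => w) z.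
Proof. by exists 1; exact: cdiff_at_id. Qed.
Lemma cdiff_add f g z : cdiff f z -> cdiff g z -> cdiff (fun w => f w + g w) z.
Proof. by move=> [d H] [d' H']; exists (d + d'); exact: cdiff_at_add. Qed.
Lemma cdiff_mul f g z : cdiff f z -> cdiff g z -> cdiff (fun w => f w * g w) z.
Proof. by move=> [d H] [d' H']; eexists; exact: (cdiff_at_mul H H'). Qed.
Lemma cdiff_comp f g z : cdiff g z -> cdiff f (g z) ->
  cdiff (fun w => f (g w)) z.
Proof. by move=> [d H] [d' H']; eexists; exact: (cdiff_at_comp H H'). Qed.
Lemma cdiff_opp f z : cdiff f z -> cdiff (fun w => - f w) z.
Proof.
move=> H; apply: (@cdiff_ext (fun w => -1 * f w) _ z 1) => //.
  by move=> h _; rewrite mulN1r.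
by apply: cdiff_mul => //; exact: cdiff_cst.
Qed.
Lemma cdiff_sub f g z : cdiff f z -> cdiff g z -> cdiff (fun w => f w - g w) z.
Proof. by move=> H H'; apply: cdiff_add => //; exact: cdiff_opp. Qed.
Lemma cdiff_inv f z : cdiff f z -> f z != 0 -> cdiff (fun w => (f w)^-1) z.
Proof.
move=> H f0; apply: (@cdiff_comp (fun w => w^-1)) => //.
by eexists; exact: cdiff_at_inv.
Qed.
Lemma cdiff_div f g z : cdiff f z -> cdiff g z -> g z != 0 ->
  cdiff (fun w => f w / g w) z.
Proof. by move=> H H' g0; apply: cdiff_mul => //; exact: cdiff_inv. Qed.
Lemma cdiff_exp f n z : cdiff f z -> cdiff (fun w => f w ^+ n) z.
Proof.
move=> H; elim: n => [|n IH].
  apply: (@cdiff_ext (fun=> 1) _ z 1) => //; last exact: cdiff_cst.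
apply: (@cdiff_ext (fun w => f w * f w ^+ n) _ z 1) => //.
  by move=> h _; rewrite exprS.
exact: cdiff_mul.
Qed.
Lemma cdiff_sum (I : Type) (s : seq I) (P : pred I) (F : I -> C -> C) z :
  (forall i, cdiff (F i) z) -> cdiff (fun w => \sum_(i <- s | P i) F i w) z.
Proof.
move=> H; elim: s => [|i s IH].
  apply: (@cdiff_ext (fun=> 0) _ z 1) => //; last exact: cdiff_cst.
  by move=> h _; rewrite big_nil.
case Pi : (P i).
  apply: (@cdiff_ext (fun w => F i w + \sum_(i <- s | P i) F i w) _ z 1) => //.
    by move=> h _; rewrite big_cons Pi.
  exact: cdiff_add.
apply: cdiff_ext IH => [|h _]; first exact: ltr01.
by rewrite big_cons Pi.
Qed.
Lemma cdiff_poly (p : {poly C}) z : cdiff (fun w => p.[w]) z.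
Proof.
apply: (@cdiff_ext (fun w => \sum_(i < size p) p`_i * w ^+ i) _ z 1) => //.
  by move=> h _; rewrite horner_coef.
apply: cdiff_sum => i; apply: cdiff_mul; first exact: cdiff_cst.
apply: cdiff_exp; exact: cdiff_id.
Qed.

Lemma derivable_cdiff f z : derivable (f : C^o -> C^o) z 1 -> cdiff f z.
Proof.
move=> /cvg_ex[d /= /cvgrPdist_le Hd]; exists d => e e0.
have eC : 0 < e%:C by rewrite ltcR.
have := Hd _ eC; rewrite near_withinE /= => /nbhs_ballP[r /= r0 Hr].
have [rr Er] : exists rr : R, r = rr%:C.
  by apply/complex_realP; rewrite ger0_real // ltW.
exists rr; first by rewrite -ltcR -Er.
move=> h hr.
have [->|h0] := eqVneq h 0.
  by rewrite addr0 subrr mulr0 subrr normc0 mulr0.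
have := Hr h; rewrite /ball_ /= sub0r normrN normcE Er ltcR => /(_ hr h0).
rewrite normcE lecR => H.
have -> : f (z + h) - f z - d * h = - (d - h^-1 *: (f (h *: 1 + z) - f z)) * h.
  by rewrite /GRing.scale /= mulr1 (addrC h); field.
by rewrite normcM normcN ler_wpM2r ?normc_ge0.
Qed.

Lemma cdiff_derivable f z : cdiff f z -> derivable (f : C^o -> C^o) z 1.
Proof.
move=> [d Hd]; apply/cvg_ex; exists d; apply/cvgrPdist_le => /= eC e0.
have [e Ee] : exists e : R, eC = e%:C.
  by apply/complex_realP; rewrite ger0_real // ltW.
rewrite Ee ltcR in e0; rewrite Ee.
have [r r0 Hr] := Hd e e0.
rewrite near_withinE; apply/nbhs_ballP; exists r%:C; first by rewrite /= ltcR.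
move=> h; rewrite -ball_normE /= sub0r normrN normcE ltcR => hr h0.
rewrite normcE lecR.
have -> : d - h^-1 *: (f (h *: 1 + z) - f z) = - h^-1 * (f (z + h) - f z - d * h).
  by rewrite /GRing.scale /= mulr1 (addrC h); field.
rewrite normcM normcN normcV mulrC ler_pdivrMr ?normc_gt0 //.
exact: Hr.
Qed.

Lemma ccont_cvg f z : ccont f z ->
  (f : C^o -> C^o) @ nbhs (z : C^o) --> (f z : C^o).
Proof.
move=> Hf; apply/cvgrPdist_lt => /= eC e0.
have [e Ee] : exists e : R, eC = e%:C.
  by apply/complex_realP; rewrite ger0_real // ltW.
rewrite Ee ltcR in e0; rewrite Ee.
have [r r0 Hr] := Hf e e0.
apply/nbhs_ballP; exists r%:C; first by rewrite /= ltcR.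
move=> w; rewrite -ball_normE /= normcE ltcR => hr.
rewrite normcE ltcR normc_distC -[w](subrK z) (addrC _ z); apply: Hr.
by rewrite normc_distC.
Qed.

End ComplexDiff.

#[global] Arguments normc : simpl never.

(** * Complex integrals over real intervals and the fundamental theorem of calculus *)

Section PathIntegral.
Context {R : realType}.
Local Notation C := R[i].
Local Notation leb := (@lebesgue_measure R).
Implicit Types (z w : C) (g h : R -> C) (D : set (measurableTypeR R)).

Definition pcont g (y : R) := forall e : R, 0 < e -> exists2 r : R, 0 < r &
  forall t, `|t - y| < r -> normc (g t - g y) < e.

Lemma pcont_Re g y : pcont g y -> {for y, continuous (fun t => complex.Re (g t))}.
Proof.
move=> H; apply/cvgrPdist_lt => e e0; have [r r0 Hr] := H e e0.
apply/nbhs_ballP; exists r => // t; rewrite /ball /= distrC => /Hr.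
by apply: le_lt_trans; rewrite distrC -ReN -ReD ler_normRe.
Qed.

Lemma pcont_Im g y : pcont g y -> {for y, continuous (fun t => complex.Im (g t))}.
Proof.
move=> H; apply/cvgrPdist_lt => e e0; have [r r0 Hr] := H e e0.
apply/nbhs_ballP; exists r => // t; rewrite /ball /= distrC => /Hr.
by apply: le_lt_trans; rewrite distrC -ImN -ImD ler_normIm.
Qed.

Lemma pcontP g y : {for y, continuous (fun t => complex.Re (g t))} ->
  {for y, continuous (fun t => complex.Im (g t))} -> pcont g y.
Proof.
move=> /cvgrPdist_lt H1 /cvgrPdist_lt H2 e e0.
have e2 : 0 < e / 2 by rewrite divr_gt0.
have /nbhs_ballP[r1 /= r10 h1] := H1 _ e2.
have /nbhs_ballP[r2 /= r20 h2] := H2 _ e2.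
exists (Num.min r1 r2); first by rewrite lt_min r10.
move=> t; rewrite lt_min => /andP[t1 t2].
apply: le_lt_trans (normc_le_ReIm _) _; rewrite ReD ImD ReN ImN.
have := h1 t; rewrite /ball /= distrC => /(_ t1).
have := h2 t; rewrite /ball /= distrC => /(_ t2).
rewrite ![`|_ - _ t|]distrC; lra.
Qed.

Lemma pcont_within g a b : (forall y, a <= y <= b -> pcont g y) ->
  {within `[a, b], continuous (fun t => complex.Re (g t))} /\
  {within `[a, b], continuous (fun t => complex.Im (g t))}.
Proof.
move=> H; split; apply: continuous_in_subspaceT => y; rewrite inE /= in_itv /= => yab.
- exact/pcont_Re/H.
- exact/pcont_Im/H.
Qed.

Lemma pcont_ext g h y r : 0 < r -> (forall t, `|t - y| < r -> g t = h t) ->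
  pcont g y -> pcont h y.
Proof.
move=> r0 gh H e e0; have [r' r'0 Hr] := H e e0.
exists (Num.min r r'); first by rewrite lt_min r0.
move=> t; rewrite lt_min => /andP[t1 t2].
by rewrite -gh // -gh ?subrr ?normr0 // Hr.
Qed.

Lemma pcont_eq g h y : g =1 h -> pcont g y -> pcont h y.
Proof. by move=> gh; apply: (@pcont_ext g h y 1). Qed.

Lemma pcont_cst c y : pcont (fun=> c) y.
Proof. by move=> e e0; exists 1 => // t _; rewrite subrr normc0. Qed.

Lemma pcont_add g h y : pcont g y -> pcont h y -> pcont (fun t => g t + h t) y.
Proof.
move=> H1 H2 e e0.
have e2 : 0 < e / 2 by rewrite divr_gt0.
have [r1 r10 h1] := H1 _ e2; have [r2 r20 h2] := H2 _ e2.
exists (Num.min r1 r2); first by rewrite lt_min r10.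
move=> t; rewrite lt_min => /andP[/h1 t1 /h2 t2].
have -> : g t + h t - (g y + h y) = (g t - g y) + (h t - h y) by ring.
by apply: le_lt_trans (le_normcD _ _) _; lra.
Qed.

Lemma pcont_comp (F : C -> C) g y : pcont g y -> ccont F (g y) ->
  pcont (fun t => F (g t)) y.
Proof.
move=> H HF e e0; have [r r0 hr] := HF e e0.
have [r' r'0 hr'] := H r r0; exists r' => // t /hr' /hr.
have -> : F (g t) = F (g y + (g t - g y)) by congr F; ring.
by [].
Qed.

Lemma pcont_mul g h y : pcont g y -> pcont h y -> pcont (fun t => g t * h t) y.
Proof.
move=> H1 H2 e e0.
have [r0 r00 h0] := H2 _ ltr01.
set K := normc (g y) + normc (h y) + 2.
have K0 : 0 < K by rewrite /K ltr_wpDl // addr_ge0 ?normc_ge0.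
have e2 : 0 < e / 2 / K by rewrite !divr_gt0.
have [r1 r10 h1] := H1 _ e2; have [r2 r20 h2] := H2 _ e2.
exists (Num.min r0 (Num.min r1 r2)); first by rewrite !lt_min r10 r20 r00.
move=> t; rewrite !lt_min => /andP[/h0 t0 /andP[/h1 t1 /h2 t2]].
have -> : g t * h t - g y * h y = (g t - g y) * h t + g y * (h t - h y) by ring.
apply: le_lt_trans (le_normcD _ _) _; rewrite !normcM.
have ht : normc (h t) <= K.
  have := normc_tri (h t) (h y); rewrite /K; have := normc_ge0 (g y); lra.
have gy : normc (g y) <= K by rewrite /K; have := normc_ge0 (h y); lra.
have A : normc (g t - g y) * normc (h t) < e / 2.
  apply: (@le_lt_trans _ _ (normc (g t - g y) * K)).
    by rewrite ler_wpM2l ?normc_ge0.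
  by rewrite -ltr_pdivlMr.
have B : normc (g y) * normc (h t - h y) < e / 2.
  apply: (@le_lt_trans _ _ (K * normc (h t - h y))).
    by rewrite ler_wpM2r ?normc_ge0.
  by rewrite mulrC -ltr_pdivlMr.
lra.
Qed.

Lemma pcont_real (f : R -> R) y : {for y, continuous f} -> pcont (fun t => (f t)%:C) y.
Proof. by move=> H; apply: pcontP => //=; exact: cst_continuous. Qed.

Lemma pcont_bounded g a b : a <= b -> (forall y, a <= y <= b -> pcont g y) ->
  exists2 K : R, 0 < K & forall y, a <= y <= b -> normc (g y) <= K.
Proof.
move=> ab H; have [cR cI] := pcont_within H.
have cR' : {within `[a, b], continuous (fun t => `|complex.Re (g t)|)}.
  by move=> x; apply: (@continuous_comp _ _ _ _ (@Num.norm R R)) ; [exact: cR|exact: norm_continuous].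
have cI' : {within `[a, b], continuous (fun t => `|complex.Im (g t)|)}.
  by move=> x; apply: (@continuous_comp _ _ _ _ (@Num.norm R R)) ; [exact: cI|exact: norm_continuous].
have [c1 _ h1] := EVT_max ab cR'; have [c2 _ h2] := EVT_max ab cI'.
exists (`|complex.Re (g c1)| + `|complex.Im (g c2)| + 1).
  by rewrite ltr_wpDl ?addr_ge0.
move=> y yab; apply: le_trans (normc_le_ReIm _) _.
have /= := h1 y; rewrite in_itv => /(_ yab).
have /= := h2 y; rewrite in_itv => /(_ yab); lra.
Qed.

Definition cint D g : C :=
  (\int[leb]_(y in D) complex.Re (g y)) +i* (\int[leb]_(y in D) complex.Im (g y)).

Definition cintegrable D g :=
  leb.-integrable D (EFin \o (fun y => complex.Re (g y))) /\
  leb.-integrable D (EFin \o (fun y => complex.Im (g y))).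

Lemma integralCE g : integralC g = cint setT g.
Proof. by []. Qed.

Lemma cint_eq D g h : {in D, g =1 h} -> cint D g = cint D h.
Proof.
by move=> gh; rewrite /cint; congr (_ +i* _); apply: eq_Rintegral => y yD; rewrite gh.
Qed.

Lemma cintegrable_eq D g h : measurable D -> {in D, g =1 h} ->
  cintegrable D g -> cintegrable D h.
Proof.
move=> mD gh [H1 H2]; split.
- by apply: eq_integrable H1 => // y yD /=; rewrite gh.
- by apply: eq_integrable H2 => // y yD /=; rewrite gh.
Qed.

Lemma cintegrable_add D g h : measurable D ->
  cintegrable D g -> cintegrable D h -> cintegrable D (fun y => g y + h y).
Proof.
move=> mD [g1 g2] [h1 h2]; split.
- by apply: eq_integrable (integrableD mD g1 h1) => // y _ /=; rewrite ReD.
- by apply: eq_integrable (integrableD mD g2 h2) => // y _ /=; rewrite ImD.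
Qed.

Lemma cint_add D g h : measurable D -> cintegrable D g -> cintegrable D h ->
  cint D (fun y => g y + h y) = cint D g + cint D h.
Proof.
move=> mD [g1 g2] [h1 h2]; apply: complexP; rewrite ?ReD ?ImD /=.
- by rewrite -RintegralD //; apply: eq_Rintegral => y _; rewrite ReD.
- by rewrite -RintegralD //; apply: eq_Rintegral => y _; rewrite ImD.
Qed.

Lemma cintegrable_scale D c g : measurable D ->
  cintegrable D g -> cintegrable D (fun y => c * g y).
Proof.
move=> mD [g1 g2]; split.
- have := integrableB mD (integrableZl mD (complex.Re c) g1) (integrableZl mD (complex.Im c) g2).
  by apply: eq_integrable => // y _ /=; rewrite ReM EFinB !EFinM.
- have := integrableD mD (integrableZl mD (complex.Re c) g2) (integrableZl mD (complex.Im c) g1).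
  by apply: eq_integrable => // y _ /=; rewrite ImM EFinD !EFinM.
Qed.

Lemma integrableZE D (r : R) (f : R -> R) : measurable D ->
  leb.-integrable D (EFin \o f) -> leb.-integrable D (EFin \o (fun y => r * f y)).
Proof.
move=> mD fi; have := integrableZl mD r fi.
by apply: eq_integrable => // y _ /=; rewrite EFinM.
Qed.

Lemma cint_scale D c g : measurable D -> cintegrable D g ->
  cint D (fun y => c * g y) = c * cint D g.
Proof.
move=> mD [g1 g2]; apply: complexP; rewrite ?ReM ?ImM /=.
- rewrite -!RintegralZl // -RintegralB //; last 2 first.
  + exact: integrableZE.
  + exact: integrableZE.
  by apply: eq_Rintegral => y _; rewrite ReM.
- rewrite -!RintegralZl // -RintegralD //; last 2 first.
  + exact: integrableZE.
  + exact: integrableZE.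
  by apply: eq_Rintegral => y _; rewrite ImM.
Qed.

Lemma cint_sub D g h : measurable D -> cintegrable D g -> cintegrable D h ->
  cint D (fun y => g y - h y) = cint D g - cint D h.
Proof.
move=> mD ig ih.
rewrite -[- cint D h]mulN1r -cint_scale // -cint_add //; last exact: cintegrable_scale.
by apply: cint_eq => y _; rewrite mulN1r.
Qed.

Lemma cintegrable_sub D g h : measurable D ->
  cintegrable D g -> cintegrable D h -> cintegrable D (fun y => g y - h y).
Proof.
move=> mD ig ih; have := cintegrable_add mD ig (cintegrable_scale (-1) mD ih).
by apply: cintegrable_eq => // y _; rewrite mulN1r.
Qed.

(** The factor 2 comes from estimating real and imaginary parts separately; it propagates to all
    edge bounds below. *)
Lemma cint_le D g (f : R -> R) : measurable D -> cintegrable D g ->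
  leb.-integrable D (EFin \o f) -> (forall y, D y -> normc (g y) <= f y) ->
  normc (cint D g) <= 2 * \int[leb]_(y in D) f y.
Proof.
move=> mD [g1 g2] fi gf; apply: le_trans (normc_le_ReIm _) _ => /=.
rewrite mulr_natl mulr2n; apply: lerD.
- apply: le_trans (le_normr_Rintegral mD g1) _.
  apply: le_Rintegral => //; first exact: integrable_norm.
  by move=> y yD; apply: le_trans (gf y yD); exact: ler_normRe.
- apply: le_trans (le_normr_Rintegral mD g2) _.
  apply: le_Rintegral => //; first exact: integrable_norm.
  by move=> y yD; apply: le_trans (gf y yD); exact: ler_normIm.
Qed.

Lemma cintegrable_cont g a b : (forall y, a <= y <= b -> pcont g y) ->
  cintegrable `[a, b] g.
Proof.
move=> /pcont_within[cR cI]; split; apply: continuous_compact_integrable => //;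
  exact: segment_compact.
Qed.

Lemma integrable_cst_itv (a b K : R) :
  leb.-integrable `[a, b] (EFin \o (fun=> K)).
Proof.
apply: continuous_compact_integrable; first exact: segment_compact.
by apply: continuous_subspaceT => x; exact: cst_continuous.
Qed.

Lemma cint_itv_le g a b K : a <= b -> (forall y, a <= y <= b -> pcont g y) ->
  (forall y, a <= y <= b -> normc (g y) <= K) ->
  normc (cint `[a, b] g) <= 2 * (K * (b - a)).
Proof.
move=> ab cg gK.
have := cint_le (measurable_itv `[a, b]) (cintegrable_cont cg) (integrable_cst_itv a b K).
have -> : \int[leb]_(y in `[a, b]) K = K * (b - a).
  rewrite Rintegral_cst //; congr (_ * _).
  have E : leb (`[a, b]%classic : set R) = (b - a)%:E.
    rewrite lebesgue_measure_itv /= lte_fin.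
    by case: ltP => [//|ba]; rewrite (_ : b = a) ?subrr //; apply/eqP; rewrite eq_le ab ba.
  by rewrite -[RHS]/(fine (b - a)%:E) -E.
apply => y; rewrite /= in_itv; exact: gK.
Qed.

Lemma cint_cat g a b c : a <= b -> b <= c -> cintegrable `[a, c] g ->
  cint `[a, c] g = cint `[a, b] g + cint `[b, c] g.
Proof.
move=> ab bc [g1 g2].
have sub D : D `<=` `[a, c] -> measurable D -> cintegrable D g.
  by move=> Dac mD; split; apply: integrableS g1 || apply: integrableS g2.
have iab : `]b, c] `<=` `[a, c].
  by move=> y /=; rewrite !in_itv /= => /andP[/ltW by_ ->]; rewrite (le_trans ab).
have [bc1 bc2] := sub _ iab (measurable_itv _).
apply: complexP; rewrite ?ReD ?ImD /=; apply/eqP; rewrite addrC -subr_eq; apply/eqP.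
- rewrite Rintegral_itvB ?bnd_simp // Rintegral_itv_obnd_cbnd //.
- rewrite Rintegral_itvB ?bnd_simp // Rintegral_itv_obnd_cbnd //.
Qed.

Definition pdiff g y (d : C) :=
  is_derive y (1 : R) (fun t => complex.Re (g t)) (complex.Re d) /\
  is_derive y (1 : R) (fun t => complex.Im (g t)) (complex.Im d).

Lemma pdiff_pcont g y d : pdiff g y d -> pcont g y.
Proof.
move=> [[H1 _] [H2 _]]; apply: pcontP.
- exact: differentiable_continuous (iffLR (derivable1_diffP _ _) H1).
- exact: differentiable_continuous (iffLR (derivable1_diffP _ _) H2).
Qed.

Lemma pdiff_cst c y : pdiff (fun=> c) y 0.
Proof. by split; exact: is_derive_cst. Qed.

Lemma pdiff_add g h y d e : pdiff g y d -> pdiff h y e ->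
  pdiff (fun t => g t + h t) y (d + e).
Proof.
move=> [g1 g2] [h1 h2]; split; rewrite ?ReD ?ImD.
- have -> : (fun t => complex.Re (g t + h t)) =
    (fun t => complex.Re (g t)) + (fun t => complex.Re (h t)).
    by apply/funext => t; rewrite ReD.
  exact: is_deriveD.
- have -> : (fun t => complex.Im (g t + h t)) =
    (fun t => complex.Im (g t)) + (fun t => complex.Im (h t)).
    by apply/funext => t; rewrite ImD.
  exact: is_deriveD.
Qed.

Lemma pdiff_mul g h y d e : pdiff g y d -> pdiff h y e ->
  pdiff (fun t => g t * h t) y (d * h y + g y * e).
Proof.
move=> [g1 g2] [h1 h2]; split; rewrite ?ReD ?ImD ?ReM ?ImM.
- have -> : (fun t => complex.Re (g t * h t)) =
    (fun t => complex.Re (g t)) * (fun t => complex.Re (h t))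
    - (fun t => complex.Im (g t)) * (fun t => complex.Im (h t)).
    by apply/funext => t; rewrite ReM.
  apply: (is_derive_eq (is_deriveB (is_deriveM g1 h1) (is_deriveM g2 h2))).
  rewrite /GRing.scale /=; ring.
- have -> : (fun t => complex.Im (g t * h t)) =
    (fun t => complex.Re (g t)) * (fun t => complex.Im (h t))
    + (fun t => complex.Im (g t)) * (fun t => complex.Re (h t)).
    by apply/funext => t; rewrite ImM.
  apply: (is_derive_eq (is_deriveD (is_deriveM g1 h2) (is_deriveM g2 h1))).
  rewrite /GRing.scale /=; ring.
Qed.

Lemma pdiff_eq g y d e : d = e -> pdiff g y d -> pdiff g y e.
Proof. by move=> ->. Qed.

Lemma pdiff_real (f : R -> R) y (d : R) : is_derive y (1 : R) f d ->
  pdiff (fun t => (f t)%:C) y d%:C.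
Proof. by move=> H; split => //=; exact: is_derive_cst. Qed.

Lemma pdiff_id y : pdiff (fun t => t%:C) y 1.
Proof. by apply: pdiff_real; exact: is_derive_id. Qed.

Lemma FTC_real (G g : R -> R) (a b : R) : a <= b ->
  (forall y, a <= y <= b -> is_derive y (1 : R) G (g y)) ->
  {within `[a, b], continuous g} ->
  \int[leb]_(y in `[a, b]) g y = G b - G a.
Proof.
rewrite le_eqVlt => /predU1P[<-|ab] dG cg.
  by rewrite set_itv1 Rintegral_set1 subrr.
have cG y : a <= y <= b -> {for y, continuous G}.
  move=> /dG[H _]; exact: differentiable_continuous (iffLR (derivable1_diffP _ _) H).
rewrite /Rintegral (@continuous_FTC2 _ _ G) //.
- split.
  + move=> y; rewrite in_itv /= => /andP[ay yb].
    by have [] // := dG y _; rewrite !ltW.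
  + by apply: cvg_at_right_filter; apply: cG; rewrite lexx ltW.
  + by apply: cvg_at_left_filter; apply: cG; rewrite lexx ltW.
- move=> y; rewrite in_itv /= => /andP[ay yb].
  have [|H1 H2] := dG y _; first by rewrite !ltW.
  by rewrite derive1E H2.
Qed.

Lemma cint_FTC G g a b : a <= b -> (forall y, a <= y <= b -> pdiff G y (g y)) ->
  (forall y, a <= y <= b -> pcont g y) -> cint `[a, b] g = G b - G a.
Proof.
move=> ab dG cg; have [cR cI] := pcont_within cg.
apply: complexP; rewrite ?ReD ?ImD ?ReN ?ImN /=.
- by apply: (@FTC_real (fun t => complex.Re (G t))) => // y /dG[].
- by apply: (@FTC_real (fun t => complex.Im (G t))) => // y /dG[].
Qed.

End PathIntegral.

#[global] Arguments cint : simpl never.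

(** * Goursat's theorem on ruled patches *)

Section Goursat.
Context {R : realType}.
Local Notation C := R[i].
Variables (P V P' V' : R -> C).
Hypothesis dP : forall y, pdiff P y (P' y).
Hypothesis dV : forall y, pdiff V y (V' y).
Hypothesis cP' : forall y, pcont P' y.
Hypothesis cV' : forall y, pcont V' y.

(** The patch swept by segments of direction [V y]. Three cases are used: the strip between two
    multiples of a graph ([strip_shift]), the translation of a graph to infinity ([half_shift]), and
    the cone from a point to a circle ([cauchy_formula]). *)
Definition ruled (t y : R) : C := P y + t%:C * V y.
Definition ruled_y (t y : R) : C := P' y + t%:C * V' y.

Definition edge_y (F : C -> C) t y1 y2 :=
  cint `[y1, y2] (fun y => F (ruled t y) * ruled_y t y).
Definition edge_t (F : C -> C) y t1 t2 :=
  cint `[t1, t2] (fun t => F (ruled t y) * V y).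
Definition ruled_bd F t1 t2 y1 y2 :=
  edge_y F t2 y1 y2 - edge_y F t1 y1 y2 - edge_t F y2 t1 t2 + edge_t F y1 t1 t2.

Lemma pcont_ruled_y1 t y : pcont (ruled t) y.
Proof.
apply: pcont_add; first exact: pdiff_pcont (dP y).
by apply: pcont_mul; [exact: pcont_cst|exact: pdiff_pcont (dV y)].
Qed.

Lemma pcont_ruled_t1 y t : pcont (fun t => ruled t y) t.
Proof.
apply: pcont_add; first exact: pcont_cst.
by apply: pcont_mul; [apply: pcont_real; exact: cvg_id|exact: pcont_cst].
Qed.

Lemma pcont_ruled_y t y : pcont (ruled_y t) y.
Proof. by apply: pcont_add => //; apply: pcont_mul => //; exact: pcont_cst. Qed.

Lemma pcont_edge_y F t y : ccont F (ruled t y) ->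
  pcont (fun y => F (ruled t y) * ruled_y t y) y.
Proof.
move=> cF; apply: pcont_mul; last exact: pcont_ruled_y.
by apply: pcont_comp => //; exact: pcont_ruled_y1.
Qed.

Lemma pcont_edge_t F t y : ccont F (ruled t y) ->
  pcont (fun t => F (ruled t y) * V y) t.
Proof.
move=> cF; apply: pcont_mul; last exact: pcont_cst.
by apply: (@pcont_comp _ F (fun t => ruled t y)) => //; exact: pcont_ruled_t1.
Qed.

Definition in_rect (t1 t2 y1 y2 t y : R) := (t1 <= t <= t2) /\ (y1 <= y <= y2).

Definition rect_cont F t1 t2 y1 y2 :=
  forall t y, in_rect t1 t2 y1 y2 t y -> ccont F (ruled t y).

Lemma ruled_bd_cat_t F t1 t2 t3 y1 y2 : t1 <= t2 -> t2 <= t3 -> y1 <= y2 ->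
  rect_cont F t1 t3 y1 y2 ->
  ruled_bd F t1 t3 y1 y2 = ruled_bd F t1 t2 y1 y2 + ruled_bd F t2 t3 y1 y2.
Proof.
move=> t12 t23 y12 cF; rewrite /ruled_bd /edge_t.
rewrite (@cint_cat _ (fun t => F (ruled t y2) * V y2) t1 t2 t3) //; last first.
  by apply: cintegrable_cont => t tt; apply: pcont_edge_t; apply: cF; rewrite /in_rect y12 lexx.
rewrite (@cint_cat _ (fun t => F (ruled t y1) * V y1) t1 t2 t3) //; last first.
  by apply: cintegrable_cont => t tt; apply: pcont_edge_t; apply: cF; rewrite /in_rect y12 lexx.
ring.
Qed.

Lemma ruled_bd_cat_y F t1 t2 y1 y2 y3 : t1 <= t2 -> y1 <= y2 -> y2 <= y3 ->
  rect_cont F t1 t2 y1 y3 ->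
  ruled_bd F t1 t2 y1 y3 = ruled_bd F t1 t2 y1 y2 + ruled_bd F t1 t2 y2 y3.
Proof.
move=> t12 y12 y23 cF; rewrite /ruled_bd /edge_y.
rewrite (@cint_cat _ (fun y => F (ruled t2 y) * ruled_y t2 y) y1 y2 y3) //; last first.
  by apply: cintegrable_cont => t tt; apply: pcont_edge_y; apply: cF; rewrite /in_rect t12 lexx.
rewrite (@cint_cat _ (fun y => F (ruled t1 y) * ruled_y t1 y) y1 y2 y3) //; last first.
  by apply: cintegrable_cont => t tt; apply: pcont_edge_y; apply: cF; rewrite /in_rect t12 lexx.
ring.
Qed.

(** The primitive [a z + b z^2 / 2] makes the four edges telescope. In [goursat] this removes the
    first-order Taylor polynomial. *)
Lemma ruled_bd_affine (a b : C) t1 t2 y1 y2 : t1 <= t2 -> y1 <= y2 ->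
  ruled_bd (fun z => a + b * z) t1 t2 y1 y2 = 0.
Proof.
move=> t12 y12.
have cF z : ccont (fun z => a + b * z) z.
  apply: cdiff_ccont; apply: cdiff_add; first exact: cdiff_cst.
  by apply: cdiff_mul; [exact: cdiff_cst|exact: cdiff_id].
pose G z : C := a * z + b * (z * z) / 2.
have half (x : C) : 2^-1 * (x + x) = x by field.
have Ey t : edge_y (fun z => a + b * z) t y1 y2 = G (ruled t y2) - G (ruled t y1).
  rewrite /edge_y (@cint_FTC _ (fun y => G (ruled t y))) // => y _; last first.
    exact: (@pcont_edge_y (fun z => a + b * z)).
  have D : pdiff (ruled t) y (ruled_y t y).
    apply: pdiff_add => //; apply: (pdiff_eq _ (pdiff_mul (pdiff_cst t%:C y) (dV y))).
    by rewrite mul0r add0r.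
  have := pdiff_add (pdiff_mul (pdiff_cst a y) D)
    (pdiff_mul (pdiff_mul (pdiff_cst b y) (pdiff_mul D D)) (pdiff_cst (2^-1) y)).
  apply: pdiff_eq.
  by field.
have Et y : edge_t (fun z => a + b * z) y t1 t2 = G (ruled t2 y) - G (ruled t1 y).
  rewrite /edge_t (@cint_FTC _ (fun t => G (ruled t y))) // => t _; last first.
    exact: (@pcont_edge_t (fun z => a + b * z)).
  have D : pdiff (fun t => ruled t y) t (V y).
    have := pdiff_add (pdiff_cst (P y) t) (pdiff_mul (pdiff_id t) (pdiff_cst (V y) t)).
    by apply: pdiff_eq; ring.
  have := pdiff_add (pdiff_mul (pdiff_cst a t) D)
    (pdiff_mul (pdiff_mul (pdiff_cst b t) (pdiff_mul D D)) (pdiff_cst (2^-1) t)).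
  apply: pdiff_eq.
  by field.
rewrite /ruled_bd !Ey !Et; ring.
Qed.

Lemma ruled_bd_sub F G t1 t2 y1 y2 : t1 <= t2 -> y1 <= y2 ->
  rect_cont F t1 t2 y1 y2 -> rect_cont G t1 t2 y1 y2 ->
  ruled_bd (fun z => F z - G z) t1 t2 y1 y2 =
  ruled_bd F t1 t2 y1 y2 - ruled_bd G t1 t2 y1 y2.
Proof.
move=> t12 y12 cF cG.
have Ey t : t1 <= t <= t2 -> edge_y (fun z => F z - G z) t y1 y2 =
    edge_y F t y1 y2 - edge_y G t y1 y2.
  move=> tt; rewrite /edge_y -cint_sub //.
  - by apply: cint_eq => y _; rewrite mulrBl.
  - by apply: cintegrable_cont => y yy; apply: pcont_edge_y; exact: cF.
  - by apply: cintegrable_cont => y yy; apply: pcont_edge_y; exact: cG.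
have Et y : y1 <= y <= y2 -> edge_t (fun z => F z - G z) y t1 t2 =
    edge_t F y t1 t2 - edge_t G y t1 t2.
  move=> tt; rewrite /edge_t -cint_sub //.
  - by apply: cint_eq => t _; rewrite mulrBl.
  - by apply: cintegrable_cont => t yy; apply: pcont_edge_t; exact: cF.
  - by apply: cintegrable_cont => t yy; apply: pcont_edge_t; exact: cG.
by rewrite /ruled_bd !Ey ?Et ?lexx ?t12 ?y12 //; ring.
Qed.

(** Four edges, each with the factor 2 of [cint_itv_le], give the 8. *)
Lemma ruled_bd_le F t1 t2 y1 y2 (K M d : R) : t1 <= t2 -> y1 <= y2 ->
  rect_cont F t1 t2 y1 y2 ->
  (forall t y, in_rect t1 t2 y1 y2 t y -> normc (ruled_y t y) <= K) ->
  (forall y, y1 <= y <= y2 -> normc (V y) <= K) ->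
  (forall t y, in_rect t1 t2 y1 y2 t y -> normc (F (ruled t y)) <= M) ->
  t2 - t1 <= d -> y2 - y1 <= d ->
  normc (ruled_bd F t1 t2 y1 y2) <= 8 * (M * K * d).
Proof.
move=> t12 y12 cF bG bV bF td yd.
have r11 : in_rect t1 t2 y1 y2 t1 y1 by rewrite /in_rect !lexx t12 y12.
have M0 : 0 <= M by apply: le_trans (bF _ _ r11); exact: normc_ge0.
have K0 : 0 <= K by apply: le_trans (bG _ _ r11); exact: normc_ge0.
have Ey t : t1 <= t <= t2 -> normc (edge_y F t y1 y2) <= 2 * (M * K * d).
  move=> tt; apply: le_trans (cint_itv_le (K := M * K) y12 _ _) _.
  - by move=> y yy; apply: pcont_edge_y; exact: cF.
  - by move=> y yy; rewrite normcM ler_pM ?normc_ge0 ?bF ?bG.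
  - by rewrite !ler_wpM2l // mulr_ge0.
have Et y : y1 <= y <= y2 -> normc (edge_t F y t1 t2) <= 2 * (M * K * d).
  move=> yy; apply: le_trans (cint_itv_le (K := M * K) t12 _ _) _.
  - by move=> t tt; apply: pcont_edge_t; exact: cF.
  - by move=> t tt; rewrite normcM ler_pM ?normc_ge0 ?bF ?bV.
  - by rewrite !ler_wpM2l // mulr_ge0.
rewrite /ruled_bd.
apply: le_trans (le_normcD _ _) _.
have := Et y1; rewrite lexx y12 => /(_ isT).
have : normc (edge_y F t2 y1 y2 - edge_y F t1 y1 y2 - edge_t F y2 t1 t2) <= 6 * (M * K * d).
  apply: le_trans (normcB _ _) _.
  have := Et y2; rewrite lexx y12 => /(_ isT).
  have := normcB (edge_y F t2 y1 y2) (edge_y F t1 y1 y2).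
  have := Ey t1; rewrite lexx t12 => /(_ isT).
  have := Ey t2; rewrite lexx t12 => /(_ isT).
  lra.
lra.
Qed.

Lemma nested_intervals (a b : nat -> R) : (forall n, a n <= a n.+1) ->
  (forall n, b n.+1 <= b n) -> (forall n, a n <= b n) ->
  exists p, forall n, a n <= p <= b n.
Proof.
move=> ha hb hab.
have ma m n : (m <= n)%N -> a m <= a n.
  by move=> /subnK <-; elim: (n - m)%N => [//|k IH]; rewrite addSn (le_trans IH).
have mb m n : (m <= n)%N -> b n <= b m.
  by move=> /subnK <-; elim: (n - m)%N => [//|k IH]; rewrite addSn (le_trans _ IH).
have ab m n : a m <= b n.
  case/orP: (leq_total m n) => mn; first by rewrite (le_trans (ma _ _ mn)).
  by rewrite (le_trans _ (mb _ _ mn)).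
have S : has_sup (range a).
  by split; [exists (a 0%N), 0%N|exists (b 0%N) => _ [n _ <-]].
exists (sup (range a)) => n; apply/andP; split.
  by apply: ub_le_sup; [case: S|exists n].
by apply: ge_sup; [case: S|move=> _ [m _ <-]].
Qed.

Lemma ruled_lipschitz t1 t2 y1 y2 : t1 <= t2 -> y1 <= y2 -> exists2 K : R, 0 < K &
  [/\ forall t y, in_rect t1 t2 y1 y2 t y -> normc (ruled_y t y) <= K,
      forall y, y1 <= y <= y2 -> normc (V y) <= K &
      forall t y s x, in_rect t1 t2 y1 y2 t y -> in_rect t1 t2 y1 y2 s x ->
        normc (ruled t y - ruled s x) <= K * `|t - s| + 2 * K * `|y - x|].
Proof.
move=> t12 y12.
have [K1 K10 h1] := pcont_bounded y12 (fun y _ => cP' y).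
have [K2 K20 h2] := pcont_bounded y12 (fun y _ => cV' y).
have [K3 K30 h3] := pcont_bounded y12 (fun y _ => pdiff_pcont (dV y)).
pose T := `|t1| + `|t2|.
have Tt t : t1 <= t <= t2 -> `|t| <= T.
  move=> /andP[A B]; rewrite ler_norml /T.
  have := ler_norm t2; have := ler_norm (- t1); rewrite normrN.
  have := normr_ge0 t1; have := normr_ge0 t2.
  by move=> *; apply/andP; split; lra.
have T0 : 0 <= T by rewrite addr_ge0.
set K := K1 + T * K2 + K3.
have K0 : 0 < K by rewrite /K ltr_wpDl // addr_ge0 ?mulr_ge0 // ltW.
have bG t y : in_rect t1 t2 y1 y2 t y -> normc (ruled_y t y) <= K.
  move=> [tt yy]; apply: le_trans (le_normcD _ _) _.
  rewrite normcM normc_real /K.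
  have := h1 _ yy; have : `|t| * normc (V' y) <= T * K2.
    by apply: ler_pM; rewrite ?normc_ge0 ?Tt ?h2.
  lra.
have TK2 : 0 <= T * K2 by rewrite mulr_ge0 // ltW.
have bV y : y1 <= y <= y2 -> normc (V y) <= K.
  by move=> /h3; rewrite /K; lra.
exists K => //; split => // t y s x [tt yy] [ss xx].
have lip : forall y x, y1 <= y <= y2 -> y1 <= x <= y2 -> x <= y ->
    normc (ruled t y - ruled t x) <= 2 * K * (y - x).
  move=> {}y {}x {}yy {}xx xy.
  have sub z : x <= z <= y -> y1 <= z <= y2.
    move=> /andP[A B]; move: yy xx => /andP[? ?] /andP[? ?].
    by apply/andP; split; lra.
  have -> : ruled t y - ruled t x = cint `[x, y] (ruled_y t).
    rewrite (@cint_FTC _ (ruled t)) // => z _; last exact: pcont_ruled_y.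
    apply: pdiff_add => //; apply: (pdiff_eq _ (pdiff_mul (pdiff_cst t%:C z) (dV z))).
    by rewrite mul0r add0r.
  rewrite -mulrA; apply: cint_itv_le => // z zz; first exact: pcont_ruled_y.
  by apply: bG; split => //; exact: sub.
have -> : ruled t y - ruled s x = (ruled t x - ruled s x) + (ruled t y - ruled t x) by ring.
apply: le_trans (le_normcD _ _) _; apply: lerD.
  have -> : ruled t x - ruled s x = (t - s)%:C * V x by rewrite /ruled rmorphB /=; ring.
  by rewrite normcM normc_real mulrC ler_wpM2r // bV.
have [xy|/ltW yx] := leP x y; first by rewrite ger0_norm ?subr_ge0 // lip.
by rewrite normc_distC distrC ger0_norm ?subr_ge0 // lip.
Qed.

Section Bisection.
Variables (F : C -> C) (T1 T2 Y1 Y2 : R).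
Hypotheses (T12 : T1 <= T2) (Y12 : Y1 <= Y2).
Hypothesis dF : forall t y, in_rect T1 T2 Y1 Y2 t y -> cdiff F (ruled t y).

Let bd (r : R * R * (R * R)) := normc (ruled_bd F r.1.1 r.1.2 r.2.1 r.2.2).
Let quarter (s s' : bool) (r : R * R * (R * R)) : R * R * (R * R) :=
  let mt := (r.1.1 + r.1.2) / 2 in let my := (r.2.1 + r.2.2) / 2 in
  (if s then (r.1.1, mt) else (mt, r.1.2), if s' then (r.2.1, my) else (my, r.2.2)).
(** By the triangle inequality some quarter carries at least a fourth of the boundary integral; the
    last one is taken when the other three fail, which [step_bd] justifies. *)
Let step r : R * R * (R * R) :=
  if bd r / 4 <= bd (quarter true true r) then quarter true true r else
  if bd r / 4 <= bd (quarter true false r) then quarter true false r else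
  if bd r / 4 <= bd (quarter false true r) then quarter false true r else
  quarter false false r.
Let r0 : R * R * (R * R) := ((T1, T2), (Y1, Y2)).
Let rn n := iter n step r0.
Let ok (r : R * R * (R * R)) := [/\ T1 <= r.1.1, r.1.1 <= r.1.2, r.1.2 <= T2 &
  [/\ Y1 <= r.2.1, r.2.1 <= r.2.2 & r.2.2 <= Y2]].

Let step_quarter r : exists s s', step r = quarter s s' r.
Proof.
rewrite /step; case: ifP => _; first by exists true, true.
case: ifP => _; first by exists true, false.
by case: ifP => _; [exists false, true|exists false, false].
Qed.

Let quarter_ok s s' r : ok r -> [/\ ok (quarter s s' r),
  r.1.1 <= (quarter s s' r).1.1, (quarter s s' r).1.2 <= r.1.2 &
  [/\ r.2.1 <= (quarter s s' r).2.1, (quarter s s' r).2.2 <= r.2.2,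
  (quarter s s' r).1.2 - (quarter s s' r).1.1 = (r.1.2 - r.1.1) / 2 &
  (quarter s s' r).2.2 - (quarter s s' r).2.1 = (r.2.2 - r.2.1) / 2]].
Proof.
case: r => [[a b] [c d]] [/= A1 A2 A3 [A4 A5 A6]]; rewrite /ok /quarter /=.
by case: s; case: s' => /=; split; try split; try split; lra.
Qed.

Let step_bd r : ok r -> bd r / 4 <= bd (step r).
Proof.
move=> okr; rewrite /step.
case: ifP => // /negbT; rewrite -ltNge => l1.
case: ifP => // /negbT; rewrite -ltNge => l2.
case: ifP => // /negbT; rewrite -ltNge => l3.
suff : bd r <= bd (quarter true true r) + bd (quarter true false r) +
    bd (quarter false true r) + bd (quarter false false r) by lra.
case: r okr {l1 l2 l3} => [[a b] [c d]] [/= A1 A2 A3 [A4 A5 A6]]; rewrite /bd /quarter /=.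
have cF t1 t2 y1 y2 : T1 <= t1 -> t2 <= T2 -> Y1 <= y1 -> y2 <= Y2 ->
    rect_cont F t1 t2 y1 y2.
  move=> *; move=> t y [/andP[? ?] /andP[? ?]]; apply: cdiff_ccont; apply: dF.
  by split; apply/andP; split; lra.
rewrite (@ruled_bd_cat_t F a ((a + b) / 2) b c d); try lra; last by apply: cF; lra.
rewrite (@ruled_bd_cat_y F a ((a + b) / 2) c ((c + d) / 2) d); try lra; last by apply: cF; lra.
rewrite (@ruled_bd_cat_y F ((a + b) / 2) b c ((c + d) / 2) d); try lra; last by apply: cF; lra.
apply: le_trans (le_normcD _ _) _; rewrite -[leRHS]addrA.
by apply: lerD; apply: le_normcD.
Qed.

(** Bisection of the parameter rectangle. The n-th boundary integral is at least [4^-n] times the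
    first. It is also at most a small multiple of [4^-n]: near the limit point F differs from its
    affine approximation by at most [e1] times the distance, and both distances and edges shrink
    like [2^-n]. *)
Theorem goursat : ruled_bd F T1 T2 Y1 Y2 = 0.
Proof.
have okn n : ok (rn n).
  elim: n => [|n IH]; first by rewrite /ok /= !lexx; split.
  by rewrite /rn iterS; have [s [s' ->]] := step_quarter (rn n); case: (quarter_ok s s' IH).
have stepn n : [/\ (rn n).1.1 <= (rn n.+1).1.1, (rn n.+1).1.2 <= (rn n).1.2,
   (rn n).2.1 <= (rn n.+1).2.1 & (rn n.+1).2.2 <= (rn n).2.2].
  rewrite /rn iterS; have [s [s' ->]] := step_quarter (rn n).
  by case: (quarter_ok s s' (okn n)) => _ ? ? [].
have [p hp] : exists p, forall n, (rn n).1.1 <= p <= (rn n).1.2.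
  by apply: nested_intervals => n; [case: (stepn n)|case: (stepn n)|case: (okn n)].
have [q hq] : exists q, forall n, (rn n).2.1 <= q <= (rn n).2.2.
  by apply: nested_intervals => n; [case: (stepn n)|case: (stepn n)|case: (okn n) => _ _ _ []].
have bdn n : bd r0 / 4 ^+ n <= bd (rn n).
  elim: n => [|n IH]; first by rewrite expr0 divr1.
  rewrite /rn iterS; apply: le_trans _ (step_bd (okn n)).
  by rewrite exprSr invfM mulrA ler_pM2r.
pose D := (T2 - T1) + (Y2 - Y1).
have D0 : 0 <= D by rewrite addr_ge0 // subr_ge0.
have side n : (rn n).1.2 - (rn n).1.1 <= D / 2 ^+ n /\ (rn n).2.2 - (rn n).2.1 <= D / 2 ^+ n.
  elim: n => [|n [IH1 IH2]].
    by rewrite expr0 divr1 /= /D; split; [rewrite lerDl|rewrite lerDr]; rewrite subr_ge0.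
  rewrite /rn iterS; have [s [s' ->]] := step_quarter (rn n).
  case: (quarter_ok s s' (okn n)) => _ _ _ [_ _ -> ->].
  by rewrite exprSr invfM mulrA; split; rewrite ler_pM2r.
have [K K0 [bG bV lip]] := ruled_lipschitz T12 Y12.
have [d hd] : cdiff F (ruled p q).
  by apply: dF; split; [exact: (hp 0%N)|exact: (hq 0%N)].
apply/eqP; rewrite -normc_eq0; apply/eqP; apply/le_anti; rewrite normc_ge0 andbT.
apply/ler_addgt0Pr => e e0; rewrite add0r.
rewrite -[X in X <= _]/(bd r0).
(* 24 is the 8 of [ruled_bd_le] times the 3 of the distance bound [3 K D / 2^n]; the 1 keeps the
   denominator positive. *)
pose e1 := e / (24 * K * K * (D * D) + 1).
have Q0 : 0 <= 24 * K * K * (D * D) by rewrite !mulr_ge0 // ltW.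
have e10 : 0 < e1 by rewrite divr_gt0 // ltr_wpDl.
have [r rpos hr] := hd _ e10.
have [n hn] : exists n, 3 * K * (D / 2 ^+ n) < r.
  have := @near_infty_natSinv_expn_lt R (PosNum (divr_gt0 rpos (ltr_wpDl (mulr_ge0 (mulr_ge0 (ler0n _ 3) (ltW K0)) D0) ltr01))).
  move=> [n _ hn]; exists n; have := hn n (leqnn n) => /=.
  rewrite ltr_pdivlMr ?ltr_wpDl ?mulr_ge0 // ?ltW // mulrDr mul1r => h.
  have -> : 3 * K * (D / 2 ^+ n) = 2 ^- n * (3 * K * D) by ring.
  by apply: le_lt_trans h; rewrite mulr1 lerDl invr_ge0 exprn_ge0.
have inr t y : in_rect (rn n).1.1 (rn n).1.2 (rn n).2.1 (rn n).2.2 t y ->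
    in_rect T1 T2 Y1 Y2 t y.
  case: (okn n) => ? ? ? [? ? ?] [/andP[? ?] /andP[? ?]].
  by split; apply/andP; split; lra.
set z0 := ruled p q in hd hr.
have near t y : in_rect (rn n).1.1 (rn n).1.2 (rn n).2.1 (rn n).2.2 t y ->
    normc (ruled t y - z0) <= 3 * K * (D / 2 ^+ n).
  move=> /[dup] I [/andP[I1 I2] /andP[I3 I4]].
  apply: le_trans (lip t y p q (inr _ _ I) _) _; first by split; [exact: (hp 0%N)|exact: (hq 0%N)].
  have [s1 s2] := side n; have /andP[p1 p2] := hp n; have /andP[q1 q2] := hq n.
  have A : `|t - p| <= D / 2 ^+ n by rewrite ler_norml; apply/andP; split; lra.
  have B : `|y - q| <= D / 2 ^+ n by rewrite ler_norml; apply/andP; split; lra.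
  have := ler_wpM2l (ltW K0) A; have := ler_wpM2l (ltW K0) B.
  set X := K * `|t - p|; set Y := K * `|y - q|; rewrite -!mulrA -/Y; lra.
pose A (z : C) := (F z0 - d * z0) + d * z.
have cA : rect_cont A (rn n).1.1 (rn n).1.2 (rn n).2.1 (rn n).2.2.
  move=> t y _; apply: cdiff_ccont; apply: cdiff_add; first exact: cdiff_cst.
  by apply: cdiff_mul; [exact: cdiff_cst|exact: cdiff_id].
have cF : rect_cont F (rn n).1.1 (rn n).1.2 (rn n).2.1 (rn n).2.2.
  by move=> t y /inr I; apply: cdiff_ccont; exact: dF.
have [b1 b2 b3 [b4 b5 b6]] := okn n.
have [s1 s2] := side n.
have E : bd (rn n) <= 8 * ((e1 * (3 * K * (D / 2 ^+ n))) * K * (D / 2 ^+ n)).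
  rewrite /bd.
  have -> : ruled_bd F (rn n).1.1 (rn n).1.2 (rn n).2.1 (rn n).2.2 =
     ruled_bd (fun z => F z - A z) (rn n).1.1 (rn n).1.2 (rn n).2.1 (rn n).2.2.
    by rewrite ruled_bd_sub // ruled_bd_affine // subr0.
  apply: ruled_bd_le => //.
  - move=> t y I e' e'0.
    have [rF rF0 hF] := cF t y I _ (divr_gt0 e'0 (ltr0n _ 2)).
    have [rA rA0 hA] := cA t y I _ (divr_gt0 e'0 (ltr0n _ 2)).
    exists (Num.min rF rA); first by rewrite lt_min rF0.
    move=> h; rewrite lt_min => /andP[/hF h1 /hA h2].
    have -> : F (ruled t y + h) - A (ruled t y + h) - (F (ruled t y) - A (ruled t y)) =
      (F (ruled t y + h) - F (ruled t y)) - (A (ruled t y + h) - A (ruled t y)) by ring.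
    by apply: le_lt_trans (normcB _ _) _; lra.
  - by move=> t y /inr; exact: bG.
  - by move=> y /andP[? ?]; apply: bV; apply/andP; split; lra.
  - move=> t y I; have N := near t y I.
    have := hr (ruled t y - z0) (le_lt_trans N hn).
    have -> : F (z0 + (ruled t y - z0)) - F z0 - d * (ruled t y - z0) =
        F (ruled t y) - A (ruled t y).
      by rewrite /A [z0 + _]addrC subrK; ring.
    by move=> h; apply: le_trans h _; rewrite ler_wpM2l // ltW.
have := le_trans (bdn n) E.
rewrite ler_pdivrMr ?exprn_gt0 // => H; apply: le_trans H _.
have -> : 8 * (e1 * (3 * K * (D / 2 ^+ n)) * K * (D / 2 ^+ n)) * 4 ^+ n =
   e1 * (24 * K * K * (D * D)).
  have -> : (4 : R) ^+ n = 2 ^+ n * 2 ^+ n by rewrite -exprMn -natrM.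
  by field; rewrite expf_neq0.
rewrite /e1 mulrAC ler_pdivrMr ?ltr_wpDl //.
by rewrite ler_wpM2l ?lerDl // ltW.
Qed.

End Bisection.
End Goursat.

(** * Dominated convergence and integrals over the whole line *)

Section Limits.
Context {R : realType}.
Local Notation C := R[i].
Local Notation leb := (@lebesgue_measure R).

Lemma nat_above (x : R) : exists N : nat, x <= N%:R.
Proof. by exists (Num.Def.truncn x).+1; exact/ltW/truncnS_gt. Qed.

Lemma real_DCT (D : set (measurableTypeR R)) (f_ : nat -> R -> R) (f b : R -> R) :
  measurable D -> (forall n, leb.-integrable D (EFin \o f_ n)) ->
  (forall x, D x -> f_ ^~ x @ \oo --> f x) ->
  leb.-integrable D (EFin \o b) -> (forall n x, D x -> `|f_ n x| <= b x) ->
  leb.-integrable D (EFin \o f) /\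
  (\int[leb]_(x in D) f_ n x) @[n --> \oo] --> \int[leb]_(x in D) f x.
Proof.
move=> mD fi cf bi bd.
have cfE x : D x -> (fun n => (EFin \o f_ n) x) @ \oo --> (EFin \o f) x.
  by move=> Dx; apply: cvg_EFin; [near=> n|exact: cf].
have mf := measurable_realfun.emeasurable_fun_cvg (fun n => EFin \o f_ n) (EFin \o f)
  (fun n => measurable_int leb (fi n)) cfE.
have bdE x n : D x -> (`|(EFin \o f_ n) x| <= (EFin \o b) x)%E.
  by move=> Dx; rewrite /= lee_fin; exact: bd.
have [H1 _ H3] := @dominated_convergence _ _ R leb D mD (fun n => EFin \o f_ n) (EFin \o f)
  (EFin \o b) (fun n => measurable_int leb (fi n)) mf (aeW _ cfE) bi
  (aeW _ bdE).
split=> //; apply: fine_cvg; rewrite fineK; first exact: H3.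
exact: integrable_fin_num.
Unshelve. all: by end_near. Qed.

Lemma complex_DCT (D : set (measurableTypeR R)) (g_ : nat -> R -> C) (g : R -> C) (b : R -> R) :
  measurable D -> (forall n, cintegrable D (g_ n)) ->
  (forall x, D x -> forall e : R, 0 < e ->
     exists N, forall n, (N <= n)%N -> normc (g_ n x - g x) <= e) ->
  leb.-integrable D (EFin \o b) -> (forall n x, D x -> normc (g_ n x) <= b x) ->
  cintegrable D g /\ forall e : R, 0 < e ->
     exists N, forall n, (N <= n)%N -> normc (cint D (g_ n) - cint D g) <= e.
Proof.
move=> mD gi cg bi bd.
have [iR cR] : leb.-integrable D (EFin \o (fun x => complex.Re (g x))) /\
  (\int[leb]_(x in D) complex.Re (g_ n x)) @[n --> \oo] --> \int[leb]_(x in D) complex.Re (g x).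
  apply: (@real_DCT D (fun n x => complex.Re (g_ n x)) _ b) => //.
  - by move=> n; case: (gi n).
  - move=> x Dx; apply/cvgrPdist_le => e e0; have [N hN] := cg x Dx e e0.
    exists N => // n /hN; apply: le_trans.
    by rewrite distrC -ReN -ReD ler_normRe.
  - by move=> n x Dx; apply: le_trans (ler_normRe _) (bd n x Dx).
have [iI cI] : leb.-integrable D (EFin \o (fun x => complex.Im (g x))) /\
  (\int[leb]_(x in D) complex.Im (g_ n x)) @[n --> \oo] --> \int[leb]_(x in D) complex.Im (g x).
  apply: (@real_DCT D (fun n x => complex.Im (g_ n x)) _ b) => //.
  - by move=> n; case: (gi n).
  - move=> x Dx; apply/cvgrPdist_le => e e0; have [N hN] := cg x Dx e e0.
    exists N => // n /hN; apply: le_trans.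
    by rewrite distrC -ImN -ImD ler_normIm.
  - by move=> n x Dx; apply: le_trans (ler_normIm _) (bd n x Dx).
split=> // e e0.
have e2 : 0 < e / 2 by rewrite divr_gt0.
move/cvgrPdist_le: cR => /(_ _ e2)[N1 _ h1].
move/cvgrPdist_le: cI => /(_ _ e2)[N2 _ h2].
exists (maxn N1 N2) => n; rewrite geq_max => /andP[n1 n2].
apply: le_trans (normc_le_ReIm _) _; rewrite ReD ImD ReN ImN /cint /=.
have := h1 n n1; have := h2 n n2; rewrite /= => ? ?.
rewrite distrC [X in _ + X <= _]distrC; lra.
Qed.

Lemma cint_patch (D : set (measurableTypeR R)) (g : R -> C) :
  cint D g = cint setT (fun y => if y \in D then g y else 0).
Proof.
rewrite /cint Rintegral_mkcond [X in _ +i* X]Rintegral_mkcond; congr (_ +i* _).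
- by apply: eq_Rintegral => y _; rewrite patchE; case: ifP.
- by apply: eq_Rintegral => y _; rewrite patchE; case: ifP.
Qed.

Lemma cintegrable_patch (D : set (measurableTypeR R)) (g : R -> C) : measurable D ->
  cintegrable D g -> cintegrable setT (fun y => if y \in D then g y else 0).
Proof.
move=> mD [/(integrable_mkcond _ mD) H1 /(integrable_mkcond _ mD) H2]; split.
- by apply: eq_integrable H1 => // y _; rewrite patchE /=; case: ifP.
- by apply: eq_integrable H2 => // y _; rewrite patchE /=; case: ifP.
Qed.

Lemma cintegrableS (D E : set (measurableTypeR R)) (g : R -> C) :
  measurable D -> measurable E -> D `<=` E -> cintegrable E g -> cintegrable D g.
Proof.
by move=> mD mE DE [H1 H2]; split; apply: (integrableS mE mD DE).
Qed.

Lemma cint_lim (g : R -> C) : cintegrable setT g -> forall e : R, 0 < e ->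
  exists N : nat, forall n, (N <= n)%N -> normc (cint `[- n%:R, n%:R] g - cint setT g) <= e.
Proof.
move=> gi.
pose g_ n (y : R) := if y \in (`[- n%:R, n%:R]%classic : set (measurableTypeR R)) then g y else 0.
have gi' n : cintegrable `[- n%:R, n%:R] g by apply: cintegrableS gi.
have Ib : leb.-integrable setT (EFin \o (fun y => `|complex.Re (g y)| + `|complex.Im (g y)|)).
  case: gi => g1 g2.
  have := integrableD measurableT (integrable_norm g1) (integrable_norm g2).
  by apply: eq_integrable.
have [//|n|x _ e e0|//|n x _|_ H] := @complex_DCT setT g_ g
  (fun y => `|complex.Re (g y)| + `|complex.Im (g y)|).
- exact: (@cintegrable_patch `[- n%:R, n%:R]%classic g (measurable_itv _) (gi' n)).
- have [N hN] := nat_above `|x|; exists N => n hn.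
  suff -> : g_ n x = g x by rewrite subrr normc0 ltW.
  rewrite /g_ mem_set //= in_itv /= -ler_norml.
  by rewrite (le_trans hN) // ler_nat.
- by rewrite /g_; case: ifP => _; [exact: normc_le_ReIm|rewrite normc0 addr_ge0].
move=> e e0; have [N hN] := H e e0; exists N => n nN.
by rewrite cint_patch; exact: hN.
Qed.

Lemma cint_zero (g : R -> C) : cintegrable setT g ->
  (forall e : R, 0 < e -> exists N : nat, forall n, (N <= n)%N ->
    normc (cint `[- n%:R, n%:R] g) <= e) -> cint setT g = 0.
Proof.
move=> gi H; apply/eqP; rewrite -normc_eq0; apply/eqP/le_anti; rewrite normc_ge0 andbT.
apply/ler_addgt0Pr => e e0; rewrite add0r.
have e2 : 0 < e / 2 by rewrite divr_gt0.
have [N hN] := H _ e2; have [M hM] := cint_lim gi e2.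
have := hN _ (leq_maxl N M); have := hM _ (leq_maxr N M).
set a := cint _ _; set b := cint _ _ => h1 h2.
have -> : b = a - (a - b) by ring.
by apply: le_trans (normcB _ _) _; lra.
Qed.

End Limits.

(** * Displacement of graphs under the integral sign *)

Section RuledPaths.
Context {R : realType}.
Local Notation C := R[i].
Local Notation leb := (@lebesgue_measure R).

Definition C1 (g g' : R -> R) := forall y,
  is_derive y (1 : R) g (g' y) /\ {for y, continuous g'}.

Lemma C1_pdiff g g' y : C1 g g' -> pdiff (fun y => (g y)%:C) y (g' y)%:C.
Proof. by move=> H; apply: pdiff_real; case: (H y). Qed.

Lemma C1_pcont' g g' y : C1 g g' -> pcont (fun y => (g' y)%:C) y.
Proof. by move=> H; apply: pcont_real; case: (H y). Qed.

Lemma C1_pcont g g' y : C1 g g' -> pcont (fun y => (g y)%:C) y.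
Proof. by move=> H; apply: pdiff_pcont (C1_pdiff y H). Qed.

Lemma complex_iE (a b : R) : a +i* b = a%:C + 'i * b%:C.
Proof. by apply: complexP; rewrite ?ReD ?ImD ?ReM ?ImM /=; ring. Qed.

Lemma complex_lin (s a b : R) : (s * a) +i* b = s%:C * a%:C + 'i * b%:C.
Proof. by apply: complexP; rewrite ?ReD ?ImD ?ReM ?ImM /=; ring. Qed.

Lemma graph_pdiff g g' y : C1 g g' -> pdiff (fun y => g y +i* y) y (g' y +i* 1).
Proof.
move=> H.
have := pdiff_add (C1_pdiff y H) (pdiff_mul (pdiff_cst 'i y) (pdiff_id y)).
rewrite mul0r add0r mulr1.
have -> : (fun t => (g t)%:C + 'i * t%:C) = (fun t => g t +i* t).
  by apply/funext => t; rewrite complex_iE.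
by rewrite complex_iE mulr1.
Qed.

Lemma graph_pcont g g' y : C1 g g' -> pcont (fun y => g y +i* y) y.
Proof. by move=> H; apply: pdiff_pcont (graph_pdiff y H). Qed.

Lemma graph_pcont' g g' y : C1 g g' -> pcont (fun y => g' y +i* 1) y.
Proof.
move=> H; have := pcont_add (C1_pcont' y H) (pcont_cst 'i y).
by apply: pcont_eq => t; rewrite complex_iE mulr1.
Qed.

Lemma C1_cst (a : R) : C1 (fun=> a) (fun=> 0).
Proof. by move=> y; split; [exact: is_derive_cst|exact: cst_continuous]. Qed.

Lemma C1N g g' : C1 g g' -> C1 (fun y => - g y) (fun y => - g' y).
Proof.
move=> H y; have [d c] := H y; split; last exact: continuousN.
exact: is_deriveN.
Qed.

(** By Goursat the two graph integrals differ by the horizontal edges at heights Y and - Y, each at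
    most [2 M (t2 - t1)]. The factor [g y] in the hypothesis on [M] is the length element of these
    edges. *)
Lemma strip_shift g g' (F : C -> C) (t1 t2 Y : R) : C1 g g' -> t1 <= t2 -> 0 <= Y ->
  (forall t y, t1 <= t <= t2 -> - Y <= y <= Y -> cdiff F ((t * g y) +i* y)) ->
  forall M, 0 <= M ->
  (forall t y, t1 <= t <= t2 -> `|y| = Y -> normc (F ((t * g y) +i* y) * (g y)%:C) <= M) ->
  normc (cint `[- Y, Y] (fun y => F ((t2 * g y) +i* y) * ((t2 * g' y) +i* 1)) -
         cint `[- Y, Y] (fun y => F ((t1 * g y) +i* y) * ((t1 * g' y) +i* 1)))
  <= 4 * (M * (t2 - t1)).
Proof.
move=> cg t12 Y0 dF M M0 FM.
pose P (y : R) : C := 0 +i* y; pose P' (y : R) : C := 0 +i* 1.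
pose V (y : R) : C := (g y)%:C; pose V' (y : R) : C := (g' y)%:C.
have E t y : ruled P V t y = (t * g y) +i* y.
  by rewrite /ruled /P /V; apply: complexP; rewrite ?ReD ?ImD ?ReM ?ImM /=; ring.
have E' t y : ruled_y P' V' t y = (t * g' y) +i* 1.
  by rewrite /ruled_y /P' /V'; apply: complexP; rewrite ?ReD ?ImD ?ReM ?ImM /=; ring.
have dP y : pdiff P y (P' y) by exact: graph_pdiff (C1_cst 0).
have dV y : pdiff V y (V' y) by exact: C1_pdiff.
have cP' y : pcont P' y by exact: pcont_cst.
have cV' y : pcont V' y by exact: C1_pcont' cg.
have YY : - Y <= Y by lra.
have dF' t y : in_rect t1 t2 (- Y) Y t y -> cdiff F (ruled P V t y).
  by move=> [tt yy]; rewrite E; exact: dF.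
have := goursat dP dV cP' cV' t12 YY dF'.
have Ey t : edge_y P V P' V' F t (- Y) Y =
    cint `[- Y, Y] (fun y => F ((t * g y) +i* y) * ((t * g' y) +i* 1)).
  by apply: cint_eq => y _; rewrite E E'.
have Et y : `|y| = Y -> normc (edge_t P V F y t1 t2) <= 2 * (M * (t2 - t1)).
  move=> yY; apply: cint_itv_le => // t tt; last by rewrite E; exact: FM.
  apply: pcont_edge_t; apply/cdiff_ccont/dF'; split=> //.
  by rewrite -ler_norml yY.
have := Et Y (ger0_norm Y0); have := Et (- Y).
rewrite normrN ger0_norm // => /(_ erefl) e1 e2.
rewrite /ruled_bd !Ey; set A := cint _ _ - cint _ _ => H.
have -> : A = edge_t P V F Y t1 t2 - edge_t P V F (- Y) t1 t2.
  by apply/eqP; rewrite -subr_eq0 -H; apply/eqP; ring.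
by apply: le_trans (normcB _ _) _; lra.
Qed.

Lemma inv_sqr_continuous (x : R) : x != 0 -> {for x, continuous (fun x : R => x^-1 ^+ 2)}.
Proof.
move=> x0; have -> : (fun x : R => x^-1 ^+ 2) = (fun x => x^-1 * x^-1).
  by apply/funext => t; rewrite expr2.
by apply: cvgM; exact: inv_continuous.
Qed.

Lemma cint_inv_sqr (a b : R) : 0 < a -> a <= b ->
  \int[leb]_(x in `[a, b]) (x^-1 ^+ 2) = a^-1 - b^-1.
Proof.
move=> a0 ab.
have x0 x : a <= x <= b -> x != 0 by move=> /andP[ax _]; rewrite gt_eqF // (lt_le_trans a0).
transitivity (- b^-1 - - a^-1); last by rewrite opprK addrC.
apply: (@FTC_real _ (fun x => - x^-1) (fun x => x^-1 ^+ 2)) => //.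
- move=> x /x0 xn0.
  have D : is_derive x (1 : R) (fun x : R => - x^-1) (- (- x ^- 2 *: 1)).
    exact: (is_deriveN (is_deriveV xn0 (is_derive_id x (1 : R)))).
  apply: (is_derive_eq D); rewrite /GRing.scale /=; field.
  exact: xn0.
- apply: continuous_in_subspaceT => x; rewrite inE /= in_itv /= => /x0 xn0.
  exact: inv_sqr_continuous.
Qed.

(* Pushing the graph x = s (g y + t) to infinity kills the integral: the
   far edge is O(1/t^2) and each horizontal edge is at most int K/(t^2+Y^2). *)
Lemma half_shift (s : R) g g' (F : C -> C) (K r Y : R) : `|s| = 1 -> C1 g g' ->
  (forall y, 0 <= g y) -> 0 <= K ->
  (forall t y, 0 <= t -> cdiff F ((s * (g y + t)) +i* y)) ->
  (forall t y, 0 <= t -> r <= normc ((s * (g y + t)) +i* y) ->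
     normc (F ((s * (g y + t)) +i* y)) <= K / normc ((s * (g y + t)) +i* y) ^+ 2) ->
  1 <= Y -> r <= Y ->
  normc (cint `[- Y, Y] (fun y => F ((s * g y) +i* y) * ((s * g' y) +i* 1))) <= 8 * K / Y.
Proof.
move=> s1 cg g0 K0 dF FK Y1 rY.
have Y0 : 0 < Y by lra.
pose P (y : R) : C := (s * g y) +i* y; pose P' (y : R) : C := (s * g' y) +i* 1.
pose V (y : R) : C := s%:C; pose V' (y : R) : C := 0.
have E t y : ruled P V t y = (s * (g y + t)) +i* y.
  by rewrite /ruled /P /V; apply: complexP; rewrite ?ReD ?ImD ?ReM ?ImM /=; ring.
have E' t y : ruled_y P' V' t y = (s * g' y) +i* 1.
  by rewrite /ruled_y /P' /V' mulr0 addr0.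
have dP y : pdiff P y (P' y).
  have := pdiff_add (pdiff_mul (pdiff_cst s%:C y) (C1_pdiff y cg))
    (pdiff_mul (pdiff_cst 'i y) (pdiff_id y)).
  rewrite !mul0r !add0r mulr1.
  have -> : (fun t => s%:C * (g t)%:C + 'i * t%:C) = P.
    by apply/funext => t; rewrite /P complex_lin.
  by rewrite /P' complex_lin mulr1.
have dV y : pdiff V y (V' y) by exact: pdiff_cst.
have cP' y : pcont P' y.
  have := pcont_add (pcont_mul (pcont_cst s%:C y) (C1_pcont' y cg)) (pcont_cst 'i y).
  by apply: pcont_eq => t; rewrite /P' complex_lin mulr1.
have cV' y : pcont V' y by exact: pcont_cst.
have dF' X t y : in_rect 0 X (- Y) Y t y -> cdiff F (ruled P V t y).
  by move=> [/andP[t0 _] _]; rewrite E; exact: dF.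
have YY : - Y <= Y by lra.
have zt t y : 0 <= t -> t <= normc (ruled P V t y).
  move=> t0; rewrite E; apply: le_trans (ler_normRe _) => /=.
  by rewrite normrM s1 mul1r ger0_norm ?lerDr ?addr_ge0.
have zy t y : `|y| <= normc (ruled P V t y).
  by rewrite E; apply: le_trans (ler_normIm _).
have Fb t y d : 0 <= t -> 0 < d -> r <= d -> d <= normc (ruled P V t y) ->
    normc (F (ruled P V t y)) <= K * d^-1 ^+ 2.
  move=> t0 d0 rd dz; have := FK t y t0; rewrite -E => /(_ (le_trans rd dz)) h.
  apply: le_trans h _; rewrite ler_wpM2l // exprVn lef_pV2 ?posrE ?exprn_gt0 //.
    by rewrite lerXn2r ?nnegrE // ltW // (lt_le_trans d0).
  by rewrite (lt_le_trans d0).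
have cE X y : (forall t, 0 <= t <= X -> pcont (fun t => F (ruled P V t y) * V y) t).
  move=> t /andP[t0 _]; apply: pcont_edge_t; apply: cdiff_ccont.
  by rewrite E; exact: dF.
have V1 y : normc (V y) = 1 by rewrite /V normc_real s1.
have Et X y : Y <= X -> `|y| = Y -> normc (edge_t P V F y 0 X) <= 4 * K / Y.
  (* On [[0, Y]] the ordinate gives [|z| >= Y]; on [[Y, X]] the displacement gives [|z| >= t], and
     the integral of [1 / t^2] stays below [1 / Y] whatever X is. *)
  move=> YX yY; rewrite /edge_t (@cint_cat _ _ 0 Y X) ?(ltW Y0) //; last first.
    exact/cintegrable_cont/cE.
  apply: le_trans (le_normcD _ _) _.
  have -> : 4 * K / Y = 2 * (K * Y^-1 ^+ 2 * (Y - 0)) + 2 * (K * Y^-1).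
    by field; rewrite gt_eqF.
  apply: lerD.
    apply: cint_itv_le; first exact: ltW.
      by move=> t /andP[t0 tY]; apply: (cE Y); rewrite t0.
    move=> t /andP[t0 tY]; rewrite normcM V1 mulr1.
    by apply: Fb => //; rewrite -yY.
  have iI : leb.-integrable `[Y, X] (EFin \o (fun x => K * x^-1 ^+ 2)).
    apply: continuous_compact_integrable; first exact: segment_compact.
    apply: continuous_in_subspaceT => x; rewrite inE /= in_itv /= => /andP[xY _].
    apply: cvgM; first exact: cvg_cst.
    apply: inv_sqr_continuous.
    by rewrite gt_eqF // (lt_le_trans Y0).
  have iI' : leb.-integrable `[Y, X] (EFin \o (fun x => x^-1 ^+ 2)).
    apply: continuous_compact_integrable; first exact: segment_compact.
    apply: continuous_in_subspaceT => x; rewrite inE /= in_itv /= => /andP[xY _].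
    apply: inv_sqr_continuous.
    by rewrite gt_eqF // (lt_le_trans Y0).
  apply: le_trans (@cint_le _ _ _ (fun x => K * x^-1 ^+ 2) _ _ iI _) _ => //.
  - apply: cintegrable_cont => t /andP[Yt tX]; apply: (cE X).
    by rewrite tX (le_trans (ltW Y0)).
  - move=> t; rewrite /= in_itv /= => /andP[Yt tX]; rewrite normcM V1 mulr1.
    have t0 : 0 < t by rewrite (lt_le_trans Y0).
    by apply: Fb => //; [exact: ltW|exact: le_trans Yt|exact/zt/ltW].
  rewrite RintegralZl // cint_inv_sqr // !ler_wpM2l //.
  by rewrite gerBl invr_ge0 (le_trans (ltW Y0)).
have [B B0 hB] := pcont_bounded YY (fun y _ => cP' y).
apply/ler_addgt0Pr => e e0.
(* The far edge is at most [4 K B Y / X^2]; this X makes it at most [e]. *)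
pose X := Y + 1 + 4 * K * B * Y / e.
have Q0 : 0 <= 4 * K * B * Y / e by rewrite !mulr_ge0 ?invr_ge0 // ltW.
have X0 : 0 < X by rewrite /X; lra.
have YX : Y <= X by rewrite /X; lra.
have X1 : 1 <= X by rewrite /X; lra.
have EX : normc (edge_y P V P' V' F X (- Y) Y) <= e.
  apply: le_trans (cint_itv_le (K := K * X^-1 ^+ 2 * B) YY _ _) _.
  - move=> y yy; apply: (pcont_edge_y dP dV cP' cV'); apply: cdiff_ccont.
    by rewrite E; apply: dF; exact: ltW.
  - move=> y yy; rewrite normcM; apply: ler_pM; rewrite ?normc_ge0 //.
      by apply: Fb => //; [exact: ltW|exact: le_trans YX|exact/zt/ltW].
    by rewrite E'; exact: hB.
  have -> : 2 * (K * X^-1 ^+ 2 * B * (Y - - Y)) = 4 * K * B * Y / X / X.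
    by field; rewrite gt_eqF.
  rewrite ler_pdivrMr //; apply: (@le_trans _ _ (4 * K * B * Y / 1)).
    by rewrite ler_wpM2l ?lef_pV2 ?posrE // !mulr_ge0 // ltW.
  rewrite divr1 /X mulrDr (mulrCA e) mulfV ?gt_eqF // mulr1 lerDr mulr_ge0 ?addr_ge0 // ltW //.
have G := goursat dP dV cP' cV' (ltW X0) YY (dF' X).
have -> : cint `[- Y, Y] (fun y => F ((s * g y) +i* y) * ((s * g' y) +i* 1)) =
    edge_y P V P' V' F 0 (- Y) Y.
  by apply: cint_eq => y _; rewrite E E' addr0.
have -> : edge_y P V P' V' F 0 (- Y) Y =
    edge_y P V P' V' F X (- Y) Y - (edge_t P V F Y 0 X - edge_t P V F (- Y) 0 X).
  by apply/eqP; rewrite -subr_eq0 -oppr_eq0 -G /ruled_bd; apply/eqP; ring.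
apply: le_trans (normcB _ _) _.
have := Et X Y YX (ger0_norm (ltW Y0)); have := Et X (- Y) YX.
rewrite normrN (ger0_norm (ltW Y0)) => /(_ erefl) e1 e2.
have := normcB (edge_t P V F Y 0 X) (edge_t P V F (- Y) 0 X).
set u := 4 * K / Y in e1 e2; have -> : 8 * K / Y = u + u by rewrite /u; ring.
lra.
Qed.

Lemma half_zero (s : R) g g' (F : C -> C) (K r : R) : `|s| = 1 -> C1 g g' ->
  (forall y, 0 <= g y) -> 0 <= K ->
  (forall t y, 0 <= t -> cdiff F ((s * (g y + t)) +i* y)) ->
  (forall t y, 0 <= t -> r <= normc ((s * (g y + t)) +i* y) ->
     normc (F ((s * (g y + t)) +i* y)) <= K / normc ((s * (g y + t)) +i* y) ^+ 2) ->
  cintegrable setT (fun y => F ((s * g y) +i* y) * ((s * g' y) +i* 1)) ->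
  cint setT (fun y => F ((s * g y) +i* y) * ((s * g' y) +i* 1)) = 0.
Proof.
move=> s1 cg g0 K0 dF FK Fi; apply: cint_zero => // e e0.
have [N hN] := nat_above (1 + `|r| + 8 * K / e).
exists N => n Nn.
have nN : 1 + `|r| + 8 * K / e <= n%:R by rewrite (le_trans hN) // ler_nat.
have Q0 : 0 <= 8 * K / e by rewrite !mulr_ge0 ?invr_ge0 // ltW.
have rn := ler_norm r; have r0 := normr_ge0 r.
have n0 : 0 < n%:R :> R by lra.
apply: le_trans (half_shift s1 cg g0 K0 dF FK _ _) _; try lra.
by rewrite ler_pdivrMr // -ler_pdivrMl // mulrC; lra.
Qed.

End RuledPaths.

(** * Cauchy integrals over a circle *)

Section Regularity.
Context {R : realType}.
Local Notation C := R[i].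
Variables (c : C) (rho : R).
Hypothesis rho0 : 0 < rho.

Let cis (y : R) : C := cos y +i* sin y.
Let cis' (y : R) : C := (- sin y) +i* cos y.
Let dcis y : pdiff cis y (cis' y).
Proof. by split; [exact: is_derive_cos|exact: is_derive_sin]. Qed.
Let dcis' y : pdiff cis' y (- cis y).
Proof.
split; rewrite ?ReN ?ImN /=; last exact: is_derive_cos.
by apply: (is_derive_eq (is_deriveN (is_derive_sin y))).
Qed.
Let ncis y : normc (cis y) = 1.
Proof. by rewrite /normc /= cos2Dsin2 sqrtr1. Qed.
Let ncis' y : normc (cis' y) = 1.
Proof. by rewrite /normc /= sqrrN addrC cos2Dsin2 sqrtr1. Qed.

Let circ (y : R) : C := c + rho%:C * cis y.
Let circ' (y : R) : C := rho%:C * cis' y.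

Let dcirc y : pdiff circ y (circ' y).
Proof.
have := pdiff_add (pdiff_cst c y) (pdiff_mul (pdiff_cst rho%:C y) (dcis y)).
by rewrite mul0r !add0r.
Qed.
Let ccirc' y : pcont circ' y.
Proof. by apply: pcont_mul; [exact: pcont_cst|exact: pdiff_pcont (dcis' y)]. Qed.
Let ncirc y : normc (circ y - c) = rho.
Proof. by rewrite /circ addrC addKr normcM ncis mulr1 normc_real gtr0_norm. Qed.
Let ncirc' y : normc (circ' y) = rho.
Proof. by rewrite /circ' normcM ncis' mulr1 normc_real gtr0_norm. Qed.

Let pi2_ge0 : (0 : R) <= pi *+ 2.
Proof. by rewrite mulrn_wge0 // pi_ge0. Qed.

Let circ_dist (z : C) d y : normc (z - c) <= rho - d -> d <= normc (circ y - z).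
Proof.
move=> zd; have := normc_tri (circ y - c) (z - c); rewrite ncirc.
have -> : circ y - c - (z - c) = circ y - z by ring.
lra.
Qed.

(** Not divided by [2 pi i]: the normalization is the integral of the constant 1, whose value is
    computed at the centre only ([cauchy_cst]). *)
Definition cauchy_circle (phi : C -> C) (z : C) :=
  cint `[0, pi *+ 2] (fun y => phi (circ y) * circ' y / (circ y - z)).

Definition circle_cont (phi : C -> C) := forall y, ccont phi (circ y).

Let icirc (phi : C -> C) z y : circle_cont phi -> normc (z - c) < rho ->
  pcont (fun y => phi (circ y) * circ' y / (circ y - z)) y.
Proof.
move=> cphi zr; apply: pcont_mul.
  by apply: pcont_mul => //; apply: pcont_comp => //; exact: pdiff_pcont (dcirc y).
apply: (@pcont_comp _ (fun w => (w - z)^-1) circ); first exact: pdiff_pcont (dcirc y).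
apply: cdiff_ccont; apply: cdiff_inv; first by apply: cdiff_sub; [exact: cdiff_id|exact: cdiff_cst].
rewrite -normc_gt0; have := @circ_dist z (rho - normc (z - c)) y; lra.
Qed.

Let cauchy_cst : cauchy_circle (fun=> 1) c = (pi *+ 2)%:C * 'i.
Proof.
rewrite /cauchy_circle.
have E y : 1 * circ' y / (circ y - c) = 'i.
  rewrite mul1r /circ /circ' addrC addKr invfM mulrACA mulfV ?mul1r; last first.
    by rewrite -normc_gt0 normc_real normr_gt0 gt_eqF.
  have c0 : cis y != 0 by rewrite -normc_gt0 ncis.
  apply: (mulIf c0); rewrite mulfVK //.
  by rewrite /cis /cis'; apply: complexP; rewrite ?ReM ?ImM /=; ring.
rewrite (@cint_eq _ _ _ (fun=> 'i)) // (@cint_FTC _ (fun y => y%:C * 'i)) //.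
- by rewrite mul0r subr0.
- move=> y _; have := pdiff_mul (pdiff_id y) (pdiff_cst 'i y).
  by rewrite mul1r mulr0 addr0.
- by move=> y _; exact: pcont_cst.
Qed.

Let quot_cont (phi : C -> C) w : circle_cont phi -> normc (w - c) < rho ->
  circle_cont (fun v => phi v / (v - w)).
Proof.
move=> cphi wr y.
have nz : circ y - w != 0.
  by rewrite -normc_gt0; have := @circ_dist w (rho - normc (w - c)) y; lra.
have c2 : ccont (fun v => (v - w)^-1) (circ y).
  apply: cdiff_ccont; apply: cdiff_inv => //.
  by apply: cdiff_sub; [exact: cdiff_id|exact: cdiff_cst].
exact: ccont_mul.
Qed.

(** Resolvent identity for the Cauchy kernel. Applied twice, it writes the remainder of the
    derivative as [h^2] times a bounded Cauchy integral ([cauchy_cdiff]). *)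
Let cauchy_diff (phi : C -> C) z w : circle_cont phi -> normc (z - c) < rho ->
  normc (w - c) < rho -> cauchy_circle phi z - cauchy_circle phi w =
  (z - w) * cauchy_circle (fun v => phi v / (v - w)) z.
Proof.
move=> cphi zr wr; rewrite /cauchy_circle -cint_sub //; last 2 first.
- by apply: cintegrable_cont => y _; exact: icirc.
- by apply: cintegrable_cont => y _; exact: icirc.
have nz v y : normc (v - c) < rho -> circ y - v != 0.
  by move=> vr; rewrite -normc_gt0; have := @circ_dist v (rho - normc (v - c)) y; lra.
rewrite -cint_scale //; last first.
  apply: cintegrable_cont => y _.
  by apply: (@icirc (fun v => phi v / (v - w)) z y _ zr); exact: quot_cont.
apply: cint_eq => y _; field.
by rewrite !nz.
Qed.

Let cauchy_bound (phi : C -> C) : circle_cont phi -> exists2 K : R, 0 < K &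
  forall z, normc (z - c) <= rho / 2 -> normc (cauchy_circle phi z) <= K.
Proof.
move=> cphi.
have [M M0 hM] : exists2 M : R, 0 < M & forall y, 0 <= y <= pi *+ 2 -> normc (phi (circ y)) <= M.
  apply: pcont_bounded => // y _; apply: pcont_comp => //; exact: pdiff_pcont (dcirc y).
exists (2 * (M * rho * (rho / 2)^-1 * (pi *+ 2 - 0)) + 1).
  rewrite ltr_wpDl // subr0 !mulr_ge0 ?invr_ge0 ?divr_ge0 // ltW //.
move=> z zr; apply: (@le_trans _ _ (2 * (M * rho * (rho / 2)^-1 * (pi *+ 2 - 0)))); last by rewrite lerDl.
have zr' : normc (z - c) < rho by apply: le_lt_trans zr _; rewrite ltr_pdivrMr // ltr_pMr // ltr1n.
apply: cint_itv_le => // y yy; first exact: icirc.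
have d : rho / 2 <= normc (circ y - z) by apply: circ_dist; lra.
have r2 : 0 < rho / 2 by rewrite divr_gt0.
rewrite normcM normcM normcV ncirc'; apply: ler_pM.
- by rewrite mulr_ge0 ?normc_ge0 ?(ltW rho0).
- by rewrite invr_ge0 normc_ge0.
- by apply: ler_wpM2r; [exact: ltW|exact: hM].
- by rewrite lef_pV2 ?posrE // (lt_le_trans r2).
Qed.

Let cauchy_cdiff (phi : C -> C) z : circle_cont phi -> normc (z - c) < rho / 2 ->
  cdiff (cauchy_circle phi) z.
Proof.
move=> cphi zr.
have zr' : normc (z - c) < rho by apply: lt_le_trans zr _; rewrite ler_pdivrMr // ler_pMr // ler1n.
have q1 := quot_cont cphi zr'; have q2 := quot_cont q1 zr'.
have [K K0 hK] := cauchy_bound q2.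
exists (cauchy_circle (fun v => phi v / (v - z)) z) => e e0.
exists (Num.min (rho / 2 - normc (z - c)) (e / K)).
  by rewrite lt_min subr_gt0 zr divr_gt0.
move=> h; rewrite lt_min => /andP[h1 h2].
have zh : normc (z + h - c) <= rho / 2.
  have -> : z + h - c = (z - c) + h by ring.
  by apply: le_trans (le_normcD _ _) _; lra.
have zh' : normc (z + h - c) < rho by apply: le_lt_trans zh _; rewrite ltr_pdivrMr // ltr_pMr // ltr1n.
have E : z + h - z = h by ring.
rewrite (cauchy_diff cphi zh' zr') E [_ * h]mulrC -mulrBr.
rewrite (cauchy_diff q1 zh' zr') E !normcM [leRHS]mulrC.
rewrite ler_wpM2l ?normc_ge0 //.
apply: (@le_trans _ _ (e / K * K)); last by rewrite mulfVK ?gt_eqF.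
by apply: ler_pM; rewrite ?normc_ge0 ?hK // ltW.
Qed.

(** Goursat for the difference quotient of f at z, on the cone from z to the circle. The two radial
    edges coincide by periodicity, so the circle can be shrunk towards z, where the quotient is
    bounded. *)
Let cauchy_formula (f : C -> C) z : (forall w, normc (w - c) <= rho -> cdiff f w) ->
  normc (z - c) < rho -> cauchy_circle f z = f z * cauchy_circle (fun=> 1) z.
Proof.
move=> df zr.
have cf : circle_cont f by move=> y; apply/cdiff_ccont/df; rewrite ncirc.
have c1 : circle_cont (fun=> 1) by move=> y; apply/cdiff_ccont; exact: cdiff_cst.
pose P (y : R) : C := z; pose P' (y : R) : C := 0.
pose V (y : R) : C := circ y - z.
pose F w := (f w - f z) / (w - z).
have dP y : pdiff P y (P' y) by exact: pdiff_cst.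
have dV y : pdiff V y (circ' y).
  by have := pdiff_add (dcirc y) (pdiff_cst (- z) y); rewrite addr0.
have cP' y : pcont P' y by exact: pcont_cst.
have V0 y : V y != 0.
  by rewrite -normc_gt0; have := @circ_dist z (rho - normc (z - c)) y; rewrite /V; lra.
have EV t y : ruled P V t y - z = t%:C * V y by rewrite /ruled /P; ring.
have inD t y : 0 <= t <= 1 -> normc (ruled P V t y - c) <= rho.
  move=> /andP[t0 t1].
  have -> : ruled P V t y - c = (1 - t)%:C * (z - c) + t%:C * (circ y - c).
    by rewrite /ruled /P /V rmorphB /=; ring.
  apply: le_trans (le_normcD _ _) _; rewrite !normcM !normc_real ncirc ger0_norm ?subr_ge0 // ger0_norm //.
  have := ler_wpM2l (_ : 0 <= 1 - t) (ltW zr); rewrite subr_ge0 => /(_ t1); lra.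
have dF t y : 0 < t <= 1 -> cdiff F (ruled P V t y).
  move=> /andP[t0 t1]; apply: cdiff_div.
  - by apply: cdiff_sub; [apply/df/inD; rewrite t1 ltW|exact: cdiff_cst].
  - by apply: cdiff_sub; [exact: cdiff_id|exact: cdiff_cst].
  - rewrite EV mulf_neq0 // -normc_gt0 normc_real normr_gt0 gt_eqF //.
have per t : edge_t P V F (pi *+ 2) t 1 = edge_t P V F 0 t 1.
  by apply: cint_eq => s _; rewrite /ruled /P /V /circ /cis cos2pi sin2pi cos0 sin0.
have eqt t : 0 < t <= 1 -> edge_y P V P' circ' F 1 0 (pi *+ 2) = edge_y P V P' circ' F t 0 (pi *+ 2).
  move=> /andP[t0 t1].
  have := @goursat _ _ _ _ _ dP dV cP' ccirc' F t 1 0 (pi *+ 2) t1 pi2_ge0.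
  rewrite /ruled_bd per subrK => H; apply/eqP; rewrite -subr_eq0 H //.
  by move=> s y [/andP[ts s1] _]; apply: dF; rewrite s1 (lt_le_trans t0).
have E0 : edge_y P V P' circ' F 1 0 (pi *+ 2) = 0.
  have dz : cdiff f z by apply: df; exact: ltW.
  have [d /cdiff_at_bound[r r0 hr]] := dz.
  apply/eqP; rewrite -normc_eq0; apply/eqP/le_anti; rewrite normc_ge0 andbT.
  apply/ler_addgt0Pr => e e0; rewrite add0r.
  pose K := (normc d + 1) * rho * (pi *+ 2 - 0) * 2 + 1.
  have K0 : 0 < K.
    rewrite ltr_wpDl // subr0; apply: mulr_ge0 => //; apply: mulr_ge0 => //.
    by apply: mulr_ge0; [rewrite addr_ge0 ?normc_ge0|exact: ltW].
  (* [t (2 rho + 1) <= r] puts the shrunk circle where the difference quotient is at most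
     [normc d + 1]; [t K <= e] then bounds the integral. *)
  pose t := Num.min 1 (Num.min (r / (2 * rho + 1)) (e / K)).
  have t0 : 0 < t by rewrite /t !lt_min ltr01 !divr_gt0 // ltr_wpDl // mulr_ge0 // ltW.
  have t1 : t <= 1 by rewrite /t ge_min lexx.
  have tr : t * (2 * rho + 1) <= r.
    by rewrite -ler_pdivlMr ?ltr_wpDl ?mulr_ge0 ?(ltW rho0) // /t !ge_min lexx !orbT.
  have te : t * K <= e by rewrite -ler_pdivlMr // /t !ge_min lexx !orbT.
  rewrite (eqt t) ?t0 //.
  apply: le_trans (cint_itv_le (K := (normc d + 1) * (t * rho)) pi2_ge0 _ _) _.
  - move=> y _; apply: (pcont_edge_y dP dV cP' ccirc'); apply: cdiff_ccont; apply: dF.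
    by rewrite t0.
  - move=> y _; rewrite normcM; apply: ler_pM; rewrite ?normc_ge0 //; last first.
      by rewrite /ruled_y /P' add0r normcM ncirc' normc_real gtr0_norm.
    have vb : normc (t%:C * V y) < r.
      have : normc (V y) <= 2 * rho.
        rewrite /V; have -> : circ y - z = (circ y - c) - (z - c) by ring.
        by apply: le_trans (normcB _ _) _; rewrite ncirc; lra.
      rewrite normcM normc_real gtr0_norm // => vb.
      apply: lt_le_trans tr; rewrite ltr_pM2l //; lra.
    have := hr _ vb; rewrite -EV [z + _]addrC subrK => h.
    by rewrite /F normcM normcV ler_pdivrMr // EV normc_gt0 mulf_neq0 // -normc_gt0 normc_real normr_gt0 gt_eqF.
  - apply: le_trans te; rewrite /K [leRHS]mulrDr [t * 1]mulr1.
    have -> : 2 * ((normc d + 1) * (t * rho) * (pi *+ 2 - 0)) =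
      t * ((normc d + 1) * rho * (pi *+ 2 - 0) * 2) by ring.
    by rewrite lerDl ltW.
apply/eqP; rewrite -subr_eq0 -E0; apply/eqP.
rewrite /cauchy_circle -cint_scale //; last first.
  by apply: cintegrable_cont => y _; exact: (@icirc (fun=> 1) z y c1 zr).
rewrite -cint_sub //; last 2 first.
- by apply: cintegrable_cont => y _; exact: icirc.
- by apply: cintegrable_scale => //; apply: cintegrable_cont => y _; exact: (@icirc (fun=> 1) z y c1 zr).
apply: cint_eq => y _.
rewrite /F EV /ruled_y /ruled /P /P' rmorph1 !mul1r add0r /V [z + _]addrC subrK.
field; exact: V0.
Qed.

(** Near c, [f w] is a Cauchy integral divided by [I1 w], and [I1] does not vanish there;
    [cauchy_diff] extracts the factor [w - c]. *)
Lemma local_quotient (f : C -> C) : (forall w, normc (w - c) <= rho -> cdiff f w) ->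
  exists g, cdiff g c /\ exists2 r : R, 0 < r &
    forall w, normc (w - c) < r -> f w - f c = (w - c) * g w.
Proof.
move=> df.
have cf : circle_cont f by move=> y; apply/cdiff_ccont/df; rewrite ncirc.
have c1 : circle_cont (fun=> 1) by move=> y; apply/cdiff_ccont; exact: cdiff_cst.
have cc : normc (c - c) < rho / 2 by rewrite subrr normc0 divr_gt0.
have cc' : normc (c - c) < rho by rewrite subrr normc0.
pose J phi := cauchy_circle (fun v => phi v / (v - c)).
have dJ phi : circle_cont phi -> cdiff (J phi) c.
  by move=> cphi; apply: cauchy_cdiff => //; exact: quot_cont.
pose I1 := cauchy_circle (fun=> 1).
have dI1 : cdiff I1 c by exact: cauchy_cdiff.
have I1c : I1 c != 0.
  rewrite /I1 cauchy_cst mulf_neq0 //.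
    by rewrite -normc_gt0 normc_real normr_gt0 mulrn_eq0 /= gt_eqF // pi_gt0.
  by rewrite eq_complex /= oner_eq0 andbF.
have pos : 0 < normc (I1 c) by rewrite normc_gt0.
have [r r0 hr] := cdiff_ccont dI1 pos.
exists (fun w => (J f w - f c * J (fun=> 1) w) / I1 w); split.
  apply: cdiff_div => //; apply: cdiff_sub; first exact: dJ.
  by apply: cdiff_mul; [exact: cdiff_cst|exact: dJ].
exists (Num.min r rho); first by rewrite lt_min r0.
move=> w; rewrite lt_min => /andP[wr wrho].
have Iw : I1 w != 0.
  apply/eqP => I0; have := hr _ wr; rewrite [c + _]addrC subrK I0 sub0r normcN ltxx.
  by [].
rewrite mulrA mulrBr mulrCA -!cauchy_diff //.
rewrite (cauchy_formula df wrho) (cauchy_formula df cc') -/I1.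
by field.
Qed.

End Regularity.

Section DividedDifference.
Context {R : realType}.
Local Notation C := R[i].

(** The removable singularity at c is what later arguments take from Cauchy's formula: Newton
    interpolation in [hermite] and division by [w - z] in [dec_quotient]. Away from c
    differentiability is inherited point by point, so no domain is fixed. *)
Theorem divided_difference (f : C -> C) (c : C) (r : R) : 0 < r ->
  (forall w, normc (w - c) < r -> cdiff f w) ->
  exists g, (forall w, f w - f c = (w - c) * g w) /\
    (forall w, cdiff f w -> cdiff g w).
Proof.
move=> r0 df; have r2 : 0 < r / 2 by rewrite divr_gt0.
have [|g0 [dg0 [s s0 hs]]] := @local_quotient R c (r / 2) r2 f.
  by move=> w wr; apply: df; apply: le_lt_trans wr _; rewrite ltr_pdivrMr //; lra.
exists (fun w => if w == c then g0 c else (f w - f c) / (w - c)); split.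
  move=> w; case: eqVneq => [->|wc]; first by rewrite !subrr mul0r.
  by rewrite mulrC mulfVK // subr_eq0.
move=> w dw; have [->|wc] := eqVneq w c.
  apply: cdiff_ext s0 _ dg0 => h hs'.
  case: eqVneq => [->//|hc].
  have := hs (c + h); rewrite addrAC subrr add0r => -> //.
  have h0 : h != 0 by apply: contraNneq hc => ->; rewrite addr0.
  by rewrite mulrC mulKf.
have d0 : 0 < normc (w - c) by rewrite normc_gt0 subr_eq0.
apply: (@cdiff_ext _ (fun w => (f w - f c) / (w - c)) _ w _ d0).
  move=> h hd; case: eqVneq => [E|//]; exfalso; move: hd.
  by rewrite -E opprD addrA subrr add0r normcN ltxx.
apply: cdiff_div; last by rewrite subr_eq0.
- by apply: cdiff_sub => //; exact: cdiff_cst.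
- by apply: cdiff_sub; [exact: cdiff_id|exact: cdiff_cst].
Qed.

End DividedDifference.

(** * The space L^2(C) and the contour pairing *)

Section CurveL2.
Context {R : realType}.
Local Notation C := R[i].
Local Notation leb := (@lebesgue_measure R).
Variable omega : R -> R.
Local Notation omega' := (derive1 omega).
Local Notation speed := (arc_speed omega).
Local Notation gam := (curve_pt omega).
Hypothesis hC1 : C1 omega omega'.
Implicit Types (u v w g h : C -> C) (s : bool).

Definition sg s : R := if s then 1 else -1.

Lemma norm_sg s : `|sg s| = 1.
Proof. by case: s; rewrite /sg ?normrN normr1. Qed.

Definition dgam s (y : R) : C := (sg s * omega' y) +i* 1.

Lemma gamE s y : gam s y = (sg s * omega y) +i* y.
Proof. by case: s; rewrite /curve_pt /sg ?mul1r ?mulN1r. Qed.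

Lemma normc_dgam s y : normc (dgam s y) = speed y.
Proof.
rewrite /dgam /normc /arc_speed exprMn expr1n addrC.
by rewrite (_ : sg s ^+ 2 = 1) ?mul1r //; case: s; rewrite /sg ?sqrrN expr1n.
Qed.

Lemma speed_ge1 y : 1 <= speed y.
Proof.
rewrite /arc_speed -[X in X <= _]sqrtr1 ler_sqrt ?lerDl ?sqr_ge0 //.
by rewrite addr_ge0 ?sqr_ge0.
Qed.
Lemma speed_gt0 y : 0 < speed y. Proof. exact: lt_le_trans (speed_ge1 y). Qed.
Lemma speed_ge0 y : 0 <= speed y. Proof. exact: ltW (speed_gt0 y). Qed.

Lemma pcont_gam s y : pcont (gam s) y.
Proof.
have := pcont_add (pcont_mul (pcont_cst (sg s)%:C y) (C1_pcont y hC1))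
  (pcont_mul (pcont_cst 'i y) (pcont_real (@cvg_id _ (nbhs y)))).
by apply: pcont_eq => t; rewrite gamE complex_lin.
Qed.

Lemma pcont_dgam s y : pcont (dgam s) y.
Proof.
have := pcont_add (pcont_mul (pcont_cst (sg s)%:C y) (C1_pcont' y hC1))
  (pcont_cst 'i y).
by apply: pcont_eq => t; rewrite /dgam complex_lin mulr1.
Qed.

Definition pmeas (g : R -> C) :=
  measurable_fun setT (fun y => complex.Re (g y)) /\
  measurable_fun setT (fun y => complex.Im (g y)).

Lemma pmeas_cont (g : R -> C) : (forall y, pcont g y) -> pmeas g.
Proof.
move=> cg; split; apply: continuous_measurable_fun => y.
- exact/pcont_Re/cg.
- exact/pcont_Im/cg.
Qed.

Lemma pmeas_cst c : pmeas (fun=> c).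
Proof. by split; exact: measurable_cst. Qed.

Lemma pmeas_add (g h : R -> C) : pmeas g -> pmeas h -> pmeas (fun y => g y + h y).
Proof.
move=> [g1 g2] [h1 h2]; split.
- rewrite (_ : (fun y => _) = (fun y => complex.Re (g y)) \+ (fun y => complex.Re (h y))).
    exact: measurable_funD.
  by apply/funext => y; rewrite ReD.
- rewrite (_ : (fun y => _) = (fun y => complex.Im (g y)) \+ (fun y => complex.Im (h y))).
    exact: measurable_funD.
  by apply/funext => y; rewrite ImD.
Qed.

Lemma pmeas_mul (g h : R -> C) : pmeas g -> pmeas h -> pmeas (fun y => g y * h y).
Proof.
move=> [g1 g2] [h1 h2]; split.
- rewrite (_ : (fun y => _) = ((fun y => complex.Re (g y)) \* (fun y => complex.Re (h y)))
    \- ((fun y => complex.Im (g y)) \* (fun y => complex.Im (h y)))).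
    by apply: measurable_funB; exact: measurable_funM.
  by apply/funext => y; rewrite ReM.
- rewrite (_ : (fun y => _) = ((fun y => complex.Re (g y)) \* (fun y => complex.Im (h y)))
    \+ ((fun y => complex.Im (g y)) \* (fun y => complex.Re (h y)))).
    by apply: measurable_funD; exact: measurable_funM.
  by apply/funext => y; rewrite ImM.
Qed.

Lemma pmeas_norm (g : R -> C) : pmeas g -> measurable_fun setT (fun y => normc (g y)).
Proof.
move=> [g1 g2].
rewrite (_ : (fun y => _) = (fun y => Num.sqrt (complex.Re (g y) ^+ 2 + complex.Im (g y) ^+ 2))).
  apply: (@measurableT_comp _ _ _ _ _ _ (@Num.sqrt R)).
    by apply: continuous_measurable_fun; exact: sqrt_continuous.
  by apply: measurable_funD; apply: measurable_funX.
by apply/funext => y; case: (g y).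
Qed.

Lemma meas_speed : measurable_fun setT speed.
Proof.
rewrite (_ : speed = (fun y => normc (dgam true y))).
  apply: pmeas_norm; apply: pmeas_cont => y; exact: pcont_dgam.
by apply/funext => y; rewrite normc_dgam.
Qed.

Lemma measurable_curveE u : measurable_curve omega u <-> forall s, pmeas (fun y => u (gam s y)).
Proof. by []. Qed.

Lemma integrable_ge0 (f : R -> R) : measurable_fun setT f -> (forall y, 0 <= f y) ->
  (\int[leb]_y (f y)%:E < +oo)%E -> leb.-integrable setT (EFin \o f).
Proof.
move=> mf f0 fi; apply/integrableP; split; first exact/measurable_EFinP.
apply: le_lt_trans fi; apply: ge0_le_integral => //.
- by apply: measurableT_comp => //; exact/measurable_EFinP.
- exact/measurable_EFinP.
- by move=> y _ /=; rewrite lee_fin ger0_norm.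
Qed.

Lemma integrable_le (f b : R -> R) : measurable_fun setT f -> (forall y, `|f y| <= b y) ->
  leb.-integrable setT (EFin \o b) -> leb.-integrable setT (EFin \o f).
Proof.
move=> mf fb; apply: le_integrable => //; first exact/measurable_EFinP.
by move=> y _ /=; rewrite lee_fin (le_trans (fb y)) // ler_norm.
Qed.

Lemma pmeas_cintegrable (g : R -> C) (b : R -> R) : pmeas g ->
  (forall y, normc (g y) <= b y) -> leb.-integrable setT (EFin \o b) -> cintegrable setT g.
Proof.
move=> [g1 g2] gb bi; split; apply: integrable_le bi => // y.
- exact: le_trans (ler_normRe _) (gb y).
- exact: le_trans (ler_normIm _) (gb y).
Qed.

Definition mass u s y : R := normc (u (gam s y)) ^+ 2 * speed y.

Definition L2b u := (forall s, pmeas (fun y => u (gam s y))) /\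
  forall s, leb.-integrable setT (EFin \o mass u s).

Definition nrm2 u : R := \int[leb]_y mass u true y + \int[leb]_y mass u false y.

Lemma mass_ge0 u s y : 0 <= mass u s y.
Proof. by rewrite mulr_ge0 ?exprn_ge0 ?normc_ge0 ?speed_ge0. Qed.

Lemma meas_mass u s : pmeas (fun y => u (gam s y)) -> measurable_fun setT (mass u s).
Proof.
move=> mu; apply: measurable_funM; last exact: meas_speed.
by apply: measurable_funX; exact: pmeas_norm.
Qed.

Lemma sqnormE u : sqnorm omega 0 u =
  (\int[leb]_y (mass u true y)%:E + \int[leb]_y (mass u false y)%:E)%E.
Proof.
rewrite /sqnorm /arc_integral; congr (_ + _)%E; apply: eq_integral => y _.
- by rewrite muln0 expr0 invr1 mulr1.
- by rewrite muln0 expr0 invr1 mulr1.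
Qed.

Lemma L2_curveP u : L2_curve omega u <-> L2b u.
Proof.
rewrite /L2_curve sqnormE; split=> [[mu ui]|[mu ui]]; split=> //.
  have i0 s : (0 <= \int[leb]_y (mass u s y)%:E)%E.
    by apply: integral_ge0 => y _; rewrite lee_fin mass_ge0.
  move=> s; apply: integrable_ge0; first exact: meas_mass (mu s).
    exact: mass_ge0.
  apply: le_lt_trans ui; case: s; [rewrite leeDl|rewrite leeDr] => //; exact: i0.
apply: lte_add_pinfty; apply: integrable_lty => //.
- exact: (ui true).
- exact: (ui false).
Qed.

Lemma sqnorm_nrm2 u : L2b u -> sqnorm omega 0 u = (nrm2 u)%:E.
Proof.
move=> [mu ui]; rewrite sqnormE /nrm2 /Rintegral EFinD !fineK //.
- exact: (integrable_fin_num measurableT (ui false)).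
- exact: (integrable_fin_num measurableT (ui true)).
Qed.

Lemma nrm2_ge0 u : 0 <= nrm2 u.
Proof. by rewrite addr_ge0 //; apply: Rintegral_ge0 => y _; exact: mass_ge0. Qed.

Lemma L2b_le u v (K : R) : (forall s, pmeas (fun y => u (gam s y))) -> 0 <= K -> L2b v ->
  (forall s y, normc (u (gam s y)) <= K * normc (v (gam s y))) ->
  L2b u /\ nrm2 u <= K ^+ 2 * nrm2 v.
Proof.
move=> mu K0 [mv vi] uv.
have b s y : mass u s y <= K ^+ 2 * mass v s y.
  rewrite /mass mulrA ler_wpM2r ?speed_ge0 // -exprMn lerXn2r ?nnegrE ?mulr_ge0 ?normc_ge0 //.
have vi' s : leb.-integrable setT (EFin \o (fun y => K ^+ 2 * mass v s y)).
  exact: integrableZE.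
have ui s : leb.-integrable setT (EFin \o mass u s).
  apply: integrable_le (vi' s); first exact: meas_mass.
  by move=> y; rewrite ger0_norm ?mass_ge0.
split; first by split.
rewrite /nrm2 mulrDr; apply: lerD.
- by rewrite -RintegralZl //; apply: le_Rintegral => // y _; exact: b.
- by rewrite -RintegralZl //; apply: le_Rintegral => // y _; exact: b.
Qed.

Lemma L2b_add u v : L2b u -> L2b v -> L2b (fun l => u l + v l) /\
  nrm2 (fun l => u l + v l) <= 2 * nrm2 u + 2 * nrm2 v.
Proof.
move=> [mu ui] [mv vi].
have m s : pmeas (fun y => u (gam s y) + v (gam s y)) by exact: pmeas_add.
have b s y : mass (fun l => u l + v l) s y <= 2 * mass u s y + 2 * mass v s y.
  rewrite /mass !mulrA -mulrDl ler_wpM2r ?speed_ge0 //.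
  set a := normc (u _); set c := normc (v _).
  apply: (@le_trans _ _ ((a + c) ^+ 2)).
    by rewrite lerXn2r ?nnegrE ?addr_ge0 ?normc_ge0 // le_normcD.
  have := sqr_ge0 (a - c); rewrite !expr2; lra.
have i2 w s : leb.-integrable setT (EFin \o mass w s) -> leb.-integrable setT (EFin \o (fun y => 2 * mass w s y)).
  by move=> wi; exact: integrableZE.
have bi s : leb.-integrable setT (EFin \o (fun y => 2 * mass u s y + 2 * mass v s y)).
  by have := integrableD measurableT (i2 _ _ (ui s)) (i2 _ _ (vi s)); apply: eq_integrable.
have ai s : leb.-integrable setT (EFin \o mass (fun l => u l + v l) s).
  apply: integrable_le (bi s); first exact: meas_mass.
  by move=> y; rewrite ger0_norm ?mass_ge0.
split; first by split.
have H s : \int[leb]_y mass (fun l => u l + v l) s y <=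
    2 * \int[leb]_y mass u s y + 2 * \int[leb]_y mass v s y.
  rewrite -!RintegralZl // -RintegralD //; [|exact: i2|exact: i2].
  by apply: le_Rintegral => // y _; exact: b.
by rewrite /nrm2 !mulrDr addrACA; apply: lerD; exact: H.
Qed.

Lemma L2b_scale c u : L2b u -> L2b (fun l => c * u l) /\
  nrm2 (fun l => c * u l) <= normc c ^+ 2 * nrm2 u.
Proof.
move=> ui; apply: L2b_le => //; first 2 last.
- by move=> s y; rewrite normcM.
- by move=> s; apply: pmeas_mul; [exact: pmeas_cst|case: ui].
- exact: normc_ge0.
Qed.

Lemma L2b_sub u v : L2b u -> L2b v -> L2b (fun l => u l - v l) /\
  nrm2 (fun l => u l - v l) <= 2 * nrm2 u + 2 * nrm2 v.
Proof.
move=> ui vi; have [w1 w2] := L2b_scale (-1) vi.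
have [x1 x2] := L2b_add ui w1.
have E : (fun l => u l + -1 * v l) = (fun l => u l - v l).
  by apply/funext => l; rewrite mulN1r.
rewrite E in x1 x2; split=> //.
move: w2; rewrite normcN normc1 expr1n mul1r; lra.
Qed.

Lemma L2b0 : L2b (fun=> 0).
Proof.
split=> [s|s]; first exact: pmeas_cst.
apply: (@eq_integrable _ _ _ _ _ _ (cst 0%E)) => //; last exact: integrable0.
by move=> y _; rewrite /= /mass normc0 expr0n /= mul0r.
Qed.

End CurveL2.

Section Pairing.
Context {R : realType}.
Local Notation C := R[i].
Local Notation leb := (@lebesgue_measure R).
Variable omega : R -> R.
Local Notation omega' := (derive1 omega).
Local Notation speed := (arc_speed omega).
Local Notation gam := (curve_pt omega).
Local Notation dgam := (dgam omega).
Local Notation mass := (mass omega).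
Local Notation L2b := (L2b omega).
Local Notation nrm2 := (nrm2 omega).
Local Notation mcurve u := (forall s : bool, pmeas (fun y => u (gam s y))).
Hypothesis hC1 : C1 omega omega'.
Implicit Types (u v w g h : C -> C) (s : bool).

Definition cL1 g := forall s, cintegrable setT (fun y => g (gam s y) * dgam s y).

Definition branch_int g s := cint setT (fun y => g (gam s y) * dgam s y).

Lemma contourE g : contour_integral omega g = branch_int g true - branch_int g false.
Proof.
rewrite /contour_integral !integralCE /branch_int; congr (_ - _).
- by apply: cint_eq => y _; rewrite /dgam /sg mul1r.
- by apply: cint_eq => y _; rewrite /dgam /sg mulN1r.
Qed.

Lemma cL1_scale c g : cL1 g -> cL1 (fun l => c * g l).
Proof.
move=> ig s; have := cintegrable_scale c measurableT (ig s).
by apply: cintegrable_eq => // y _; rewrite mulrA.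
Qed.

Lemma contour_add g h : cL1 g -> cL1 h ->
  contour_integral omega (fun l => g l + h l) =
  contour_integral omega g + contour_integral omega h.
Proof.
move=> ig ih; have E s : branch_int (fun l => g l + h l) s = branch_int g s + branch_int h s.
  by rewrite /branch_int -cint_add //; apply: cint_eq => y _; rewrite mulrDl.
by rewrite !contourE !E; ring.
Qed.

Lemma contour_scale c g : cL1 g ->
  contour_integral omega (fun l => c * g l) = c * contour_integral omega g.
Proof.
move=> ig; have E s : branch_int (fun l => c * g l) s = c * branch_int g s.
  by rewrite /branch_int -cint_scale //; apply: cint_eq => y _; rewrite mulrA.
by rewrite !contourE !E; ring.
Qed.

Lemma L2b_cL1 u v : L2b u -> L2b v -> cL1 (fun l => u l * v l).
Proof.
move=> [mu ui] [mv vi] s.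
apply: (@pmeas_cintegrable _ _ (fun y => mass u s y + mass v s y)).
- apply: pmeas_mul; first by apply: pmeas_mul; [exact: mu|exact: mv].
  by apply: pmeas_cont => y; exact: pcont_dgam.
- move=> y; rewrite !normcM normc_dgam /mass -mulrDl ler_wpM2r ?speed_ge0 //.
  set a := normc (u _); set c := normc (v _).
  have := sqr_ge0 (a - c); have := normc_ge0 (u (gam s y)).
  have := normc_ge0 (v (gam s y)); rewrite -/a -/c => a0 c0 H.
  have : 0 <= a * c by rewrite mulr_ge0.
  by move: H; rewrite !expr2; lra.
- by have := integrableD measurableT (ui s) (vi s); apply: eq_integrable.
Qed.

(** The weighted arithmetic-geometric inequality replaces Cauchy-Schwarz: the free weight [e] stands
    for the ratio of the norms and avoids square roots. Its 1/2 cancels the 2 of [cint_le]. *)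
Lemma branch_int_le u v s (e : R) : 0 < e -> L2b u -> L2b v ->
  normc (branch_int (fun l => u l * v l) s) <=
  e * \int[leb]_y mass u s y + e^-1 * \int[leb]_y mass v s y.
Proof.
move=> e0 ui vi.
have i1 : leb.-integrable setT (EFin \o (fun y => e / 2 * mass u s y)).
  by apply: integrableZE => //; case: ui => _ /(_ s).
have i2 : leb.-integrable setT (EFin \o (fun y => e^-1 / 2 * mass v s y)).
  by apply: integrableZE => //; case: vi => _ /(_ s).
have i12 : leb.-integrable setT (EFin \o (fun y => e / 2 * mass u s y + e^-1 / 2 * mass v s y)).
  by have := integrableD measurableT i1 i2; apply: eq_integrable.
apply: le_trans (cint_le measurableT (L2b_cL1 ui vi s) i12 _) _.
  move=> y _; rewrite !normcM normc_dgam /mass !mulrA -mulrDl ler_wpM2r ?speed_ge0 //.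
  set a := normc (u _); set c := normc (v _).
  have E : e / 2 * a * a + e^-1 / 2 * c * c - a * c = e / 2 * (a - c / e) ^+ 2.
    by field; rewrite gt_eqF.
  by rewrite -subr_ge0 E mulr_ge0 ?sqr_ge0 ?divr_ge0 // ltW.
rewrite RintegralD // !RintegralZl //; last first.
- by case: ui => _ /(_ s).
- by case: vi => _ /(_ s).
by rewrite le_eqVlt; apply/orP; left; apply/eqP; field; rewrite gt_eqF.
Qed.

Definition pair u v := contour_integral omega (fun l => u l * v l).

Lemma pair_le u v (e : R) : 0 < e -> L2b u -> L2b v ->
  normc (pair u v) <= e * nrm2 u + e^-1 * nrm2 v.
Proof.
move=> e0 ui vi; rewrite /pair contourE; apply: le_trans (normcB _ _) _.
rewrite /nrm2 !mulrDr addrACA; apply: lerD; exact: branch_int_le.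
Qed.

Lemma pair_addl u u' v : L2b u -> L2b u' -> L2b v ->
  pair (fun l => u l + u' l) v = pair u v + pair u' v.
Proof.
move=> ui ui' vi; rewrite /pair -contour_add; [|exact: L2b_cL1|exact: L2b_cL1].
by congr contour_integral; apply/funext => l; rewrite mulrDl.
Qed.

Lemma pairC u v : pair u v = pair v u.
Proof. by congr contour_integral; apply/funext => l; rewrite mulrC. Qed.

Lemma pair_scalel c u v : L2b u -> L2b v -> pair (fun l => c * u l) v = c * pair u v.
Proof.
move=> ui vi; rewrite /pair -contour_scale; last exact: L2b_cL1.
by congr contour_integral; apply/funext => l; rewrite mulrA.
Qed.

Lemma pair_subl u u' v : L2b u -> L2b u' -> L2b v ->
  pair (fun l => u l - u' l) v = pair u v - pair u' v.
Proof.
move=> ui ui' vi; rewrite -[- pair u' v]mulN1r -pair_scalel // -pair_addl //; last exact: (L2b_scale hC1 (-1) ui').1.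
by have -> : (fun l => u l + -1 * u' l) = (fun l => u l - u' l) by apply/funext => l; rewrite mulN1r.
Qed.

Lemma pair_addr u v v' : L2b u -> L2b v -> L2b v' ->
  pair u (fun l => v l + v' l) = pair u v + pair u v'.
Proof. by move=> *; rewrite pairC pair_addl // !(pairC u). Qed.

Lemma pair_scaler c u v : L2b u -> L2b v -> pair u (fun l => c * v l) = c * pair u v.
Proof. by move=> *; rewrite pairC pair_scalel // pairC. Qed.

Lemma pair_limit u v : L2b u -> L2b v ->
  (forall e : R, 0 < e -> exists2 u', L2b u' /\ pair u' v = 0 &
     nrm2 (fun l => u l - u' l) <= e) -> pair u v = 0.
Proof.
move=> ui vi H; apply/eqP; rewrite -normc_eq0; apply/eqP/le_anti; rewrite normc_ge0 andbT.
apply/ler_addgt0Pr => e e0; rewrite add0r.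
(* The weight [d] makes the term in v at most [e / 2]; its inverse is paid by taking [u'] within
   [e d / 2] of u. *)
pose d := e / 2 / (nrm2 v + 1).
have n0 := nrm2_ge0 omega v.
have d0 : 0 < d by rewrite !divr_gt0 // ltr_wpDl.
have [u' [ui' pu'] uu'] := H (e / 2 * d) (mulr_gt0 (divr_gt0 e0 (ltr0n _ 2)) d0).
have -> : pair u v = pair (fun l => u l - u' l) v by rewrite pair_subl // pu' subr0.
have wi := (L2b_sub hC1 ui ui').1.
have di : 0 < d^-1 by rewrite invr_gt0.
apply: le_trans (pair_le di wi vi) _; rewrite invrK.
have h1 : d^-1 * nrm2 (fun l => u l - u' l) <= e / 2.
  by rewrite mulrC ler_pdivrMr.
have h2 : d * nrm2 v <= e / 2.
  by rewrite /d mulrAC ler_pdivrMr ?ltr_wpDl // ler_wpM2l ?lerDl // divr_ge0 // ltW.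
lra.
Qed.

Lemma ae_mono (P Q : R -> Prop) : {ae leb, forall y, P y} -> (forall y, P y -> Q y) ->
  {ae leb, forall y, Q y}.
Proof.
move=> HP PQ; apply: (@negligibleS _ _ _ leb _ _ _ HP) => y /=.
by apply: contra_not; exact: PQ.
Qed.

Lemma ae_mono2 (P P' Q : R -> Prop) : {ae leb, forall y, P y} -> {ae leb, forall y, P' y} ->
  (forall y, P y -> P' y -> Q y) -> {ae leb, forall y, Q y}.
Proof.
move=> HP HP' PQ; apply: (@negligibleS _ _ _ leb _ _ _ (negligibleU HP HP')) => y /= nQ.
by case: (pselect (P y)) => py; [right|left] => // p'y; exact/nQ/PQ.
Qed.

Lemma eq_curve_refl u : eq_curve omega u u.
Proof. by move=> s; apply: aeW. Qed.
Lemma eq_curve_sym u v : eq_curve omega u v -> eq_curve omega v u.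
Proof. by move=> H s; apply: ae_mono (H s) _ => y ->. Qed.
Lemma eq_curve_trans u v w : eq_curve omega u v -> eq_curve omega v w -> eq_curve omega u w.
Proof. by move=> H K s; apply: ae_mono2 (H s) (K s) _ => y -> ->. Qed.
Lemma eq_curve_map (F : C -> C -> C) u v : (eq_curve omega u v) ->
  eq_curve omega (fun l => F l (u l)) (fun l => F l (v l)).
Proof. by move=> H s; apply: ae_mono (H s) _ => y /= ->. Qed.
Lemma eq_curve_map2 (F : C -> C -> C -> C) u v u' v' : eq_curve omega u v ->
  eq_curve omega u' v' -> eq_curve omega (fun l => F l (u l) (u' l)) (fun l => F l (v l) (v' l)).
Proof. by move=> H K s; apply: ae_mono2 (H s) (K s) _ => y /= -> ->. Qed.
Lemma eq_curve_on u v : (forall l, curve omega l -> u l = v l) -> eq_curve omega u v.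
Proof. by move=> H s; apply: aeW => y /=; apply: H; exists s, y. Qed.

Lemma mass_ae u v s : eq_curve omega u v -> mcurve u -> mcurve v ->
  \int[leb]_y mass u s y = \int[leb]_y mass v s y.
Proof.
move=> uv mu mv; rewrite /Rintegral; congr fine; apply: ae_eq_integral => //.
- by apply/measurable_EFinP; exact: meas_mass.
- by apply/measurable_EFinP; exact: meas_mass.
- by apply: ae_mono (uv s) _ => y E _; rewrite /mass E.
Qed.

Lemma nrm2_ae u v : eq_curve omega u v -> mcurve u -> mcurve v -> nrm2 u = nrm2 v.
Proof. by move=> uv mu mv; rewrite /nrm2 !(mass_ae _ uv). Qed.

Lemma L2b_ae u v : eq_curve omega u v -> mcurve v -> L2b u -> L2b v.
Proof.
move=> uv mv [mu ui]; split=> // s.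
have mm : measurable_fun setT (mass v s) by exact: meas_mass.
apply: integrable_ge0 => //; first exact: mass_ge0.
have -> : (\int[leb]_y (mass v s y)%:E = \int[leb]_y (mass u s y)%:E)%E.
  apply: ae_eq_integral => //.
  - exact/measurable_EFinP.
  - by apply/measurable_EFinP; exact: meas_mass.
  - by apply: ae_mono (uv s) _ => y E _; rewrite /mass E.
exact: integrable_lty (ui s).
Qed.

Lemma nrm2_eq0 u : L2b u -> nrm2 u = 0 -> eq_curve omega u (fun=> 0).
Proof.
move=> [mu ui] u0.
have i0 s : 0 <= \int[leb]_y mass u s y by apply: Rintegral_ge0 => y _; exact: mass_ge0.
have z s : \int[leb]_y mass u s y = 0.
  by move/eqP: u0; rewrite /nrm2 paddr_eq0 ?i0 // => /andP[/eqP ? /eqP ?]; case: s.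
move=> s.
have H : (\int[leb]_y `|(mass u s y)%:E| = 0)%E.
  transitivity (\int[leb]_y (mass u s y)%:E)%E.
    by apply: eq_integral => y _; rewrite gee0_abs // lee_fin mass_ge0.
  have := z s; rewrite /Rintegral => Z; rewrite -[LHS]fineK ?Z //.
  exact: (integrable_fin_num measurableT (ui s)).
have mm : measurable_fun setT (EFin \o mass u s) by apply/measurable_EFinP; exact: meas_mass.
have := (ae_eq_integral_abs leb measurableT mm).1 H.
move=> Z; apply: ae_mono Z _ => y /= /(_ I) [] /eqP; rewrite /mass mulf_eq0 (gt_eqF (speed_gt0 _ _)) orbF.
by rewrite expf_eq0 /= normc_eq0 => /eqP.
Qed.

Lemma contour_ae g h : mcurve g -> mcurve h -> eq_curve omega g h ->
  contour_integral omega g = contour_integral omega h.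
Proof.
move=> mg mh gh; rewrite !contourE.
have E s : branch_int g s = branch_int h s.
  have md : pmeas (dgam s) by apply: pmeas_cont => y; exact: pcont_dgam.
  have [g1 g2] := pmeas_mul (mg s) md; have [h1 h2] := pmeas_mul (mh s) md.
  rewrite /branch_int /cint /Rintegral; congr (fine _ +i* fine _).
  - apply: ae_eq_integral => //; [exact/measurable_EFinP|exact/measurable_EFinP|].
    by apply: ae_mono (gh s) _ => y E _; rewrite E.
  - apply: ae_eq_integral => //; [exact/measurable_EFinP|exact/measurable_EFinP|].
    by apply: ae_mono (gh s) _ => y E _; rewrite E.
by rewrite !E.
Qed.

Lemma pair_ae u u' v : mcurve u -> mcurve u' -> mcurve v -> eq_curve omega u u' ->
  pair u v = pair u' v.
Proof.
move=> mu mu' mv uu'; apply: contour_ae.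
- by move=> s; exact: pmeas_mul.
- by move=> s; exact: pmeas_mul.
- exact: (eq_curve_map (fun l x => x * v l) uu').
Qed.

(* Testing against conj(u dl/|dl|) recovers the norm of u. *)
Definition dual_test u : C -> C := fun l =>
  (u l)^* * (if 0 < complex.Re l then (dgam true (complex.Im l))^*
             else - (dgam false (complex.Im l))^*) / (speed (complex.Im l))%:C.

Hypothesis hpos : forall y, 0 < omega y.

Lemma Re_gam s y : complex.Re (gam s y) = sg s * omega y.
Proof. by rewrite gamE. Qed.
Lemma Im_gam s y : complex.Im (gam s y) = y.
Proof. by rewrite gamE. Qed.

Lemma dual_testE u s y : dual_test u (gam s y) =
  (u (gam s y))^* * ((sg s)%:C * (dgam s y)^*) / (speed y)%:C.
Proof.
rewrite /dual_test Im_gam Re_gam; case: s; rewrite /sg ?mul1r ?mulN1r.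
  by rewrite hpos.
by rewrite oppr_gt0 ltNge ltW ?hpos //= rmorphN1 mulN1r.
Qed.

Lemma continuous_speed y : {for y, continuous speed}.
Proof.
have -> : speed = (fun y => Num.sqrt (1 + omega' y * omega' y)).
  by apply/funext => t; rewrite /arc_speed expr2.
apply: (@continuous_comp _ _ _ (fun y => 1 + omega' y * omega' y)); last exact: sqrt_continuous.
apply: cvgD; first exact: cvg_cst.
by apply: cvgM; case: (hC1 y).
Qed.

Lemma dual_test_L2b u : L2b u -> L2b (dual_test u).
Proof.
move=> [mu ui].
have conjm (g : R -> C) : pmeas g -> pmeas (fun y => (g y)^*).
  move=> [g1 g2]; split.
  - by rewrite (_ : (fun y => _) = (fun y => complex.Re (g y))) //; apply/funext => y; case: (g y).
  - rewrite (_ : (fun y => _) = (fun y => - complex.Im (g y))); first exact: measurable_funN.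
    by apply/funext => y; case: (g y).
apply: (@L2b_le _ _ hC1 _ u 1 _ _ _ _).1 => //.
- move=> s; rewrite (_ : (fun y => _) = (fun y => (u (gam s y))^* * ((sg s)%:C * (dgam s y)^*) * ((speed y)^-1)%:C)).
    apply: pmeas_mul.
      apply: pmeas_mul; first exact/conjm/mu.
      apply: pmeas_mul; first exact: pmeas_cst.
      by apply/conjm/pmeas_cont => y; exact: pcont_dgam.
    split => /=; last exact: measurable_cst.
    apply: continuous_measurable_fun => y; apply: cvgV; first by rewrite gt_eqF // speed_gt0.
    exact: continuous_speed.
  by apply/funext => y; rewrite dual_testE fmorphV.
- move=> s y; rewrite mul1r dual_testE !normcM normcJ normcV !normc_real normcJ normc_dgam norm_sg mul1r.
  by rewrite (ger0_norm (speed_ge0 _ _)) mulfK // gt_eqF // speed_gt0.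
Qed.

Lemma pair_dual u : L2b u -> pair u (dual_test u) = (nrm2 u)%:C.
Proof.
move=> ui; rewrite /pair contourE.
have E s : branch_int (fun l => u l * dual_test u l) s = (sg s * \int[leb]_y mass u s y)%:C.
  rewrite /branch_int (@cint_eq _ _ _ (fun y => (sg s)%:C * (mass u s y)%:C)); last first.
    move=> y _; rewrite dual_testE /mass.
    have c2 (z : C) : z * z^* = (normc z ^+ 2)%:C.
      by rewrite -sqr_normc normcE rmorphXn.
    have -> : u (gam s y) * ((u (gam s y))^* * ((sg s)%:C * (dgam s y)^*) / (speed y)%:C) * dgam s y =
      (sg s)%:C * ((u (gam s y) * (u (gam s y))^*) * ((dgam s y * (dgam s y)^*) / (speed y)%:C)) by ring.
    have e2 : (speed y ^+ 2)%:C / (speed y)%:C = (speed y)%:C.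
      by rewrite expr2 rmorphM mulfK // -normc_gt0 normc_real normr_gt0 gt_eqF // speed_gt0.
    by rewrite !c2 normc_dgam e2 -rmorphM.
  rewrite cint_scale //; last first.
    split => /=; first by case: ui => _ /(_ s).
    by apply: (@eq_integrable _ _ _ _ _ _ (cst 0%E)) => //; exact: integrable0.
  rewrite rmorphM /=; congr (_ * _).
  rewrite /cint /=; congr (_ +i* _).
  by rewrite /Rintegral integral0.
by rewrite !E /nrm2 /sg rmorphD !mulN1r rmorphN !mul1r opprK.
Qed.

End Pairing.

(** * The reflection l -> - l *)

Section Reflect.
Context {R : realType}.
Local Notation C := R[i].
Local Notation leb := (@lebesgue_measure R).

Lemma ge0_integral_opp (f : R -> \bar R) :
  measurable_fun [set: R] f -> (forall r, (0 <= f r)%E) ->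
  (\int[leb]_r f (- r)%R = \int[leb]_r f r)%E.
Proof.
move=> mf f0; apply/esym.
transitivity (\int[pushforward leb (-%R : _ -> measurableTypeR R)]_r f r)%E.
  by apply: eq_measure_integral => //= A mA AS; exact/esym/lebesgue_measureN.
rewrite ge0_integral_pushforward //=.
Qed.

Lemma integral_opp (f : R -> \bar R) : measurable_fun [set: R] f ->
  (\int[leb]_r f (- r)%R = \int[leb]_r f r)%E.
Proof.
move=> mf; rewrite integralE [RHS]integralE.
have -> : (\int[leb]_r (fun r => f (- r)%R)^\+ r = \int[leb]_r f^\+ r)%E.
  have mp : measurable_fun [set: R] (f^\+)%E by exact: measurable_funepos mf.
  have p0 r : (0 <= (f^\+)%E r)%E by exact: funepos_ge0.
  by rewrite -(ge0_integral_opp mp p0); apply: eq_integral => r _; rewrite !funeposE.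
have mn : measurable_fun [set: R] (f^\-)%E by exact: measurable_funeneg mf.
have n0 r : (0 <= (f^\-)%E r)%E by exact: funeneg_ge0.
congr (_ - _)%E.
by rewrite -(ge0_integral_opp mn n0); apply: eq_integral => r _; rewrite !funenegE.
Qed.

Lemma integrable_opp (f : R -> R) : leb.-integrable setT (EFin \o f) ->
  leb.-integrable setT (EFin \o (fun r => f (- r))).
Proof.
move=> /integrableP[mf fi]; apply/integrableP; split.
  apply/measurable_EFinP; apply: (@measurableT_comp _ _ _ _ _ _ f); first exact/measurable_EFinP.
  by apply: continuous_measurable_fun; exact: opp_continuous.
apply: le_lt_trans fi.
have -> : (\int[leb]_x `|(EFin \o (fun r => f (- r)%R)) x| = \int[leb]_x `|(f (- x)%R)%:E|)%E by [].
rewrite (@ge0_integral_opp (fun x => `|(f x)%:E|)%E) //.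
by apply: measurableT_comp.
Qed.

Lemma Rintegral_opp (f : R -> R) : leb.-integrable setT (EFin \o f) ->
  \int[leb]_r f (- r) = \int[leb]_r f r.
Proof.
move=> fi; rewrite /Rintegral; congr fine; apply: (@integral_opp (EFin \o f)).
exact: measurable_int fi.
Qed.

Lemma cint_reflect (g : R -> C) : cintegrable setT g -> cint setT (fun y => g (- y)) = cint setT g.
Proof.
move=> [g1 g2]; rewrite /cint; congr (_ +i* _).
- exact: (Rintegral_opp (f := fun y => complex.Re (g y))).
- exact: (Rintegral_opp (f := fun y => complex.Im (g y))).
Qed.

Lemma ae_opp (P : R -> Prop) : {ae leb, forall y, P y} -> {ae leb, forall y, P (- y)}.
Proof.
have mo : measurable_fun setT (-%R : R -> R).
  by apply: continuous_measurable_fun; exact: opp_continuous.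
move=> [N [mN N0 sN]]; exists (-%R @^-1` N); split.
- by rewrite -[X in measurable X]setTI; exact: mo.
- by have := lebesgue_measureN mN; rewrite N0.
- by move=> y /= nP; apply: sN.
Qed.

Lemma smooth_C1 (omega : R -> R) : smooth omega -> C1 omega (derive1 omega).
Proof.
move=> sm y; split.
  by apply: DeriveDef; [exact: (sm 0%N y)|rewrite derive1E].
by apply: differentiable_continuous; apply/derivable1_diffP; exact: (sm 1%N y).
Qed.

Variable omega : R -> R.
Local Notation omega' := (derive1 omega).
Local Notation speed := (arc_speed omega).
Local Notation gam := (curve_pt omega).
Local Notation dgam := (dgam omega).
Local Notation mass := (mass omega).
Local Notation L2b := (L2b omega).
Local Notation nrm2 := (nrm2 omega).
Local Notation mcurve u := (forall s : bool, pmeas (fun y => u (gam s y))).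
Hypothesis hC1 : C1 omega omega'.
Hypothesis hev : forall y, omega (- y) = omega y.
Implicit Types (u v w g h : C -> C) (s : bool).

Lemma omega'_odd y : omega' (- y) = - omega' y.
Proof.
have D1 : is_derive (- y) (1 : R) (fun t => omega (- t)) (omega' (- - y) * (-1)).
  by apply: is_derive1_comp; case: (hC1 (- - y)).
have [D2 _] := hC1 (- y).
have E : (fun t => omega (- t)) = omega by apply/funext => t; exact: hev.
rewrite E in D1.
have H1 := @derive_val _ _ _ _ _ _ _ D1; have H2 := @derive_val _ _ _ _ _ _ _ D2.
by rewrite -H2 H1 opprK mulrN1.
Qed.

Lemma gam_opp s y : gam s (- y) = - gam (~~ s) y.
Proof.
rewrite !gamE hev; apply: complexP; rewrite ?ReN ?ImN //=.
by case: s; rewrite /sg /= ?mulN1r ?mul1r ?opprK.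
Qed.

Lemma dgam_opp s y : dgam s (- y) = dgam (~~ s) y.
Proof.
rewrite /dgam omega'_odd; congr (_ +i* _).
by case: s; rewrite /sg /= ?mulN1r ?mul1r ?opprK.
Qed.

Lemma speed_opp y : speed (- y) = speed y.
Proof. by rewrite /arc_speed omega'_odd sqrrN. Qed.

Lemma gam_opp' s y : - gam s y = gam (~~ s) (- y).
Proof. by rewrite gam_opp negbK. Qed.

Lemma branch_int_opp g s : cL1 omega g -> 
  branch_int omega (fun l => g (- l)) s = branch_int omega g (~~ s).
Proof.
move=> ig; rewrite /branch_int -[RHS]cint_reflect; last exact: ig.
by apply: cint_eq => y _; rewrite gam_opp' dgam_opp negbK.
Qed.

(** The half turn preserves the orientation of the curve, while [d(- l) = - dl]. Here this shows up
    as the exchange of the two branches, which are counted with opposite signs. *)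
Lemma contour_opp g : cL1 omega g ->
  contour_integral omega (fun l => g (- l)) = - contour_integral omega g.
Proof. by move=> ig; rewrite !contourE !branch_int_opp // opprB. Qed.

Lemma pmeas_opp (g : R -> C) : pmeas g -> pmeas (fun y => g (- y)).
Proof.
move=> [g1 g2]; have mo : measurable_fun setT (-%R : R -> R).
  by apply: continuous_measurable_fun; exact: opp_continuous.
by split; [apply: (measurableT_comp g1)|apply: (measurableT_comp g2)].
Qed.

Lemma mcurve_opp u : mcurve u -> mcurve (fun l => u (- l)).
Proof.
move=> mu s; have := pmeas_opp (mu (~~ s)).
by rewrite (_ : (fun y => u (gam (~~ s) (- y))) = (fun y => u (- gam s y))) //;
  apply/funext => y; rewrite gam_opp'.
Qed.

Lemma mass_opp u s y : mass (fun l => u (- l)) s y = mass u (~~ s) (- y).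
Proof. by rewrite /mass gam_opp' speed_opp. Qed.

Lemma L2b_opp u : L2b u -> L2b (fun l => u (- l)) /\ nrm2 (fun l => u (- l)) = nrm2 u.
Proof.
move=> [mu ui].
have E s : mass (fun l => u (- l)) s = (fun y => mass u (~~ s) (- y)).
  by apply/funext => y; exact: mass_opp.
split.
  split=> [|s]; first exact: mcurve_opp.
  by rewrite E; exact: integrable_opp (ui (~~ s)).
rewrite /nrm2 !E !Rintegral_opp; [|exact: ui|exact: ui].
by rewrite addrC.
Qed.

Lemma eq_curve_opp u v : eq_curve omega u v -> eq_curve omega (fun l => u (- l)) (fun l => v (- l)).
Proof.
move=> uv s; apply: ae_mono (ae_opp (uv (~~ s))) _ => y /=.
by rewrite gam_opp negbK.
Qed.

Lemma pair_opp u v : L2b u -> L2b v ->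
  pair omega (fun l => u (- l)) v = - pair omega u (fun l => v (- l)).
Proof.
move=> ui vi; rewrite /pair -contour_opp; last exact: (L2b_cL1 hC1 ui (L2b_opp vi).1).
by congr contour_integral; apply/funext => l; rewrite opprK.
Qed.

End Reflect.

(** * Integrability of |dl| / (1 + (Im l)^2) *)

Section Length.
Context {R : realType}.
Local Notation C := R[i].
Local Notation leb := (@lebesgue_measure R).
Variable omega : R -> R.
Local Notation omega' := (derive1 omega).
Local Notation speed := (arc_speed omega).
Local Notation gam := (curve_pt omega).
Hypothesis hC1 : C1 omega omega'.
Hypothesis hev : forall y, omega (- y) = omega y.
Hypothesis hpos : forall y, 0 < omega y.
Variable W : R.
Hypothesis hW : forall y, omega y <= W.
Variable K : R.
Hypothesis hlen : forall z, curve omega z ->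
    (arc_integral omega (fun l => (if normc (l - z) <= 1 then 1 else 0)%R) <= K%:E)%E.

Let chi z y : R := (if normc (gam true y - z) <= 1 then 1 else 0) * speed y.

Let chi_ge0 z y : 0 <= chi z y.
Proof. by rewrite mulr_ge0 ?speed_ge0 //; case: ifP. Qed.

Let meas_chi z : measurable_fun setT (chi z).
Proof.
apply: measurable_funM; last exact: meas_speed.
apply: measurable_fun_ifT; [|exact: measurable_cst|exact: measurable_cst].
apply: measurable_fun_ler; last exact: measurable_cst.
apply: pmeas_norm; apply: pmeas_cont => y.
have := pcont_add (pcont_gam hC1 true y) (pcont_cst (- z) y).
exact.
Qed.

Let chi_int z : curve omega z -> (\int[leb]_y (chi z y)%:E <= K%:E)%E.
Proof.
move=> cz; apply: le_trans (hlen cz); rewrite /arc_integral leeDl //.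
by apply: integral_ge0 => y _; rewrite lee_fin mulr_ge0 ?speed_ge0 //; case: ifP.
Qed.

Let rint_cat (f : R -> R) (a b c : R) : a <= b -> b <= c -> (forall y, {for y, continuous f}) ->
  \int[leb]_(y in `[a, c]) f y = \int[leb]_(y in `[a, b]) f y + \int[leb]_(y in `[b, c]) f y.
Proof.
move=> ab bc cf; have := @cint_cat R (fun y => (f y)%:C) a b c ab bc.
have H : cintegrable `[a, c] (fun y => (f y)%:C).
  by apply: cintegrable_cont => y _; exact: pcont_real.
by move=> /(_ H) /(congr1 (fun z : C => complex.Re z)); rewrite ReD.
Qed.

(** The length hypothesis counts the points within distance 1 of a point of the curve. Over an
    interval of length 1/2 the branch is cut, by the value of [omega], into slabs of width 1/2; two
    points of one slab are at distance at most 1, and boundedness of [omega] leaves N slabs. *)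
Lemma half_length : exists2 M : R, 0 < M & forall a : R,
  \int[leb]_(y in `[a, a + 2^-1]) speed y <= M.
Proof.
have [N hN] := nat_above (2 * W + 1).
exists (N%:R * `|K| + 1); first by rewrite ltr_wpDl // mulr_ge0.
move=> a; apply: (@le_trans _ _ (N%:R * `|K|)); last by rewrite lerDl.
pose A j := [set y0 : R | (a <= y0 <= a + 2^-1) /\ (j%:R / 2 <= omega y0 <= (j%:R + 1) / 2)].
(* For an empty slab the default [a] still gives a point of the curve, so that [chi_int] applies to
   every j. *)
pose z j := gam true (xget a (A j)).
have pw y : a <= y <= a + 2^-1 -> speed y <= \sum_(j <- iota 0 N) chi (z j) y.
  move=> yy; pose j := Num.Def.truncn (2 * omega y).
  have o0 : 0 <= 2 * omega y by rewrite mulr_ge0 // ltW.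
  have /andP[j1 j2] := truncn_itv o0.
  have jN : (j < N)%N.
    rewrite -(ltr_nat R); apply: le_lt_trans j1 _; apply: lt_le_trans hN.
    by have := hW y; lra.
  have Aj : A j y by split=> //; rewrite -natr1 in j2; apply/andP; split; lra.
  have [B1 B2] : A j (xget a (A j)) by apply: xgetPex; exists y.
  have jin : j \in iota 0 N by rewrite mem_iota.
  rewrite (big_rem _ jin) /=; apply: (@le_trans _ _ (chi (z j) y)).
    rewrite /chi ifT ?mul1r //; apply: le_trans (normc_le_ReIm _) _.
    rewrite /z !gamE ReD ImD ReN ImN /= /sg !mul1r.
    case: Aj => /andP[a1 a2] /andP[a3 a4]; case/andP: B1 => b1 b2; case/andP: B2 => b3 b4.
    have h1 : `|omega y - omega (xget a (A j))| <= 2^-1 by rewrite ler_norml; apply/andP; split; lra.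
    have h2 : `|y - xget a (A j)| <= 2^-1 by rewrite ler_norml; apply/andP; split; lra.
    lra.
  by rewrite lerDl sumr_ge0.
have mI : measurable (`[a, a + 2^-1]%classic : set (measurableTypeR R)) by exact: measurable_itv.
have ms : measurable_fun setT (fun y => \sum_(j <- iota 0 N) chi (z j) y).
  by apply: measurable_sum => j; exact: meas_chi.
have E : (\int[leb]_(y in `[a, (a + 2^-1)%R]) (speed y)%:E <= (N%:R * `|K|)%:E)%E.
  apply: (@le_trans _ _ (\int[leb]_(y in `[a, (a + 2^-1)%R]) (\sum_(j <- iota 0 N) chi (z j) y)%:E)%E).
    apply: ge0_le_integral => //.
    - by move=> y _; rewrite lee_fin speed_ge0.
    - by apply/measurable_EFinP; apply: measurable_funTS; exact: meas_speed.
    - by apply/measurable_EFinP; apply: measurable_funTS.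
  apply: (@le_trans _ _ (\int[leb]_y (\sum_(j <- iota 0 N) chi (z j) y)%:E)%E).
    apply: ge0_subset_integral => //; first exact/measurable_EFinP.
    by move=> y _; rewrite lee_fin sumr_ge0.
  rewrite (_ : (\int[leb]_y _)%E = (\sum_(j <- iota 0 N) \int[leb]_y (chi (z j) y)%:E)%E); last first.
    rewrite -ge0_integral_sum //.
    - by apply: eq_integral => y _; rewrite sumEFin.
    - by move=> j; apply/measurable_EFinP; exact: meas_chi.
    - by move=> j y _; rewrite lee_fin.
  apply: (@le_trans _ _ (\sum_(j <- iota 0 N) `|K|%:E)%E).
    apply: lee_sum => j _; apply: le_trans (chi_int _) _; first by exists true, (xget a (A j)).
    by rewrite lee_fin ler_norm.
  by rewrite sumEFin lee_fin big_const_seq count_predT size_iota iter_addr_0 mulr_natl.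
rewrite -lee_fin /Rintegral fineK //.
apply: (integrable_fin_num mI); apply: continuous_compact_integrable; first exact: segment_compact.
by apply: continuous_subspaceT => y; exact: continuous_speed.
Qed.

Definition decay (y : R) : R := (1 + y ^+ 2)^-1.

Let wgt y : R := speed y * decay y.

Let decay_pos y : 0 < 1 + y ^+ 2 :> R.
Proof. by rewrite ltr_pwDl // sqr_ge0. Qed.

Let cwgt y : {for y, continuous wgt}.
Proof.
apply: cvgM; first exact: continuous_speed.
rewrite /decay; apply: cvgV; first by rewrite gt_eqF.
by apply: cvgD; [exact: cvg_cst|exact: exprn_continuous].
Qed.

Let wgt_ge0 y : 0 <= wgt y.
Proof. by rewrite mulr_ge0 ?speed_ge0 // invr_ge0 ltW. Qed.

Lemma speed_decay_integrable : leb.-integrable setT (EFin \o (fun y => speed y * decay y)).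
Proof.
have [M M0 hM] := half_length.
have unit_len (a : R) : \int[leb]_(y in `[a, a + 1]) speed y <= 2 * M.
  rewrite (@rint_cat _ a (a + 2^-1)) ?lerD2l ?lerDl //; first last.
  - by move=> y; exact: continuous_speed.
  - by rewrite invf_le1 // ler1n.
  have -> : a + 1 = (a + 2^-1) + 2^-1 by field.
  by have h1 := hM a; have h2 := hM (a + 2^-1); rewrite mulr_natl mulr2n; apply: lerD.
have iC (f : R -> R) (a b : R) : (forall y, {for y, continuous f}) -> leb.-integrable `[a, b] (EFin \o f).
  move=> cf; apply: continuous_compact_integrable; first exact: segment_compact.
  exact: continuous_subspaceT.
have cs y : {for y, continuous speed} by exact: continuous_speed.
have step n : \int[leb]_(y in `[n%:R, n.+1%:R]) wgt y <= 2 * M * (1 + n%:R ^+ 2)^-1.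
  apply: (@le_trans _ _ (\int[leb]_(y in `[n%:R, n.+1%:R]) (speed y * (1 + n%:R ^+ 2)^-1))).
    apply: le_Rintegral => //; first exact: iC.
    - apply: iC => y; apply: cvgM; [exact: cs|exact: cvg_cst].
    - move=> y; rewrite /= in_itv /= => /andP[ny _].
      rewrite ler_wpM2l ?speed_ge0 // lef_pV2 ?posrE // lerD2l lerXn2r ?nnegrE //.
      exact: le_trans ny.
  rewrite RintegralZr //; last exact: iC.
  by rewrite ler_wpM2r ?invr_ge0 ?(ltW (decay_pos _)) // -natr1.
(* Telescoping majorant. Its increment [6 M / ((n+1) (n+2))] is at least [2 M / (1 + n^2)] because
   [3 (1 + n^2) - (n+1) (n+2) = (2 n - 1) (n - 1)], which is nonnegative at integers. *)
have bnd n : \int[leb]_(y in `[0, n%:R]) wgt y <= 6 * M * (1 - n.+1%:R^-1).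
  elim: n => [|n IH]; first by rewrite set_itv1 Rintegral_set1 invr1 subrr mulr0.
  rewrite (@rint_cat _ 0 n%:R) //; last by rewrite ler_nat.
  apply: le_trans (lerD IH (step n)) _.
  have E : 6 * M * (1 - n.+2%:R^-1) - (6 * M * (1 - n.+1%:R^-1) + 2 * M * (1 + n%:R ^+ 2)^-1)
    = 2 * M * ((2 * n%:R - 1) * (n%:R - 1)) / ((n%:R + 1) * (n%:R + 2) * (1 + n%:R ^+ 2)) :> R.
    have -> : n.+2%:R = n%:R + 2 :> R by rewrite -addn2 natrD.
    rewrite -natr1; field.
    by rewrite (gt_eqF (decay_pos _)) !gt_eqF // ltr_wpDl.
  rewrite -subr_ge0 E; apply: divr_ge0; last first.
    by rewrite !mulr_ge0 ?addr_ge0 // ?sqr_ge0.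
  rewrite mulr_ge0 //; first by rewrite mulr_ge0 // ltW.
  case: n {IH E} => [|n]; first by rewrite mulr0 !sub0r mulrNN mulr1.
  by rewrite mulr_ge0 // -natr1; have := ler0n R n; lra.
apply: integrable_ge0 => //; first by apply: continuous_measurable_fun.
rewrite ge0_symfun_integralT //; last first.
  by move=> y /=; rewrite /wgt /decay speed_opp // sqrrN.
rewrite -set_itvcy ge0_integral_ereal_sup //; last by apply: continuous_measurable_fun.
apply: (@le_lt_trans _ _ (2%:E * (6 * M)%:E)%E); last by rewrite -EFinM ltry.
rewrite lee_pmul2l //; apply: ge_ereal_sup => _ [n _ <-].
have H : \int[leb]_(y in `[0, n.+1%:R]) wgt y <= 6 * M.
  apply: le_trans (bnd n.+1) _; rewrite ler_piMr ?mulr_ge0 ?(ltW M0) //.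
move: H; rewrite -lee_fin /Rintegral fineK //.
have I := iC wgt 0 n.+1%:R cwgt.
exact: (integrable_fin_num _ I).
Qed.

End Length.

(** * Test functions and Hardy spaces *)

Section Decay.
Context {R : realType}.
Local Notation C := R[i].
Local Notation leb := (@lebesgue_measure R).

Record regular_curve (omega : R -> R) (W : R) : Prop := RegularCurve {
  rc_C1 : C1 omega (derive1 omega) ;
  rc_even : forall y, omega (- y) = omega y ;
  rc_pos : forall y, 0 < omega y ;
  rc_le : forall y, omega y <= W ;
  rc_decay : leb.-integrable setT
    (EFin \o (fun y => arc_speed omega y * decay y))
}.

(** The exponent [n.-1] being nonnegative, the decay condition bounds [omega] by a constant far out,
    and continuity bounds it on the remaining interval. The length condition is kept in the form
    [rc_decay]. *)
Lemma curve_setup_regular mu0 n (omega : R -> R) : curve_setup mu0 n omega ->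
  exists W, regular_curve omega W.
Proof.
move=> hC.
have hC1 := smooth_C1 (curve_smooth hC).
have hev := curve_even hC; have hpos := curve_gt0 hC.
have [W hW] : exists W, forall y, omega y <= W.
  have [K [r hK]] := curve_decay hC.
  pose a := `|r| + 1.
  have a1 : 1 <= a by rewrite /a lerDr.
  have [M M0 hM] : exists2 M : R, 0 < M & forall y, - a <= y <= a -> normc (omega y)%:C <= M.
    apply: pcont_bounded => [|y _]; first by rewrite -subr_ge0 opprK; lra.
    exact: (C1_pcont _ hC1).
  exists (M + `|K|) => y; have [ya|ya] := leP `|y| a.
    apply: (@le_trans _ _ M); last by rewrite lerDl.
    have := hM y; rewrite normc_real gtr0_norm // => H; apply: H.
    by rewrite -ler_norml.
  have y1 : 1 <= `|y| by apply: (le_trans a1); exact: ltW.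
  apply: (@le_trans _ _ `|K|); last by rewrite lerDr ltW.
  have ry : r <= `|y|.
    by apply: (le_trans (ler_norm _)); move: ya; rewrite /a; lra.
  apply: (le_trans (hK _ ry)).
  apply: (@le_trans _ _ (`|K| * `|y| ^- n.-1)).
    by rewrite ler_wpM2r ?ler_norm // invr_ge0 exprn_ge0.
  by rewrite ler_piMr // invf_le1 ?exprn_ege1 // exprn_gt0 // (lt_le_trans _ y1).
have [K hlen] := curve_length hC.
exists W; split=> //.
exact: (speed_decay_integrable hC1 hev hpos hW hlen).
Qed.

Variables (omega : R -> R) (W : R).
Hypothesis hC : regular_curve omega W.
Local Notation omega' := (derive1 omega).
Local Notation speed := (arc_speed omega).
Local Notation gam := (curve_pt omega).
Local Notation dgam := (dgam omega).
Local Notation mcurve u := (forall s : bool, pmeas (fun y => u (gam s y))).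
Implicit Types (u v w g h f : C -> C) (b s : bool).
Let hC1 := rc_C1 hC.
Let hpos := rc_pos hC.

(* [true] stands for D_+ and [false] for D_-. *)
Definition side b : set C := [set z | if b then `|complex.Re z| <= omega (complex.Im z)
  else omega (complex.Im z) <= `|complex.Re z|].

Definition Dside b : set C := if b then Dplus omega else Dminus omega.

Lemma Dside_side b z : Dside b z -> side b z.
Proof. by case: b; rewrite /Dside /side /=; exact: ltW. Qed.

Lemma abs_Re_gam s y : `|complex.Re (gam s y)| = omega y.
Proof. by rewrite Re_gam normrM norm_sg mul1r gtr0_norm. Qed.

Lemma side_gam b s y : side b (gam s y).
Proof. by case: b; rewrite /side /= -/(omega _) [`|_|]abs_Re_gam. Qed.

Lemma sideN b z : side b (- z) <-> side b z.
Proof.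
by case: b; rewrite /side /= ReN ImN normrN (rc_even hC).
Qed.

Lemma nsideP b z : ~ side b z <-> Dside (~~ b) z.
Proof.
case: b; rewrite /side /Dside /Dplus /Dminus /=.
  by split => [/negP|H]; [rewrite -ltNge | apply/negP; rewrite -ltNge].
by split => [/negP|H]; [rewrite -ltNge | apply/negP; rewrite -ltNge].
Qed.

Lemma side_cases b z : side b z -> Dside b z \/ exists s, z = gam s (complex.Im z).
Proof.
have K : `|complex.Re z| = omega (complex.Im z) -> exists s, z = gam s (complex.Im z).
  move=> E; exists (0 < complex.Re z); rewrite gamE.
  case: (ltP 0 (complex.Re z)) E => [z0 E|z0 E].
    rewrite /sg mul1r -E gtr0_norm //; by case: z {E z0}.
  rewrite /sg mulN1r -E ler0_norm // opprK; by case: z {E z0}.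
case: b; rewrite /side /Dside /Dplus /Dminus /= le_eqVlt => /orP[/eqP E|H]; auto.
Qed.

(** Closedness of the side, in the quantitative form used for poles in [dec_inv] and for compactness
    in [dec_intro]. *)
Lemma side_dist b a : ~ side b a -> exists2 d : R, 0 < d &
  forall z, side b z -> d <= normc (z - a).
Proof.
move=> na.
pose e := if b then `|complex.Re a| - omega (complex.Im a)
          else omega (complex.Im a) - `|complex.Re a|.
have e0 : 0 < e.
  by move: na; rewrite nsideP /e {e} /Dside /Dplus /Dminus; case: b => /=; rewrite subr_gt0.
have co : pcont (fun y => (omega y)%:C) (complex.Im a) by exact: (C1_pcont _ hC1).
have [|r r0 hr] := co (e / 2); first by rewrite divr_gt0.
exists (Num.min r (e / 2)); first by rewrite lt_min r0 divr_gt0.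
move=> z bz; rewrite leNgt; apply/negP; rewrite lt_min => /andP[zr ze].
have h1 : `|complex.Re z - complex.Re a| < e / 2.
  by apply: le_lt_trans ze; have := ler_normRe (z - a); rewrite ReD ReN.
have h2 : `|omega (complex.Im z) - omega (complex.Im a)| < e / 2.
  rewrite -normc_real rmorphB /=; apply: hr.
  by apply: le_lt_trans zr; have := ler_normIm (z - a); rewrite ImD ImN.
have h3 := lerB_dist (complex.Re z) (complex.Re a).
have h4 := lerB_dist (complex.Re a) (complex.Re z); rewrite distrC in h4.
move: h2; rewrite ltr_norml => /andP[h2 h2'].
by move: bz h1 h2 h2' e0 h3 h4; rewrite /e /side /=; clear; case: b => *; lra.
Qed.

(** The test functions, differentiable in the two-sided sense even at points of the curve. Order 1
    puts them in L^2(C) ([dec_L2b]), and order 2 makes the contour integral vanish ([contour_dec]),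
    so that two test functions of order 1 on the same side pair to zero. *)
Definition dec b (N : nat) f := (forall z, side b z -> cdiff f z) /\
  exists2 K : R, 0 <= K & forall z, side b z -> normc (f z) * (1 + normc z) ^+ N <= K.

Lemma dec_cst b c : dec b 0 (fun=> c).
Proof.
split=> [z _|]; first exact: cdiff_cst.
by exists (normc c) => [|z _]; rewrite ?normc_ge0 // expr0 mulr1.
Qed.

Lemma dec_mul b N M f g : dec b N f -> dec b M g -> dec b (N + M) (fun z => f z * g z).
Proof.
move=> [df [K K0 hK]] [dg [K' K0' hK']]; split=> [z bz|]; first exact: cdiff_mul (df _ bz) (dg _ bz).
exists (K * K') => [|z bz]; first exact: mulr_ge0.
have p0 : 0 <= 1 + normc z by rewrite addr_ge0 ?normc_ge0.
rewrite normcM exprD mulrACA; apply: ler_pM; rewrite ?mulr_ge0 ?exprn_ge0 ?normc_ge0 //; auto.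
Qed.

Lemma dec_le b N M f : (M <= N)%N -> dec b N f -> dec b M f.
Proof.
move=> MN [df [K K0 hK]]; split=> //; exists K => // z bz; apply: le_trans (hK z bz).
by rewrite ler_wpM2l ?normc_ge0 // ler_weXn2l // lerDl normc_ge0.
Qed.

Lemma dec_add b N f g : dec b N f -> dec b N g -> dec b N (fun z => f z + g z).
Proof.
move=> [df [K K0 hK]] [dg [K' K0' hK']]; split=> [z bz|]; first exact: cdiff_add (df _ bz) (dg _ bz).
exists (K + K') => [|z bz]; first exact: addr_ge0.
apply: (@le_trans _ _ ((normc (f z) + normc (g z)) * (1 + normc z) ^+ N)).
  by rewrite ler_wpM2r ?le_normcD // exprn_ge0 // addr_ge0 ?normc_ge0.
by rewrite mulrDl lerD ?hK ?hK'.
Qed.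

Lemma dec_scale b N c f : dec b N f -> dec b N (fun z => c * f z).
Proof. by move=> /(dec_mul (dec_cst b c)). Qed.

Lemma dec_sub b N f g : dec b N f -> dec b N g -> dec b N (fun z => f z - g z).
Proof.
move=> df /(dec_scale (-1)) dg; have [H1 [K K0 H2]] := dec_add df dg; split=> [z bz|].
  have [d hd] := H1 z bz; exists d; apply: cdiff_at_ext ltr01 _ hd => h _.
  by rewrite mulN1r.
by exists K => // z bz; have := H2 z bz; rewrite mulN1r.
Qed.

Lemma dec_eq b N f g : f =1 g -> dec b N f -> dec b N g.
Proof. by move=> /funext ->. Qed.

Lemma dec_exp b N f k : dec b N f -> dec b (N * k) (fun z => f z ^+ k).
Proof.
move=> df; elim: k => [|k IH].
  by rewrite muln0; apply: dec_eq (dec_cst b 1) => z; rewrite expr0.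
by rewrite mulnS; apply: dec_eq (dec_mul df IH) => z; rewrite exprS.
Qed.

Lemma dec_opp b N f : dec b N f -> dec b N (fun z => f (- z)).
Proof.
move=> [df [K K0 hK]]; split=> [z bz|].
  by exact: (cdiff_comp (cdiff_opp (cdiff_id z)) (df _ (proj2 (sideN b z) bz))).
by exists K => // z bz; have := hK (- z); rewrite normcN => H; apply/H/sideN.
Qed.

Lemma dec_inv b a : ~ side b a -> dec b 1 (fun z => (z - a)^-1).
Proof.
move=> na; have [d d0 hd] := side_dist na; split=> [z bz|].
  apply: (@cdiff_inv _ (fun z => z - a)); first by apply: cdiff_sub; [exact: cdiff_id | exact: cdiff_cst].
  by rewrite -normc_gt0 (lt_le_trans d0) // hd.
exists ((1 + normc a) / d + 1) => [|z bz].
  by rewrite addr_ge0 // divr_ge0 ?(ltW d0) // addr_ge0 ?normc_ge0.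
have h := hd z bz; have p0 : 0 < normc (z - a) by exact: lt_le_trans h.
rewrite normcV expr1 ler_pdivrMl //.
have h2 : normc z <= normc (z - a) + normc a by rewrite -{1}(subrK a z) le_normcD.
have h3 : 1 + normc a <= (1 + normc a) / d * normc (z - a).
  by rewrite mulrAC ler_pdivlMr // ler_wpM2l // addr_ge0 ?normc_ge0.
by rewrite mulrDr mulr1 [_ * (_ / d)]mulrC; lra.
Qed.

Lemma dec_frac b a c : ~ side b a -> dec b 0 (fun z => (z - c) / (z - a)).
Proof.
move=> na.
have [H1 H2] := dec_add (dec_cst b 1) (dec_scale (a - c) (dec_le (leq0n 1) (dec_inv na))).
have E z : side b z -> 1 + (a - c) * (z - a)^-1 = (z - c) / (z - a).
  move=> bz; have za : z - a != 0 by rewrite subr_eq0; apply/eqP => E; apply: na; rewrite -E.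
  by rewrite -(mulfV za) -mulrDl; congr (_ / _); ring.
split=> [z bz|]; last by have [K K0 hK] := H2; exists K => // z bz; rewrite -E // hK.
have za : z - a != 0 by rewrite subr_eq0; apply/eqP => e; apply: na; rewrite -e.
apply: (@cdiff_div _ (fun z => z - c) (fun z => z - a)) za; apply: cdiff_sub; solve [exact: cdiff_id | exact: cdiff_cst].
Qed.

Lemma dec_mcurve b N f : dec b N f -> mcurve f.
Proof.
move=> [df _] s; apply: pmeas_cont => y; apply: pcont_comp; first exact: pcont_gam.
exact/cdiff_ccont/df/side_gam.
Qed.

Lemma decay_gam s y : 1 + y ^+ 2 <= (1 + normc (gam s y)) ^+ 2.
Proof.
have := ler_normIm (gam s y); rewrite Im_gam -(real_normK (num_real y)) => hy.
have := normr_ge0 y; have := normc_ge0 (gam s y); nra.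
Qed.

Lemma dec_L2b b f : dec b 1 f -> L2b omega f.
Proof.
move=> df; split; first exact: dec_mcurve df.
have [_ [K K0 hK]] := df; move=> s.
apply: (integrable_le (b := fun y => K ^+ 2 * (speed y * decay y))).
- exact: (meas_mass hC1 (dec_mcurve df s)).
- move=> y; rewrite ger0_norm ?mass_ge0 // /mass [_ ^+ 2 * (_ * _)]mulrCA mulrC ler_wpM2l ?speed_ge0 //.
  rewrite /decay ler_pdivlMr; last by rewrite ltr_pwDl ?sqr_ge0.
  have := hK _ (side_gam b s y); rewrite expr1 => h.
  have h0 : 0 <= normc (f (gam s y)) * (1 + normc (gam s y)).
    by rewrite mulr_ge0 ?addr_ge0 ?normc_ge0.
  apply: (@le_trans _ _ ((normc (f (gam s y)) * (1 + normc (gam s y))) ^+ 2)).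
    rewrite exprMn ler_wpM2l ?sqr_ge0 //.
    exact: decay_gam.
  by rewrite lerXn2r // nnegrE.
- by apply: integrableZE => //; exact: rc_decay hC.
Qed.

(** On D_+ the strip [t omega(y) + i y], with t from -1 to 1, sweeps one branch onto the other. On
    D_- each branch is pushed to infinity through its own component, and the two integrals vanish
    separately. *)
Lemma contour_dec b f : dec b 2 f -> contour_integral omega f = 0.
Proof.
move=> df; have [cf [K K0 hK]] := df.
have ig s : cintegrable setT (fun y => f (gam s y) * dgam s y).
  apply: (pmeas_cintegrable (b := fun y => K * (speed y * decay y))).
  - by apply: pmeas_mul; [exact: (dec_mcurve df) | apply: pmeas_cont => y; exact: pcont_dgam].
  - move=> y; rewrite normcM normc_dgam // mulrCA mulrC ler_wpM2l ?speed_ge0 //.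
    rewrite /decay ler_pdivlMr; last by rewrite ltr_pwDl ?sqr_ge0.
    apply: le_trans (hK _ (side_gam b s y)); rewrite ler_wpM2l ?normc_ge0 //.
    exact: decay_gam.
  - by apply: integrableZE => //; exact: rc_decay hC.
have bd z : side b z -> 0 < normc z -> normc (f z) <= K / normc z ^+ 2.
  move=> bz z0; rewrite ler_pdivlMr ?exprn_gt0 //; apply: le_trans (hK z bz).
  by rewrite ler_wpM2l ?normc_ge0 // lerXn2r ?nnegrE ?addr_ge0 ?normc_ge0 // lerDr.
rewrite contourE; case: b cf hK bd {df} => cf hK bd.
  rewrite /branch_int -cint_sub //.
  apply: cint_zero; first exact: cintegrable_sub.
  move=> e e0.
  have W0 : 0 <= W by apply: le_trans (rc_le hC 0); exact: ltW.
  have [N hN] := nat_above (Num.max 1 (8 * K * W / e)).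
  exists N => k Nk.
  have k1 : 1 <= k%:R :> R.
    by apply: (@le_trans _ _ N%:R); rewrite ?ler_nat // (le_trans _ hN) // le_max lexx.
  have k2 : 8 * K * W / e <= k%:R :> R.
    by apply: (@le_trans _ _ N%:R); rewrite ?ler_nat // (le_trans _ hN) // le_max lexx orbT.
  rewrite cint_sub //; last 2 first.
  - by apply: cintegrableS (ig true).
  - by apply: cintegrableS (ig false).
  have cl t y : -1 <= t <= 1 -> side true ((t * omega y) +i* y).
    move=> t1; rewrite /side /= normrM (gtr0_norm (hpos y)) ler_piMl ?(ltW (hpos y)) //.
    by rewrite ler_norml.
  have M0 : 0 <= K / k%:R ^+ 2 * W by rewrite mulr_ge0 ?divr_ge0 ?sqr_ge0.
  have := @strip_shift _ omega omega' f (-1) 1 k%:R hC1 _ _ _ (K / k%:R ^+ 2 * W) M0 _.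
  have E s : (fun y => f (gam s y) * dgam s y) =
             (fun y => f ((sg s * omega y) +i* y) * ((sg s * omega' y) +i* 1)).
    by apply/funext => y; rewrite gamE.
  rewrite !E /sg => H; apply: (le_trans (H _ _ _ _)) => //.
  - by move=> t y t1 _; apply: cf; exact: cl.
  - move=> t y t1 yk; rewrite normcM normc_real (gtr0_norm (hpos y)).
    apply: ler_pM; rewrite ?normc_ge0 ?(ltW (hpos y)) ?(rc_le hC) //.
    have hz := ler_normIm ((t * omega y) +i* y); rewrite /= yk in hz.
    have z0 : 0 < normc ((t * omega y) +i* y) by rewrite (lt_le_trans _ hz) // (lt_le_trans ltr01).
    apply: (le_trans (bd _ (cl _ _ t1) z0)); rewrite ler_wpM2l // lef_pV2 ?posrE ?exprn_gt0 //.
      by rewrite lerXn2r ?nnegrE ?normc_ge0.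
    by rewrite (lt_le_trans ltr01).
  - have k0 : 0 < k%:R :> R by rewrite (lt_le_trans ltr01).
    move: k2; rewrite ler_pdivrMr // => k2.
    rewrite opprK (_ : 4 * (K / k%:R ^+ 2 * W * (1 + 1)) = (8 * K * W) / k%:R ^+ 2); last by field; rewrite gt_eqF.
    rewrite ler_pdivrMr ?exprn_gt0 // (le_trans k2) // expr2 mulrA [e * _]mulrC ler_peMr //.
    by rewrite mulr_ge0 // ltW.
have Z s : branch_int omega f s = 0.
  rewrite /branch_int.
  have E : (fun y => f (gam s y) * dgam s y) =
           (fun y => f ((sg s * omega y) +i* y) * ((sg s * omega' y) +i* 1)).
    by apply/funext => y; rewrite gamE.
  have cl t y : 0 <= t -> side false ((sg s * (omega y + t)) +i* y).
    by move=> t0; rewrite /side /= normrM norm_sg mul1r ger0_norm ?lerDl // addr_ge0 // ltW.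
  have I := ig s; rewrite E in I *.
  apply: (@half_zero _ (sg s) omega omega' f K 1) => //.
  - exact: norm_sg.
  - by move=> y; rewrite ltW.
  - by move=> t y t0; apply/cf/cl.
  - by move=> t y t0 h; apply: bd; [exact: cl | rewrite (lt_le_trans ltr01)].
by rewrite !Z subrr.
Qed.

End Decay.

Section CompactBound.
Context {R : realType}.
Local Notation C := R[i].

(** Compactness of a square of [R * R] is used in near-covering form, the bound being the parameter
    that tends to [+oo]. Near points of the square outside A the claim is vacuous, by the closedness
    hypothesis. *)
Lemma compact_bounded (A : set C) (f : C -> C) (rho : R) :
  (forall z, A z -> normc z <= rho) ->
  (forall z, ~ A z -> exists2 d : R, 0 < d & forall w, A w -> d <= normc (w - z)) ->
  (forall z, A z -> ccont f z) ->
  exists2 B : R, 0 <= B & forall z, A z -> normc (f z) <= B.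
Proof.
move=> Ab Ac fc.
have cK : compact (`[- rho, rho]%classic `*` `[- rho, rho]%classic : set (R * R)).
  by apply: compact_setX; exact: segment_compact.
have /compact_near_coveringP/(_ R (@pinfty_nbhs R)
  (fun B p => A (p.1 +i* p.2) -> normc (f (p.1 +i* p.2)) <= B)) H := cK.
have loc (x : R * R) : (`[- rho, rho]%classic `*` `[- rho, rho]%classic) x ->
    \forall x' \near x & i \near +oo, A (x'.1 +i* x'.2) -> normc (f (x'.1 +i* x'.2)) <= i.
  move=> _; pose z := x.1 +i* x.2.
  have near (d : R) (P : C -> R -> Prop) (B : R) : 0 < d ->
      (forall w i, normc (w - z) < d -> B < i -> P w i) ->
      \forall x' \near x & i \near +oo, P (x'.1 +i* x'.2) i.
    move=> d0 hP.
    exists ((ball x.1 (d / 2) `*` ball x.2 (d / 2)), [set i | B < i]).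
      split; last by apply: nbhs_pinfty_gt; exact: num_real.
      by exists (ball x.1 (d / 2), ball x.2 (d / 2)) => //; split; apply: nbhsx_ballx; rewrite divr_gt0.
    move=> [x' i] [[/= h1 h2] h3]; apply: hP => //.
    apply: le_lt_trans (normc_le_ReIm _) _.
    rewrite ReD ReN ImD ImN /= distrC [X in _ + X]distrC.
    by move: h1 h2; rewrite /ball /=; lra.
  have [Az|/Ac[d d0 hd]] := pselect (A z).
    have [r r0 hr] := fc z Az 1 ltr01.
    apply: (near r (fun w i => A w -> normc (f w) <= i) (normc (f z) + 1)) => // w i wz iB _.
    have := hr (w - z) wz; rewrite addrCA subrr addr0 => h.
    by have := normc_tri (f w) (f z); lra.
  apply: (near d (fun w i => A w -> normc (f w) <= i) 0) => // w i wz _ Aw.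
  by have := hd w Aw; rewrite leNgt wz.
have [B [hB B0]] := filter_ex (filterI (H _ loc) (nbhs_pinfty_gt (num_real (0 : R)))).
exists B => [|z Az]; first exact: ltW.
have := hB (complex.Re z, complex.Im z); rewrite /= (_ : _ +i* _ = z); last by case: (z).
apply=> //; split; rewrite /= in_itv /= -ler_norml.
  by apply: le_trans (Ab _ Az); exact: ler_normRe.
by apply: le_trans (Ab _ Az); exact: ler_normIm.
Qed.

End CompactBound.

(** * Growth of polynomials at infinity *)

Section Polynomials.
Context {R : realType}.
Local Notation C := R[i].
Implicit Types (p q : {poly C}) (z : C).

Lemma poly_upper p : exists2 K : R, 0 <= K &
  forall z, normc p.[z] <= K * (1 + normc z) ^+ (size p).-1.
Proof.
exists (\sum_(i < size p) normc p`_i); first by apply: sumr_ge0 => i _; exact: normc_ge0.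
move=> z; rewrite horner_coef mulr_suml.
apply: (@le_trans _ _ (\sum_(i < size p) normc (p`_i * z ^+ i))).
  elim/big_ind2: _ => [|x1 x2 y1 y2 h1 h2|//]; first by rewrite normc0.
  by apply: le_trans (le_normcD _ _) _; exact: lerD.
apply: ler_sum => i _; rewrite normcM normcX ler_wpM2l ?normc_ge0 //.
have h1 : 1 <= 1 + normc z by rewrite lerDl normc_ge0.
apply: (@le_trans _ _ ((1 + normc z) ^+ i)).
  by rewrite lerXn2r ?nnegrE ?normc_ge0 ?addr_ge0 ?normc_ge0 // lerDr.
by rewrite ler_weXn2l // -ltnS (leq_trans (ltn_ord i)) // leqSpred.
Qed.

Lemma prod_lower (s : seq C) : exists c r : R, [/\ 0 < c, 0 <= r &
  forall z, r <= normc z ->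
    c * (1 + normc z) ^+ size s <= normc (\prod_(a <- s) (z - a))].
Proof.
elim: s => [|a s [c [r [c0 r0 IH]]]].
  by exists 1, 0; split=> // z _; rewrite big_nil expr0 normc1 mulr1.
exists (c / 2), (Num.max r (1 + 2 * normc a)); split; rewrite ?divr_gt0 ?le_max ?r0 // => z.
rewrite ge_max => /andP[rz az]; rewrite big_cons normcM /= exprS mulrACA mulrC.
rewrite [c * _]mulrC -!mulrA [_^-1 * _]mulrC !mulrA.
have h : (1 + normc z) / 2 <= normc (z - a) by have := normc_tri z a; lra.
rewrite mulrAC; apply: (@le_trans _ _ ((1 + normc z) / 2 * (c * (1 + normc z) ^+ size s))).
  by rewrite le_eqVlt; apply/orP; left; apply/eqP; ring.
by apply: ler_pM; rewrite ?IH ?mulr_ge0 ?divr_ge0 ?exprn_ge0 ?addr_ge0 ?normc_ge0 ?(ltW c0).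
Qed.

Lemma poly_factor p : {s : seq C | p = lead_coef p *: \prod_(a <- s) ('X - a%:P)}.
Proof. exact: closed_field_poly_normal. Qed.

Lemma size_factor p (s : seq C) : p != 0 -> p = lead_coef p *: \prod_(a <- s) ('X - a%:P) ->
  (size p).-1 = size s.
Proof. by move=> p0 ->; rewrite size_scale ?lead_coef_eq0 // size_prod_XsubC. Qed.

Lemma horner_prod_XsubC (s : seq C) z : (\prod_(a <- s) ('X - a%:P)).[z] = \prod_(a <- s) (z - a).
Proof. by rewrite horner_prod; apply: eq_bigr => a _; rewrite hornerXsubC. Qed.

Lemma poly_lower p : p != 0 -> exists c r : R, [/\ 0 < c, 0 <= r &
  forall z, r <= normc z -> c * (1 + normc z) ^+ (size p).-1 <= normc p.[z]].
Proof.
move=> p0; have [s E] := poly_factor p; rewrite (size_factor p0 E).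
have [c [r [c0 r0 H]]] := prod_lower s.
have l0 : 0 < normc (lead_coef p) by rewrite normc_gt0 lead_coef_eq0.
exists (normc (lead_coef p) * c), r; split=> // [|z rz]; first exact: mulr_gt0.
by rewrite [in leRHS]E hornerZ horner_prod_XsubC normcM -mulrA ler_wpM2l ?normc_ge0 // H.
Qed.

End Polynomials.

(** * The Hardy spaces as annihilators *)

Section Duality.
Context {R : realType}.
Local Notation C := R[i].
Local Notation leb := (@lebesgue_measure R).
Variables (omega : R -> R) (W : R).
Hypothesis hC : regular_curve omega W.
Local Notation omega' := (derive1 omega).
Local Notation speed := (arc_speed omega).
Local Notation gam := (curve_pt omega).
Local Notation dgam := (dgam omega).
Local Notation mass := (mass omega).
Local Notation L2b := (L2b omega).
Local Notation nrm2 := (nrm2 omega).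
Local Notation pair := (pair omega).
Local Notation side := (side omega).
Local Notation dec := (dec omega).
Local Notation mcurve u := (forall s : bool, pmeas (fun y => u (gam s y))).
Implicit Types (u v w g h f : C -> C) (b s : bool) (p q : {poly C}).
Let hC1 := rc_C1 hC.
Let hpos := rc_pos hC.

Lemma dec0 b N : dec b N (fun=> 0).
Proof.
split=> [z _|]; first exact: cdiff_cst.
by exists 0 => // z _; rewrite normc0 mul0r.
Qed.

Lemma dec_prod_inv b (s : seq C) : (forall a, a \in s -> ~ side b a) ->
  dec b (size s) (fun z => (\prod_(a <- s) (z - a))^-1).
Proof.
elim: s => [|a s IH] hs.
  by apply: dec_eq (dec_cst _ b 1) => z; rewrite big_nil invr1.
apply: (dec_eq (f := fun z => (z - a)^-1 * (\prod_(a <- s) (z - a))^-1)).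
  by move=> z; rewrite big_cons invfM.
apply: (dec_mul (N := 1)); first by apply: (dec_inv hC); apply: hs; rewrite mem_head.
by apply: IH => x xs; apply: hs; rewrite inE xs orbT.
Qed.

Lemma dec_ratfun b p q N : q != 0 -> (forall z, side b z -> ~~ root q z) ->
  (size p + N <= size q)%N -> dec b N (ratfun p q).
Proof.
move=> q0 nr spq; have [s E] := poly_factor q.
have l0 : lead_coef q != 0 by rewrite lead_coef_eq0.
have [p0|p0] := eqVneq p 0.
  by apply: dec_eq (dec0 b N) => z; rewrite /ratfun p0 horner0 mul0r.
have /(dec_scale (lead_coef q)^-1)[H1 [K K0 hK]] : dec b (size s) (fun z => (\prod_(a <- s) (z - a))^-1).
  apply: dec_prod_inv => a sa /nr; rewrite E rootZ // root_prod_XsubC sa //.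
have F z : ratfun p q z = p.[z] * ((lead_coef q)^-1 * (\prod_(a <- s) (z - a))^-1).
  by rewrite /ratfun {1}E hornerZ horner_prod_XsubC invfM.
rewrite (funext F); split=> [z bz|].
  by apply: cdiff_mul; [exact: cdiff_poly | exact: H1].
have [K' K0' hK'] := poly_upper p; exists (K' * K) => [|z bz]; first exact: mulr_ge0.
have h1 : 1 <= 1 + normc z by rewrite lerDl normc_ge0.
rewrite normcM -mulrA; apply: le_trans (ler_wpM2r _ (hK' z)) _.
  by rewrite mulr_ge0 ?normc_ge0 // exprn_ge0 // (le_trans ler01).
rewrite -mulrA ler_wpM2l //; apply: le_trans (hK z bz).
rewrite mulrCA -exprD ler_wpM2l ?normc_ge0 // ler_weXn2l //.
rewrite -(size_factor q0 E); move: spq; rewrite -(size_poly_gt0 p) in p0.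
by case: (size p) p0 => // k _; case: (size q) => [|j]; rewrite addSn.
Qed.

Lemma mass_itv_lower u s (a b c : R) : L2b u -> a <= b -> 0 <= c ->
  (forall y, a <= y <= b -> c <= mass u s y) -> c * (b - a) <= nrm2 u.
Proof.
move=> lu ab c0 h.
have [mu iu] := lu.
apply: (@le_trans _ _ (\int[leb]_y mass u s y)); last first.
  by rewrite /nrm2; case: s {h}; rewrite ?lerDl ?lerDr Rintegral_ge0 // => y _; exact: mass_ge0.
rewrite -lee_fin /Rintegral fineK; last exact: integrable_fin_num (iu s).
have mI : measurable (`[a, b]%classic : set (measurableTypeR R)) by exact: measurable_itv.
apply: (@le_trans _ _ (\int[leb]_(y in `[a, b]) (cst c%:E) y)%E).
  rewrite integral_cst //.
  have E : leb (`[a, b]%classic : set R) = (b - a)%:E.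
    rewrite lebesgue_measure_itv /= lte_fin.
    by case: ltP => [//|ba]; rewrite (_ : b = a) ?subrr //; apply/eqP; rewrite eq_le ab ba.
  by rewrite -[X in (_ * X)%E]/(leb (`[a, b]%classic : set R)) E.
apply: (@le_trans _ _ (\int[leb]_(y in `[a, b]) (mass u s y)%:E)%E).
  apply: ge0_le_integral => //.
  - by apply/measurable_EFinP/measurable_funTS; apply: meas_mass.
apply: ge0_subset_integral => //; first by apply/measurable_EFinP; apply: meas_mass.
by move=> y _; rewrite lee_fin mass_ge0.
Qed.

Lemma pdiff_gam s y : pdiff (gam s) y (dgam s y).
Proof.
rewrite (_ : gam s = fun y => (sg s * omega y) +i* y); last by apply/funext => ?; exact: gamE.
apply: (@graph_pdiff _ (fun y => sg s * omega y) (fun y => sg s * omega' y)).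
have E (k : R -> R) : (fun y => sg s * k y) = if s then k else (fun y => - k y).
  by case: s; apply/funext => x; rewrite /sg ?mul1r ?mulN1r.
by rewrite !E; case: s {E y} => //; exact: C1N.
Qed.

Lemma gap_right (x : R) (xs : seq R) : exists2 d : R, 0 < d &
  forall y, y \in xs -> ~ (x < y < x + d).
Proof.
elim: xs => [|a xs [d d0 hd]]; first by exists 1.
have [xa|ax] := ltP x a; last first.
  by exists d => // y; rewrite inE => /orP[/eqP->|/hd//]; rewrite ltNge ax.
exists (Num.min d (a - x)); first by rewrite lt_min d0 subr_gt0.
move=> y; rewrite inE => /orP[/eqP-> /andP[_]|/hd H /andP[h1 h2]].
  by move=> h; have : Num.min d (a - x) <= a - x; [rewrite ge_min lexx orbT | lra].
apply: H; rewrite h1 /=; apply: lt_le_trans h2 _.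
by rewrite lerD2l ge_min lexx.
Qed.

(** Next to a root of q on the curve, [|p / q|^2] is at least a constant over [(y - y0)^2], which is
    not integrable: the piece [[y0 + t/2, y0 + t]] alone contributes at least [A / (2 t)]. *)
Lemma L2_ratfun_noroot p q s y0 : q != 0 -> coprimep p q -> L2b (ratfun p q) ->
  ~~ root q (gam s y0).
Proof.
move=> q0 cpq lr; apply/negP => rq.
have pz : p.[gam s y0] != 0.
  by rewrite -/(root _ _); apply: coprimep_root rq; rewrite coprimep_sym.
have [q1 E] := factor_theorem _ _ rq.
have [M M0 hM] : exists2 K : R, 0 < K & forall y, y0 <= y <= y0 + 1 -> normc q1.[gam s y] <= K.
  apply: pcont_bounded => [|y _]; first by rewrite lerDl.
  by apply: pcont_comp; [exact: pcont_gam | exact/cdiff_ccont/cdiff_poly].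
have [K K0 hK] : exists2 K : R, 0 < K & forall y, y0 <= y <= y0 + 1 -> normc (dgam s y) <= K.
  by apply: pcont_bounded => [|y _]; [rewrite lerDl | exact: pcont_dgam].
have lip y : y0 <= y <= y0 + 1 -> normc (gam s y - gam s y0) <= 2 * (K * (y - y0)).
  move=> /andP[y1 y2]; rewrite -(@cint_FTC _ (gam s) (dgam s)) //.
  - apply: cint_itv_le => // x /andP[x1 x2]; first exact: pcont_dgam.
    by apply: hK; rewrite x1 (le_trans x2).
  - by move=> x _; exact: pdiff_gam.
  - by move=> x _; exact: pcont_dgam.
have cp : pcont (fun y => p.[gam s y]) y0.
  by apply: (pcont_comp (F := fun z => p.[z])); [exact: pcont_gam | exact/cdiff_ccont/cdiff_poly].
have [|d d0 hd] := cp (normc p.[gam s y0] / 2); first by rewrite divr_gt0 // normc_gt0.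
have [sq Eq] := poly_factor q.
(* At another root of q division by zero would make [ratfun] vanish and spoil the lower bound; [d']
   keeps the ordinates away from those of all roots. *)
have [d' d0' hd'] := gap_right y0 [seq complex.Im a | a <- sq].
pose c := normc p.[gam s y0] / 2.
have c0 : 0 < c by rewrite divr_gt0 // normc_gt0.
pose A := (c / (2 * K * M)) ^+ 2.
have A0 : 0 < A by rewrite exprn_gt0 // divr_gt0 // !mulr_gt0.
have key t : 0 < t -> t < d -> t < d' -> t <= 1 -> A / (2 * t) <= nrm2 (ratfun p q).
  move=> t0 td td' t1.
  rewrite (_ : A / (2 * t) = A / t ^+ 2 * (y0 + t - (y0 + t / 2))); last by field; rewrite gt_eqF.
  apply: (mass_itv_lower (s := s)) => //; [by lra | by rewrite divr_ge0 ?(ltW A0) ?sqr_ge0 |].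
  move=> y /andP[y1 y2].
  have yy : y0 <= y <= y0 + 1 by apply/andP; split; lra.
  rewrite /mass -[leLHS]mulr1; apply: ler_pM; rewrite ?speed_ge1 ?divr_ge0 ?(ltW A0) ?sqr_ge0 //.
  rewrite /A -expr_div_n; apply: lerXn2r; rewrite ?nnegrE ?normc_ge0 // ?divr_ge0 ?(ltW c0) ?mulr_ge0 ?(ltW K0) ?(ltW M0) ?(ltW t0) ?normc_ge0 //.
  have hp : c <= normc p.[gam s y].
    have : normc (p.[gam s y] - p.[gam s y0]) < c by apply: hd; rewrite ger0_norm; lra.
    have := normc_tri p.[gam s y0] p.[gam s y]; rewrite normc_distC /c; lra.
  have zz : gam s y - gam s y0 != 0.
    by rewrite subr_eq0; apply/eqP => /(congr1 (@complex.Im _)); rewrite !Im_gam; lra.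
  have hz := lip _ yy.
  rewrite /ratfun E hornerM hornerXsubC normcM normcV normcM.
  have q1z : q1.[gam s y] != 0.
    apply/eqP => q1z; have : root q (gam s y) by rewrite E rootM /root q1z eqxx.
    rewrite Eq rootZ ?lead_coef_eq0 // root_prod_XsubC => /(map_f (@complex.Im _)) /hd'.
    by rewrite Im_gam; apply; lra.
  have n1 : 0 < normc q1.[gam s y] by rewrite normc_gt0.
  have n2 : 0 < normc (gam s y - gam s y0) by rewrite normc_gt0.
  rewrite -[c / _ / _]mulrA -invfM.
  apply: ler_pM => //; rewrite ?(ltW c0) ?invr_ge0 ?mulr_ge0 ?(ltW K0) ?(ltW M0) ?(ltW t0) //.
  rewrite lef_pV2 ?posrE ?mulr_gt0 //.
  have := hM _ yy; have : normc (gam s y - gam s y0) <= 2 * K * t.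
    by apply: le_trans hz _; rewrite mulrA ler_wpM2l ?mulr_ge0 ?(ltW K0) //; lra.
  move=> h1 h2; apply: (@le_trans _ _ (M * (2 * K * t))); last by rewrite le_eqVlt; apply/orP; left; apply/eqP; ring.
  by apply: ler_pM; rewrite ?normc_ge0.
pose N := nrm2 (ratfun p q); have N0 : 0 <= N by exact: nrm2_ge0.
pose t := Num.min (Num.min (d / 2) (d' / 2)) (Num.min 1 (A / (4 * (N + 1)))).
have N1 : 0 < 4 * (N + 1) by rewrite mulr_gt0 // ltr_wpDl.
have t0 : 0 < t by rewrite !lt_min !divr_gt0 // ltr01.
have td : t <= d / 2 by rewrite !ge_min lexx.
have td' : t <= d' / 2 by rewrite !ge_min lexx orbT.
have t1 : t <= 1 by rewrite !ge_min lexx !orbT.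
have tA : t <= A / (4 * (N + 1)) by rewrite !ge_min lexx !orbT.
have := key t t0 _ _ t1; rewrite ler_pdivrMr ?mulr_gt0 // => H.
have {}H : A <= N * (2 * t) by apply: H; lra.
move: tA H N0 t0; rewrite ler_pdivlMr //.
by move: A N t {key A0 N1 td td' t1} => A N t; clear => *; nra.
Qed.

(** If deg p >= deg q, then [p / q] is bounded below far out, on a curve of infinite length. *)
Lemma L2_ratfun_size p q : q != 0 -> coprimep p q -> L2b (ratfun p q) ->
  (size p < size q)%N.
Proof.
move=> q0 cpq lr; rewrite ltnNge; apply/negP => spq.
have p0 : p != 0.
  by apply: contraTneq spq => ->; rewrite size_poly0 -ltnNge size_poly_gt0.
have [c [r [c0 r0 hp]]] := poly_lower p0.
have [K K0 hq] := poly_upper q.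
pose A := (c / (K + 1)) ^+ 2.
have K1 : 0 < K + 1 by rewrite ltr_wpDl.
have A0 : 0 < A by rewrite exprn_gt0 // divr_gt0.
have N0 : 0 <= nrm2 (ratfun p q) by exact: nrm2_ge0.
have key T : 0 <= T -> A * (r + T - r) <= nrm2 (ratfun p q).
  move=> T0; apply: (mass_itv_lower (s := true)) => //; [by rewrite lerDl | exact: ltW |].
  move=> y /andP[y1 y2]; rewrite /mass -[leLHS]mulr1.
  apply: ler_pM; rewrite ?speed_ge1 ?(ltW A0) //.
  rewrite /A lerXn2r ?nnegrE ?normc_ge0 ?divr_ge0 ?(ltW c0) ?(ltW K1) //.
  have rz : r <= normc (gam true y).
    by apply: le_trans (ler_normIm _); rewrite Im_gam (le_trans y1) // ler_norm.
  have h1 : 1 <= 1 + normc (gam true y) by rewrite lerDl normc_ge0.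
  have qz : 0 < normc q.[gam true y].
    by rewrite normc_gt0; have := L2_ratfun_noroot true y q0 cpq lr.
  rewrite /ratfun normcM normcV ler_pdivlMr // mulrAC ler_pdivrMr //.
  have s1 : (0 < size q)%N by rewrite size_poly_gt0.
  have e : (1 + normc (gam true y)) ^+ (size q).-1 <= (1 + normc (gam true y)) ^+ (size p).-1.
    by rewrite ler_weXn2l // -!subn1 leq_sub2r.
  have E0 : 0 <= (1 + normc (gam true y)) ^+ (size q).-1 by rewrite exprn_ge0 // (le_trans ler01).
  have := hp _ rz; have := hq (gam true y) => h2 h3.
  apply: (@le_trans _ _ (c * ((K + 1) * (1 + normc (gam true y)) ^+ (size p).-1))).
    rewrite ler_wpM2l ?(ltW c0) // (le_trans h2) //.
    apply: ler_pM => //; lra.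
  by rewrite mulrCA mulrC ler_wpM2r ?(ltW K1).
have T0 : 0 <= (nrm2 (ratfun p q) + 1) / A by apply: divr_ge0; [exact: addr_ge0 | exact: ltW].
have := key _ T0; rewrite addrAC subrr add0r mulrC divfK ?gt_eqF //; lra.
Qed.

(** Square integrability excludes poles on the curve and forces decay, so the rational functions
    that define H(D) are test functions. This links the definition by closure with the description
    by annihilators. *)
Lemma dec_rational b p q : q != 0 -> coprimep p q ->
  (forall z, Dside omega b z -> ~~ root q z) -> L2_curve omega (ratfun p q) ->
  dec b 1 (ratfun p q).
Proof.
move=> q0 cpq nr /(L2_curveP hC1) lr; apply: dec_ratfun => // [z bz|].
  by have [/nr//|[s ->]] := side_cases bz; exact: (L2_ratfun_noroot s _ q0 cpq lr).
by rewrite addn1; exact: L2_ratfun_size.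
Qed.

Lemma pair_dec b f g : dec b 1 f -> dec b 1 g -> pair f g = 0.
Proof. by move=> df dg; apply: (contour_dec hC (b := b)); exact: (dec_mul (N := 1) df dg). Qed.

(* H(D_+) and H(D_-) are described by duality: their annihilators for the
   bilinear pairing given by the contour integral are themselves. *)
Definition hs b u := L2b u /\ forall f, dec b 1 f -> pair u f = 0.

Lemma hs_dec b f : dec b 1 f -> hs b f.
Proof. by move=> df; split=> [|g dg]; [exact: (dec_L2b hC df) | exact: pair_dec df dg]. Qed.

Lemma hardy_hs b u : hardy omega (Dside omega b) u -> hs b u.
Proof.
move=> [/(L2_curveP hC1) lu hu]; split=> // f df; apply: (pair_limit hC1) => //.
  exact: (dec_L2b hC df).
move=> e e0; have [p [q [q0 cpq nr lr he]]] := hu e e0.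
have dr := dec_rational q0 cpq nr lr.
have lr' := dec_L2b hC dr.
exists (ratfun p q); first by split=> //; exact: pair_dec dr df.
by move: he; rewrite sqnorm_nrm2 ?lte_fin; [exact: ltW | case: (L2b_sub hC1 lu lr')].
Qed.

Lemma hs_pair b u v : hs b u -> hardy omega (Dside omega b) v -> pair u v = 0.
Proof.
move=> [lu hu] [/(L2_curveP hC1) lv hv]; rewrite pairC; apply: (pair_limit hC1) => //.
move=> e e0; have [p [q [q0 cpq nr lr he]]] := hv e e0.
have dr := dec_rational q0 cpq nr lr; have lr' := dec_L2b hC dr.
exists (ratfun p q); first by split=> //; rewrite pairC hu.
by move: he; rewrite sqnorm_nrm2 ?lte_fin; [exact: ltW | case: (L2b_sub hC1 lv lr')].
Qed.

Lemma hardy_ae D u v : eq_curve omega u v -> mcurve v -> hardy omega D u -> hardy omega D v.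
Proof.
move=> uv mv [lu hu].
have lu' : L2b u by exact/L2_curveP.
have lv : L2b v by exact: (L2b_ae hC1 uv).
split; first exact/L2_curveP.
move=> e /hu[p [q [q0 cpq nr lr he]]]; exists p, q; split=> //.
have lr' : L2b (ratfun p q) by exact/L2_curveP.
have [l1 _] := L2b_sub hC1 lu' lr'; have [l2 _] := L2b_sub hC1 lv lr'.
move: he; rewrite !sqnorm_nrm2 // (nrm2_ae hC1 _ (proj1 l1) (proj1 l2)) //.
exact: (eq_curve_map (fun l x => x - ratfun p q l)).
Qed.

Hypothesis hH : hardy_decomposition omega.

(** The dual test of u splits along the decomposition, and u annihilates both components; but its
    pairing with the dual test is its squared norm. *)
Lemma hs_inter u : hs true u -> hs false u -> eq_curve omega u (fun=> 0).
Proof.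
move=> hp hm; have lu := proj1 hp.
apply: (nrm2_eq0 hC1) => //.
have lt := dual_test_L2b hC1 hpos lu.
have [|up [um [h1 h2 E]]] := hH.1 (dual_test omega u); first exact/L2_curveP.
have l1 : L2b up by exact/(L2_curveP hC1)/(proj1 h1).
have l2 : L2b um by exact/(L2_curveP hC1)/(proj1 h2).
have := pair_dual hpos lu.
rewrite pairC (pair_ae hC1 (proj1 lt) (proj1 (proj1 (L2b_add hC1 l1 l2))) (proj1 lu)) //.
rewrite (pair_addl hC1) // pairC (hs_pair (b := true)) // pairC (hs_pair (b := false)) //.
by rewrite addr0 => -[].
Qed.

Lemma hs_sub b u v : hs b u -> hs b v -> hs b (fun l => u l - v l).
Proof.
move=> [lu hu] [lv hv]; split=> [|f df]; first by case: (L2b_sub hC1 lu lv).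
by rewrite (pair_subl hC1) ?hu ?hv ?subrr //; exact: (dec_L2b hC df).
Qed.

(** In the decomposition of u, the component on the wrong side is also a difference of two elements
    of [hs b]. It lies in both annihilators and vanishes by [hs_inter]. *)
Lemma hs_hardy b u : hs b u -> hardy omega (Dside omega b) u.
Proof.
move=> hu; have lu := proj1 hu.
have [|up [um [h1 h2 E]]] := hH.1 u; first exact/L2_curveP.
have k1 := hardy_hs (b := true) h1; have k2 := hardy_hs (b := false) h2.
have [l1 l2] := (proj1 k1, proj1 k2).
have other (v w : C -> C) c : hs c u -> hs c v -> eq_curve omega u (fun l => v l + w l) ->
    hs (~~ c) w -> hs c w.
  move=> [_ hu'] [lv hv] Euvw [lw _]; split=> // f df.
  have lf := dec_L2b hC df.
  have := hu' f df; rewrite (pair_ae hC1 (proj1 lu) (proj1 (proj1 (L2b_add hC1 lv lw))) (proj1 lf) Euvw).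
  by rewrite (pair_addl hC1) // hv // add0r.
case: b hu => hu.
  have z2 := hs_inter (other up um true hu k1 E k2) k2.
  apply: hardy_ae h1 => //; last exact: (proj1 lu).
  apply: (eq_curve_trans (v := fun l => up l + um l)); last exact: eq_curve_sym.
  apply: eq_curve_sym; apply: eq_curve_trans (eq_curve_map (fun l x => up l + x) z2) _.
  by apply: eq_curve_on => l _; rewrite addr0.
have E' : eq_curve omega u (fun l => um l + up l).
  by apply: eq_curve_trans E _; apply: eq_curve_on => l _; rewrite addrC.
have z1 := hs_inter k1 (other um up false hu k2 E' k1).
apply: hardy_ae h2 => //; last exact: (proj1 lu).
apply: (eq_curve_trans (v := fun l => um l + up l)); last exact: eq_curve_sym.
apply: eq_curve_sym; apply: eq_curve_trans (eq_curve_map (fun l x => um l + x) z1) _.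
by apply: eq_curve_on => l _; rewrite addr0.
Qed.

End Duality.

(** * Operations on the annihilators *)

Section HardyClosure.
Context {R : realType}.
Local Notation C := R[i].
Variables (omega : R -> R) (W : R).
Hypothesis hC : regular_curve omega W.
Local Notation gam := (curve_pt omega).
Local Notation L2b := (L2b omega).
Local Notation nrm2 := (nrm2 omega).
Local Notation pair := (pair omega).
Local Notation side := (side omega).
Local Notation dec := (dec omega).
Local Notation hs := (hs omega).
Local Notation mcurve u := (forall s : bool, pmeas (fun y => u (gam s y))).
Implicit Types (u v w g h f : C -> C) (b s : bool).
Let hC1 := rc_C1 hC.
Let hpos := rc_pos hC.

Lemma hs_add b u v : hs b u -> hs b v -> hs b (fun l => u l + v l).
Proof.
move=> [lu hu] [lv hv]; split=> [|f df]; first by case: (L2b_add hC1 lu lv).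
by rewrite (pair_addl hC1) ?hu ?hv ?addr0 //; exact: (dec_L2b hC df).
Qed.

Lemma hs_scale b c u : hs b u -> hs b (fun l => c * u l).
Proof.
move=> [lu hu]; split=> [|f df]; first by case: (L2b_scale hC1 c lu).
by rewrite (pair_scalel hC1) ?hu ?mulr0 //; exact: (dec_L2b hC df).
Qed.

Lemma hs_ae b u v : eq_curve omega u v -> mcurve v -> hs b u -> hs b v.
Proof.
move=> uv mv [lu hu]; split=> [|f df]; first exact: (L2b_ae hC1 uv mv lu).
have lf := dec_L2b hC df.
by rewrite -(pair_ae hC1 (proj1 lu) mv (proj1 lf) uv) hu.
Qed.

Lemma hs_opp b u : hs b u -> hs b (fun l => u (- l)).
Proof.
move=> [lu hu]; split=> [|f df]; first by case: (L2b_opp hC1 (rc_even hC) lu).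
rewrite (pair_opp hC1 (rc_even hC)) //; last exact: (dec_L2b hC df).
by rewrite hu ?oppr0 //; exact: (dec_opp hC).
Qed.

Lemma L2b_mul u f (K : R) : mcurve f -> 0 <= K -> (forall s y, normc (f (gam s y)) <= K) ->
  L2b u -> L2b (fun l => f l * u l) /\ nrm2 (fun l => f l * u l) <= K ^+ 2 * nrm2 u.
Proof.
move=> mf K0 hK lu; apply: (L2b_le hC1) => //.
  by move=> s; apply: pmeas_mul => //; exact: (proj1 lu).
by move=> s y; rewrite normcM ler_wpM2r ?normc_ge0.
Qed.

Lemma dec0_L2b b f u : dec b 0 f -> L2b u -> exists2 K : R, 0 <= K &
  L2b (fun l => f l * u l) /\ nrm2 (fun l => f l * u l) <= K * nrm2 u.
Proof.
move=> df lu; have [_ [K K0 hK]] := df; exists (K ^+ 2); first exact: sqr_ge0.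
apply: L2b_mul => //; first exact: (dec_mcurve hC df).
by move=> s y; have := hK _ (side_gam hC b s y); rewrite expr0 mulr1.
Qed.

Lemma hs_mul b f u : dec b 0 f -> hs b u -> hs b (fun l => f l * u l).
Proof.
move=> df [lu hu]; split=> [|g dg]; first by have [K _ []] := dec0_L2b df lu.
rewrite -(hu (fun l => f l * g l)); last exact: (dec_mul df dg).
by rewrite /pair; congr contour_integral; apply/funext => l; ring.
Qed.

Lemma hs0 b : hs b (fun=> 0).
Proof. exact: (hs_dec hC (dec0 _ b 1)). Qed.

End HardyClosure.

(** * Summation of rapidly decreasing series in L^2(C) *)

Section Completeness.
Context {R : realType}.
Local Notation C := R[i].
Local Notation leb := (@lebesgue_measure R).
Variables (omega : R -> R) (W : R).
Hypothesis hC : regular_curve omega W.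
Local Notation speed := (arc_speed omega).
Local Notation gam := (curve_pt omega).
Local Notation mass := (mass omega).
Local Notation L2b := (L2b omega).
Local Notation nrm2 := (nrm2 omega).
Local Notation mcurve u := (forall s : bool, pmeas (fun y => u (gam s y))).
Implicit Types (u v w g h f : C -> C) (b s : bool).
Let hC1 := rc_C1 hC.
Let hpos := rc_pos hC.

Definition of_branches (g : bool -> R -> C) : C -> C := fun l =>
  if 0 < complex.Re l then g true (complex.Im l) else g false (complex.Im l).

Lemma of_branchesE (gg : bool -> R -> C) s y : of_branches gg (gam s y) = gg s y.
Proof.
rewrite /of_branches Re_gam Im_gam; case: s; rewrite /sg ?mul1r ?mulN1r ?hpos //.
by rewrite oppr_gt0 ltNge ltW.
Qed.

Variable u_ : nat -> C -> C.
Hypothesis lu : forall k, L2b (u_ k).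
Hypothesis nu : forall k, nrm2 (u_ k) <= 64 ^- k.
Let X n : C -> C := fun l => \sum_(k < n) u_ k l.
(** The weight [16^k] against norms [64^-k] leaves the integrable sum of [4^-k]; and where [G] is
    finite, [|u_k| <= 4^-k sqrt G], so the series converges absolutely. *)
Let G s (y : R) : \bar R := (\sum_(k <oo) (16 ^+ k * mass (u_ k) s y)%:E)%E.
Let A s : set R := [set y | (G s y < +oo)%E].

Let term0 s y k : (0 <= (16 ^+ k * mass (u_ k) s y)%:E)%E.
Proof. by rewrite lee_fin mulr_ge0 ?exprn_ge0 ?mass_ge0. Qed.

Let mterm s k : measurable_fun setT (fun y => (16 ^+ k * mass (u_ k) s y)%:E).
Proof.
apply/measurable_EFinP; apply: measurable_funM; first exact: measurable_cst.
exact: (meas_mass hC1 (proj1 (lu k) s)).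
Qed.

Let mG s : measurable_fun setT (G s).
Proof. by apply: ge0_emeasurable_sum => [k y _ _|k _]; [exact: term0 | exact: mterm]. Qed.

Let G0 s y : (0 <= G s y)%E.
Proof. by apply: nneseries_ge0 => k _ _; exact: term0. Qed.

Let int_mass k s : \int[leb]_y mass (u_ k) s y <= 64 ^- k.
Proof.
apply: le_trans (nu k); rewrite /nrm2; case: s; rewrite ?lerDl ?lerDr;
  by apply: Rintegral_ge0 => y _; exact: mass_ge0.
Qed.

Let intG s : (\int[leb]_y G s y < +oo)%E.
Proof.
rewrite /G integral_nneseries //; last by move=> n; exact: mterm.
apply: (@le_lt_trans _ _ (\sum_(k <oo) (4 ^- k)%:E)%E).
  apply: lee_nneseries => [k *|k *].
    by apply: integral_ge0 => y _; exact: term0.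
  have iu := integrableZE (16 ^+ k) measurableT (proj2 (lu k) s).
  rewrite -(fineK (integrable_fin_num measurableT iu)) lee_fin.
  rewrite -[fine _]/(\int[leb]_y (16 ^+ k * mass (u_ k) s y)) RintegralZl //; last exact: (proj2 (lu k) s).
  apply: (@le_trans _ _ (16 ^+ k * 64 ^- k)); first by rewrite ler_wpM2l ?exprn_ge0.
  by rewrite -exprVn -exprMn (_ : 16 * 64^-1 = 4^-1) ?exprVn //; field.
have -> : (fun n => (\sum_(0 <= k < n) (4 ^- k)%:E)%E) = EFin \o series (geometric 1 4^-1) :> (nat -> \bar R).
  apply/funext => n; rewrite /= /series /= -sumEFin; apply: eq_bigr => k _.
  by rewrite /geometric /= mul1r exprVn.
have c4 : cvgn (series (geometric 1 (4^-1 : R))) by apply: is_cvg_geometric_series; rewrite ger0_norm; lra.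
by rewrite EFin_lim // ltry.
Qed.

Let mA s : measurable (A s : set (measurableTypeR R)).
Proof.
by have := emeasurable_fun_infty_o measurableT (mG s) +oo%E; rewrite setTI.
Qed.

Let aeA s : {ae leb, forall y, A s y}.
Proof.
have : leb.-integrable setT (G s).
  apply/integrableP; split; first exact: mG.
  rewrite (_ : (\int[leb]_y `|G s y|)%E = (\int[leb]_y G s y)%E); first exact: intG.
  by apply: eq_integral => y _; rewrite gee0_abs.
move=> iG; have H := integrable_ae measurableT iG.
apply: (ae_mono H) => y /(_ I).
by rewrite /A /= ge0_fin_numE.
Qed.

Let d s y : R := fine (G s y).

Let d0 s y : 0 <= d s y.
Proof. exact: fine_ge0. Qed.

Let integrable_d s : leb.-integrable setT (EFin \o d s).
Proof.
have md : measurable_fun setT (d s) by apply: (measurableT_comp (fine_measurable _) (mG s)).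
apply: integrable_ge0 => //.
apply: le_lt_trans (intG s); apply: ge0_le_integral => //.
- by move=> y _; rewrite lee_fin.
- exact/measurable_EFinP.
- exact: mG.
- by move=> y _; rewrite /d; have := G0 s y; case: (G s y).
Qed.

(** Cutting off the null set where [G] is infinite makes the series converge at every point, as
    [real_DCT] asks. *)
Let v_ k := of_branches (fun s y => (\1_(A s) y)%:C * u_ k (gam s y)).

Let vE k s y : v_ k (gam s y) = (\1_(A s) y)%:C * u_ k (gam s y).
Proof. exact: of_branchesE. Qed.

Let mv k : mcurve (v_ k).
Proof.
move=> s; rewrite (funext (vE k s)); apply: pmeas_mul; last exact: (proj1 (lu k)).
by split; [exact: (measurable_indic (mA s)) | exact: (measurable_cst (0 : R))].
Qed.

Let uv k : eq_curve omega (u_ k) (v_ k).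
Proof.
move=> s; apply: (ae_mono (aeA s)) => y Ay.
by rewrite vE indicE mem_set // mul1r.
Qed.

Let v_bound k s y : mass (v_ k) s y <= 16 ^- k * d s y.
Proof.
rewrite /mass vE indicE; case: (boolP (y \in A s)) => yA; last first.
  by rewrite mul0r normc0 expr0n mul0r mulr_ge0 // invr_ge0 exprn_ge0.
rewrite mul1r -/(mass (u_ k) s y) mulrC ler_pdivlMr ?exprn_gt0 // mulrC.
rewrite -lee_fin fineK; last by rewrite ge0_fin_numE //; exact: (set_mem yA).
apply: le_trans (nneseries_lim_ge k.+1 _); last by move=> j _ _; exact: term0.
rewrite big_nat_recr //= leeDr //; apply: sume_ge0 => j _; exact: term0.
Qed.

Let V n s y : C := \sum_(k < n) v_ k (gam s y).

Let v_norm k s y : normc (v_ k (gam s y)) * Num.sqrt (speed y) <= 4 ^- k * Num.sqrt (d s y).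
Proof.
have -> : 4 ^- k * Num.sqrt (d s y) = Num.sqrt (16 ^- k * d s y).
  rewrite sqrtrM ?invr_ge0 ?exprn_ge0 //; congr (_ * _).
  rewrite (_ : 16 ^- k = (4 ^- k) ^+ 2) ?sqrtr_sqr ?ger0_norm ?invr_ge0 ?exprn_ge0 //.
  by rewrite -!exprVn exprAC; congr (_ ^+ _); field.
rewrite -[normc _]ger0_norm ?normc_ge0 // -sqrtr_sqr -sqrtrM ?sqr_ge0 //.
by rewrite ler_wsqrtr //; exact: v_bound.
Qed.

Let geo4 n : \sum_(k < n) 4 ^- k <= 2 :> R.
Proof.
suff -> : \sum_(k < n) 4 ^- k = 4 / 3 - 4 / 3 * 4 ^- n :> R.
  have : 0 <= 4 ^- n :> R by rewrite invr_ge0 exprn_ge0.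
  by lra.
elim: n => [|n IH]; first by rewrite big_ord0 expr0 invr1; lra.
rewrite big_ord_recr IH /= exprS invfM; have : (4:R) ^+ n != 0 by rewrite expf_neq0.
by move: (4 ^+ n) => t t0; field.
Qed.

Let V_norm n m s y : normc (V n s y - V m s y) * Num.sqrt (speed y) <= 4 * Num.sqrt (d s y).
Proof.
have H k : normc (V k s y) * Num.sqrt (speed y) <= 2 * Num.sqrt (d s y).
  apply: (@le_trans _ _ (\sum_(j < k) normc (v_ j (gam s y)) * Num.sqrt (speed y))).
    rewrite -mulr_suml ler_wpM2r ?sqrtr_ge0 // /V.
    elim/big_ind2: _ => [|x1 x2 y1 y2 h1 h2|//]; first by rewrite normc0.
    by apply: le_trans (le_normcD _ _) _; exact: lerD.
  apply: (@le_trans _ _ (\sum_(j < k) 4 ^- j * Num.sqrt (d s y))).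
    by apply: ler_sum => j _; exact: v_norm.
  by rewrite -mulr_suml ler_wpM2r ?sqrtr_ge0.
apply: (@le_trans _ _ ((normc (V n s y) + normc (V m s y)) * Num.sqrt (speed y))).
  by rewrite ler_wpM2r ?sqrtr_ge0 // normcB.
by rewrite mulrDl; have := H n; have := H m; lra.
Qed.

Let V_mass n m s y : normc (V n s y - V m s y) ^+ 2 * speed y <= 16 * d s y.
Proof.
have := V_norm n m s y; rewrite -(@ler_pXn2r _ 2) ?nnegrE ?mulr_ge0 ?normc_ge0 ?sqrtr_ge0 //.
by rewrite !exprMn !sqr_sqrtr ?speed_ge0 // => /le_trans; apply; rewrite -natrX.
Qed.

Let part_cvg (prt : C -> R) s y : (forall z, `|prt z| <= normc z) ->
  (forall n, prt (V n s y) = \sum_(k < n) prt (v_ k (gam s y))) ->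
  cvgn (fun n => prt (V n s y)).
Proof.
move=> pn pV; rewrite (funext pV).
have := @normed_cvg _ _ (fun k => prt (v_ k (gam s y))).
rewrite (_ : (fun n => \sum_(k < n) _) = series (fun k => prt (v_ k (gam s y)))); last first.
  by apply/funext => n; rewrite /series /= big_mkord.
apply.
have geo : cvgn (series (geometric (Num.sqrt (d s y)) (4^-1 : R))).
  by apply: is_cvg_geometric_series; rewrite ger0_norm; lra.
apply: (series_le_cvg _ _ _ geo) => [k|k|k] //=.
apply: le_trans (pn _) _; apply: (@le_trans _ _ (normc (v_ k (gam s y)) * Num.sqrt (speed y))).
  rewrite ler_peMr ?normc_ge0 // -[leLHS]sqrtr1 ler_wsqrtr //; exact: speed_ge1.
by rewrite mulrC exprVn mulrC [_ * 4 ^- _]mulrC; apply: v_norm.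
Qed.

Let x : C -> C := of_branches (fun s y =>
  (limn (fun n => complex.Re (V n s y))) +i* (limn (fun n => complex.Im (V n s y)))).

Let Re_cvg s y : complex.Re (V n s y) @[n --> \oo] --> complex.Re (x (gam s y)).
Proof.
rewrite /x of_branchesE /=; apply: part_cvg => [z|n]; first exact: ler_normRe.
by rewrite /V; elim/big_ind2: _ => // a1 a2 b1 b2 <- <-; rewrite ReD.
Qed.

Let Im_cvg s y : complex.Im (V n s y) @[n --> \oo] --> complex.Im (x (gam s y)).
Proof.
rewrite /x of_branchesE /=; apply: part_cvg => [z|n]; first exact: ler_normIm.
by rewrite /V; elim/big_ind2: _ => // a1 a2 b1 b2 <- <-; rewrite ImD.
Qed.

Let mV n s : pmeas (V n s).
Proof.
rewrite /V; elim: n => [|n IH].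
  by apply: pmeas_cont => y; apply: pcont_eq (pcont_cst 0 y) => t; rewrite big_ord0.
rewrite (_ : (fun y => _) = fun y => \sum_(k < n) v_ k (gam s y) + v_ n (gam s y)); last first.
  by apply/funext => y; rewrite big_ord_recr.
exact: (pmeas_add IH (mv n s)).
Qed.

Let mx : mcurve x.
Proof.
move=> s; split.
  by apply: (measurable_fun_cvg (fun n => proj1 (mV n s))) => y _; exact: Re_cvg.
by apply: (measurable_fun_cvg (fun n => proj2 (mV n s))) => y _; exact: Im_cvg.
Qed.

Let dist_cvg m s :
  leb.-integrable setT (EFin \o (fun y => normc (x (gam s y) - V m s y) ^+ 2 * speed y)) /\
  (\int[leb]_y (normc (V n s y - V m s y) ^+ 2 * speed y)) @[n --> \oo] -->
  \int[leb]_y (normc (x (gam s y) - V m s y) ^+ 2 * speed y).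
Proof.
apply: (real_DCT (b := fun y => 16 * d s y)) => //.
- move=> n; apply: (integrable_le (b := fun y => 16 * d s y)).
  + apply: measurable_funM; last exact: meas_speed.
    apply: measurable_funX; apply: pmeas_norm.
    have mN : pmeas (fun y => -1 * V m s y) by exact: (pmeas_mul (pmeas_cst (-1)) (mV m s)).
    rewrite (_ : (fun y => _) = fun y => V n s y + -1 * V m s y); first exact: (pmeas_add (mV n s) mN).
    by apply/funext => y; rewrite mulN1r.
  + by move=> y; rewrite ger0_norm ?V_mass // mulr_ge0 ?sqr_ge0 ?speed_ge0.
  + exact: (integrableZE 16 measurableT (integrable_d s)).
- move=> y _; rewrite normc_sqr ReD ReN ImD ImN.
  under eq_fun do rewrite normc_sqr ReD ReN ImD ImN.
  apply: cvgMr_tmp; apply: cvgD; rewrite expr2; under eq_fun do rewrite expr2; apply: cvgM;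
    apply: cvgB; solve [exact: Re_cvg | exact: Im_cvg | exact: cvg_cst].
- exact: (integrableZE 16 measurableT (integrable_d s)).
- by move=> n y _; rewrite ger0_norm ?V_mass // mulr_ge0 ?sqr_ge0 ?speed_ge0.
Qed.

Let Xuv n : eq_curve omega (X n) (fun l => \sum_(k < n) v_ k l).
Proof.
rewrite /X; elim: n => [|n IH]; first by apply: eq_curve_on => l _; rewrite !big_ord0.
have H := eq_curve_map2 (fun _ a b : C => a + b) IH (uv n).
by move=> s; apply: (ae_mono (H s)) => y; rewrite !big_ord_recr.
Qed.

(** Completeness in the form suited to the gliding hump: a bound on the differences of partial sums
    passes to the limit, by dominated convergence with majorant [16 d]. *)
Lemma L2_series : exists2 x, L2b x & forall m (B : R),
  (forall n, (m <= n)%N ->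
    nrm2 (fun l => \sum_(k < n) u_ k l - \sum_(k < m) u_ k l) <= B) ->
  nrm2 (fun l => x l - \sum_(k < m) u_ k l) <= B.
Proof.
have mX n : mcurve (X n).
  move=> s; rewrite /X; elim: n => [|n IH].
    by apply: pmeas_cont => y; apply: pcont_eq (pcont_cst 0 y) => t; rewrite big_ord0.
  rewrite (_ : (fun y => _) = fun y => \sum_(k < n) u_ k (gam s y) + u_ n (gam s y)); last first.
    by apply/funext => y; rewrite big_ord_recr.
  by apply: pmeas_add => //; exact: (proj1 (lu n)).
have msub (f g : C -> C) : mcurve f -> mcurve g -> mcurve (fun l => f l - g l).
  move=> mf mg s; rewrite (_ : (fun y => _) = fun y => f (gam s y) + -1 * g (gam s y)).
    by apply: pmeas_add => //; apply: pmeas_mul => //; exact: pmeas_cst.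
  by apply/funext => y; rewrite mulN1r.
have mW n : mcurve (fun l => \sum_(k < n) v_ k l) by move=> s; exact: (mV n s).
exists x.
  split=> // s; have [H _] := dist_cvg 0 s; move: H.
  by rewrite /V; under eq_fun do rewrite big_ord0 subr0.
move=> m B hB.
have E n : nrm2 (fun l => X n l - X m l) =
    \int[leb]_y (normc (V n true y - V m true y) ^+ 2 * speed y) +
    \int[leb]_y (normc (V n false y - V m false y) ^+ 2 * speed y).
  rewrite (nrm2_ae hC1 (v := fun l => \sum_(k < n) v_ k l - \sum_(k < m) v_ k l)) //.
  - exact: (eq_curve_map2 (fun _ a b : C => a - b) (Xuv n) (Xuv m)).
  - exact: (msub (X n) (X m)).
  - exact: (msub (fun l => \sum_(k < n) v_ k l) (fun l => \sum_(k < m) v_ k l)).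
have -> : nrm2 (fun l => x l - \sum_(k < m) u_ k l) =
    \int[leb]_y (normc (x (gam true y) - V m true y) ^+ 2 * speed y) +
    \int[leb]_y (normc (x (gam false y) - V m false y) ^+ 2 * speed y).
  rewrite (nrm2_ae hC1 (v := fun l => x l - \sum_(k < m) v_ k l)) //.
  - exact: (eq_curve_map (fun l a : C => x l - a) (Xuv m)).
  - exact: (msub x (X m)).
  - exact: (msub x (fun l => \sum_(k < m) v_ k l)).
have [_ H1] := dist_cvg m true; have [_ H2] := dist_cvg m false.
set a := (X in X <= _).
have H : (fun n => nrm2 (fun l => X n l - X m l)) @ \oo --> a.
  by under eq_fun do rewrite E; exact: cvgD H1 H2.
have <- := cvg_lim (@Rhausdorff R) H.
apply: limr_le; first by apply/cvg_ex; eexists; exact: H.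
by near=> n; apply: hB; near: n; exact: nbhs_infty_ge.
Unshelve. all: by end_near.
Qed.

End Completeness.

Lemma tail_arith {R : realType} (t a b : R) : 0 <= t -> a <= t -> b <= 5 / 2 * (t / 64) ->
  2 * a + 2 * b <= 5 / 2 * t.
Proof. by move=> *; lra. Qed.

(** * The projection onto H(D_+) *)

Section Projection.
Context {R : realType}.
Local Notation C := R[i].
Variables (omega : R -> R) (W : R).
Hypothesis hC : regular_curve omega W.
Hypothesis hH : hardy_decomposition omega.
Local Notation gam := (curve_pt omega).
Local Notation L2b := (L2b omega).
Local Notation nrm2 := (nrm2 omega).
Local Notation pair := (pair omega).
Local Notation hs := (hs omega).
Implicit Types (u v w g h f : C -> C) (b s : bool).
Let hC1 := rc_C1 hC.
Let hpos := rc_pos hC.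

Lemma proj_exists u : L2b u -> exists p, hs true p /\ hs false (fun l => u l - p l).
Proof.
move=> lu; have [|up [um [h1 h2 E]]] := hH.1 u; first exact/L2_curveP.
have k1 := hardy_hs hC (b := true) h1; have k2 := hardy_hs hC (b := false) h2.
exists up; split=> //.
apply: (hs_ae hC _ (proj1 (proj1 (L2b_sub hC1 lu (proj1 k1)))) k2).
by move=> s; apply: (ae_mono (E s)) => y ->; rewrite addrAC subrr add0r.
Qed.

Definition proj u : C -> C := match pselect (L2b u) with
  | left h => projT1 (cid (proj_exists h)) | right _ => u end.

Lemma projP u : L2b u -> hs true (proj u) /\ hs false (fun l => u l - proj u l).
Proof. by rewrite /proj; case: pselect => // h _; case: cid. Qed.

Lemma hs_orth b u v : hs b u -> hs b v -> pair u v = 0.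
Proof. by move=> hu hv; apply: (hs_pair hC hu); exact: (hs_hardy hC hH). Qed.

(** Both Hardy spaces are isotropic for the pairing, so only cross terms survive: the transpose of
    the projection is the complementary projection. *)
Lemma pair_proj u v : L2b u -> L2b v -> pair u (proj v) = pair (fun l => u l - proj u l) v.
Proof.
move=> lu lv; have [pu mu] := projP lu; have [pv mv] := projP lv.
have := hs_orth mu mv; have := hs_orth pu pv.
have := pair_addl hC1 (proj1 pu) (proj1 mu) (proj1 pv).
rewrite (_ : (fun l => proj u l + _) = u); last by apply/funext => l; rewrite addrC subrK.
move=> -> ->; rewrite add0r => E.
have := pair_addr hC1 (proj1 mu) (proj1 pv) (proj1 mv).
by rewrite (_ : (fun l => proj v l + _) = v) => [->|]; [rewrite E addr0 | apply/funext => l; rewrite addrC subrK].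
Qed.

Lemma nrm2_dual_test u : L2b u -> nrm2 (dual_test omega u) <= nrm2 u.
Proof.
move=> lu; have [|_] := @L2b_le _ _ hC1 (dual_test omega u) u 1 (proj1 (dual_test_L2b hC1 hpos lu)) ler01 lu.
  move=> s y; rewrite mul1r (dual_testE hpos) 3!normcM normcV 2!normcJ normc_dgam normc_real.
  rewrite normc_real norm_sg mul1r gtr0_norm ?speed_gt0 // mulfK ?gt_eqF ?speed_gt0 //.
by rewrite expr1n mul1r.
Qed.

Section GlidingHump.
Variable v : nat -> C -> C.
Hypothesis lv : forall n, L2b (v n).
Hypothesis big : forall n, (32 ^+ n) ^+ 2 * nrm2 (v n) < nrm2 (proj (v n)).

Let p n := proj (v n).
Let M n := nrm2 (p n).
Let lp n : L2b (p n). Proof. exact: (proj1 (projP (lv n)).1). Qed.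

Let M0 n : 0 < M n.
Proof. by apply: le_lt_trans (big n); apply: mulr_ge0; [exact: sqr_ge0 | exact: nrm2_ge0]. Qed.

Let S0 n : 0 < Num.sqrt (M n). Proof. by rewrite sqrtr_gt0. Qed.

Let xi n : C -> C := fun l => (8 ^- n / Num.sqrt (M n))%:C * dual_test omega (p n) l.

Let lxi n : L2b (xi n) /\ nrm2 (xi n) <= 64 ^- n.
Proof.
have ld := dual_test_L2b hC1 hpos (lp n).
have [l1 h1] := L2b_scale hC1 (8 ^- n / Num.sqrt (M n))%:C ld.
split=> //; apply: (le_trans h1); rewrite normc_real ger0_norm; last first.
  by rewrite divr_ge0 ?invr_ge0 ?exprn_ge0 // ltW.
apply: (@le_trans _ _ ((8 ^- n / Num.sqrt (M n)) ^+ 2 * M n)).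
  by rewrite ler_wpM2l ?sqr_ge0 //; exact: nrm2_dual_test.
rewrite expr_div_n sqr_sqrtr ?(ltW (M0 n)) // divfK ?gt_eqF //.
by rewrite -exprVn -exprM mulnC exprM -exprVn (_ : 8^-1 ^+ 2 = 64^-1) //; field.
Qed.

Let T_xi n : pair (xi n) (p n) = (8 ^- n * Num.sqrt (M n))%:C.
Proof.
have ld := dual_test_L2b hC1 hpos (lp n).
rewrite /xi (pair_scalel hC1) // pairC (pair_dual hpos) // -/(M n) -rmorphM /=; congr (_%:C).
by rewrite -{2}(sqr_sqrtr (ltW (M0 n))) expr2 mulrA divfK ?gt_eqF.
Qed.

(** The sign of a hump is chosen after the preceding ones: of [a + c] and [a - c], one has modulus
    at least [|c|]. *)
Let u_of (x : C -> C) n : C -> C :=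
  if 8 ^- n * Num.sqrt (M n) <= normc (pair (fun l => x l + xi n l) (p n)) then xi n
  else fun l => -1 * xi n l.
Fixpoint hump n : C -> C :=
  if n is k.+1 then fun l => hump k l + u_of (hump k) k l else fun=> 0.
Let u_ n := u_of (hump n) n.

Let lu n : L2b (u_ n) /\ nrm2 (u_ n) <= 64 ^- n.
Proof.
have [l1 h1] := lxi n; rewrite /u_ /u_of; case: ifP => _ //.
have [l2 h2] := L2b_scale hC1 (-1) l1; split=> //; apply: (le_trans h2).
by rewrite normcN normc1 expr1n mul1r.
Qed.

Let humpE n : hump n = fun l => \sum_(k < n) u_ k l.
Proof.
elim: n => [|n IH]; apply/funext => l; first by rewrite big_ord0.
by rewrite big_ord_recr /= -/(u_ n) IH.
Qed.

Let lhump n : L2b (hump n).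
Proof.
elim: n => [|n IH] /=; first exact: L2b0.
by have [] := L2b_add hC1 IH (lu n).1.
Qed.

Let hump_large n : 8 ^- n * Num.sqrt (M n) <= normc (pair (hump n.+1) (p n)).
Proof.
rewrite /= /u_of; case: ifP => // /negbT; rewrite -ltNge => h.
have lh := lhump n; have lpn := lp n.
have [l1 _] := lxi n; have [l2 _] := L2b_scale hC1 (-1) l1.
move: h; rewrite (pair_addl hC1 lh l1 lpn) (pair_addl hC1 lh l2 lpn) (pair_scalel hC1 _ l1 lpn) T_xi.
move: (pair _ _) (8 ^- n * _) => a c; rewrite mulN1r => h.
have c0 : 0 <= c by rewrite leNgt; apply/negP => c0; have := normc_ge0 (a + c%:C); lra.
have := normc_tri (a + c%:C) (2 * c%:C); rewrite normc_distC.
have -> : 2 * c%:C = (2 * c)%:C by rewrite rmorphM /= rmorphMn.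
have -> : (2 * c)%:C - (a + c%:C) = - (a - c%:C).
  by rewrite mulr2n mulrDl mul1r rmorphD /=; ring.
have := normc_tri (2 * c)%:C (a + c%:C).
have -> : (2 * c)%:C - (a + c%:C) = - (a - c%:C).
  by rewrite mulr2n mulrDl mul1r rmorphD /=; ring.
rewrite normcN normc_real ger0_norm; lra.
Qed.

(** The constant satisfies [2 + 2 (5/2) / 64 <= 5/2], where the factors 2 come from [L2b_add]. *)
Let tail m j : nrm2 (fun l => hump (m + j) l - hump m l) <= 5 / 2 * 64 ^- m.
Proof.
have p64 k : 0 <= 64 ^- k :> R by rewrite invr_ge0 exprn_ge0.
elim: j m => [|j IH] m.
  rewrite addn0 (_ : (fun l => _) = fun=> 0); last by apply/funext => l; rewrite subrr.
  have [_] := L2b_scale hC1 0 (L2b0 omega).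
  rewrite (_ : (fun l => _) = fun=> 0); last by apply/funext => l; rewrite mul0r.
  rewrite normc0 expr0n mul0r => /le_trans; apply; rewrite mulr_ge0 //; lra.
have [ls hl] := L2b_sub hC1 (lhump (m.+1 + j)) (lhump m.+1).
have [_ h] := L2b_add hC1 (lu m).1 ls.
rewrite (_ : (fun l => _) = fun l => u_ m l + (hump (m.+1 + j) l - hump m.+1 l)); last first.
  by apply/funext => l; rewrite addSnnS /= -/(u_ m); ring.
apply: (le_trans h); have := IH m.+1; have := (lu m).2.
have -> : 64 ^- m.+1 = 64 ^- m / 64 :> R by rewrite exprS invfM mulrC.
exact: (tail_arith (p64 m)).
Qed.

(** Uniform boundedness by hand. The sum x of all humps pairs with [p n] to at least half of
    [sqrt (M n) / 8^n]. By [pair_proj] the same number is the pairing of the fixed function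
    [x - proj x] with [v n], whose norm is below [sqrt (M n) / 32^n]. Hence [4^n] would be
    bounded. *)
Lemma gliding_hump : False.
Proof.
have [x lx hx] := L2_series hC (fun n => (lu n).1) (fun n => (lu n).2).
have dist n : nrm2 (fun l => x l - hump n.+1 l) <= 5 / 2 * 64 ^- n.+1.
  rewrite humpE; apply: hx => m nm; have := tail n.+1 (m - n.+1).
  by rewrite subnKC // !humpE.
pose B := nrm2 (fun l => x l - proj x l).
have B0 : 0 <= B by exact: nrm2_ge0.
have [_ mx] := projP lx.
have key n : 4 ^+ n <= 2 * (B + 1) :> R.
  have s0 := S0 n; set s := Num.sqrt (M n) in s0.
  have sM : M n = s * s by rewrite -expr2 sqr_sqrtr // ltW.
  have p8 : 0 < 8 ^+ n :> R by rewrite exprn_gt0.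
  have p32 : 0 < 32 ^+ n :> R by rewrite exprn_gt0.
  (* Weights for [pair_le]: [e1] makes the humps after the n-th cost at most [25/128 + 1/5 <= 2/5]
     of [s / 8^n], less than one half; [e2] balances [nrm2 (v n)] against the constant B. *)
  have e1 : 0 < 5 * (s * 8 ^+ n) by rewrite !mulr_gt0.
  have e2 : 0 < s / 32 ^+ n by rewrite divr_gt0.
  have [ld _] := L2b_sub hC1 lx (lhump n.+1).
  have h1 := pair_le hC1 e1 ld (lp n).
  have h2 := pair_le hC1 e2 (proj1 mx) (lv n).
  rewrite -(pair_proj lx (lv n)) -/(p n) in h2.
  rewrite (pair_subl hC1) // -/(M n) in h1.
  have h3 := normc_tri (pair (hump n.+1) (p n)) (pair x (p n)).
  rewrite normc_distC in h3.
  have h4 := hump_large n; have h5 := dist n; have h6 := big n.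
  rewrite -/B in h2; rewrite -/(p n) -/(M n) in h6; rewrite -/s in h4.
  rewrite sM in h1 h6.
  have E1 : 64 ^- n.+1 = (8 ^+ n)^-1 ^+ 2 / 64 :> R.
    by rewrite exprS invfM mulrC exprVn -exprM mulnC exprM (_ : 8 ^+ 2 = 64) //; ring.
  have E3 : 32 ^+ n = 8 ^+ n * 4 ^+ n :> R by rewrite -exprMn (_ : 8 * 4 = 32) //; ring.
  rewrite E1 in h5.
  have a1 : normc (pair x (p n) - pair (hump n.+1) (p n)) <= s / 8 ^+ n * (2 / 5).
    apply: (le_trans h1).
    apply: (@le_trans _ _ (5 * (s * 8 ^+ n) * (5 / 2 * ((8 ^+ n)^-1 ^+ 2 / 64)) + (5 * (s * 8 ^+ n))^-1 * (s * s))).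
      by rewrite lerD2r ler_wpM2l // ltW.
    have -> : 5 * (s * 8 ^+ n) * (5 / 2 * ((8 ^+ n)^-1 ^+ 2 / 64)) + (5 * (s * 8 ^+ n))^-1 * (s * s)
      = s / 8 ^+ n * (25 / 128 + 1 / 5) by field; rewrite ?gt_eqF // ?mulr_gt0.
    rewrite ler_wpM2l ?divr_ge0 ?(ltW s0) ?(ltW p8) //; lra.
  have a2 : normc (pair x (p n)) <= s / 32 ^+ n * (B + 1).
    apply: (le_trans h2); rewrite -/B [s / _ * (B + 1)]mulrDr mulr1 lerD2l.
    rewrite ler_pdivrMl // mulrACA -invfM -expr2.
    by rewrite ler_pdivlMr ?exprn_gt0 // mulrC ltW // [X in X < _]mulrC mulrC.
  have a3 : s / 8 ^+ n / 2 <= s / 32 ^+ n * (B + 1).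
    have E8 : 8 ^- n * s = s / 8 ^+ n by rewrite mulrC.
    rewrite E8 in h4.
    have t0 : 0 <= s / 8 ^+ n by rewrite divr_ge0 ?(ltW s0) ?(ltW p8).
    by move: h3 h4 a1 a2 t0; move: (s / 8 ^+ n) => t; lra.
  move: a3; rewrite E3 invfM -!mulrA ler_pM2l // ler_pM2l ?invr_gt0 //.
  by rewrite mulrC ler_pdivlMr ?exprn_gt0 // => ?; lra.
have [N hN] := nat_above (2 * (B + 1) + 1).
have h4 : forall n, n%:R <= 4 ^+ n :> R.
  move=> n; rewrite -natrX ler_nat; exact/ltnW/ltn_expl.
have := key N; have := h4 N; lra.
Qed.
End GlidingHump.

Lemma proj_bounded : exists2 K : R, 0 <= K & forall u, L2b u -> nrm2 (proj u) <= K * nrm2 u.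
Proof.
apply: contrapT => nb.
have H (n : nat) : {u | L2b u /\ (32 ^+ n) ^+ 2 * nrm2 u < nrm2 (proj u)}.
  apply: cid; apply: contrapT => h; apply: nb; exists ((32 ^+ n) ^+ 2); first exact: sqr_ge0.
  by move=> u lu; rewrite leNgt; apply/negP => hu; apply: h; exists u.
apply: (@gliding_hump (fun n => sval (H n))) => n; by case: (svalP (H n)).
Qed.

End Projection.

(** * Weighted Hardy spaces and Toeplitz operators *)

Section WeightedHardy.
Context {R : realType}.
Local Notation C := R[i].
Local Notation leb := (@lebesgue_measure R).
Variables (omega : R -> R) (W : R).
Hypothesis hC : regular_curve omega W.
Hypothesis hH : hardy_decomposition omega.
Local Notation speed := (arc_speed omega).
Local Notation gam := (curve_pt omega).
Local Notation dgam := (dgam omega).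
Local Notation mass := (mass omega).
Local Notation L2b := (L2b omega).
Local Notation nrm2 := (nrm2 omega).
Local Notation pair := (pair omega).
Local Notation side := (side omega).
Local Notation dec := (dec omega).
Local Notation hs := (hs omega).
Local Notation mcurve u := (forall s : bool, pmeas (fun y => u (gam s y))).
Implicit Types (u v w g h f : C -> C) (b s : bool).
Let hC1 := rc_C1 hC.
Let hpos := rc_pos hC.

Lemma W_gt0 : 0 < W.
Proof. exact: lt_le_trans (hpos 0) (rc_le hC 0). Qed.

Lemma nside_real (x : R) : W < `|x| -> ~ side true x%:C.
Proof. by move=> Wx; rewrite /side /= leNgt; apply/negP; rewrite negbK (le_lt_trans (rc_le hC 0)). Qed.

Definition base : C := (W + 1)%:C.

Lemma nside_base : ~ side true base.
Proof. by apply: nside_real; rewrite ger0_norm ?ltrDl // addr_ge0 // ltW // W_gt0. Qed.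

Lemma nside_0 : ~ side false 0.
Proof. by rewrite /side /= normr0 leNgt hpos. Qed.

Lemma gam_sub_neq0 s y (c : C) b : ~ side b c -> gam s y - c != 0.
Proof. by move=> nc; rewrite subr_eq0; apply/eqP => E; apply: nc; rewrite -E; exact: (side_gam hC). Qed.

Lemma base_neq0 s y : gam s y - base != 0.
Proof. exact: gam_sub_neq0 nside_base. Qed.

Lemma gam_neq0 s y : gam s y != 0.
Proof. by have := gam_sub_neq0 s y nside_0; rewrite subr0. Qed.

Definition over_base N u : C -> C := fun l => u l / (l - base) ^+ N.
(* Membership in H_N(D_+), with the base point fixed. *)
Definition hn N u := hs true (over_base N u).

Lemma mcurve_polyX (c : C) N : mcurve (fun l => (l - c) ^+ N).
Proof.
move=> s; apply: pmeas_cont => y; apply: (pcont_comp (F := fun l => (l - c) ^+ N)).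
  exact: pcont_gam.
apply: cdiff_ccont; apply: (@cdiff_exp _ (fun l => l - c)).
by apply: cdiff_sub; [exact: cdiff_id | exact: cdiff_cst].
Qed.

Lemma dec_inv_base N : dec true N (fun l => ((l - base) ^+ N)^-1).
Proof.
have := dec_exp N (dec_inv hC nside_base); rewrite mul1n; apply: dec_eq => l.
by rewrite exprVn.
Qed.

Lemma mcurve_over N u : mcurve u -> mcurve (over_base N u).
Proof. by move=> mu s; apply: pmeas_mul => //; exact: (dec_mcurve hC (dec_inv_base N)). Qed.

Lemma over_baseK N u s y : over_base N u (gam s y) * (gam s y - base) ^+ N = u (gam s y).
Proof. by rewrite /over_base divfK // expf_neq0 // base_neq0. Qed.

Lemma hn_mcurve N u : hn N u -> mcurve u.
Proof.
move=> [[mu _] _] s; have := pmeas_mul (mu s) (mcurve_polyX base N s).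
by rewrite (_ : (fun y => _ * _) = fun y => u (gam s y)) //; apply/funext => y; exact: over_baseK.
Qed.

(** Changing the base point multiplies by [((l - b) / (l - base))^N], which is bounded and
    differentiable on the closed side of D_+. *)
Lemma hardyNP N u : hardyN omega N u <-> hn N u.
Proof.
split=> [[mu [b [h [hb hh E]]]]|hu].
  have hh' := hardy_hs hC (b := true) hh.
  have d0 := dec_exp N (dec_frac hC b nside_base); rewrite mul0n in d0.
  apply: (hs_ae hC _ (mcurve_over N mu) (hs_mul hC d0 hh')).
  move=> s; apply: (ae_mono (E s)) => y e.
  by rewrite /over_base e expr_div_n mulrAC.
split; first exact: hn_mcurve hu.
exists base, (over_base N u); split; [|exact: (hs_hardy hC hH hu)|].
  by apply/(nsideP omega true); exact: nside_base.
by move=> s; apply: aeW => y; rewrite mulrC over_baseK.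
Qed.

Lemma hn_add N u v : hn N u -> hn N v -> hn N (fun l => u l + v l).
Proof.
move=> hu hv; have := hs_add hC hu hv; rewrite /hn.
by congr hs; apply/funext => l; rewrite /over_base mulrDl.
Qed.

Lemma hn_scale N c u : hn N u -> hn N (fun l => c * u l).
Proof.
move=> hu; have := hs_scale hC c hu; rewrite /hn.
by congr hs; apply/funext => l; rewrite /over_base mulrA.
Qed.

Lemma hn_sub N u v : hn N u -> hn N v -> hn N (fun l => u l - v l).
Proof.
move=> hu hv; have := hn_add hu (hn_scale (-1) hv).
by congr hn; apply/funext => l; rewrite mulN1r.
Qed.

Lemma hn_mul N f u : dec true 0 f -> hn N u -> hn N (fun l => f l * u l).
Proof.
move=> df hu; have := hs_mul hC df hu; rewrite /hn.
by congr hs; apply/funext => l; rewrite /over_base mulrA.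
Qed.

Lemma hn_opp N u : hn N u -> hn N (fun l => u (- l)).
Proof.
move=> hu; have h := hs_opp hC hu.
have d0 := dec_exp N (dec_scale (-1) (dec_frac hC (- base) nside_base)); rewrite mul0n in d0.
apply: (hs_ae hC _ (mcurve_over N (mcurve_opp (rc_even hC) (hn_mcurve hu))) (hs_mul hC d0 h)).
apply: eq_curve_on => l [s [y ->]]; rewrite /over_base mulN1r opprK.
have -> : - gam s y - base = - (gam s y + base) by ring.
have n1 : gam s y + base != 0.
  rewrite -[base]opprK; apply: (@gam_sub_neq0 _ _ _ true).
  by rewrite (sideN hC); exact: nside_base.
by rewrite mulrC -mulNr expr_div_n mulrA; congr (_ / _); rewrite divfK // expf_neq0 // oppr_eq0.
Qed.

Lemma hn_le N M u : (N <= M)%N -> hn N u -> hn M u.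
Proof.
move=> NM hu.
have d0 : dec true 0 (fun l => ((l - base) ^+ (M - N))^-1) by apply: dec_le (dec_inv_base _).
have := hs_mul hC d0 hu; rewrite /hn; congr hs; apply/funext => l.
by rewrite /over_base -[in RHS](subnK NM) exprD invfM mulrCA.
Qed.

Lemma hs_hn N u : hs true u -> hn N u.
Proof.
move=> hu; apply: (hn_le (leq0n N)).
by have := hu; rewrite /hn; congr hs; apply/funext => l; rewrite /over_base expr0 divr1.
Qed.

Lemma pair_ext u v u' v' : (forall s y, u (gam s y) * v (gam s y) = u' (gam s y) * v' (gam s y)) ->
  pair u v = pair u' v'.
Proof.
move=> E; rewrite /pair !contourE; congr (_ - _); rewrite /branch_int;
  by apply: cint_eq => y _; rewrite /= E.
Qed.

(* The functions (K/(K-l))^N tend boundedly to 1 and compensate the growth of u. *)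
Lemma hn_L2 N u : hn N u -> L2b u -> hs true u.
Proof.
move=> hu lu; split=> // f df.
have lf := dec_L2b hC df.
(* [K >= 2 (W + 1)] keeps the pole at distance at least [K / 2] from the curve, whence the bound 2
   on [e n], uniform in n. *)
pose K (n : nat) : R := 2 * (W + 1) + n%:R.
have K0 n : 2 * (W + 1) <= K n by rewrite lerDl.
have W0 := W_gt0.
have nK n : ~ side true (K n)%:C.
  by apply: nside_real; have h := K0 n; rewrite ger0_norm; lra.
pose e n (l : C) := (- (K n)%:C / (l - (K n)%:C)).
have den n s y : (K n) / 2 <= normc (gam s y - (K n)%:C).
  apply: le_trans (ler_normRe _); rewrite ReD ReN /= distrC.
  have := abs_Re_gam hC s y; have := rc_le hC y; have := K0 n.
  move=> h1 h2 h3; have := ler_norm (complex.Re (gam s y)).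
  have := ler_norm (K n - complex.Re (gam s y)); lra.
have Kp n : 0 < K n by have := K0 n; lra.
have e2 n s y : normc (e n (gam s y)) <= 2.
  rewrite normcM normcV normcN normc_real gtr0_norm //.
  have := den n s y => h; rewrite ler_pdivrMr; last by apply: lt_le_trans h; rewrite divr_gt0.
  by lra.
have zero n : pair u (fun l => e n l ^+ N * f l) = 0.
  have d0 := dec_exp N (dec_scale (- (K n)%:C) (dec_frac hC base (nK n))).
  rewrite mul0n in d0.
  have := proj2 hu _ (dec_mul d0 df).
  have E s y : u (gam s y) * (e n (gam s y) ^+ N * f (gam s y)) = over_base N u (gam s y) *
      ((- (K n)%:C * ((gam s y - base) / (gam s y - (K n)%:C))) ^+ N * f (gam s y)).
    rewrite -[in LHS](over_baseK N u) -mulrA; congr (_ * _); rewrite mulrA; congr (_ * _).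
    by rewrite -exprMn /e; congr (_ ^+ _); rewrite mulrCA.
  by move=> z0; apply: etrans z0; apply: pair_ext => s y; exact: E.
have br s : forall d : R, 0 < d -> exists M, forall n, (M <= n)%N ->
    normc (branch_int omega (fun l => u l * (e n l ^+ N * f l)) s -
           branch_int omega (fun l => u l * f l) s) <= d.
  have me n : mcurve (e n).
    by apply: (dec_mcurve hC (b := true) (N := 1)); apply: dec_scale; exact: (dec_inv hC (nK n)).
  have mdg : pmeas (dgam s) by apply: pmeas_cont => y; exact: pcont_dgam.
  have men n : pmeas (fun y => e n (gam s y) ^+ N).
    elim: (N) => [|k IH]; first by apply: pmeas_cont => y; apply: pcont_eq (pcont_cst 1 y) => t; rewrite expr0.
    by under eq_fun do rewrite exprS; exact: pmeas_mul.
  pose bd y := 2 ^+ N * (mass u s y + mass f s y).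
  have ibd : leb.-integrable setT (EFin \o bd).
    apply: integrableZE => //.
    rewrite (_ : EFin \o _ = ((EFin \o mass u s) \+ (EFin \o mass f s))%E); last first.
      by apply/funext => y; rewrite /= EFinD.
    by apply: integrableD => //; [exact: (proj2 lu) | exact: (proj2 lf)].
  have hbd n y : normc (u (gam s y) * (e n (gam s y) ^+ N * f (gam s y)) * dgam s y) <= bd y.
    rewrite 3!normcM normc_dgam normcX /bd.
    have h1 : normc (e n (gam s y)) ^+ N <= 2 ^+ N by rewrite lerXn2r ?nnegrE ?normc_ge0.
    rewrite [X in X * _]mulrCA -mulrA; apply: ler_pM => //; rewrite ?exprn_ge0 ?mulr_ge0 ?normc_ge0 ?speed_ge0 //.
    rewrite /mass -mulrDl ler_wpM2r ?speed_ge0 //.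
    have := normc_ge0 (u (gam s y)); have := normc_ge0 (f (gam s y)).
    by move: (normc _) (normc _) => a c *; nra.
  have [||_] := @complex_DCT R setT (fun n y => u (gam s y) * (e n (gam s y) ^+ N * f (gam s y)) * dgam s y)
    (fun y => u (gam s y) * f (gam s y) * dgam s y) bd measurableT _ _ ibd (fun n y _ => hbd n y).
  - move=> n; apply: (pmeas_cintegrable _ (hbd n) ibd); apply: pmeas_mul => //.
    by apply: pmeas_mul; [exact: (proj1 lu) | apply: pmeas_mul; [exact: men | exact: (proj1 lf)]].
  - move=> y _ d d0; set a := u (gam s y); set c := f (gam s y).
    pose q := normc (a * c * dgam s y) * (2 ^+ N * (2 * normc (gam s y))).
    have [M hM] := nat_above (q / d); exists M => n Mn.
    have -> : a * (e n (gam s y) ^+ N * c) * dgam s y - a * c * dgam s y =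
      (a * c * dgam s y) * (e n (gam s y) ^+ N - 1) by ring.
    rewrite normcM.
    have he : normc (e n (gam s y) - 1) <= 2 * normc (gam s y) / K n.
      have E : e n (gam s y) - 1 = - gam s y / (gam s y - (K n)%:C).
        by rewrite /e; field; apply: gam_sub_neq0 (nK n).
      have h := den n s y; have h0 : 0 < K n / 2 by rewrite divr_gt0.
      rewrite E normcM normcN normcV mulrAC [2 / _ * _]mulrC ler_wpM2l ?normc_ge0 //.
      by rewrite -[2 / K n]invrK invf_div lef_pV2 ?posrE // (lt_le_trans h0).
    have hN k : normc (e n (gam s y) ^+ k - 1) <= (2 ^+ k - 1) * normc (e n (gam s y) - 1).
      elim: k => [|k IH]; first by rewrite expr0 subrr normc0 mulr_ge0 ?normc_ge0 // expr0 subrr.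
      have -> : e n (gam s y) ^+ k.+1 - 1 = e n (gam s y) * (e n (gam s y) ^+ k - 1) + (e n (gam s y) - 1).
        by rewrite exprS; ring.
      apply: le_trans (le_normcD _ _) _; rewrite normcM exprS.
      have -> : (2 * 2 ^+ k - 1) * normc (e n (gam s y) - 1) =
        2 * ((2 ^+ k - 1) * normc (e n (gam s y) - 1)) + normc (e n (gam s y) - 1) by ring.
      by rewrite lerD2r; apply: ler_pM; rewrite ?normc_ge0.
    apply: (@le_trans _ _ (normc (a * c * dgam s y) * (2 ^+ N * (2 * normc (gam s y) / K n)))).
      rewrite ler_wpM2l ?normc_ge0 //; apply: le_trans (hN N) _.
      by apply: ler_pM; rewrite ?normc_ge0 ?subr_ge0 ?exprn_ege1 ?ler1n // lerBlDr lerDl.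
    rewrite !mulrA -[X in X / _]mulrA -[X in X / _]mulrA -/q ler_pdivrMr //.
    have q1 : q / d <= K n.
      apply: le_trans hM _; apply: (@le_trans _ _ n%:R); first by rewrite ler_nat.
      by rewrite /K; have := W_gt0; lra.
    by move: q1; rewrite ler_pdivrMr // mulrC.
  move=> H d d0; have [M hM] := H d d0; exists M => n Mn.
  have -> : branch_int omega (fun l => u l * (e n l ^+ N * f l)) s =
    cint setT (fun y => u (gam s y) * (e n (gam s y) ^+ N * f (gam s y)) * dgam s y) by [].
  by apply: le_trans (hM n Mn).
apply/eqP; rewrite -normc_eq0 eq_le normc_ge0 andbT; apply/ler_addgt0Pr => d d0.
have d2 : 0 < d / 2 by rewrite divr_gt0.
have [M1 h1] := br true _ d2; have [M2 h2] := br false _ d2.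
pose n := maxn M1 M2.
have := zero n; have := h1 n (leq_maxl _ _); have := h2 n (leq_maxr _ _).
rewrite /pair !contourE; move: (branch_int _ _ true) (branch_int _ _ false) => a1 a2.
move: (branch_int _ _ true) (branch_int _ _ false) => c1 c2 k2 k1 E.
rewrite add0r (_ : c1 - c2 = (a2 - c2) - (a1 - c1)); last by rewrite -[a1](subrK a2) E; ring.
by apply: le_trans (normcB _ _) _; lra.
Qed.

(** Elements of [hs false] are square integrable, and [hn_L2] then removes the weight. This is the
    uniqueness that makes [T(a) u] well defined by a condition modulo H(D_-). *)
Lemma hn_hs_eq0 N u : hn N u -> hs false u -> eq_curve omega u (fun=> 0).
Proof. by move=> hu mu; apply: (hs_inter hC hH) => //; exact: (hn_L2 hu (proj1 mu)). Qed.

End WeightedHardy.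

(** * Scalar symbols and their Toeplitz operators *)

Section Toeplitz.
Context {R : realType}.
Local Notation C := R[i].
Local Notation leb := (@lebesgue_measure R).
Variables (omega : R -> R) (W : R).
Hypothesis hC : regular_curve omega W.
Hypothesis hH : hardy_decomposition omega.
Local Notation gam := (curve_pt omega).
Local Notation L2b := (L2b omega).
Local Notation nrm2 := (nrm2 omega).
Local Notation side := (side omega).
Local Notation dec := (dec omega).
Local Notation hs := (hs omega).
Local Notation hn := (hn omega W).
Local Notation base := (base W).
Local Notation over_base := (over_base W).
Local Notation mcurve u := (forall s : bool, pmeas (fun y => u (gam s y))).
Implicit Types (u v w g h f c : C -> C) (b s : bool) (L N : nat).
Let hC1 := rc_C1 hC.
Let hpos := rc_pos hC.

Definition approx L c f := exists2 K : R, 0 <= K &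
  forall s y, normc (c (gam s y) - f (gam s y)) * (1 + normc (gam s y)) ^+ L <= K.
(* A strong form of the class A_L(C). *)
Definition sc L c := mcurve c /\ exists2 f, dec true 0 f & approx L c f.

Let p1 s y : 1 <= 1 + normc (gam s y).
Proof. by rewrite lerDl normc_ge0. Qed.

Let p0 s y n : 0 <= (1 + normc (gam s y)) ^+ n.
Proof. by rewrite exprn_ge0 // (le_trans ler01). Qed.

Lemma dec_curve_bounded b N f : dec b N f -> exists2 K : R, 0 <= K &
  forall s y, normc (f (gam s y)) * (1 + normc (gam s y)) ^+ N <= K.
Proof. by move=> [_ [K K0 hK]]; exists K => // s y; apply/hK/(side_gam hC). Qed.

Lemma sc_bounded L c : sc L c -> exists2 K : R, 0 <= K & forall s y, normc (c (gam s y)) <= K.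
Proof.
move=> [_ [f df [K K0 hK]]]; have [K' K0' hK'] := dec_curve_bounded df.
exists (K + K') => [|s y]; first exact: addr_ge0.
have := hK' s y; rewrite expr0 mulr1 => h'.
rewrite -[c _](subrK (f (gam s y))); apply: le_trans (le_normcD _ _) _; apply: lerD => //.
by apply: le_trans (hK s y); rewrite ler_peMr ?normc_ge0 // exprn_ege1.
Qed.

Lemma sc_dec L f : dec true 0 f -> sc L f.
Proof.
move=> df; split; first exact: (dec_mcurve hC df).
by exists f => //; exists 0 => // s y; rewrite subrr normc0 mul0r.
Qed.

Lemma sc_small L N c : mcurve c -> (L <= N)%N -> (exists2 K : R, 0 <= K &
  forall s y, normc (c (gam s y)) * (1 + normc (gam s y)) ^+ N <= K) -> sc L c.
Proof.
move=> mc LN [K K0 hK]; split=> //; exists (fun=> 0); first exact: (dec0 omega true 0).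
exists K => // s y; rewrite subr0; apply: le_trans (hK s y).
by rewrite ler_wpM2l ?normc_ge0 // ler_weXn2l.
Qed.

Lemma sc_add L c c' : sc L c -> sc L c' -> sc L (fun l => c l + c' l).
Proof.
move=> [mc [f df [K K0 hK]]] [mc' [f' df' [K' K0' hK']]]; split.
  by move=> s; exact: pmeas_add.
exists (fun l => f l + f' l); first exact: dec_add.
exists (K + K') => [|s y]; first exact: addr_ge0.
rewrite opprD addrACA; apply: le_trans (lerD (hK s y) (hK' s y)).
by rewrite -mulrDl ler_wpM2r ?le_normcD.
Qed.

Lemma sc_mul L c c' : sc L c -> sc L c' -> sc L (fun l => c l * c' l).
Proof.
move=> hc hc'; have [B B0 hB] := sc_bounded hc'.
have [mc [f df [K K0 hK]]] := hc; have [mc' [f' df' [K' K0' hK']]] := hc'.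
have [B' B0' hB'] := dec_curve_bounded df.
split; first by move=> s; exact: pmeas_mul.
exists (fun l => f l * f' l); first exact: (dec_mul df df').
exists (K * B + B' * K') => [|s y]; first by rewrite addr_ge0 ?mulr_ge0.
set t := gam s y.
have -> : c t * c' t - f t * f' t = (c t - f t) * c' t + f t * (c' t - f' t) by ring.
apply: le_trans (ler_wpM2r (p0 s y L) (le_normcD _ _)) _.
rewrite mulrDl 2!normcM; apply: lerD.
  by rewrite mulrAC; apply: ler_pM; rewrite ?mulr_ge0 ?normc_ge0 // /t.
rewrite -mulrA; apply: ler_pM; rewrite ?mulr_ge0 ?normc_ge0 // /t.
  by have := hB' s y; rewrite expr0 mulr1.
exact: hK'.
Qed.

Lemma sc_cst L (a : C) : sc L (fun=> a).
Proof. exact/sc_dec/dec_cst. Qed.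

Lemma sc_exp L c k : sc L c -> sc L (fun l => c l ^+ k).
Proof.
move=> hc; elim: k => [|k IH].
  by rewrite (_ : (fun l => _) = fun=> 1); [exact: sc_cst | apply/funext => l; rewrite expr0].
by rewrite (_ : (fun l => _) = fun l => c l * c l ^+ k); [exact: sc_mul | apply/funext => l; rewrite exprS].
Qed.

Lemma sc_sum L n (F : nat -> C -> C) : (forall k, sc L (F k)) -> sc L (fun l => \sum_(k < n) F k l).
Proof.
move=> hF; elim: n => [|n IH].
  by rewrite (_ : (fun l => _) = fun=> 0); [exact: sc_cst | apply/funext => l; rewrite big_ord0].
rewrite (_ : (fun l => _) = fun l => \sum_(k < n) F k l + F n l); first exact: sc_add.
by apply/funext => l; rewrite big_ord_recr.
Qed.

Lemma sc_eq L c c' : (forall s y, c (gam s y) = c' (gam s y)) -> sc L c -> sc L c'.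
Proof.
move=> E [mc [f df [K K0 hK]]]; split.
  by move=> s; rewrite (_ : (fun y => c' _) = fun y => c (gam s y)) //; apply/funext => y.
by exists f => //; exists K => // s y; rewrite -E.
Qed.

Lemma sc_opp L c : sc L c -> sc L (fun l => c (- l)).
Proof.
move=> [mc [f df [K K0 hK]]]; split; first exact: (mcurve_opp (rc_even hC)).
exists (fun l => f (- l)); first exact: (dec_opp hC).
exists K => // s y; have := hK (~~ s) (- y).
by rewrite -(gam_opp' (rc_even hC)) normcN.
Qed.

Lemma dec_inv0 : dec false 1 (fun z => z^-1).
Proof.
have := dec_inv hC (nside_0 hC); apply: dec_eq => z; by rewrite subr0.
Qed.

(* With g = -b/(z-b), (1 - g^L)/z is analytic on D_+ and differs from 1/z by g^L/z. *)
Lemma sc_invz L : sc L (fun l => l^-1).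
Proof.
pose g z := - base / (z - base).
have dg : dec true 1 g by apply: dec_scale; exact: (dec_inv hC (nside_base hC)).
pose f z := (z - base)^-1 * \sum_(k < L) g z ^+ k.
have dS m : dec true 0 (fun z => \sum_(k < m) g z ^+ k).
  elim: m => [|n IH].
    by apply: dec_eq (dec_cst omega true 0) => z; rewrite big_ord0.
  apply: (dec_eq (f := fun z => \sum_(k < n) g z ^+ k + g z ^+ n)).
    by move=> z; rewrite big_ord_recr.
  by apply: dec_add => //; apply: dec_le (dec_exp n dg).
have df : dec true 0 f by apply: (dec_mul (N := 0) (M := 0)) => //; apply: dec_le (dec_inv hC (nside_base hC)).
split; first exact: (dec_mcurve hC dec_inv0).
exists f => //.
have [K K0 hK] := dec_curve_bounded (dec_exp L dg).
have [K' K0' hK'] := dec_curve_bounded dec_inv0.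
exists (K * K') => [|s y]; first exact: mulr_ge0.
set t := gam s y; have t0 : t != 0 by exact: (gam_neq0 hC).
have tb : t - base != 0 by exact: (base_neq0 hC).
have E : t^-1 - f t = g t ^+ L * t^-1.
  have H := subrX1 (g t) L.
  have g1 : g t - 1 = - t / (t - base) by apply: (mulIf tb); rewrite /g mulrBl !divfK // mul1r; ring.
  rewrite g1 in H; have -> : g t ^+ L = 1 + - t / (t - base) * \sum_(i < L) g t ^+ i.
    by rewrite -H addrC subrK.
  by rewrite /f; move: (t - base)^-1 (\sum_(i < L) _) => d S; field.
rewrite E normcM mulrAC; apply: ler_pM; rewrite ?mulr_ge0 ?normc_ge0 ?(p0 s y) //.
  by have := hK s y; rewrite mul1n.
by apply: le_trans (hK' s y); rewrite expr1 ler_peMr ?normc_ge0 ?p1.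
Qed.

(** With [e = 1 - c = O(1/z)], [1/c] is the sum of [e^k] for [k < L] plus [e^L / c]. The sum stays
    in the class, which is an algebra, and the last term is [O(z^-L)] on the curve, so 0 serves as
    its analytic part. *)
Lemma sc_invert L c : sc L c -> dec false 0 (fun z => (c z)^-1) -> dec false 1 (fun z => 1 - c z) ->
  (forall s y, c (gam s y) != 0) -> sc L (fun l => (c l)^-1).
Proof.
move=> hc di de nz; pose e z := 1 - c z.
have he : sc L e.
  have := sc_add (sc_cst L 1) (sc_mul (sc_cst L (-1)) hc).
  by apply: sc_eq => s y; rewrite mulN1r.
have h1 : sc L (fun l => \sum_(k < L) e l ^+ k) by exact: (@sc_sum L L (fun k l => e l ^+ k) (fun k => sc_exp k he)).
have h2 : sc L (fun l => e l ^+ L * (c l)^-1).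
  have d2 := dec_mul (dec_exp L de) di; rewrite mul1n addn0 in d2.
  by apply: (sc_small (N := L)) => //; [exact: (dec_mcurve hC d2) | exact: dec_curve_bounded d2].
apply: sc_eq (sc_add h1 h2) => s y; have n0 := nz s y.
have H := subrX1 (e (gam s y)) L.
apply: (mulfI n0); rewrite mulrDr mulrCA !mulfV // mulr1.
have -> : c (gam s y) = - (e (gam s y) - 1) by rewrite /e; ring.
by rewrite mulNr -H; ring.
Qed.

(* Equivalent to the norm ||u||_N of the paper. *)
Definition nrmN N u : R := nrm2 (over_base N u).

Lemma approx_L2 L c f : mcurve c -> dec true 0 f -> approx L c f ->
  exists2 K : R, 0 <= K & forall u, hn L u -> L2b (fun l => (c l - f l) * u l) /\
    nrm2 (fun l => (c l - f l) * u l) <= K * nrmN L u.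
Proof.
move=> mc df [K K0 hK].
pose B := 1 + normc base.
have B1 : 1 <= B by rewrite lerDl normc_ge0.
have B0 : 0 <= B ^+ L by rewrite exprn_ge0 // (le_trans ler01).
exists ((K * B ^+ L) ^+ 2) => [|u hu]; first exact: sqr_ge0.
have lu := proj1 hu.
apply: (L2b_le hC1) => //; last 1 first.
- move=> s y; rewrite normcM -(over_baseK hC L u s y) normcM normcX.
  have h1 : normc (gam s y - base) <= B * (1 + normc (gam s y)).
    apply: le_trans (normcB _ _) _; rewrite /B.
    by have := normc_ge0 (gam s y); have := normc_ge0 base; nra.
  have h2 : normc (gam s y - base) ^+ L <= B ^+ L * (1 + normc (gam s y)) ^+ L.
    by rewrite -exprMn lerXn2r ?nnegrE ?normc_ge0 // mulr_ge0 ?(le_trans ler01) ?p1.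
  rewrite mulrCA mulrC; apply: ler_wpM2r; first exact: normc_ge0.
  apply: (@le_trans _ _ (normc (c (gam s y) - f (gam s y)) * (B ^+ L * (1 + normc (gam s y)) ^+ L))).
    by rewrite ler_wpM2l ?normc_ge0.
  by rewrite mulrCA mulrC ler_wpM2r.
- move=> s; apply: pmeas_mul; last exact: (hn_mcurve hC hu).
  have := pmeas_add (mc s) (pmeas_mul (pmeas_cst (-1)) (dec_mcurve hC df s)).
  by under eq_fun do rewrite mulN1r.
- by rewrite mulr_ge0.
Qed.

(* x = T(c) u is characterized by c u - x in H(D_-). *)
Lemma toep_exists L c : sc L c -> exists2 K : R, 0 <= K & forall u, hn L u ->
  exists x, [/\ hn L x, hs false (fun l => c l * u l - x l) & nrmN L x <= K * nrmN L u].
Proof.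
move=> [mc [f df ap]]; have [K K0 hK] := approx_L2 mc df ap.
have [P P0 hP] := proj_bounded hC hH.
have [_ [F F0 hF]] := df.
have [D D0 hD] := dec_curve_bounded (dec_inv_base hC L).
exists (2 * F ^+ 2 + 2 * (D ^+ 2 * (P * K))) => [|u hu].
  by rewrite addr_ge0 // mulr_ge0 ?sqr_ge0 // mulr_ge0 ?sqr_ge0 ?mulr_ge0.
have [lv nv] := hK u hu; set v := (fun l => _) in lv nv.
have [pv mv] := projP hC hH lv; set p := proj _ _ _ in pv mv.
exists (fun l => f l * u l + p l).
have hfu := hn_mul hC df hu; have hp := hs_hn hC L pv.
split; first exact: (hn_add hC).
- move: mv; congr hs; apply/funext => l; rewrite /v; ring.
- have [_ n1] := L2b_add hC1 (proj1 hfu) (proj1 hp).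
  have -> : nrmN L (fun l => f l * u l + p l) = nrm2 (fun l => over_base L (fun l => f l * u l) l + over_base L p l).
    by rewrite /nrmN; congr nrm2; apply/funext => l; rewrite /over_base mulrDl.
  apply: (le_trans n1); rewrite [leRHS]mulrDl; apply: lerD.
    rewrite -mulrA ler_wpM2l //.
    have [||_] := @L2b_le _ _ hC1 (over_base L (fun l => f l * u l)) (over_base L u) F _ F0 (proj1 hu) => //.
    - exact: (proj1 (proj1 hfu)).
    - move=> s y; rewrite /over_base -mulrA normcM ler_wpM2r ?normc_ge0 //.
      by have := hF _ (side_gam hC true s y); rewrite expr0 mulr1.
  rewrite -mulrA ler_wpM2l //.
  have [||_ n2] := @L2b_le _ _ hC1 (over_base L p) p D _ D0 (proj1 pv).
  - exact: (proj1 (proj1 hp)).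
  - move=> s y; rewrite /over_base mulrC normcM ler_wpM2r ?normc_ge0 //.
    by apply: le_trans (hD s y); rewrite ler_peMr ?normc_ge0 // exprn_ege1.
  apply: (le_trans n2); rewrite -mulrA ler_wpM2l ?sqr_ge0 //.
  by apply: le_trans (hP _ lv) _; rewrite -mulrA ler_wpM2l.
Qed.

Lemma toep_unique L g g' x x' : hn L x -> hn L x' -> eq_curve omega g g' ->
  hs false (fun l => g l - x l) -> hs false (fun l => g' l - x' l) -> eq_curve omega x x'.
Proof.
move=> hx hx' E h h'.
have hd := hn_sub hC hx hx'.
have mh : hs false (fun l => x l - x' l).
  apply: (hs_ae hC _ (hn_mcurve hC hd) (hs_sub hC h' h)).
  by move=> s; apply: (ae_mono (E s)) => y ->; ring.
have Z := hn_hs_eq0 hC hH hd mh.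
by move=> s; apply: (ae_mono (Z s)) => y /eqP; rewrite subr_eq0 => /eqP.
Qed.

End Toeplitz.

Lemma opp_frac {F : fieldType} (U c d : F) n : c != 0 ->
  U / d ^+ n = (- (c / d)) ^+ n * (U / (- c) ^+ n).
Proof.
move=> c0; have c1 : (- c) ^+ n != 0 by rewrite expf_neq0 // oppr_eq0.
rewrite -mulNr expr_div_n; move: ((- c) ^+ n) c1 (d ^+ n)^-1 => e e0 k.
by rewrite [RHS]mulrC mulrA divfK.
Qed.

(** * Vector symbols: parity and inversion *)

Section VectorToeplitz.
Context {R : realType}.
Local Notation C := R[i].
Local Notation leb := (@lebesgue_measure R).
Variables (omega : R -> R) (W : R).
Hypothesis hC : regular_curve omega W.
Hypothesis hH : hardy_decomposition omega.
Local Notation gam := (curve_pt omega).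
Local Notation L2b := (L2b omega).
Local Notation nrm2 := (nrm2 omega).
Local Notation side := (side omega).
Local Notation dec := (dec omega).
Local Notation hs := (hs omega).
Local Notation hn := (hn omega W).
Local Notation base := (base W).
Local Notation over_base := (over_base W).
Local Notation nrmN := (nrmN omega W).
Local Notation sc := (sc omega).
Local Notation approx := (approx omega).
Local Notation mcurve u := (forall s : bool, pmeas (fun y => u (gam s y))).
Implicit Types (u v w g h f c : C -> C) (b s : bool) (L N : nat).
Let hC1 := rc_C1 hC.
Let hpos := rc_pos hC.

(** f is continuous at each point of the curve, so its values there are its nontangential limits. *)
Lemma analytic_part_dec L c f : dec true 0 f -> approx L c f -> analytic_part omega L c f.
Proof.
move=> df [K K0 hK]; have [cf [B B0 hB]] := df; split.
- by move=> z Dz; apply/cdiff_derivable/cf/(Dside_side (b := true)).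
- exists B => z Dz; have := hB z (Dside_side (b := true) Dz).
  by rewrite expr0 mulr1.
- split; first by apply/measurable_curveE => s; exact: (dec_mcurve hC df).
  move=> s; apply: aeW => y alpha A /(ccont_cvg (cdiff_ccont (cf _ (side_gam hC true s y)))) nA.
  by move: nA; apply: cvg_app; exact: cvg_within.
- exists K => _ [s [y ->]]; apply: le_trans (hK s y).
  rewrite normcM normcX mulrC ler_wpM2l ?normc_ge0 //.
  by rewrite lerXn2r ?nnegrE ?addr_ge0 ?normc_ge0 // lerDr.
Qed.

Lemma sc_symbol_class L c : sc L c -> symbol_class omega L c.
Proof.
move=> hc; have [B B0 hB] := sc_bounded hC hc; have [mc [f df ap]] := hc; split.
- exact/measurable_curveE.
- by exists B => _ [s [y ->]].
- by exists f; exact: analytic_part_dec.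
Qed.

Lemma toeplitz_intro L c u x : sc L c -> hn L u -> hn L x ->
  hs false (fun l => c l * u l - x l) -> toeplitz omega L c u x.
Proof.
move=> [mc [f df ap]] hu hx h.
have [K K0 hK] := approx_L2 hC mc df ap; have [lv _] := hK u hu.
exists f, (fun l => x l - f l * u l); split; first exact: analytic_part_dec.
  split.
    apply: (hs_hardy hC hH (b := true)); apply: (hn_L2 hC (N := L)).
      by apply: (hn_sub hC) => //; exact: (hn_mul hC).
    have := (L2b_sub hC1 lv (proj1 h)).1.
    by congr (L2b _); apply/funext => l; ring.
  apply: (hs_hardy hC hH (b := false)); move: h; congr hs; apply/funext => l; ring.
by apply: eq_curve_on => l _; rewrite addrC subrK.
Qed.

Lemma toeplitz_elim L c u w : toeplitz omega L c u w ->
  exists2 g, hs false g & eq_curve omega w (fun l => c l * u l - g l).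
Proof.
move=> [f [h [_ [_ hm] E]]]; exists (fun l => (c l - f l) * u l - h l).
  exact: (hardy_hs hC (b := false)).
by move=> s; apply: (ae_mono (E s)) => y ->; ring.
Qed.

Lemma hn_even N u : hn N u -> hn N (even_part u).
Proof.
move=> hu; have := hn_scale hC 2^-1 (hn_add hC hu (hn_opp hC hu)).
by congr hn; apply/funext => l; rewrite /even_part mulrC.
Qed.

Lemma hn_odd N u : hn N u -> hn N (odd_part u).
Proof.
move=> hu; have := hn_scale hC 2^-1 (hn_sub hC hu (hn_opp hC hu)).
by congr hn; apply/funext => l; rewrite /odd_part mulrC.
Qed.

Lemma hs_even b u : hs b u -> hs b (even_part u).
Proof.
move=> hu; have := hs_scale hC 2^-1 (hs_add hC hu (hs_opp hC hu)).
by congr hs; apply/funext => l; rewrite /even_part mulrC.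
Qed.

Lemma hs_odd b u : hs b u -> hs b (odd_part u).
Proof.
move=> hu; have := hs_scale hC 2^-1 (hs_sub hC hu (hs_opp hC hu)).
by congr hs; apply/funext => l; rewrite /odd_part mulrC.
Qed.

Lemma even_odd u l : even_part u l + odd_part u l = u l.
Proof. by rewrite /even_part /odd_part; field. Qed.

Lemma even_partN u l : even_part u (- l) = even_part u l.
Proof. by rewrite /even_part opprK addrC. Qed.

Lemma odd_partN u l : odd_part u (- l) = - odd_part u l.
Proof. by rewrite /odd_part opprK -mulNr opprB. Qed.

Section Symbol.
Variables (L : nat) (a : @vsymbol R).
Hypotheses (sa1 : sc L a.1) (sa2 : sc L a.2).

Lemma vt_exists u : hn L u -> exists2 w, hn L w & hs false (fun l => vsymbol_act a u l - w l).
Proof.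
move=> hu.
have [K1 _ h1] := toep_exists hC hH sa1; have [x1 [hx1 m1 _]] := h1 _ (hn_even hu).
have [K2 _ h2] := toep_exists hC hH sa2; have [x2 [hx2 m2 _]] := h2 _ (hn_odd hu).
exists (fun l => x1 l + x2 l); first exact: (hn_add hC).
have := hs_add hC m1 m2; congr hs; apply/funext => l; rewrite /vsymbol_act; ring.
Qed.

Lemma mcurve_act u : mcurve u -> mcurve (vsymbol_act a u).
Proof.
move=> mu s; have mo := mcurve_opp (rc_even hC) mu.
have me : pmeas (fun y => even_part u (gam s y)).
  exact: (pmeas_mul (pmeas_add (mu s) (mo s)) (pmeas_cst 2^-1)).
have mo' : pmeas (fun y => odd_part u (gam s y)).
  have := pmeas_mul (pmeas_add (mu s) (pmeas_mul (pmeas_cst (-1)) (mo s))) (pmeas_cst 2^-1).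
  by under eq_fun do rewrite mulN1r.
by apply: pmeas_add; apply: pmeas_mul => //; [case: sa1 => + _ | case: sa2 => + _]; apply.
Qed.

Lemma mcurve_sub u v : mcurve u -> mcurve v -> mcurve (fun l => u l - v l).
Proof.
move=> mu mv s; have := pmeas_add (mu s) (pmeas_mul (pmeas_cst (-1)) (mv s)).
by under eq_fun do rewrite mulN1r.
Qed.

(** The two scalar conditions add up to one. Conversely the images of the even and odd parts exist
    by [toep_exists], and their sum is w by uniqueness. Later arguments on T(a) use this form of its
    graph. *)
Lemma vtP u w : hn L u -> hn L w ->
  (vtoeplitz omega L a u w <-> hs false (fun l => vsymbol_act a u l - w l)).
Proof.
move=> hu hw; have mact := mcurve_act (hn_mcurve hC hu).
have md := mcurve_sub mact (hn_mcurve hC hw).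
split=> [[w1 [w2 [/toeplitz_elim[g1 h1 E1] /toeplitz_elim[g2 h2 E2] E]]]|h].
  apply: (hs_ae hC _ md (hs_add hC h1 h2)) => s.
  apply: (ae_mono2 (E s)) (ae_mono2 (E1 s) (E2 s) (fun y e1 e2 => conj e1 e2)) _ => y e [e1 e2].
  by rewrite /vsymbol_act e e1 e2; ring.
have [K1 _ h1] := toep_exists hC hH sa1; have [x1 [hx1 m1 _]] := h1 _ (hn_even hu).
have [K2 _ h2] := toep_exists hC hH sa2; have [x2 [hx2 m2 _]] := h2 _ (hn_odd hu).
exists x1, x2; split.
- exact: (toeplitz_intro sa1 (hn_even hu)).
- exact: (toeplitz_intro sa2 (hn_odd hu)).
apply: (toep_unique hC hH hw (hn_add hC hx1 hx2) (eq_curve_refl omega (vsymbol_act a u)) h).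
have := hs_add hC m1 m2; congr hs; apply/funext => l; rewrite /vsymbol_act; ring.
Qed.
End Symbol.

Section NormCompare.
Variable L : nat.

(** 0 and [base] both lie off the curve, so [l^L] and [(l - base)^L] have comparable moduli on it.
    The real number x serves to leave the extended reals. *)
Lemma sqnorm_nrmN : exists2 K : R, 0 <= K & forall u, hn L u -> exists2 x : R,
  sqnorm omega L u = x%:E & x <= K * nrmN L u /\ nrmN L u <= K * x.
Proof.
have d1 := dec_exp L (dec_frac hC base (nside_0 hC)); rewrite mul0n in d1.
have d2 := dec_exp L (dec_frac hC 0 (nside_base hC)); rewrite mul0n in d2.
have [K1 K10 h1] := dec_curve_bounded hC d1.
have [K2 K20 h2] := dec_curve_bounded hC d2.
exists (K1 ^+ 2 + K2 ^+ 2) => [|u hu]; first by rewrite addr_ge0 ?sqr_ge0.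
have mu := hn_mcurve hC hu; have lu := proj1 hu.
pose v : C -> C := fun l => u l / l ^+ L.
have mv : mcurve v.
  move=> s; apply: pmeas_mul => //.
  have := dec_exp L (dec_inv0 hC) => d; have := dec_mcurve hC d s.
  by under eq_fun do rewrite exprVn.
have n0 s y : gam s y != 0 by exact: (gam_neq0 hC).
have nb s y : gam s y - base != 0 by exact: (base_neq0 hC).
have [|lv nv] := @L2b_le _ _ hC1 v (over_base L u) K1 mv K10 lu.
  move=> s y; have := h1 s y; rewrite expr0 mulr1 subr0 => h.
  rewrite /v -(over_baseK hC L u s y) -mulrA mulrC normcM ler_wpM2r ?normc_ge0 //.
  by rewrite -expr_div_n.
have [|_ nu] := @L2b_le _ _ hC1 (over_base L u) v K2 (proj1 lu) K20 lv.
  move=> s y; have := h2 s y; rewrite expr0 mulr1 subr0 => h.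
  rewrite /v /over_base.
  have -> : u (gam s y) / (gam s y - base) ^+ L =
    (gam s y / (gam s y - base)) ^+ L * (u (gam s y) / gam s y ^+ L).
    have : gam s y ^+ L != 0 by rewrite expf_neq0.
    by rewrite expr_div_n; move: (gam s y ^+ L) ((gam s y - base) ^+ L)^-1 => t d t0; field.
  by rewrite normcM ler_wpM2r ?normc_ge0.
exists (nrm2 v).
  rewrite -(sqnorm_nrm2 lv) /sqnorm; congr arc_integral; apply/funext => l.
  rewrite muln0 expr0 invr1 mulr1 /v normcM normcV normcX expr_div_n.
  by rewrite mulnC exprM.
split.
  by apply: le_trans nv _; rewrite ler_wpM2r ?nrm2_ge0 // lerDl sqr_ge0.
by apply: le_trans nu _; rewrite ler_wpM2r ?nrm2_ge0 // lerDr sqr_ge0.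
Qed.
End NormCompare.

Section Inversion.
Variables (L : nat) (c : C -> C).
Hypothesis hc : sc L c.
Let q := even_part c.
Let k := odd_part c.
Hypothesis dq : dec false 0 q.
Hypothesis diq : dec false 0 (fun z => (q z)^-1).
Hypothesis scq : sc L (fun z => (q z)^-1).
Hypothesis q0 : forall s y, q (gam s y) != 0.
Let a : @vsymbol R := ((fun=> 1), c).

Let sck : sc L k.
Proof.
have h1 := sc_opp hC hc.
have := sc_mul hC (sc_cst hC L 2^-1) (sc_add hc (sc_mul hC (sc_cst hC L (-1)) h1)).
by apply: sc_eq => s y; rewrite /k /odd_part mulN1r mulrC.
Qed.

Lemma nrmN_lin N (al be : C) u v : hn N u -> hn N v ->
  nrmN N (fun l => al * u l + be * v l) <=
  2 * normc al ^+ 2 * nrmN N u + 2 * normc be ^+ 2 * nrmN N v.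
Proof.
move=> hu hv; have [l1 h1] := L2b_scale hC1 al (proj1 hu); have [l2 h2] := L2b_scale hC1 be (proj1 hv).
have [_ h3] := L2b_add hC1 l1 l2.
have -> : nrmN N (fun l => al * u l + be * v l) =
  nrm2 (fun l => al * over_base N u l + be * over_base N v l).
  by rewrite /nrmN; congr nrm2; apply/funext => l; rewrite /over_base mulrDl !mulrA.
by apply: (le_trans h3); apply: lerD; rewrite -mulrA ler_wpM2l.
Qed.

Lemma nrmN_opp N : exists2 K : R, 0 <= K & forall u, hn N u ->
  nrmN N (fun l => u (- l)) <= K * nrmN N u.
Proof.
have d := dec_exp N (dec_scale (-1) (dec_frac hC (- base) (nside_base hC))).
rewrite mul0n in d; have [K K0 hK] := dec_curve_bounded hC d.
exists (K ^+ 2) => [|u hu]; first exact: sqr_ge0.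
have [lo no] := L2b_opp hC1 (rc_even hC) (proj1 hu); rewrite /nrmN -no.
have hu' := hn_opp hC hu.
have [|_] := @L2b_le _ _ hC1 (over_base N (fun l => u (- l))) (fun l => over_base N u (- l)) K
  (proj1 (proj1 hu')) K0 lo.
move=> s y; have := hK s y; rewrite expr0 mulr1 => h.
rewrite [X in normc X](_ : _ = (-1 * ((gam s y - - base) / (gam s y - base))) ^+ N * over_base N u (- gam s y)).
  by rewrite normcM ler_wpM2r ?normc_ge0.
rewrite /over_base mulN1r opprK.
have -> : - gam s y - base = - (gam s y + base) by ring.
have n1 : gam s y + base != 0.
  rewrite -[base]opprK; apply: (@gam_sub_neq0 _ _ _ hC _ _ _ true).
  by rewrite (sideN hC); exact: (nside_base hC).
exact: opp_frac.
by [].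
Qed.

Lemma nrmN_parts N : exists2 K : R, 0 <= K & forall u, hn N u ->
  nrmN N (even_part u) <= K * nrmN N u /\ nrmN N (odd_part u) <= K * nrmN N u.
Proof.
have [K K0 hK] := nrmN_opp N; exists (2 + 2 * K) => [|u hu]; first by rewrite addr_ge0 ?mulr_ge0.
have n2 : normc (2^-1 : C) ^+ 2 <= 1.
  rewrite normcV (_ : 2 = (2 : R)%:C) ?normc_real; last by rewrite rmorphMn.
  by rewrite ger0_norm // exprn_ile1 // invf_le1 // ler1n.
have n2' : normc (- 2^-1 : C) ^+ 2 <= 1 by rewrite normcN.
have u0 : 0 <= nrmN N u by exact: nrm2_ge0.
have uo0 : 0 <= nrmN N (fun l => u (- l)) by exact: nrm2_ge0.
have key (be : C) : normc be ^+ 2 <= 1 ->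
    nrmN N (fun l => 2^-1 * u l + be * u (- l)) <= (2 + 2 * K) * nrmN N u.
  move=> nbe; apply: le_trans (nrmN_lin _ _ hu (hn_opp hC hu)) _.
  rewrite [leRHS]mulrDl; apply: lerD.
    by rewrite -mulrA ler_wpM2l // ler_piMl.
  rewrite -[leLHS]mulrA -[leRHS]mulrA; apply: ler_wpM2l => //.
  by apply: le_trans (hK u hu); rewrite ler_piMl.
split.
  rewrite (_ : even_part u = fun l => 2^-1 * u l + 2^-1 * u (- l)); first exact: key.
  by apply/funext => l; rewrite /even_part mulrDl !(mulrC 2^-1).
rewrite (_ : odd_part u = fun l => 2^-1 * u l + - 2^-1 * u (- l)); first exact: key.
by apply/funext => l; rewrite /odd_part mulrBl mulNr mulrC [u (- l) * _]mulrC.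
Qed.

Lemma act_even u l : vsymbol_act a u l = even_part u l + (q l + k l) * odd_part u l.
Proof. by rewrite /vsymbol_act /= mul1r even_odd. Qed.

(** By parity the equation is triangular: its odd part involves [q u_o - w_o] only and is solved by
    [T(1/q) w_o]; its even part then gives [u_e] from [w_e - T(k) u_o]. *)
Lemma inv_exists : exists2 K : R, 0 <= K & forall w, hn L w -> exists u, [/\ hn L u,
  hs false (fun l => vsymbol_act a u l - w l) & nrmN L u <= K * nrmN L w].
Proof.
have [K1 K10 h1] := toep_exists hC hH scq; have [K2 K20 h2] := toep_exists hC hH sck.
have [P P0 hP] := nrmN_parts L.
exists (2 * (P * (2 * (P + K2 * (P * (K1 * P))))) + 2 * (P * (K1 * P))) => [|w hw].
  by rewrite !(addr_ge0, mulr_ge0).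
have hwo := hn_odd hw; have hwe := hn_even hw.
have [x [hx mx nx]] := h1 _ hwo.
(* x solves the equation for [w_o / q] but need not be odd; since q is even, taking odd parts
   preserves the condition. *)
pose uo := odd_part x; have huo : hn L uo by exact: hn_odd.
have [y [hy my ny]] := h2 _ huo.
pose r l := 1 * even_part w l + - 1 * y l.
have hr : hn L r by apply: (hn_add hC); exact: (hn_scale hC).
pose ue := even_part r; have hue : hn L ue by exact: hn_even.
have oddE l : odd_part (fun l => ue l + uo l) l = uo l.
  by rewrite /odd_part /ue even_partN /uo odd_partN; field.
have evenE l : even_part (fun l => ue l + uo l) l = ue l.
  by rewrite /even_part /ue even_partN /uo odd_partN; field.
exists (fun l => ue l + uo l); split.
- exact: (hn_add hC).
- have m1 : hs false (fun l => q l * uo l - odd_part w l).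
    have := hs_odd (hs_mul hC dq (hs_scale hC (-1) mx)).
    have E : eq_curve omega (odd_part (fun l => q l * (-1 * ((q l)^-1 * odd_part w l - x l))))
        (fun l => q l * uo l - odd_part w l).
      apply: eq_curve_on => _ [s [t ->]]; rewrite {1}/odd_part.
      have -> : q (- gam s t) = q (gam s t) by exact: even_partN.
      rewrite odd_partN /uo /odd_part; have := q0 s t.
      move: (q _) (w _) (w _) (x _) (x _) => Q w1 w2 x1 x2 Q0; field.
      exact: Q0.
    move=> h; apply: (hs_ae hC E _ h).
    apply: (mcurve_sub (u := fun l => q l * uo l)); last exact: (hn_mcurve hC hwo).
    by move=> s; apply: pmeas_mul; [exact: (dec_mcurve hC dq) | exact: (hn_mcurve hC huo)].
  have := hs_add hC (hs_even my) m1; congr hs; apply/funext => l.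
  rewrite act_even evenE oddE -[in RHS](even_odd w l) /ue /r /uo /even_part /odd_part.
  have -> : k (- l) = - k l by exact: odd_partN.
  by rewrite !opprK; move: (q l) (k l) (w l) (w _) (x l) (x _) (y l) (y _) => *; field.
- have e1 : (fun l => ue l + uo l) = (fun l => 1 * ue l + 1 * uo l).
    by apply/funext => l; rewrite !mul1r.
  rewrite e1; apply: le_trans (nrmN_lin _ _ hue huo) _.
  have n1 : normc (1 : C) ^+ 2 = 1 by rewrite normc1 expr1n.
  have n1' : normc (- 1 : C) ^+ 2 = 1 by rewrite normcN normc1 expr1n.
  rewrite n1 !mulr1 [leRHS]mulrDl.
  have b1 : nrmN L uo <= P * (K1 * P) * nrmN L w.
    apply: le_trans (proj2 (hP _ hx)) _; rewrite -!mulrA ler_wpM2l //.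
    by apply: le_trans nx _; rewrite ler_wpM2l //; case: (hP _ hw).
  apply: lerD; last by rewrite -[leRHS]mulrA ler_wpM2l.
  rewrite -[leRHS]mulrA ler_wpM2l // -mulrA; apply: le_trans (proj1 (hP _ hr)) _; rewrite ler_wpM2l //.
  apply: le_trans (nrmN_lin _ _ hwe hy) _; rewrite n1 n1' !mulr1 -mulrDr -mulrA ler_wpM2l //.
  rewrite mulrDl; apply: lerD; first by case: (hP _ hw).
  by apply: le_trans ny _; rewrite -mulrA ler_wpM2l.
Qed.

(** The odd part of the hypothesis puts [q u_o] in H(D_-); multiplication by [1/q], a bounded test
    function on D_-, puts [u_o] there, so [u_o = 0]. What remains is [u_e], which is then in H(D_-)
    too. *)
Lemma inv_unique u : hn L u -> hs false (vsymbol_act a u) -> eq_curve omega u (fun=> 0).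
Proof.
move=> hu hm.
have huo := hn_odd hu; have hue := hn_even hu.
have mo : hs false (odd_part u).
  have := hs_mul hC diq (hs_odd hm).
  have E : eq_curve omega (fun l => (q l)^-1 * odd_part (vsymbol_act a u) l) (odd_part u).
    apply: eq_curve_on => _ [s [t ->]]; rewrite {1}/odd_part !act_even.
    have -> : q (- gam s t) = q (gam s t) by exact: even_partN.
    have -> : k (- gam s t) = - k (gam s t) by exact: odd_partN.
    rewrite even_partN odd_partN; have := q0 s t.
    move: (q _) (k _) (even_part _ _) (odd_part _ _) => Q k1 e o Q0; field.
    exact: Q0.
  by apply: (hs_ae hC E); exact: (hn_mcurve hC huo).
have Z1 := hn_hs_eq0 hC hH huo mo.
have me : hs false (even_part u).
  apply: (hs_ae hC _ (hn_mcurve hC hue) hm) => s; apply: (ae_mono (Z1 s)) => y z.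
  by rewrite act_even z mulr0 addr0.
have Z2 := hn_hs_eq0 hC hH hue me.
move=> s; apply: (ae_mono2 (Z1 s) (Z2 s)) => y z1 z2.
by rewrite -(even_odd u) z1 z2 addr0.
Qed.

Lemma act_sub u v l : vsymbol_act a (fun l => u l - v l) l = vsymbol_act a u l - vsymbol_act a v l.
Proof. by rewrite /vsymbol_act /even_part /odd_part; field. Qed.

Let sa1 : sc L a.1.
Proof. exact: (sc_cst hC). Qed.

Lemma inv_solution u w : hn L u -> hn L w -> hs false (fun l => vsymbol_act a u l - w l) ->
  forall u', hn L u' -> hs false (fun l => vsymbol_act a u' l - w l) -> eq_curve omega u u'.
Proof.
move=> hu hw h u' hu' h'.
have := inv_unique (hn_sub hC hu hu'); have := hs_sub hC h h'.
have -> : (fun l => vsymbol_act a u l - w l - (vsymbol_act a u' l - w l)) =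
  vsymbol_act a (fun l => u l - u' l) by apply/funext => l; rewrite act_sub; ring.
move=> H /(_ H) Z s; apply: (ae_mono (Z s)) => y /eqP; rewrite subr_eq0 => /eqP //.
Qed.

Lemma inversion : vtoeplitz_invertible omega L a.
Proof.
split.
- move=> u /(hardyNP hC hH) hu; have [w hw h] := vt_exists sa1 hc hu.
  exists w; first exact/(hardyNP hC hH).
  by apply/(vtP sa1 hc hu hw).
- move=> w /(hardyNP hC hH) hw; have [K _ H] := inv_exists; have [u [hu h _]] := H w hw.
  exists u; first exact/(hardyNP hC hH).
  by apply/(vtP sa1 hc hu hw).
- move=> u1 u2 w1 w2 /(hardyNP hC hH) hu1 /(hardyNP hC hH) hu2.
  move=> /(hardyNP hC hH) hw1 /(hardyNP hC hH) hw2.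
  move=> /(vtP sa1 hc hu1 hw1) h1 /(vtP sa1 hc hu2 hw2) h2; split=> E.
    apply: (toep_unique hC hH hw1 hw2 _ h1 h2).
    have Eo := eq_curve_opp (rc_even hC) E.
    move=> s; apply: (ae_mono2 (E s) (Eo s)) => y e1 e2.
    by rewrite /vsymbol_act /even_part /odd_part e1 e2.
  apply: (inv_solution hu1 hw1 h1 hu2).
  apply: (hs_ae hC _ (mcurve_sub (mcurve_act sa1 hc (hn_mcurve hC hu2)) (hn_mcurve hC hw1)) h2).
  by move=> s; apply: (ae_mono (E s)) => y ->.
have [K K0 H] := inv_exists; have [M M0 hM] := sqnorm_nrmN L.
exists (M * (K * M)) => u w /(hardyNP hC hH) hu /(hardyNP hC hH) hw /(vtP sa1 hc hu hw) h.
have [x -> [x1 x2]] := hM u hu; have [y -> [y1 y2]] := hM w hw.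
have [u' [hu' h' n']] := H w hw.
rewrite -EFinM lee_fin; apply: (le_trans x1); rewrite -mulrA ler_wpM2l //.
have E := inv_solution hu hw h hu' h'.
have -> : nrmN L u = nrmN L u'.
  apply: (nrm2_ae hC1 _ (proj1 (proj1 hu)) (proj1 (proj1 hu'))).
  exact: (eq_curve_map (fun l a : C => a / (l - base) ^+ L) E).
by apply: (le_trans n'); rewrite -mulrA ler_wpM2l.
Qed.

End Inversion.
End VectorToeplitz.

(** * The symbol of m *)

Section DecIntro.
Context {R : realType}.
Local Notation C := R[i].
Variables (omega : R -> R) (W : R).
Hypothesis hC : regular_curve omega W.
Local Notation side := (side omega).
Local Notation dec := (dec omega).
Implicit Types (f g : C -> C) (b : bool).

(** Only the behaviour at infinity has to be estimated: on the bounded part of the closed side,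
    continuity and compactness give the bound. *)
Lemma dec_intro b N f (K r : R) : (forall z, side b z -> cdiff f z) ->
  (forall z, side b z -> r <= normc z -> normc (f z) * (1 + normc z) ^+ N <= K) ->
  dec b N f.
Proof.
move=> cf hK; split=> //.
pose A : set C := [set z | side b z /\ normc z <= `|r|].
have [B B0 hB] : exists2 B : R, 0 <= B & forall z, A z -> normc (f z) <= B.
  apply: (@compact_bounded _ A f `|r|) => [z [_ //]|z nA|z [bz _]]; last exact/cdiff_ccont/cf.
  have [bz|nb] := pselect (side b z); last first.
    by have [d d0 hd] := side_dist hC nb; exists d => // w [bw _]; exact: hd.
  have rz : `|r| < normc z by rewrite ltNge; apply/negP => h; apply: nA.
  exists (normc z - `|r|) => [|w [_ wr]]; first by rewrite subr_gt0.
  by rewrite normc_distC; apply: le_trans (normc_tri _ _); rewrite lerB.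
exists (`|K| + B * (1 + `|r|) ^+ N) => [|z bz].
  by rewrite addr_ge0 // mulr_ge0 // exprn_ge0 // addr_ge0.
have [zr|rz] := leP (normc z) `|r|; last first.
  apply: (@le_trans _ _ `|K|); last by rewrite lerDl mulr_ge0 // exprn_ge0 // addr_ge0.
  apply: le_trans (ler_norm K); apply: hK => //.
  by apply: le_trans (ler_norm _) _; exact: ltW.
apply: (@le_trans _ _ (B * (1 + `|r|) ^+ N)); last by rewrite lerDr.
apply: ler_pM; rewrite ?normc_ge0 ?exprn_ge0 ?addr_ge0 ?normc_ge0 //; first exact: hB.
by rewrite lerXn2r ?nnegrE ?addr_ge0 ?normc_ge0 // lerD2l.
Qed.

Lemma dec_on b N f g : (forall z, side b z -> f z = g z) -> (forall z, side b z -> cdiff g z) ->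
  dec b N f -> dec b N g.
Proof. by move=> E cg [_ [K K0 hK]]; split=> //; exists K => // z bz; rewrite -E // hK. Qed.

Lemma limit_bound f z (K : R) : ccont f z ->
  (forall e : R, 0 < e -> exists2 w, normc (w - z) < e & normc (f w) <= K) -> normc (f z) <= K.
Proof.
move=> cf h; apply/ler_addgt0Pr => e e0; have [r r0 hr] := cf e e0.
have [w wz fw] := h r r0; have := hr (w - z) wz; rewrite addrCA subrr addr0 => h1.
have := normc_tri (f z) (f w); rewrite normc_distC => h2; lra.
Qed.

End DecIntro.

Section MSymbol.
Context {R : realType}.
Local Notation C := R[i].
Variables (omega : R -> R) (W mu0 : R).
Hypothesis hC : regular_curve omega W.
Hypothesis hH : hardy_decomposition omega.
Hypothesis hI : forall x : R, `|x| <= mu0 -> Dplus omega x%:C.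
Variables (L : nat) (m : C -> C).
Hypothesis hL : (2 <= L)%N.
Hypothesis hm : analytic_on (m_domain mu0) m.
Hypothesis hM1 : m_positivity mu0 m.
Hypothesis hM2 : m_asymptotics omega L m.
Local Notation gam := (curve_pt omega).
Local Notation side := (side omega).
Local Notation dec := (dec omega).
Local Notation sc := (sc omega).
Let hpos := rc_pos hC.

Lemma side_domain z : side false z -> m_domain mu0 z.
Proof.
rewrite /side /= => h; split.
  by apply/eqP => E; move: h; rewrite E normr0 leNgt hpos.
move=> [I0 /hI]; rewrite /Dplus /= => lt; move: h; rewrite I0 leNgt lt //.
Qed.

Lemma m_cdiff z : side false z -> cdiff m z.
Proof. by move=> /side_domain /hm /derivable_cdiff. Qed.

Lemma side_neq0 z : side false z -> z != 0.
Proof. by move=> h; apply/eqP => E; apply: (nside_0 hC); rewrite -E. Qed.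

Lemma cdiff_invX z k : z != 0 -> cdiff (fun w : C => w ^- k) z.
Proof.
move=> z0; apply: (@cdiff_inv _ (fun w => w ^+ k)); first exact/cdiff_exp/cdiff_id.
by rewrite expf_neq0.
Qed.

Lemma side_approach z (e : R) : side false z -> 0 < e -> exists2 w, Dminus omega w & normc (w - z) < e.
Proof.
rewrite /side /= => bz e0; pose t := e / 2; have t0 : 0 < t by rewrite divr_gt0.
have rw : z + (if 0 <= complex.Re z then t else - t)%:C - z =
  (if 0 <= complex.Re z then t else - t)%:C by rewrite addrAC subrr add0r.
exists (z + (if 0 <= complex.Re z then t else - t)%:C); last first.
  by rewrite rw normc_real /t; case: ifP => _; rewrite ?normrN gtr0_norm; lra.
rewrite /Dminus /= ReD ImD /= addr0; apply: le_lt_trans bz _.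
case: ifP => [z0|/negbT]; first by rewrite !ger0_norm ?addr_ge0 ?(ltW t0) // ltrDl.
by rewrite -ltNge => z0; rewrite !ltr0_norm; lra.
Qed.

Definition m_tail (c : nat -> C) z : C := m z / z - 1 - \sum_(1 <= k < L.-1) c k * (z ^-1) ^+ k.+1.

(** Dividing the expansion by z gains one order. It is assumed on the open D_- only, and passes to
    the closed side because m is continuous there ([limit_bound]). *)
Lemma m_tail_dec : exists c : nat -> C, dec false L (m_tail c).
Proof.
have [c [K [r hK]]] := hM2; exists c.
have cdS z : z != 0 -> cdiff (fun w => \sum_(1 <= k < L.-1) c k * w ^- k) z.
  by move=> z0; apply: cdiff_sum => j; apply: cdiff_mul; [exact: cdiff_cst | exact: cdiff_invX].
(* The margin 1 in [r + 1] keeps the approximating points of D_- beyond r; [2^L] pays for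
   [1 + |z| <= 2 |z|]. *)
apply: (@dec_intro _ _ _ hC false L _ (2 ^+ L * K) (Num.max 1 (r + 1))).
  move=> z bz; have z0 := side_neq0 bz.
  apply: cdiff_sub.
    apply: cdiff_sub; last exact: cdiff_cst.
    by apply: cdiff_div => //; [exact: m_cdiff | exact: cdiff_id].
  apply: cdiff_sum => j; apply: cdiff_mul; first exact: cdiff_cst.
  by apply: (@cdiff_exp _ (fun w => w^-1)); apply: cdiff_inv; [exact: cdiff_id |].
move=> z bz; rewrite ge_max => /andP[z1 zr]; have z0 := side_neq0 bz.
pose G w := (m w - w - \sum_(1 <= k < L.-1) c k * w ^- k) * w ^+ L.-1.
have cG : ccont G z.
  apply/cdiff_ccont/cdiff_mul; last exact/cdiff_exp/cdiff_id.
  apply: cdiff_sub; last exact: (cdS z z0).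
  by apply: cdiff_sub; [exact: m_cdiff | exact: cdiff_id].
have GK : normc (G z) <= K.
  apply: limit_bound cG _ => e e0.
  have e1 : 0 < Num.min e 1 by rewrite lt_min e0 ltr01.
  have [w Dw] := side_approach bz e1; rewrite lt_min => /andP[we w1]; exists w => //.
  have rw : r <= normc w by have := normc_tri z w; rewrite normc_distC; lra.
  have w0 : 0 < normc w by have := normc_tri z w; rewrite normc_distC; lra.
  have := hK w Dw rw; rewrite /G normcM normcX.
  by rewrite ler_pdivlMr ?exprn_gt0.
have E : m_tail c z = G z * z ^- L.
  rewrite /m_tail /G -mulrA.
  have -> : z ^+ L.-1 / z ^+ L = z^-1.
    by case: L hL => // k _; rewrite /= exprS invfM mulrCA mulfV ?mulr1 ?expf_neq0.
  rewrite mulrBl mulrBl mulfV // mulr_suml; congr (_ - _ - _).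
  by apply: eq_bigr => k _; rewrite exprS -exprVn mulrAC mulrA [c k * _]mulrC.
have z0' : 0 < normc z by rewrite (lt_le_trans ltr01).
rewrite E normcM normcV normcX -mulrA mulrC; apply: ler_pM; rewrite ?normc_ge0 //.
  by rewrite mulr_ge0 ?invr_ge0 ?exprn_ge0 ?addr_ge0 ?normc_ge0.
by rewrite ler_pdivrMl ?exprn_gt0 // -exprMn lerXn2r ?nnegrE ?mulr_ge0 ?addr_ge0 ?normc_ge0 //; lra.
Qed.

Definition m_ratio z : C := m z / z.

Lemma m_ratio_cdiff z : side false z -> cdiff m_ratio z.
Proof.
by move=> bz; apply: cdiff_div; [exact: m_cdiff | exact: cdiff_id | exact: side_neq0].
Qed.

Lemma inv_pow_dec k : dec false k (fun z => z^-1 ^+ k).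
Proof. by have := dec_exp k (dec_inv0 hC); rewrite mul1n. Qed.

(** Powers of [1/z] are in the class for every L by [sc_invz], and the tail is [O(z^-L)]. *)
Lemma m_ratio_sc : sc L m_ratio.
Proof.
have [c dc] := m_tail_dec.
have h1 : sc L (m_tail c).
  by apply: (sc_small (N := L)) => //; [exact: (dec_mcurve hC dc) | exact: (dec_curve_bounded hC dc)].
have h2 : sc L (fun z => \sum_(k < L.-1) (if (1 <= k)%N then c k else 0) * z^-1 ^+ k.+1).
  apply: (@sc_sum _ _ _ hC L L.-1 (fun k z => (if (1 <= k)%N then c k else 0) * z^-1 ^+ k.+1)) => k.
  by apply: (sc_mul hC); [exact: (sc_cst hC) | exact/(sc_exp hC)/(sc_invz hC)].
apply: sc_eq (sc_add (sc_cst hC L 1) (sc_add h2 h1)) => s y; rewrite /m_tail /m_ratio.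
rewrite -(big_mkord predT (fun k => (if (1 <= k)%N then c k else 0) * (gam s y)^-1 ^+ k.+1)).
have -> : \sum_(0 <= k < L.-1) (if (1 <= k)%N then c k else 0) * (gam s y)^-1 ^+ k.+1 =
    \sum_(1 <= k < L.-1) c k * (gam s y)^-1 ^+ k.+1.
  case: L.-1 => [|j]; first by rewrite !big_geq.
  rewrite big_ltn //= mul0r add0r; apply: eq_big_nat => k /andP[k1 _].
  by rewrite k1.
ring.
Qed.

Lemma m_sub_id_dec : dec false 1 (fun z => m z - z).
Proof.
have [c dc] := m_tail_dec.
have d2 : dec false 2 (m_tail c) by exact: dec_le hL dc.
have d3 : dec false 2 (fun z => \sum_(1 <= k < L.-1) c k * z^-1 ^+ k.+1).
  rewrite (_ : (fun z => _) = fun z => \sum_(i <- [seq k <- index_iota 1 L.-1 | (1 <= k)%N]) c i * z^-1 ^+ i.+1); last first.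
    apply/funext => z; rewrite big_filter [LHS]big_nat_cond [RHS]big_nat_cond.
    by apply: eq_bigl => k; case: (1 <= k)%N; rewrite ?andbT ?andbF.
  elim: [seq _ <- _ | _] (filter_all (fun k => 1 <= k)%N (index_iota 1 L.-1)) => [|k s IH] /=.
    by move=> _; apply: dec_eq (dec0 omega false 2) => z; rewrite big_nil.
  move=> /andP[k1 /IH ds]; apply: (dec_eq (f := fun z => c k * z^-1 ^+ k.+1 + \sum_(i <- s) c i * z^-1 ^+ i.+1)).
    by move=> z; rewrite big_cons.
  by apply: dec_add => //; apply: dec_scale; apply: dec_le (inv_pow_dec _); rewrite ltnS.
have [_ [K K0 hK]] := dec_add d2 d3.
apply: (@dec_intro _ _ _ hC false 1 _ K 0) => [z bz|z bz _].
  by apply: cdiff_sub; [exact: m_cdiff | exact: cdiff_id].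
have z0 := side_neq0 bz; have := hK z bz; rewrite /m_tail subrK => h.
have -> : m z - z = z * (m z / z - 1) by rewrite mulrBr mulrC divfK // mulr1.
apply: le_trans h; rewrite normcM mulrAC mulrC ler_wpM2l ?normc_ge0 // expr1.
have := normc_ge0 z; nra.
Qed.

Lemma m_ratio_sub1_dec : dec false 2 (fun z => m_ratio z - 1).
Proof.
apply: (dec_on (f := fun z => (m z - z) * z^-1)).
- by move=> z bz; rewrite mulrBl mulfV // side_neq0.
- by move=> z bz; apply: cdiff_sub; [exact: m_ratio_cdiff | exact: cdiff_cst].
- exact: (dec_mul m_sub_id_dec (dec_inv0 hC)).
Qed.

Lemma m_even_sub1_dec : dec false 2 (fun z => 1 - even_part m_ratio z).
Proof.
have h := m_ratio_sub1_dec.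
have := dec_scale (- 2^-1) (dec_add h (dec_opp hC h)).
by apply: dec_eq => z; rewrite /even_part; field.
Qed.

Lemma m_even_dec : dec false 0 (even_part m_ratio).
Proof.
have := dec_sub (dec_cst omega false 1) (dec_le (leq0n 2) m_even_sub1_dec).
by apply: dec_eq => z; rewrite opprB addrC subrK.
Qed.

(** The even part is [(m z - m (- z)) / (2 z)]. Off the real axis, [m z] and [- m (- z)] both have
    imaginary part of the sign of [Im z]; on it, the second inequality of (M.1) applies. *)
Lemma m_even_neq0 z : side false z -> even_part m_ratio z != 0.
Proof.
move=> bz; have z0 := side_neq0 bz.
have E : even_part m_ratio z = (m z - m (- z)) / (2 * z).
  by rewrite /even_part /m_ratio; field.
rewrite E mulf_neq0 ?invr_eq0 ?mulf_neq0 ?pnatr_eq0 //.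
have [Re0 nI] := side_domain bz.
have [I0|I0] := eqVneq (complex.Im z) 0; last first.
  apply/eqP => H; have h1 := m_herglotz hM1 Re0 I0.
  have h2 := @m_herglotz _ _ _ hM1 (- z); rewrite ReN ImN !oppr_eq0 invrN mulrN in h2.
  have {}h2 := h2 Re0 I0.
  have /(congr1 (@complex.Im _)) := H; rewrite ImD ImN /= => h3.
  by have := addr_gt0 h1 h2; rewrite -mulrBl h3 mul0r ltxx.
have Ez : z = (complex.Re z)%:C by case: (z) I0 => a b /= ->.
have xmu : mu0 < `|complex.Re z| by rewrite ltNge; apply/negP => h; exact: nI.
have := m_real_axis hM1 xmu; rewrite rmorphN /= -Ez => h.
by apply/eqP => H; move: h; rewrite H mul0r ltxx.
Qed.

Lemma m_even_inv_dec : dec false 0 (fun z => (even_part m_ratio z)^-1).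
Proof.
have [_ [K K0 hK]] := m_even_sub1_dec.
have [cf _] := m_even_dec.
apply: (@dec_intro _ _ _ hC false 0 _ 2 (2 * K)) => [z bz|z bz hz].
  by apply: cdiff_inv; [exact: cf | exact: m_even_neq0].
rewrite expr0 mulr1 normcV.
have q0 : 0 < normc (even_part m_ratio z) by rewrite normc_gt0 m_even_neq0.
rewrite -[leRHS]invrK lef_pV2 ?posrE ?invr_gt0 //.
have h1 := hK z bz; have h2 := normc_tri 1 (even_part m_ratio z); rewrite normc1 in h2.
have h3 : normc (1 - even_part m_ratio z) <= 2^-1.
  have z0 := normc_ge0 z; have p0 : 0 < 1 + normc z by lra.
  apply: (@le_trans _ _ (K / (1 + normc z))).
    rewrite ler_pdivlMr //; apply: le_trans h1; rewrite ler_wpM2l ?normc_ge0 //.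
    by rewrite expr2; nra.
  by rewrite ler_pdivrMr //; lra.
by lra.
Qed.

Lemma m_even_curve s y : even_part m_ratio (gam s y) != 0.
Proof. exact/m_even_neq0/(side_gam hC). Qed.

Lemma m_even_inv_sc : sc L (fun z => (even_part m_ratio z)^-1).
Proof.
apply: (sc_invert hC) m_even_inv_dec _ m_even_curve.
  have h1 := sc_opp hC m_ratio_sc.
  have := sc_mul hC (sc_cst hC L 2^-1) (sc_add m_ratio_sc h1).
  by apply: sc_eq => s y; rewrite mulrC.
exact: dec_le m_even_sub1_dec.
Qed.

Lemma m_vsymbol_inv : vsymbol_inv omega L (m_symbol m).
Proof.
split.
  by split; apply: (sc_symbol_class hC); [exact: (sc_cst hC) | exact: m_ratio_sc].
exact: (inversion hC hH m_ratio_sc m_even_dec m_even_inv_dec m_even_inv_sc m_even_curve).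
Qed.

Lemma m_symbol_real l : curve omega l ->
  (m_symbol m).1 l = ((m_symbol m).1 l^*)^* /\ (m_symbol m).2 l = ((m_symbol m).2 l^*)^*.
Proof.
move=> [s [y ->]]; split; first by apply/eqP; rewrite eq_complex /= oppr0 !eqxx.
have /side_domain/(m_real hM1) E := side_gam hC false s y.
rewrite /m_symbol; cbn [snd]; rewrite [in LHS]E -[X in _ / X]conjcK.
by rewrite -fmorph_div.
Qed.

End MSymbol.

(** * The m-function *)

Section CauchyMinus.
Context {R : realType}.
Local Notation C := R[i].
Local Notation leb := (@lebesgue_measure R).
Variables (omega : R -> R) (W : R).
Hypothesis hC : regular_curve omega W.
Local Notation omega' := (derive1 omega).
Local Notation gam := (curve_pt omega).
Local Notation dgam := (dgam omega).
Local Notation side := (side omega).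
Local Notation dec := (dec omega).
Local Notation hs := (hs omega).
Implicit Types (f g : C -> C) (s : bool).
Let hC1 := rc_C1 hC.
Let hpos := rc_pos hC.

Section AtPoint.
Variable z : C.
Hypothesis Dz : Dminus omega z.
Let a := complex.Re z.
Let b := complex.Im z.
Let sz := 0 < a.

Let absa : sg sz * a = `|a|.
Proof.
rewrite /sz /sg; case: ltP => h; first by rewrite mul1r gtr0_norm.
by rewrite mulN1r ler0_norm.
Qed.

Let a_gt : omega b < `|a|. Proof. exact: Dz. Qed.
Let a0 : 0 < `|a|. Proof. exact: lt_trans (hpos b) a_gt. Qed.
Let a_neq0 : a != 0. Proof. by rewrite -normr_gt0. Qed.

(* The Cauchy kernel pair z, -conj z on the component of D_- containing z. *)
Definition pole_fn (w : C) : C := if 0 < sg sz * complex.Re w then (2 * a)%:C / (w + z^*) else 0.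

Lemma pole_fn1 : pole_fn z = 1.
Proof.
rewrite /pole_fn -/a absa a0.
have -> : z + z^* = (2 * a)%:C by rewrite /a; case: (z) => x y; apply: complexP => /=; ring.
by rewrite mulfV // -normc_eq0 normc_real normr_eq0 mulf_neq0 // pnatr_eq0.
Qed.

Let den w : 0 <= sg sz * complex.Re w -> `|a| <= normc (w + z^*).
Proof.
move=> h; apply: le_trans (ler_normRe _); rewrite ReD.
have -> : complex.Re z^* = a by rewrite /a; case: (z).
rewrite -[leRHS]mul1r -(norm_sg sz) -normrM mulrDr absa ger0_norm ?addr_ge0 //.
by rewrite lerDr.
Qed.

Lemma sg_sgn w : side false w -> 0 < sg sz * complex.Re w \/ sg sz * complex.Re w < 0.
Proof.
rewrite /side /= => h; have := lt_le_trans (hpos _) h.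
rewrite normr_gt0 => n0.
have : sg sz * complex.Re w != 0 by rewrite mulf_neq0 // /sg; case: sz; rewrite ?oppr_eq0 oner_eq0.
by rewrite neq_lt => /orP[]; auto.
Qed.

Lemma pole_fn_dec : dec false 1 pole_fn.
Proof.
apply: (@dec_intro _ _ _ hC false 1 _ (4 * `|a|) (1 + 2 * normc z)) => w bw.
  have [h|h] := sg_sgn bw.
    apply: (@cdiff_ext _ (fun w => (2 * a)%:C / (w + z^*)) _ _ (sg sz * complex.Re w)) => // [t ht|].
      have ht' : `|sg sz * complex.Re t| <= normc t by rewrite normrM norm_sg mul1r ler_normRe.
      rewrite /pole_fn ifT // ReD mulrDr; move: ht'; rewrite ler_norml => /andP[ht' _]; lra.
    apply: (@cdiff_div _ (fun=> (2 * a)%:C) (fun w => w + z^*)); first exact: cdiff_cst.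
      by apply: cdiff_add; [exact: cdiff_id | exact: cdiff_cst].
    by rewrite -normc_gt0 (lt_le_trans a0) // den // ltW.
  apply: (@cdiff_ext _ (fun=> 0) pole_fn w (- (sg sz * complex.Re w)) _ _ (cdiff_cst 0 w)); first by rewrite oppr_gt0.
    move=> t ht; have ht' : `|sg sz * complex.Re t| <= normc t by rewrite normrM norm_sg mul1r ler_normRe.
    rewrite /pole_fn ifF // ReD mulrDr; apply/negbTE; rewrite -leNgt.
    by move: ht'; rewrite ler_norml => /andP[_ ht']; lra.
move=> rw; rewrite /pole_fn expr1; case: ifP => h; last by rewrite normc0 mul0r mulr_ge0.
have n1 : 0 < normc (w + z^*) by rewrite (lt_le_trans a0) // den // ltW.
rewrite normcM normcV normc_real normrM [`|2|]ger0_norm // mulrAC ler_pdivrMr //.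
have h2 : (1 + normc w) / 2 <= normc (w + z^*).
  have := normc_tri w (- z^*); rewrite opprK normcN normcJ; lra.
rewrite (_ : 4 * `|a| * _ = 2 * `|a| * (2 * normc (w + z^*))); last by ring.
by rewrite ler_wpM2l ?mulr_ge0 //; lra.
Qed.

(** The Cauchy kernel at z minus its mirror image in the imaginary axis. On that axis it is a
    multiple of the Poisson kernel, with the arctangent primitive [G]. *)
Let F (w : C) : C := (2 * a)%:C / ((w + z^*) * (w - z)).

Let axis y : F (0 +i* y) * (0 +i* 1) = ((- 2 * a) / (a ^+ 2 + (y - b) ^+ 2))%:C * 'i.
Proof.
have s0 : a ^+ 2 + (y - b) ^+ 2 != 0 by rewrite gt_eqF // ltr_wpDr ?sqr_ge0 // exprn_even_gt0.
have -> : 0 +i* 1 = 'i :> C by [].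
congr (_ * _); rewrite /F.
have -> : ((0 +i* y) + z^*) * ((0 +i* y) - z) = (- (a ^+ 2 + (y - b) ^+ 2))%:C.
  rewrite /a /b; case: (z) => x t; simpc; congr (_ +i* _); ring.
rewrite (_ : (- (a ^+ 2 + (y - b) ^+ 2))%:C^-1 = ((- (a ^+ 2 + (y - b) ^+ 2))^-1)%:C); last by rewrite fmorphV.
by rewrite -rmorphM /=; congr (_%:C); rewrite invrN mulrN -mulNr -mulNr.
Qed.

Let G (y : R) : C := (- 2)%:C * 'i * (atan ((y - b) / a))%:C.

Let dG y : pdiff G y (((- 2 * a) / (a ^+ 2 + (y - b) ^+ 2))%:C * 'i).
Proof.
have s0 : a ^+ 2 + (y - b) ^+ 2 != 0 by rewrite gt_eqF // ltr_wpDr ?sqr_ge0 // exprn_even_gt0.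
have h1 : is_derive y (1 : R) (fun y => (y - b) / a) a^-1.
  by apply: is_derive_eq; rewrite /GRing.scale /=; ring.
have h2 := @is_derive1_comp _ atan (fun y => (y - b) / a) y _ _ (is_derive1_atan _) h1.
have h3 := pdiff_mul (pdiff_cst ((- 2)%:C * 'i) y) (pdiff_real h2).
apply: pdiff_eq h3; rewrite mul0r add0r mulrAC -rmorphM /=; congr (_%:C * _).
by field; rewrite s0 a_neq0.
Qed.

Let den2 w : `|complex.Im w| - `|b| <= normc (w + z^*) /\
  `|complex.Im w| - `|b| <= normc (w - z).
Proof.
have h1 := ler_normIm (w + z^*); have h2 := ler_normIm (w - z).
have e1 : complex.Im (w + z^*) = complex.Im w - b by rewrite ImD /b; case: (z).
have e2 : complex.Im (w - z) = complex.Im w - b by rewrite ImD ImN.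
rewrite e1 in h1; rewrite e2 in h2.
have h3 := lerB_dist (complex.Im w) b; lra.
Qed.

Let sgsg : sg sz * sg sz = 1 :> R.
Proof. by rewrite /sg; case: sz; rewrite ?mulrNN mul1r. Qed.

Let F_cd t y : 0 <= t <= 1 -> cdiff F ((t * (sg sz * omega y)) +i* y).
Proof.
move=> /andP[t0 t1]; set w := (_ +i* y).
have sw : sg sz * complex.Re w = t * omega y.
  by rewrite /w /= mulrCA (mulrA (sg sz)) sgsg mul1r.
have d1 : w + z^* != 0.
  by rewrite -normc_gt0 (lt_le_trans a0) // den // sw mulr_ge0 // ltW.
have d2 : w - z != 0.
  rewrite subr_eq0; apply/eqP => E.
  have yb : y = b by rewrite /b -E.
  have : t * omega y = `|a| by rewrite -sw E.
  move=> H; have := a_gt; rewrite -H yb -[X in X < _]mul1r ltNge => /negP; apply.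
  by rewrite ler_wpM2r // ltW.
apply: (@cdiff_div _ (fun=> (2 * a)%:C) (fun w => (w + z^*) * (w - z))); first exact: cdiff_cst.
  apply: cdiff_mul; first by apply: cdiff_add; [exact: cdiff_id | exact: cdiff_cst].
  by apply: cdiff_sub; [exact: cdiff_id | exact: cdiff_cst].
by rewrite mulf_neq0.
Qed.

Let inv_dec : dec true 1 (fun l => (l - z)^-1).
Proof. by apply: (dec_inv hC); apply/(nsideP omega true). Qed.

Let pole_L1 : cL1 omega (fun l => pole_fn l * (l - z)^-1).
Proof.
apply: (L2b_cL1 hC1); first exact: (dec_L2b hC pole_fn_dec).
exact: (dec_L2b hC inv_dec).
Qed.

Let C1sg : C1 (fun y => sg sz * omega y) (fun y => sg sz * omega' y).
Proof.
have E (k : R -> R) : (fun y => sg sz * k y) = if sz then k else (fun y => - k y).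
  by case: sz; apply/funext => x; rewrite /sg ?mul1r ?mulN1r.
by rewrite !E; case: sz => //; exact: C1N.
Qed.

Let on_branch y : pole_fn (gam sz y) * (gam sz y - z)^-1 * dgam sz y =
  F ((1 * (sg sz * omega y)) +i* y) * ((1 * (sg sz * omega' y)) +i* 1).
Proof.
rewrite !mul1r -gamE /pole_fn Re_gam mulrA sgsg mul1r hpos.
by congr (_ * _); rewrite /F invfM mulrA.
Qed.

Let axis_int n : cint `[- n%:R, n%:R] (fun y =>
    F ((0 * (sg sz * omega y)) +i* y) * ((0 * (sg sz * omega' y)) +i* 1)) = G n%:R - G (- n%:R).
Proof.
have E : (fun y => F ((0 * (sg sz * omega y)) +i* y) * ((0 * (sg sz * omega' y)) +i* 1)) =
    (fun y => F (0 +i* y) * (0 +i* 1)) by apply/funext => y; rewrite !mul0r.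
rewrite E; apply: cint_FTC.
- by rewrite -subr_ge0 opprK addr_ge0.
- by move=> y _; rewrite axis; exact: dG.
- move=> y _; apply: pcont_mul; last exact: pcont_cst.
  apply: (pcont_comp (g := fun y => 0 +i* y)).
    by have := @graph_pcont _ (fun=> 0) (fun=> 0) y (C1_cst 0).
  by apply: cdiff_ccont; have := @F_cd 0 y; rewrite mul0r; apply; rewrite lexx ler01.
Qed.

Let G_lim (e : R) : 0 < e -> exists N : nat, forall n, (N <= n)%N ->
  normc (G n%:R - G (- n%:R) - (- (2 * sg sz * pi))%:C * 'i) <= e.
Proof.
move=> e0.
have e4 : 0 < e / 4 by rewrite divr_gt0.
have [X hX] : exists X : R, forall x, X < x -> `|pi / 2 - atan x| < e / 4.
  have := @cvgy_atan R => /cvgrPdist_lt /(_ _ e4) [X [_ hX]].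
  by exists X => x Xx; exact: hX.
have [N hN] := nat_above (`|b| + `|a| * (`|X| + 1)).
exists N => n Nn.
have nN : N%:R <= n%:R :> R by rewrite ler_nat.
have large c : `|c| = `|b| -> X < (n%:R + c) / `|a|.
  move=> cb; rewrite ltr_pdivlMr //; have := ler_norm X; have := ler_norm (- c).
  rewrite normrN cb; have := normr_ge0 X; have := a0; nra.
have h1 := hX _ (large b erefl).
have h2 : `|pi / 2 - atan ((n%:R - b) / `|a|)| < e / 4 by apply/hX/large; rewrite normrN.
have A c : atan (c / a) = sg sz * atan (c / `|a|).
  rewrite /sz /sg; case: ltP => ha; first by rewrite gtr0_norm // mul1r.
  by rewrite ler0_norm // invrN mulrN atanN mulN1r opprK.
have E : G n%:R - G (- n%:R) - (- (2 * sg sz * pi))%:C * 'i =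
  (2 * sg sz * (pi / 2 - atan ((n%:R - b) / `|a|) + (pi / 2 - atan ((n%:R + b) / `|a|))))%:C * 'i.
  rewrite /G !A.
  have -> : (- n%:R - b) / `|a| = - ((n%:R + b) / `|a|) by rewrite -opprD mulNr.
  rewrite atanN; move: (atan _) (atan _) (sg sz) => x y t.
  by apply: complexP => /=; field.
rewrite E normcM normc_real (_ : normc 'i = 1) ?mulr1; last first.
  by rewrite /normc /= expr0n /= add0r expr1n sqrtr1.
rewrite 2!normrM norm_sg mulr1 [`|2|]ger0_norm //.
by apply: le_trans (_ : 2 * (`|pi / 2 - atan ((n%:R - b) / `|a|)| + `|pi / 2 - atan ((n%:R + b) / `|a|)|) <= e);
  [rewrite ler_wpM2l // ler_normD | lra].
Qed.

(** The branch on the side of z is moved to the imaginary axis through the closure of D_+, where F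
    has no pole. There the limits of the arctangent give the full [2 pi], and the horizontal edges
    vanish at infinity. *)
Let pole_branch : branch_int omega (fun l => pole_fn l * (l - z)^-1) sz = (- (2 * sg sz * pi))%:C * 'i.
Proof.
apply/eqP; rewrite -subr_eq0 -normc_eq0 eq_le normc_ge0 andbT; apply/ler_addgt0Pr => e e0; rewrite add0r.
have e6 : 0 < e / 6 by rewrite divr_gt0.
have [N1 h1] := cint_lim (pole_L1 sz) e6.
have [N2 h2] := G_lim e6.
have W0 := W_gt0 hC.
have [N3 h3] := nat_above (`|b| + 1 + 12 * (2 * `|a| * W) / e).
pose n := maxn N1 (maxn N2 N3).
have k1 := h1 n (leq_maxl _ _).
have k2 := h2 n (leq_trans (leq_maxl _ _) (leq_maxr _ _)).
have n3 : `|b| + 1 + 12 * (2 * `|a| * W) / e <= n%:R.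
  by apply: le_trans h3 _; rewrite ler_nat (leq_trans (leq_maxr _ _) (leq_maxr _ _)).
set D := n%:R - `|b|.
have c0 : 0 <= 12 * (2 * `|a| * W) / e by rewrite divr_ge0 ?mulr_ge0 ?(ltW e0) ?(ltW W0).
have D1 : 1 <= D by rewrite /D; lra.
have D2 : 12 * (2 * `|a| * W) / e <= D by rewrite /D; lra.
have D0 : 0 < D by rewrite (lt_le_trans ltr01).
pose M := (2 * `|a|) / (D * D) * W.
have M0 : 0 <= M by rewrite mulr_ge0 ?(ltW W0) // divr_ge0 ?mulr_ge0 ?(ltW D0).
have k3 := @strip_shift _ (fun y => sg sz * omega y) (fun y => sg sz * omega' y) F 0 1 n%:R C1sg
  ler01 (ler0n R n) (fun t y ht _ => F_cd y ht) M M0.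
have {}k3 := k3 _.
have M4 : 4 * (M * (1 - 0)) <= e / 3.
  have : M * D <= 2 * `|a| * W.
    have gen (p d w : R) : d != 0 -> p / (d * d) * w * d = p * w / d by move=> d0; field.
    rewrite /M gen ?gt_eqF //.
    by rewrite ler_pdivrMr // ler_peMr // !mulr_ge0 // ltW.
  move: D2; rewrite ler_pdivrMr // subr0 mulr1 => D2 MD.
  have h12 : 12 * (M * D) <= D * e by apply: le_trans D2; rewrite ler_wpM2l.
  have : 12 * M * D <= e * D by rewrite -mulrA [e * D]mulrC.
  by rewrite ler_pM2r //; lra.
have {}k3 : normc (cint `[- n%:R, n%:R] (fun y => pole_fn (gam sz y) * (gam sz y - z)^-1 * dgam sz y) -
    (G n%:R - G (- n%:R))) <= e / 3.
  apply: le_trans M4; rewrite -axis_int (funext on_branch); apply: k3 => t y ht yn.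
  rewrite normcM normc_real normrM norm_sg mul1r (gtr0_norm (hpos y)) /M.
  apply: ler_pM; rewrite ?normc_ge0 ?(ltW (hpos y)) ?(rc_le hC) //.
  rewrite /F normcM normc_real normrM [`|2|]ger0_norm // ler_wpM2l ?mulr_ge0 //.
  have [d1 d2] := den2 ((t * (sg sz * omega y)) +i* y); rewrite /= yn -/D in d1 d2.
  rewrite normcV lef_pV2 ?posrE ?mulr_gt0 // normcM.
    by apply: ler_pM; rewrite ?(ltW D0).
  by rewrite mulr_gt0 // (lt_le_trans D0).
move: k1 k2 k3; rewrite /branch_int.
move: (cint setT _) (cint _ _) (G n%:R - _) (_ * 'i) => I J H T k1 k2 k3.
have -> : I - T = (H - T) + ((J - H) - (J - I)) by ring.
apply: le_trans (le_normcD _ _) _; have := normcB (J - H) (J - I); lra.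
Qed.

Lemma contour_pole : contour_integral omega (fun l => pole_fn l * (l - z)^-1) = - ((2 * pi)%:C * 'i).
Proof.
have Z : branch_int omega (fun l => pole_fn l * (l - z)^-1) (~~ sz) = 0.
  rewrite /branch_int (_ : (fun y => _) = fun=> 0); last first.
    apply/funext => y; rewrite /pole_fn Re_gam ifF ?mul0r //.
    rewrite mulrA (_ : sg sz * sg (~~ sz) = -1) ?mulN1r; last by rewrite /sg; case: sz; rewrite ?mul1r ?mulN1r.
    by apply/negbTE; rewrite -leNgt oppr_le0 ltW.
  have := @cint_scale R setT 0 (fun=> 0) measurableT.
  move=> H; have -> : (fun _ : R => 0 : C) = fun _ => 0 * 0 by apply/funext => ?; rewrite mul0r.
  rewrite H ?mul0r //; split; exact: integrable0.
have B := pole_branch.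
rewrite contourE; move: Z B; case: sz => /= -> ->; rewrite /sg.
  by rewrite subr0 mulr1 rmorphN mulNr.
by rewrite sub0r mulrN1 mulNr opprK.
Qed.

End AtPoint.

Lemma dec_quotient f z : dec false 1 f -> Dminus omega z -> f z = 0 -> exists g,
  dec false 2 g /\ forall w, f w = (w - z) * g w.
Proof.
move=> df Dz fz; have [cf [K K0 hK]] := df.
have ns : ~ side true z by apply/(nsideP omega true).
have [d d0 hd] := side_dist hC ns.
have [|g [gE gd]] := @divided_difference _ f z d d0.
  move=> w wz; apply: cf; apply: (Dside_side (b := false)); apply/(nsideP omega true) => sw.
  by have := hd w sw; rewrite leNgt wz.
have E w : f w = (w - z) * g w by rewrite -gE fz subr0.
exists g; split=> //; apply: (@dec_intro _ _ _ hC false 2 _ (4 * K) (1 + 2 * normc z)) => [w bw|w bw rw].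
  exact/gd/cf.
have h := hK w bw; rewrite E normcM expr1 in h.
have h1 := normc_tri w z.
have h2 : (1 + normc w) / 2 <= normc (w - z) by lra.
have p0 : 0 <= 1 + normc w by rewrite addr_ge0 ?normc_ge0.
have := ler_wpM2r p0 (ler_wpM2r (normc_ge0 (g w)) h2) => h3.
rewrite expr2; have h4 := le_trans h3 h; lra.
Qed.

(** Subtracting [f z] times [pole_fn] leaves a function vanishing at z. Divided by [l - z] it is a
    test function of order 2, so its contour integral is zero, and the formula reduces to the one
    explicit integral [contour_pole]. *)
Lemma cauchy_minus f z : dec false 1 f -> Dminus omega z ->
  contour_integral omega (fun l => f l * (l - z)^-1) = - ((2 * pi)%:C * 'i) * f z.
Proof.
move=> df Dz.
have dp := pole_fn_dec Dz.
have d1 := dec_sub df (dec_scale (f z) dp).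
have [|g [dg E]] := dec_quotient d1 Dz; first by rewrite pole_fn1 // mulr1 subrr.
have n0 s y : gam s y - z != 0.
  by apply: (@gam_sub_neq0 _ _ _ hC s y z true); apply/(nsideP omega true).
have iz : dec true 1 (fun l => (l - z)^-1) by apply: (dec_inv hC); apply/(nsideP omega true).
have lz := dec_L2b hC iz; have lf := dec_L2b hC df; have lp := dec_L2b hC dp.
have I1 := L2b_cL1 hC1 lp lz.
have Ig : cL1 omega g.
  have := L2b_cL1 hC1 (dec_L2b hC d1) lz; move=> H s; have := H s.
  rewrite (_ : (fun y => _) = fun y => g (gam s y) * dgam s y) //.
  by apply/funext => y; rewrite E; congr (_ * _); rewrite mulrAC mulfV ?n0 ?mul1r.
have -> : contour_integral omega (fun l => f l * (l - z)^-1) =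
    contour_integral omega (fun l => f z * (pole_fn z l * (l - z)^-1) + g l).
  have ID s y : f (gam s y) * (gam s y - z)^-1 =
      f z * (pole_fn z (gam s y) * (gam s y - z)^-1) + g (gam s y).
    rewrite -[f (gam s y)](subrK (f z * pole_fn z (gam s y))) E.
    have nn := n0 s y; move: (gam s y - z) nn (g _) (f z) (pole_fn _ _) => t t0 x1 x2 x3.
    by field.
  rewrite !contourE; congr (_ - _); rewrite /branch_int; by apply: cint_eq => y _ /=; rewrite ID.
rewrite contour_add //; last exact: cL1_scale.
by rewrite (contour_dec hC dg) addr0 contour_scale // contour_pole // mulrC.
Qed.

Lemma ext_minus_dec f z : dec false 1 f -> Dminus omega z -> ext_minus omega f z = f z.
Proof.
move=> df Dz; rewrite /ext_minus.
rewrite (_ : contour_integral omega _ = - ((2 * pi)%:C * 'i) * f z); last exact: cauchy_minus.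
have n0 : (2 * pi)%:C * 'i != 0 :> C.
  by rewrite mulf_neq0 // -normc_gt0 ?normc_real ?normr_gt0 ?mulf_neq0 ?gt_eqF ?pi_gt0 //
    /normc /= expr0n /= add0r expr1n sqrtr1.
by rewrite mulNr mulNr mulrN opprK mulrA mulVf ?mul1r.
Qed.

(* The value c is g(z), for the analytic extension of g to D_-. *)
Lemma hs_quotient g z : hs false g -> Dminus omega z ->
  exists c : C, hs false (fun l => (g l - c) / (l - z)).
Proof.
move=> hg Dz; have [lg og] := hg.
have n0 s y : gam s y - z != 0.
  by apply: (@gam_sub_neq0 _ _ _ hC s y z true); apply/(nsideP omega true).
have iz : dec true 1 (fun l => (l - z)^-1) by apply: (dec_inv hC); apply/(nsideP omega true).
have lz := dec_L2b hC iz.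
have dp := pole_fn_dec Dz; have lp := dec_L2b hC dp.
pose e l := pole_fn z l * (l - z)^-1.
have bz : dec true 0 (fun l => (l - z)^-1) by exact: dec_le iz.
have lzg u : L2b omega u -> L2b omega (fun l => (l - z)^-1 * u l).
  by move=> lu; have [K _ []] := dec0_L2b hC bz lu.
have lgz := lzg _ lg; have lez := lzg _ lp.
set T := contour_integral omega (fun l => pole_fn z l * (l - z)^-1).
have T0 : T != 0.
  rewrite /T contour_pole // oppr_eq0 mulf_neq0 // -normc_gt0 ?normc_real ?normr_gt0 ?mulf_neq0 ?gt_eqF ?pi_gt0 //.
  by rewrite /normc /= expr0n /= add0r expr1n sqrtr1.
pose c := pair omega g (fun l => (l - z)^-1 * pole_fn z l) / T.
exists c.
have lc := (L2b_scale hC1 c lz).1.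
have Eu : (fun l => (g l - c) / (l - z)) = (fun l => (l - z)^-1 * g l - c * (l - z)^-1).
  by apply/funext => l; rewrite mulrBl mulrC.
rewrite Eu; split; first by case: (L2b_sub hC1 lgz lc).
move=> f df; have lf := dec_L2b hC df.
rewrite (pair_subl hC1 lgz lc lf) (pair_scalel hC1 c lz lf).
have P1 : pair omega (fun l => (l - z)^-1) f = f z * T.
  have := cauchy_minus df Dz; rewrite /T contour_pole // mulrC => <-.
  by rewrite pairC.
have d1 := dec_sub df (dec_scale (f z) dp).
have [|h [dh E]] := dec_quotient d1 Dz; first by rewrite pole_fn1 // mulr1 subrr.
(* f is [f z] times [pole_fn] plus [(l - z) h]; the second term contributes the pairing of g with
   the test function h, which is zero. *)
have P2 : pair omega (fun l => (l - z)^-1 * g l) f =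
    f z * pair omega g (fun l => (l - z)^-1 * pole_fn z l).
  have dh1 : dec false 1 h by exact: dec_le dh.
  rewrite -(pair_scaler hC1 (f z) lg lez) -[RHS]addr0 -(og h dh1).
  rewrite -(pair_addr hC1 lg (L2b_scale hC1 (f z) lez).1 (dec_L2b hC dh1)).
  apply: pair_ext => s y; rewrite -[f (gam s y)](subrK (f z * pole_fn z (gam s y))) E.
  have nn := n0 s y; move: (gam s y - z) nn (g _) (h _) (f z) (pole_fn _ _) => t t0 x1 x2 x3 x4.
  by field.
by rewrite P1 P2 /c mulrCA divfK // subrr.
Qed.

End CauchyMinus.

Section MFunction.
Context {R : realType}.
Local Notation C := R[i].
Variables (omega : R -> R) (W mu0 : R).
Hypothesis hC : regular_curve omega W.
Hypothesis hH : hardy_decomposition omega.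
Hypothesis hI : forall x : R, `|x| <= mu0 -> Dplus omega x%:C.
Variables (L : nat) (m : C -> C).
Hypothesis hL : (2 <= L)%N.
Hypothesis hm : analytic_on (m_domain mu0) m.
Hypothesis hM2 : m_asymptotics omega L m.

Let a := m_symbol m.

Let sc1 : sc omega L a.1. Proof. exact: (sc_cst hC). Qed.
Let sc2 : sc omega L a.2. Proof. exact: (m_ratio_sc hC hI hL hm hM2). Qed.

Let hn_monomial N : (N.+1 <= L)%N -> hn omega W N.+1 (fun l => l ^+ N).
Proof.
move=> NL; apply: (hs_dec hC).
have := dec_mul (dec_exp N (dec_frac hC 0 (nside_base hC))) (dec_inv hC (nside_base hC)).
rewrite mul0n add0n; apply: dec_eq => l.
by rewrite /over_base subr0 exprS invfM mulrCA mulrC -exprVn -exprMn mulrC.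
Qed.

(** 1 is even and the first component is 1, so T fixes 1. The odd function z is sent by the symbol
    to m, and [m - z] is in H(D_-), so T fixes z. Hence u = 1, v = z, phi = 0, kappa = 0 and psi is
    [m - z]. *)
Lemma m_mfunction : is_mfunction omega L (m_symbol m) m.
Proof.
have e1 (l : C) : even_part (fun=> 1) l = 1 :> C by rewrite /even_part; field.
have o1' (l : C) : odd_part (fun=> 1) l = 0 :> C by rewrite /odd_part; field.
have e2 (l : C) : even_part (fun l => l) l = 0 :> C by rewrite /even_part; field.
have o2 (l : C) : odd_part (fun l => l) l = l :> C by rewrite /odd_part; field.
have dpsi := m_sub_id_dec hC hI hL hm hM2.
have A1 : (fun l => vsymbol_act a (fun=> 1) l - 1) = fun=> 0.
  by apply/funext => l; rewrite /vsymbol_act e1 o1' /= mulr0 addr0 mulr1 subrr.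
have hn1 : hn omega W 1 (fun=> 1).
  by have := hn_monomial (ltnW hL); congr hn; apply/funext => l; rewrite expr0.
have hn2 : hn omega W 2 (fun l => l).
  by have := hn_monomial hL; congr hn; apply/funext => l; rewrite expr1.
have A2 s y : vsymbol_act a (fun l => l) (curve_pt omega s y) - curve_pt omega s y =
    m (curve_pt omega s y) - curve_pt omega s y.
  by rewrite /vsymbol_act e2 o2 /= mulr0 add0r divfK // (gam_neq0 hC).
have mpsi : forall s, pmeas (fun y => vsymbol_act a (fun l => l) (curve_pt omega s y) - curve_pt omega s y).
  by move=> s; rewrite (funext (A2 s)); exact: (dec_mcurve hC dpsi).
have hpsi : hs omega false (fun l => vsymbol_act a (fun l => l) l - l).
  apply: (hs_ae hC _ mpsi (hs_dec hC dpsi)).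
  by move=> s; apply: aeW => y; rewrite A2.
exists (fun=> 1), (fun l => l), 0; split.
- split; first exact/(hardyNP hC hH).
  apply/(vtP hC hH sc1 sc2); rewrite ?A1; [exact: (hn_le hC (ltnW hL)) | exact: (hn_le hC (ltnW hL)) | exact: hs0 hC false].
- split; first exact/(hardyNP hC hH).
  by apply/(vtP hC hH sc1 sc2) => //; exact: (hn_le hC hL).
- split; last exact: (hs_hardy hC hH (b := false)).
  by rewrite A1; exact: (hs_hardy hC hH (b := false) (hs0 hC false)).
- exists (fun=> 0); first exact: (hs_hardy hC hH (b := false) (hs0 hC false)).
  by rewrite A1; apply: eq_curve_on => l _; rewrite mul0r mulr0 addr0.
have X0 z : ext_minus omega (fun l => vsymbol_act a (fun=> 1) l - 1) z = 0.
  rewrite /ext_minus (_ : (fun l => _ / _) = fun=> 0); last first.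
    by apply/funext => l; rewrite (congr1 (@^~ l) A1) mul0r.
  by rewrite (contour_dec hC (dec0 omega false 2)) mulr0.
split.
  move=> z Dz; apply: subset_closure; split=> //=.
  by rewrite X0 addr0 oner_neq0.
move=> z Dz _; rewrite X0 !addr0 divr1.
have -> : ext_minus omega (fun l => vsymbol_act a (fun l => l) l - l) z =
    ext_minus omega (fun l => m l - l) z.
  rewrite /ext_minus; congr (_ * _); rewrite !contourE; congr (_ - _); rewrite /branch_int;
    by apply: cint_eq => y _; rewrite /= A2.
by rewrite (ext_minus_dec hC dpsi Dz) addrC subrK.
Qed.

End MFunction.

(** * The tau-function as a quotient of determinants *)

Section SymbolMatrix.
Variables (F : fieldType) (n : nat).
Implicit Types (Q rho : {poly F}) (u : 'rV[F]_n).

Definition xrow Q rho (i : nat) : {poly F} := (if odd i then 'X^(i.-1) * rho else 'X^i) %% Q.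
(* The matrix of U |-> U_e + (U_o/z) rho modulo Q on polynomials of degree < n,
   acting on row vectors of coefficients. *)
Definition xmat Q rho : 'M[F]_n := \matrix_(i < n, j < n) (xrow Q rho i)`_j.

Definition evp u : {poly F} := \sum_(i < n | ~~ odd i) u 0 i *: 'X^i.
Definition odp u : {poly F} := \sum_(i < n | odd i) u 0 i *: 'X^(i.-1).

Lemma rVpoly_sum u : rVpoly u = \sum_(i < n) u 0 i *: 'X^i.
Proof.
rewrite /rVpoly poly_def; apply: eq_bigr => i _; case: insubP => [j _ ji|]; last by rewrite ltn_ord.
by congr (u 0 _ *: _); apply: val_inj; rewrite ji.
Qed.

Lemma rVpoly_parts u : rVpoly u = evp u + 'X * odp u.
Proof.
rewrite rVpoly_sum (bigID (fun i : 'I_n => odd i)) /= addrC; congr (_ + _).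
rewrite mulr_sumr; apply: eq_bigr => i oi; rewrite -scalerAr -exprS.
by case: (val i) oi.
Qed.

Lemma xmatP Q rho u : size Q = n.+1 ->
  rVpoly (u *m xmat Q rho) = (evp u + odp u * rho) %% Q.
Proof.
move=> sQ.
have E : (evp u + odp u * rho) %% Q = \sum_(i < n) u 0 i *: xrow Q rho i.
  rewrite [in RHS](bigID (fun i : 'I_n => odd i)) /= addrC modpD; congr (_ + _).
    rewrite /evp (big_morph (fun p => p %% Q) (fun x y => modpD Q x y) (mod0p Q)).
    by apply: eq_bigr => i oi; rewrite modpZl /xrow (negbTE oi).
  rewrite /odp mulr_suml (big_morph (fun p => p %% Q) (fun x y => modpD Q x y) (mod0p Q)).
  by apply: eq_bigr => i oi; rewrite -scalerAl modpZl /xrow oi.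
rewrite E; apply/polyP => j; rewrite coef_rVpoly coef_sum.
case: insubP => [k _ kj|]; last first.
  rewrite -leqNgt => nj; rewrite big1 // => i _; rewrite coefZ nth_default ?mulr0 //.
  by apply: leq_trans nj; rewrite -ltnS -sQ /xrow ltn_modp -size_poly_gt0 sQ.
by rewrite mxE; apply: eq_bigr => i _; rewrite coefZ mxE kj.
Qed.

Lemma horner_evpN u z : (evp u).[- z] = (evp u).[z].
Proof.
rewrite /evp !horner_sum; apply: eq_bigr => i oi; rewrite !hornerZ !hornerXn.
by rewrite exprNn -signr_odd (negbTE oi) expr0 mul1r.
Qed.

Lemma horner_odpN u z : (odp u).[- z] = (odp u).[z].
Proof.
rewrite /odp !horner_sum; apply: eq_bigr => i oi; rewrite !hornerZ !hornerXn.
rewrite exprNn -signr_odd (_ : odd i.-1 = false) ?expr0 ?mul1r //.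
by case: (val i) oi => //= j /negbTE.
Qed.

Lemma size_odp u : (size (odp u) <= n)%N.
Proof.
apply: (leq_trans (size_sum _ _ _)); apply/bigmax_leqP => i _.
by apply: leq_trans (size_scale_leq _ _) _; rewrite size_polyXn (leq_trans _ (ltn_ord i)) // ltnS leq_pred.
Qed.

End SymbolMatrix.

Lemma map_xmat (F K : fieldType) (f : {rmorphism F -> K}) n (Q rho : {poly F}) :
  map_mx f (xmat n Q rho) = xmat n (map_poly f Q) (map_poly f rho).
Proof.
apply/matrixP => i j; rewrite !mxE -coef_map /xrow map_modp; congr ((_ %% _)`_j).
by case: ifP => _; rewrite ?rmorphM /= map_polyXn.
Qed.

(** * Hermite interpolation of m at points of D_- *)

Section Hermite.
Context {R : realType}.
Local Notation C := R[i].
Local Notation RC := (real_complex R).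
Variables (omega : R -> R) (W mu0 : R).
Hypothesis hC : regular_curve omega W.
Hypothesis hI : forall x : R, `|x| <= mu0 -> Dplus omega x%:C.
Variable m : C -> C.
Hypothesis hm : analytic_on (m_domain mu0) m.
Local Notation side := (side omega).
Local Notation dom := (m_domain mu0).

Definition prodX (s : seq C) : {poly C} := \prod_(a <- s) ('X - a%:P).

Lemma size_prodX s : size (prodX s) = (size s).+1.
Proof. exact: size_prod_XsubC. Qed.

Lemma prodX_neq0 s : prodX s != 0.
Proof. by rewrite -size_poly_gt0 size_prodX. Qed.

Lemma Dminus_ball a : Dminus omega a -> exists2 d : R, 0 < d & forall w, normc (w - a) < d -> Dminus omega w.
Proof.
move=> Da; have [|d d0 hd] := side_dist hC (b := true) (a := a); first exact/(nsideP omega true).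
exists d => // w wa; apply/(nsideP omega true) => bw.
by have := hd w bw; rewrite leNgt wa.
Qed.

(** Newton's scheme: each node adds one divided difference. Repeated nodes count with multiplicity,
    since the cofactor h stays differentiable wherever m is. *)
Lemma hermite (s : seq C) : (forall a, a \in s -> Dminus omega a) ->
  exists (rho : {poly C}) h, [/\ (size rho <= size s)%N,
    forall z, m z = rho.[z] + (prodX s).[z] * h z &
    forall w, cdiff m w -> cdiff h w].
Proof.
elim: s => [|a s IH] hs.
  exists 0, m; split=> //; first by rewrite size_poly0.
  by move=> z; rewrite horner0 add0r /prodX big_nil hornerC mul1r.
have [|rho [h [srho E dh]]] := IH; first by move=> x xs; apply: hs; rewrite inE xs orbT.
have Da : Dminus omega a by apply: hs; rewrite mem_head.
have [d d0 hd] := Dminus_ball Da.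
have [|g [gE gd]] := @divided_difference _ h a d d0.
  move=> w wa; apply: dh; apply: derivable_cdiff; apply: hm.
  by apply: (side_domain hC hI); exact: (Dside_side (b := false) (hd w wa)).
exists (rho + h a *: prodX s), g; split.
- apply: leq_trans (size_polyD _ _) _; rewrite geq_max (leq_trans srho) //=.
  by apply: leq_trans (size_scale_leq _ _) _; rewrite size_prodX.
- move=> z; rewrite E hornerD hornerZ /prodX big_cons hornerM hornerXsubC -/(prodX s).
  by rewrite -[h z](subrK (h a)) gE; ring.
- by move=> w mw; exact/gd/dh.
Qed.

Lemma cdiff_conj (f : C -> C) (z : C) : cdiff f (conjc z) -> cdiff (fun w => conjc (f (conjc w))) z.
Proof.
move=> [d hd]; exists (conjc d) => e e0; have [r r0 hr] := hd e e0.
exists r => // h hh; have := hr (conjc h); rewrite !normcJ => /(_ hh).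
rewrite -[X in X <= _]normcJ.
by rewrite !rmorphB rmorphM /= !conjcK rmorphD.
Qed.

Lemma domJ z : dom z -> dom (conjc z).
Proof. by case: z => x y [/= x0 nI]; split => //= -[/eqP]; rewrite oppr_eq0 => /eqP y0 xm; apply: nI. Qed.

Lemma conj_horner (p : {poly R}) z : conjc (map_poly RC p).[conjc z] = (map_poly RC p).[z].
Proof.
elim/poly_ind: p => [|p c IH]; first by rewrite rmorph0 !horner0 rmorph0.
rewrite !rmorphD !rmorphM /= map_polyX map_polyC /= !hornerE rmorphD rmorphM /= IH conjcK.
by congr (_ + _); apply: complexP; rewrite //= oppr0.
Qed.

Definition re_poly (p : {poly C}) : {poly R} := \poly_(i < size p) complex.Re p`_i.

Lemma coef_re_poly p i : (re_poly p)`_i = complex.Re p`_i.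
Proof. by rewrite coef_poly; case: ltnP => // h; rewrite nth_default. Qed.

Lemma horner_re_poly p z : (map_poly RC (re_poly p)).[z] = (p.[z] + conjc p.[conjc z]) / 2.
Proof.
have E : p.[z] + conjc p.[conjc z] = \sum_(i < size p) (p`_i + conjc p`_i) * z ^+ i.
  rewrite !horner_coef rmorph_sum -big_split /=; apply: eq_bigr => i _.
  by rewrite rmorphM rmorphXn /= conjcK mulrDl.
rewrite E mulr_suml (@horner_coef_wide _ (size p)); last first.
  by apply: leq_trans (size_poly _ _) _; apply: size_poly.
apply: eq_bigr => i _; rewrite coef_map coef_re_poly mulrAC; congr (_ * _).
by case: (p`_i) => x y; apply: complexP => /=; field.
Qed.

Hypothesis hM1 : m_positivity mu0 m.

(* m agrees with rho at the points of s, with multiplicities. *)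
Definition interpolates (s : seq C) (Q rho : {poly R}) (h : C -> C) :=
  [/\ forall a, a \in s -> Dminus omega a, map_poly RC Q = prodX s,
    (size rho <= size s)%N,
    forall z, dom z -> m z = (map_poly RC rho).[z] + (map_poly RC Q).[z] * h z &
    forall z, dom z -> cdiff h z].

(** Averaging the complex interpolant with its conjugate keeps the relation, since m and Q are both
    real. *)
Lemma hermite_real s Q : (forall a, a \in s -> Dminus omega a) -> map_poly RC Q = prodX s ->
  exists rho h, interpolates s Q rho h.
Proof.
move=> hs Qs; have [rho [h [srho E dh]]] := hermite hs.
exists (re_poly rho), (fun z => (h z + conjc (h (conjc z))) / 2); split=> //.
- by apply: leq_trans (size_poly _ _) _.
- move=> z dz; rewrite horner_re_poly.
  have E1 := E z; have E2 := E (conjc z); rewrite -Qs in E1 E2.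
  have : m z = (m z + m z) / 2 by field.
  rewrite {3}(m_real hM1 dz) {2}E1 E2 rmorphD rmorphM /= conj_horner => ->.
  by field.
- move=> z dz; apply: (@cdiff_mul _ (fun z => h z + conjc (h (conjc z))) (fun=> 2^-1)); last exact: cdiff_cst.
  apply: cdiff_add; first by apply/dh/derivable_cdiff/hm.
  by apply: cdiff_conj; apply/dh/derivable_cdiff/hm/domJ.
Qed.

End Hermite.

(** * The operator r^-1 T(r m) T(m)^-1 on a space of rational functions *)

Section TauOperator.
Context {R : realType}.
Local Notation C := R[i].
Local Notation RC := (real_complex R).
Variables (omega : R -> R) (W mu0 : R).
Hypothesis hC : regular_curve omega W.
Hypothesis hH : hardy_decomposition omega.
Hypothesis hI : forall x : R, `|x| <= mu0 -> Dplus omega x%:C.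
Variables (L : nat) (m : C -> C).
Hypothesis hL : (2 <= L)%N.
Hypothesis hm : analytic_on (m_domain mu0) m.
Hypothesis hM1 : m_positivity mu0 m.
Hypothesis hM2 : m_asymptotics omega L m.
Local Notation gam := (curve_pt omega).
Local Notation side := (side omega).
Local Notation dec := (dec omega).
Local Notation hs := (hs omega).
Local Notation hn := (hn omega W).
Local Notation sc := (sc omega).
Local Notation dom := (m_domain mu0).
Local Notation interpolates := (interpolates omega mu0 m).
Local Notation mcurve u := (forall s : bool, pmeas (fun y => u (gam s y))).
Implicit Types (s : seq C) (p q : {poly C}).

Lemma ratfun_far p q N : q != 0 -> (size p + N <= size q)%N -> exists K r : R,
  forall z, r <= normc z -> q.[z] != 0 /\ normc (p.[z] / q.[z]) * (1 + normc z) ^+ N <= K.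
Proof.
move=> q0 spq; have [K K0 hp] := poly_upper p; have [c [r [c0 r0 hq]]] := poly_lower q0.
exists (K / c), r => z rz.
have h1 : 1 <= 1 + normc z by rewrite lerDl normc_ge0.
have hz := hq z rz.
have e0 k : 0 < (1 + normc z) ^+ k by rewrite exprn_gt0 // (lt_le_trans ltr01).
have qz : 0 < normc q.[z] by apply: lt_le_trans hz; rewrite mulr_gt0.
split; first by rewrite -normc_gt0.
have [->|p0] := eqVneq p 0.
  by rewrite horner0 mul0r normc0 mul0r divr_ge0 // ltW.
rewrite normcM normcV mulrAC ler_pdivrMr // mulrAC ler_pdivlMr //.
apply: (@le_trans _ _ (K * (1 + normc z) ^+ (size p).-1 * (1 + normc z) ^+ N * c)).
  by rewrite ler_wpM2r ?(ltW c0) // ler_wpM2r ?(ltW (e0 _)).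
rewrite -!mulrA ler_wpM2l // mulrA -exprD mulrC; apply: le_trans hz.
rewrite ler_wpM2l ?(ltW c0) // ler_weXn2l //.
by move: spq; rewrite -size_poly_gt0 in p0; case: (size p) p0 => // k _; case: (size q) => [|j]; rewrite addSn.
Qed.

Lemma prodX_root s z : (forall a, a \in s -> Dminus omega a) -> (prodX s).[z] = 0 -> Dminus omega z.
Proof.
move=> hs /eqP; rewrite -/(root _ _) root_prod_XsubC; exact: hs.
Qed.

Lemma prodX_curve s t y : (forall a, a \in s -> Dminus omega a) -> (prodX s).[gam t y] != 0.
Proof.
move=> hs; apply/eqP => /(prodX_root hs); rewrite /Dminus /= (abs_Re_gam hC) ltxx //.
Qed.

Section Key.
Variables (s : seq C) (Q rho : {poly R}) (h : C -> C) (n : nat).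
Hypothesis hs_ : interpolates s Q rho h.
Hypothesis sn : size s = n.
Let Qc := map_poly RC Q.
Let rc := map_poly RC rho.

Definition res_num (u : 'rV[C]_n) : {poly C} := rVpoly (u *m xmat n Qc rc).
Definition residual (u : 'rV[C]_n) (l : C) : C :=
  ((evp u).[l] + m l * (odp u).[l] - (res_num u).[l]) / Qc.[l].

Let sQ : size Qc = n.+1.
Proof. by rewrite /Qc; have [_ -> _ _ _] := hs_; rewrite size_prodX sn. Qed.

Let Q0 : Qc != 0. Proof. by rewrite -size_poly_gt0 sQ. Qed.

(** Two forms of the quotient are combined. Substituting [m = rho + Q h] cancels Q and shows
    differentiability up to the curve; writing [m = z + (m - z)] exhibits the decay, a proper
    fraction plus a bounded factor times [m - z]. *)
Lemma residual_hs u : hs false (residual u).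
Proof.
have [sD Qs srho mE hd] := hs_.
pose Wp := (evp u + odp u * rc) %/ Qc.
pose g l := h l * (odp u).[l] + Wp.[l].
have E l : dom l -> (evp u).[l] + m l * (odp u).[l] - (res_num u).[l] = Qc.[l] * g l.
  move=> dl; rewrite /res_num (xmatP _ _ sQ) (mE _ dl) -/rc -/Qc.
  have := divp_eq (evp u + odp u * rc) Qc => /(congr1 (fun p => p.[l])).
  rewrite !hornerE -/Wp => H; rewrite /g.
  have -> : (evp u).[l] = Wp.[l] * Qc.[l] + ((evp u + odp u * rc) %% Qc).[l] - (odp u).[l] * rc.[l].
    by rewrite -H addrK.
  by ring.
have dg : dec false 1 g.
  pose V : {poly C} := rVpoly u; pose N : {poly C} := res_num u.
  have s1 : (size (V - N)%R + 1 <= size Qc)%N.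
    rewrite sQ addn1 ltnS; apply: leq_trans (size_polyD _ _) _; rewrite size_polyN geq_max.
    by rewrite !size_poly.
  have s2 : (size (odp u) + 0 <= size Qc)%N by rewrite addn0 sQ leqW // size_odp.
  have [K1 [r1 far1]] := ratfun_far Q0 s1; have [K2 [r2 far2]] := ratfun_far Q0 s2.
  have [_ [K3 K30 h3]] := m_sub_id_dec hC hI hL hm hM2.
  apply: (@dec_intro _ _ _ hC false 1 _ (`|K1| + K3 * `|K2|) (Num.max r1 r2)) => [l bl|l bl].
    have dl := side_domain hC hI bl.
    apply: cdiff_add; last exact: cdiff_poly.
    by apply: cdiff_mul; [exact: hd | exact: cdiff_poly].
  rewrite ge_max => /andP[/far1[n1 b1] /far2[_ b2]].
  have dl := side_domain hC hI bl.
  have -> : g l = (V - N).[l] / Qc.[l] + (m l - l) * ((odp u).[l] / Qc.[l]).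
    apply: (mulfI n1); rewrite -E // /V /N rVpoly_parts !hornerD hornerN hornerM hornerX.
    move: (evp u).[l] (odp u).[l] (res_num u).[l] (m l) Qc.[l] n1 => x1 x2 x3 x4 x5 x50.
    by field.
  apply: le_trans (ler_wpM2r _ (le_normcD _ _)) _; first by rewrite exprn_ge0 ?addr_ge0 ?normc_ge0.
  rewrite mulrDl; apply: lerD; first exact: le_trans b1 (ler_norm _).
  rewrite normcM mulrAC; apply: ler_pM; rewrite ?mulr_ge0 ?exprn_ge0 ?addr_ge0 ?normc_ge0 //; first exact: h3.
  by move: b2; rewrite expr0 mulr1 => b2; exact: le_trans b2 (ler_norm _).
apply: (hs_ae hC _ _ (hs_dec hC dg)).
  apply: eq_curve_on => _ [t [y ->]]; rewrite /residual E; last exact/(side_domain hC hI)/(side_gam hC).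
  by rewrite mulrC mulKf // /Qc Qs prodX_curve.
move=> t; rewrite (_ : (fun y => _) = fun y => g (gam t y)); first exact: (dec_mcurve hC dg).
apply/funext => y; rewrite /residual E; last exact/(side_domain hC hI)/(side_gam hC).
by rewrite mulrC mulKf // /Qc Qs prodX_curve.
Qed.

End Key.

Lemma hs_eq b f g : (forall t y, f (gam t y) = g (gam t y)) -> hs b f -> hs b g.
Proof.
move=> E hf; apply: (hs_ae hC _ _ hf); first by apply: eq_curve_on => _ [t [y ->]].
by move=> t; rewrite (_ : (fun y => _) = fun y => f (gam t y)); [exact: (proj1 (proj1 hf)) | apply/funext].
Qed.

Lemma Dminus_curve b t y : Dminus omega b -> gam t y - b != 0.
Proof. by move=> Db; apply: (@gam_sub_neq0 _ _ _ hC t y b true); apply/(nsideP omega true). Qed.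

(** Factors are peeled off one at a time through [(l - a) / (l - b) = 1 + (b - a) / (l - b)]. Each
    division by [l - b] is corrected by the constant of [hs_quotient], and P collects the
    corrections. *)
Lemma hs_ratmul qs ps g : size ps = size qs -> (forall b, b \in qs -> Dminus omega b) -> hs false g ->
  exists P : {poly C}, (size P <= size qs)%N /\
    hs false (fun l => (prodX ps).[l] / (prodX qs).[l] * g l - P.[l] / (prodX qs).[l]).
Proof.
move=> + + hg; elim: qs ps => [|b qs IH] [|a ps] //= => [_ _|[spq] hq].
  exists 0; rewrite size_poly0; split=> //; apply: hs_eq hg => t y.
  by rewrite horner0 mul0r subr0 divff ?mul1r // prodX_curve.
have Db : Dminus omega b by apply: hq; rewrite mem_head.
have hq' x : x \in qs -> Dminus omega x by move=> xq; apply: hq; rewrite inE xq orbT.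
have [P [sP h1]] := IH ps spq hq'.
have [c h2] := hs_quotient hC h1 Db.
exists (('X - a%:P) * P + ((b - a) * c) *: prodX qs); split.
  apply: leq_trans (size_polyD _ _) _; rewrite geq_max; apply/andP; split.
    by apply: leq_trans (size_polyMleq _ _) _; rewrite size_XsubC.
  by apply: leq_trans (size_scale_leq _ _) _; rewrite size_prodX.
apply: hs_eq (hs_add hC h1 (hs_scale hC (b - a) h2)) => t y.
rewrite /prodX !big_cons -/(prodX ps) -/(prodX qs) hornerD hornerZ !hornerM !hornerXsubC.
have := Dminus_curve t y Db; have := prodX_curve t y hq'.
by move=> x10 l0; field; rewrite x10 l0.
Qed.

Lemma ae_point (P : R -> Prop) (a b : R) : a < b -> {ae @lebesgue_measure R, forall y, P y} ->
  exists2 y, a < y < b & P y.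
Proof.
move=> ab [B [mB B0 PB]]; apply: contrapT => H.
have sub : `]a, b[%classic `<=` B.
  move=> y /=; rewrite in_itv /= => yab; apply: PB => /= Py; apply: H; by exists y.
have := @le_measure _ _ _ (@lebesgue_measure R) `]a, b[%classic B.
rewrite !inE => /(_ (measurable_itv _) mB sub).
have E : @lebesgue_measure R (`]a, b[%classic : set R) = (b - a)%:E.
  by rewrite lebesgue_measure_itv /= lte_fin ab.
move=> h; have : ((b - a)%:E <= 0 :> \bar R)%E by rewrite -E -B0; exact: h.
by rewrite lee_fin subr_le0 leNgt ab.
Qed.

(** An open interval is not a null set, so each []k, k+1[] contains the ordinate of a zero: too many
    for a non-zero polynomial. *)
Lemma poly_ae0 (p : {poly C}) : {ae @lebesgue_measure R, forall y, p.[gam true y] = 0} -> p = 0.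
Proof.
move=> H; apply: contrapT => /eqP p0.
have pt (k : nat) : exists y, k%:R < y < k.+1%:R /\ p.[gam true y] = 0.
  have [|y yk py] := ae_point (a := k%:R) (b := k.+1%:R) _ H; first by rewrite ltr_nat.
  by exists y.
pose yy k := projT1 (cid (pt k)).
have yyP k : k%:R < yy k < k.+1%:R /\ p.[gam true (yy k)] = 0 by exact: (projT2 (cid (pt k))).
pose rs := [seq gam true (yy k) | k <- iota 0 (size p)].
have ur : uniq rs.
  rewrite map_inj_uniq ?iota_uniq // => i j /(congr1 (@complex.Im _)); rewrite !Im_gam => E.
  have [/andP[i1 i2] _] := yyP i; have [/andP[j1 j2] _] := yyP j; rewrite E in i1 i2.
  have h1 : (i < j.+1)%N by rewrite -(ltr_nat R); exact: lt_trans i1 j2.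
  have h2 : (j < i.+1)%N by rewrite -(ltr_nat R); exact: lt_trans j1 i2.
  by apply/eqP; rewrite eqn_leq -ltnS h1 -ltnS h2.
have ar : all (root p) rs.
  by apply/allP => _ /mapP[k _ ->]; apply/eqP; have [_] := yyP k.
by have := max_poly_roots p0 ar ur; rewrite size_map size_iota ltnn.
Qed.

Let a := m_symbol m.
Let c := m_ratio m.
Let scm := m_ratio_sc hC hI hL hm hM2.
Let sa1 : sc L a.1. Proof. exact: (sc_cst hC). Qed.
Let sa2 : sc L a.2. Proof. exact: scm. Qed.
Let dq := m_even_dec hC hI hL hm hM2.
Let diq := m_even_inv_dec hC hI hL hm hM1 hM2.
Let scq := m_even_inv_sc hC hI hL hm hM1 hM2.
Let q0 := m_even_curve hC hI hM1.

Section Tau.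
Variables (k : nat) (ps qs : seq C) (c0 : C) (p q : {poly C}) (DR QR rhoD rhoQ : {poly R}) (hD hQ : C -> C).
Hypothesis c00 : c0 != 0.
Hypotheses (psk : size ps = k) (qsk : size qs = k).
Hypothesis psD : forall z, z \in ps -> Dminus omega z.
Hypothesis qsD : forall z, z \in qs -> Dminus omega z.
Hypothesis rE : forall z, ratfun p q z = c0 * ((prodX ps).[z] / (prodX qs).[z]).
(** Adding the reflected zeros makes the denominator [D], proportional to [p(z) p(-z)], even, so
    that the parity decomposition of [U / D] is that of U. *)
Let ms := [seq - z | z <- ps].
Hypothesis iD : interpolates (ps ++ ms) DR rhoD hD.
Hypothesis iQ : interpolates (qs ++ ms) QR rhoQ hQ.
Let n := (k + k)%N.
Let r := ratfun p q.
Let ra := vsymbol_scale r a.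
Let D := map_poly RC DR.
Let Q := map_poly RC QR.
Let Xp : 'M[C]_n := xmat n D (map_poly RC rhoD).
Let Xq : 'M[C]_n := xmat n Q (map_poly RC rhoQ).

Let prod_cat s t : prodX (s ++ t) = prodX s * prodX t.
Proof. by rewrite /prodX big_cat. Qed.

Let DE : D = prodX ps * prodX ms. Proof. by rewrite /D; have [_ -> _ _ _] := iD; rewrite prod_cat. Qed.
Let QE : Q = prodX qs * prodX ms. Proof. by rewrite /Q; have [_ -> _ _ _] := iQ; rewrite prod_cat. Qed.

Let sizeD : size (ps ++ ms) = n. Proof. by rewrite size_cat size_map psk. Qed.
Let sizeQ : size (qs ++ ms) = n. Proof. by rewrite size_cat size_map psk qsk. Qed.

Let msD z : z \in ms -> Dminus omega z.
Proof. by move=> /mapP[w /psD]; rewrite /Dminus /= => h ->; rewrite ReN ImN normrN (rc_even hC). Qed.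

Let nzp t y : (prodX ps).[gam t y] != 0. Proof. exact: prodX_curve. Qed.
Let nzq t y : (prodX qs).[gam t y] != 0. Proof. exact: prodX_curve. Qed.
Let nzm t y : (prodX ms).[gam t y] != 0. Proof. exact: prodX_curve. Qed.
Let nzD t y : D.[gam t y] != 0. Proof. by rewrite DE hornerM mulf_neq0. Qed.

Let D_even z : D.[- z] = D.[z].
Proof.
rewrite DE !hornerM mulrC /prodX !horner_prod !big_map -!big_split /=; apply: eq_bigr => b _.
by rewrite !hornerXsubC; ring.
Qed.

Let sD : size D = n.+1. Proof. by rewrite /D; have [_ -> _ _ _] := iD; rewrite size_prodX sizeD. Qed.
Let D0 : D != 0. Proof. by rewrite -size_poly_gt0 sD. Qed.

Let rE' t y : r (gam t y) != 0.
Proof. by rewrite /r rE !mulf_neq0 ?invr_eq0. Qed.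

Let dr : dec true 0 r.
Proof.
have d1 : dec true 0 (ratfun (prodX ps) (prodX qs)).
  apply: (dec_ratfun hC (prodX_neq0 qs)) => [z bz|]; last by rewrite addn0 !size_prodX psk qsk.
  apply/negP => rz; have /(nsideP omega true) := prodX_root qsD (eqP rz); exact.
by apply: dec_eq (dec_scale c0 d1) => z; rewrite /r rE.
Qed.

Let sr1 : sc L ra.1.
Proof. exact: (sc_mul hC (sc_dec hC L dr) sa1). Qed.
Let sr2 : sc L ra.2.
Proof. exact: (sc_mul hC (sc_dec hC L dr) sa2). Qed.

Let bf (u : 'rV[C]_n) (l : C) : C := (rVpoly u).[l] / D.[l].

Let bf_hn u : hn L (bf u).
Proof.
apply: (hs_hn hC); apply: (hs_dec hC).
apply: (dec_ratfun hC D0) => [z bz|]; last by rewrite addn1 sD ltnS size_poly.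
apply/negP => rz; have : root (prodX (ps ++ ms)) z by rewrite prod_cat -DE.
rewrite root_prod_XsubC mem_cat => zz; apply: (proj2 (nsideP omega true z)) bz.
by case/orP: zz; [exact: psD | exact: msD].
Qed.

Let act_bf u t y : vsymbol_act a (bf u) (gam t y) =
  ((evp u).[gam t y] + m (gam t y) * (odp u).[gam t y]) / D.[gam t y].
Proof.
have l0 := gam_neq0 hC t y; have d0 := nzD t y.
rewrite /vsymbol_act /even_part /odd_part /bf D_even !rVpoly_parts !hornerD !hornerM !hornerX.
rewrite horner_evpN horner_odpN /a /=.
move: (gam t y) (evp u).[_] (odp u).[_] (m _) D.[_] l0 d0 => l x1 x2 x3 x4 l0 d0.
by field; rewrite l0 d0.
Qed.

Let key1 u : hs false (fun l => vsymbol_act a (bf u) l - bf (u *m Xp) l).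
Proof.
have := residual_hs iD sizeD u; apply: hs_eq => t y.
by rewrite act_bf /residual /bf -mulrBl.
Qed.

(** [r / D] is [c0 / Q]: in the denominator r trades the zeros of p for those of q, and
    [residual_hs] for Q applies. *)
Let key2 u : hs false (fun l => vsymbol_act ra (bf u) l - r l * bf (u *m Xq) l).
Proof.
have := hs_scale hC c0 (residual_hs iQ sizeQ u); apply: hs_eq => t y.
have -> : vsymbol_act ra (bf u) (gam t y) = r (gam t y) * vsymbol_act a (bf u) (gam t y).
  by rewrite /vsymbol_act /ra /vsymbol_scale /=; ring.
rewrite act_bf /residual /res_num /bf -/Q -/Xq QE DE /r rE !hornerM.
have := nzp t y; have := nzq t y; have := nzm t y.
move: (prodX ps).[_] (prodX qs).[_] (prodX ms).[_] (evp u).[_] (odp u).[_] (m _) (rVpoly _).[_].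
move=> x1 x2 x3 x4 x5 x6 x7 h1 h2 h3; field.
by rewrite h1 h2 h3.
Qed.

Let bf_eq0 u : eq_curve omega (bf u) (fun=> 0) -> u = 0.
Proof.
move=> /(_ true) H; rewrite -[u]rVpolyK (_ : rVpoly u = 0) ?linear0 //.
apply: poly_ae0; apply: (ae_mono H) => y /eqP; rewrite /bf mulf_eq0 invr_eq0 (negbTE (nzD true y)) orbF.
by move/eqP.
Qed.

Let usol u u' w : hn L u -> hn L u' -> hn L w -> hs false (fun l => vsymbol_act a u l - w l) ->
  hs false (fun l => vsymbol_act a u' l - w l) -> eq_curve omega u u'.
Proof. by move=> hu hu' hw h h'; exact: (@inv_solution _ _ _ hC hH L c diq q0 u w hu hw h u' hu' h'). Qed.

(** By [key1] a row in the kernel gives a function [bf u] that T(m) sends to zero, so it vanishes by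
    [inv_unique]. *)
Let Xp_unit : Xp \in unitmx.
Proof.
have H (u : 'rV[C]_n) : u *m Xp = 0 -> u = 0.
  move=> uX; apply: bf_eq0; apply: (@inv_unique _ _ _ hC hH L c diq q0 _ (bf_hn u)).
  have := key1 u; rewrite uX; apply: hs_eq => t y.
  by rewrite /bf linear0 horner0 mul0r subr0.
rewrite -row_free_unit -kermx_eq0; apply/eqP/row_matrixP => i; rewrite row0; apply: H.
by rewrite -row_mul mulmx_ker row0.
Qed.

Let act_ae b u v : eq_curve omega u v -> eq_curve omega (vsymbol_act b u) (vsymbol_act b v).
Proof.
move=> E; have Eo := eq_curve_opp (rc_even hC) E.
move=> s; apply: (ae_mono2 (E s) (Eo s)) => y e1 e2.
by rewrite /vsymbol_act /even_part /odd_part e1 e2.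
Qed.

Let tauP w x : hn L w -> tau_operator omega L a r w x -> exists u v,
  [/\ hn L u, hn L v, hs false (fun l => vsymbol_act a u l - w l),
      hs false (fun l => vsymbol_act ra u l - v l) & eq_curve omega x (fun l => (r l)^-1 * v l)].
Proof.
move=> hw [u [v [/(hardyNP hC hH) hu tu /(hardyNP hC hH) hv tv E]]]; exists u, v; split=> //.
  exact/(vtP hC hH sa1 sa2 hu hw).
exact/(vtP hC hH sr1 sr2 hu hv).
Qed.

Let rVpoly_row (cf : 'I_n -> C) l : bf (\row_i cf i) l = \sum_i cf i * bf (delta_mx 0 i) l.
Proof.
rewrite /bf rVpoly_sum horner_sum mulr_suml; apply: eq_bigr => i _.
by rewrite mxE hornerZ rVpoly_delta !hornerXn mulrA.
Qed.

(** By [key1] and [key2] the operator acts on the functions [bf u] as first the inverse of [Xp],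
    then [Xq]; rows act from the left, hence the order of the product. *)
Lemma tau_exists : is_tau omega L (m_symbol m) r (\det Xq / \det Xp).
Proof.
exists n, (fun i => bf (delta_mx 0 i)), (invmx Xp *m Xq); split.
- by move=> i; apply/(hardyNP hC hH); exact: bf_hn.
- move=> cf H i.
  have : \row_i cf i = 0.
    apply: bf_eq0; apply: eq_curve_trans H; apply: eq_curve_on => l _; exact: rVpoly_row.
  by move=> /rowP /(_ i); rewrite !mxE.
- move=> w /(hardyNP hC hH) hw.
  have [K _ H] := @inv_exists _ _ _ hC hH L c scm dq scq q0.
  have [u [hu mu _]] := H w hw; have [v hv mv] := vt_exists hC hH sr1 sr2 hu.
  exists (fun l => (r l)^-1 * v l), u, v; split.
  + exact/(hardyNP hC hH).
  + exact/(vtP hC hH sa1 sa2 hu hw).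
  + exact/(hardyNP hC hH).
  + exact/(vtP hC hH sr1 sr2 hu hv).
  + exact: eq_curve_refl.
- move=> w x /(hardyNP hC hH) hw /(tauP hw)[u [v [hu hv mu mv E]]].
  (* Moving r past the element [m u - w] of H(D_-) costs [c0 P / prodX qs]; divided by r this is
     [P / prodX ps], that is [P prodX ms / D], which lies in the span. *)
  have [P [sP hP]] := hs_ratmul (etrans psk (esym qsk)) qsD mu.
  pose v' l := r l * w l + r l * bf (poly_rV (P * prodX ms)) l.
  have hv' : hn L v' by apply: (hn_add hC); apply: (hn_mul hC dr).
  have sPm : (size ((P * prodX ms)%R : {poly C}) <= n)%N.
    apply: leq_trans (size_polyMleq _ _) _; rewrite size_prodX size_map psk addnS /=.
    by rewrite leq_add2r -qsk.
  have mv' : hs false (fun l => vsymbol_act ra u l - v' l).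
    have := hs_scale hC c0 hP; apply: hs_eq => t y.
    have -> : vsymbol_act ra u (gam t y) = r (gam t y) * vsymbol_act a u (gam t y).
      by rewrite /vsymbol_act /ra /vsymbol_scale /=; ring.
    rewrite /v' /bf (poly_rV_K sPm) DE /r rE !hornerM.
    have := nzp t y; have := nzq t y; have := nzm t y.
    move: (prodX ps).[_] (prodX qs).[_] (prodX ms).[_] (vsymbol_act _ _ _) (w _) P.[_].
    move=> x1 x2 x3 x4 x5 x6 h1 h2 h3; field.
    by rewrite h1 h2 h3.
  have vv' := toep_unique hC hH hv hv' (eq_curve_refl omega (vsymbol_act ra u)) mv mv'.
  exists (fun i => (poly_rV (P * prodX ms) : 'rV[C]_n) 0 i) => s.
  apply: (ae_mono2 (E s) (vv' s)) => y e1 e2; rewrite e1 e2 -rVpoly_row.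
  rewrite (_ : \row_i _ = poly_rV (P * prodX ms)); last by apply/rowP => i; rewrite mxE.
  have := rE' s y; rewrite /v'; move: (r _) (w _) (bf _ _) => x1 x2 x3 x10.
  by field.
split; last by rewrite det_mulmx det_inv mulrC.
move=> i x /(tauP (bf_hn _))[u [v [hu hv mu mv E]]].
pose u0 := bf (delta_mx 0 i *m invmx Xp).
have k1 := key1 (delta_mx 0 i *m invmx Xp); rewrite mulmxKV // in k1.
have k2 := key2 (delta_mx 0 i *m invmx Xp); rewrite -mulmxA in k2.
have uu0 := usol hu (bf_hn _) (bf_hn _) mu k1.
have vv := toep_unique hC hH hv (hn_mul hC dr (bf_hn _)) (act_ae ra uu0) mv k2.
move=> s; apply: (ae_mono2 (E s) (vv s)) => y e1 e2; rewrite e1 e2.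
rewrite mulKf ?rE' // -(rVpoly_row (fun j => (invmx Xp *m Xq) i j)).
congr (bf _ _); rewrite -rowE; by apply/rowP => j; rewrite !mxE.
Qed.

Lemma tau_nonneg : 0 <= \det (xmat n DR rhoD) -> 0 <= \det (xmat n QR rhoQ) ->
  exists2 t, is_tau omega L (m_symbol m) r t & 0 <= t.
Proof.
move=> hp hq; exists (\det Xq / \det Xp); first exact: tau_exists.
have E n' (A rho : {poly R}) : \det (xmat n' (map_poly RC A) (map_poly RC rho)) = (\det (xmat n' A rho))%:C.
  by rewrite -map_xmat det_map_mx.
by rewrite /Xq /Xp !E divr_ge0 // lecE /= eqxx.
Qed.

End Tau.
End TauOperator.

(** * Positivity of the determinants *)

Section ClosedSets.
Context {R : realType}.
Local Notation C := R[i].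

Definition clset (A : set C) := forall z, ~ A z ->
  exists2 d : R, 0 < d & forall w, A w -> d <= normc (w - z).

Lemma clset_ge0 (f : C -> C) : (forall z, ccont f z) -> clset [set z | 0 <= complex.Re (f z)].
Proof.
move=> hf z /= /negP; rewrite -ltNge => lt0.
have [|r r0 h] := hf z (- complex.Re (f z)); first by rewrite oppr_gt0.
exists r => // w w0; rewrite leNgt; apply/negP => /h; rewrite [z + _]addrC subrK => h1.
have := le_lt_trans (ler_normRe _) h1; rewrite ReD ReN; have := ler_norm (complex.Re (f w) - complex.Re (f z)).
by move: w0; lra.
Qed.

Lemma clset_le_normc (rho : R) : clset [set z | normc z <= rho].
Proof.
move=> z /= /negP; rewrite -ltNge => lt; exists (normc z - rho); first by rewrite subr_gt0.
by move=> w hw; have := normc_tri z w; rewrite normc_distC; lra.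
Qed.

Lemma clsetI A B : clset A -> clset B -> clset (A `&` B).
Proof.
move=> hA hB z nAB; have [Az|/hA[d d0 h]] := pselect (A z); last by exists d => // w [/h].
by have [Bz|/hB[d d0 h]] := pselect (B z); [case: nAB | exists d => // w [_ /h]].
Qed.

Lemma ccont_add (f g : C -> C) z : ccont f z -> ccont g z -> ccont (fun w => f w + g w) z.
Proof.
move=> hf hg e e0; have e2 : 0 < e / 2 by rewrite divr_gt0.
have [r r0 h1] := hf _ e2; have [r' r'0 h2] := hg _ e2.
exists (Num.min r r') => [|h]; rewrite lt_min ?r0 // => /andP[/h1 l1 /h2 l2].
rewrite opprD addrACA; apply: le_lt_trans (le_normcD _ _) _; lra.
Qed.

Lemma ccont_Re (z : C) : ccont (fun w => (complex.Re w)%:C) z.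
Proof.
move=> e e0; exists e => // h he; rewrite ReD -raddfB addrAC subrr add0r normc_real.
exact: le_lt_trans (ler_normRe _) he.
Qed.

Lemma ccont_Im (z : C) : ccont (fun w => (complex.Im w)%:C) z.
Proof.
move=> e e0; exists e => // h he; rewrite ImD -raddfB addrAC subrr add0r normc_real.
exact: le_lt_trans (ler_normIm _) he.
Qed.

Lemma ccont_comp (f g : C -> C) z : ccont g z -> ccont f (g z) -> ccont (fun w => f (g w)) z.
Proof.
move=> hg hf e /hf[r /hg[r' r'0 h] hf']; exists r' => // k /h.
by rewrite -{2}(subrK (g z) (g (z + k))) addrC => /hf'; rewrite [g z + _]addrC.
Qed.

Lemma cdiff_quot (f q : C -> C) z r : 0 < r -> ccont q z ->
  (forall h, normc h < r -> f (z + h) - f z = h * q (z + h)) -> cdiff f z.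
Proof.
move=> r0 hq E; exists (q z) => e /hq[r' r'0 h]; exists (Num.min r r'); first by rewrite lt_min r0.
move=> k; rewrite lt_min => /andP[/E-> /h lt].
by rewrite [q z * _]mulrC -mulrBr normcM mulrC ler_wpM2r ?normc_ge0 // ltW.
Qed.

End ClosedSets.

(** * The variable s on the right half plane and the squeezing map *)

Section HalfPlane.
Context {R : realType}.
Local Notation C := R[i].

Lemma Re_sqrtc_ge0 (z : C) : 0 <= complex.Re (sqrtc z).
Proof. by case: z => a b /=; rewrite sqrtr_ge0. Qed.

Variable mu0 : R.

(** The inverse of [s = sqrt (z^2 - mu0^2)]. It sends [Re w > 0] into the right half plane without
    the slit up to mu0, so that both [zet w] and [- zet w] are in the domain of m ([zet_dom]). *)
Definition zet (w : C) : C := sqrtc (w ^+ 2 + (mu0 ^+ 2)%:C).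

Lemma zet_sqr w : zet w ^+ 2 = w ^+ 2 + (mu0 ^+ 2)%:C. Proof. exact: sqr_sqrtc. Qed.

Lemma zet_ReIm w : 0 <= complex.Re (zet w) /\
  complex.Re (zet w) ^+ 2 - complex.Im (zet w) ^+ 2 = complex.Re w ^+ 2 - complex.Im w ^+ 2 + mu0 ^+ 2 /\
  complex.Re (zet w) * complex.Im (zet w) = complex.Re w * complex.Im w.
Proof.
split; first exact: Re_sqrtc_ge0.
have := zet_sqr w; case: (zet w) => X Y; case: w => x y; rewrite !expr2.
move=> E; have := congr1 (@complex.Re _) E; have := congr1 (@complex.Im _) E.
by rewrite !(ReD, ImD, ReM, ImM) /= addr0 => h2 h1; split; lra.
Qed.

(** If [X < x], the first equation gives [Y^2 < y^2] as well, against [X Y = x y]. *)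
Lemma zet_aux (X Y x y u : R) : 0 < x -> 0 <= X -> X ^+ 2 - Y ^+ 2 = x ^+ 2 - y ^+ 2 + u ^+ 2 ->
  X * Y = x * y -> x <= X.
Proof.
move=> x0 X0 E1 E2; rewrite leNgt; apply/negP => lt.
have h1 : X ^+ 2 < x ^+ 2 by rewrite ltr_pXn2r ?nnegrE ?(ltW x0).
have u0 := sqr_ge0 u; have Y0 := sqr_ge0 Y.
have h2 : Y ^+ 2 < y ^+ 2 by lra.
have : X ^+ 2 * Y ^+ 2 < x ^+ 2 * y ^+ 2.
  apply: le_lt_trans (_ : x ^+ 2 * Y ^+ 2 < _); first by rewrite ler_wpM2r // ltW.
  by rewrite ltr_pM2l // exprn_gt0.
by rewrite -!exprMn E2 ltxx.
Qed.

Lemma Re_zet w : 0 < complex.Re w -> complex.Re w <= complex.Re (zet w).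
Proof. by move=> w0; have [h0 [h1 h2]] := zet_ReIm w; exact: zet_aux h1 h2. Qed.

Lemma Re_zet_gt0 w : 0 < complex.Re w -> 0 < complex.Re (zet w).
Proof. by move=> w0; apply: lt_le_trans (Re_zet w0). Qed.

Lemma Im_zet_sign e w : 0 < complex.Re w -> 0 < e * complex.Im w -> 0 < e * complex.Im (zet w).
Proof.
move=> w0 h; have [_ [_ E]] := zet_ReIm w; have z0 := Re_zet_gt0 w0.
by rewrite -(pmulr_rgt0 _ z0) mulrCA E mulrCA mulr_gt0.
Qed.

Lemma zet_dom w : 0 < complex.Re w -> m_domain mu0 (zet w) /\ m_domain mu0 (- zet w).
Proof.
move=> w0; have z0 := Re_zet_gt0 w0.
have H : ~ (complex.Im (zet w) = 0 /\ `|complex.Re (zet w)| <= mu0).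
  move=> [I0]; rewrite gtr0_norm // => le; have [_ [E1 E2]] := zet_ReIm w.
  move: E2; rewrite I0 mulr0 => /esym/eqP; rewrite mulf_eq0 (gt_eqF w0) /= => /eqP y0.
  move: E1; rewrite I0 y0 expr0n /= !subr0 => E1.
  have : complex.Re (zet w) ^+ 2 <= mu0 ^+ 2 by rewrite ler_pXn2r ?nnegrE ?(ltW z0) // (le_trans (ltW z0)).
  by rewrite E1; have := exprn_gt0 2 w0; lra.
split; split; rewrite ?ReN ?ImN ?oppr_eq0 ?gt_eqF // normrN => -[h1 h2]; apply: H.
by split=> //; apply/eqP; rewrite -oppr_eq0 h1.
Qed.

Lemma zet_sub v w : (zet v - zet w) * (zet v + zet w) = (v - w) * (v + w).
Proof.
have -> : (zet v - zet w) * (zet v + zet w) = zet v ^+ 2 - zet w ^+ 2 by ring.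
by rewrite !zet_sqr; ring.
Qed.

Lemma zet_sum_neq0 v w : 0 < complex.Re w -> zet v + zet w != 0.
Proof.
move=> w0; apply/eqP => /(congr1 (@complex.Re _)); rewrite ReD /=.
by have [h _] := zet_ReIm v; have := Re_zet_gt0 w0; lra.
Qed.

Lemma ccont_zet w : 0 < complex.Re w -> ccont zet w.
Proof.
move=> w0 e e0; set D := complex.Re (zet w).
have D0 : 0 < D by exact: Re_zet_gt0.
have n0 : 0 < 1 + normc (w + w) by rewrite ltr_wpDr ?normc_ge0.
exists (Num.min 1 (e * D / (1 + normc (w + w)))).
  by rewrite lt_min ltr01 divr_gt0 ?mulr_gt0.
move=> h; rewrite lt_min => /andP[h1]; rewrite ltr_pdivlMr // => h2.
have E := zet_sub (w + h) w; rewrite [w + h - w]addrAC subrr add0r in E.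
have D' : D <= normc (zet (w + h) + zet w).
  apply: le_trans (ler_normRe _); rewrite ReD; have [h3 _] := zet_ReIm (w + h).
  by apply: le_trans (ler_norm _); rewrite lerDr.
have := congr1 (@normc R) E; rewrite !normcM => E'.
have l1 : normc (w + h + w) <= 1 + normc (w + w).
  by rewrite addrAC; apply: le_trans (le_normcD _ _) _; rewrite addrC lerD2r ltW.
have l2 : normc (zet (w + h) - zet w) * D < e * D.
  apply: le_lt_trans h2; apply: le_trans (_ : normc (zet (w + h) - zet w) * normc (zet (w + h) + zet w) <= _).
    by rewrite ler_wpM2l ?normc_ge0.
  by rewrite E' ler_wpM2l ?normc_ge0.
by move: l2; rewrite ltr_pM2r.
Qed.

(** The difference quotient is read off the factorization [zet_sub], as the sum of two values does
    not vanish when the real part of one is positive. *)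
Lemma cdiff_zet w : 0 < complex.Re w -> cdiff zet w.
Proof.
move=> w0; apply: (@cdiff_quot _ _ (fun v => (v + w) / (zet v + zet w)) _ 1) => //.
  apply: ccont_mul; first by apply/cdiff_ccont/cdiff_add; [exact: cdiff_id | exact: cdiff_cst].
  apply: (@ccont_comp _ (fun v => v^-1) (fun v => zet v + zet w)).
    by apply: ccont_add; [exact: ccont_zet | exact/cdiff_ccont/cdiff_cst].
  by apply/cdiff_ccont/cdiff_inv; [exact: cdiff_id | exact: zet_sum_neq0].
move=> h _; have := zet_sub (w + h) w; rewrite [w + h - w]addrAC subrr add0r => E.
by rewrite mulrA -E mulfK // zet_sum_neq0.
Qed.

Lemma normc_zet_sqr w : normc (zet w) ^+ 2 = normc (w ^+ 2 + (mu0 ^+ 2)%:C).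
Proof. by rewrite -normcX zet_sqr. Qed.

Lemma normc_zet w : 0 <= mu0 -> normc (zet w) <= normc w + mu0 /\ normc w <= normc (zet w) + mu0.
Proof.
move=> m0; have a0 := normc_ge0 (zet w); have b0 := normc_ge0 w.
have E : normc (mu0 ^+ 2)%:C = mu0 ^+ 2 by rewrite normc_real ger0_norm ?sqr_ge0.
split; rewrite -(ler_pXn2r (_ : 0 < 2)%N) ?nnegrE ?addr_ge0 //.
  rewrite normc_zet_sqr; apply: le_trans (le_normcD _ _) _; rewrite E normcX; nra.
rewrite -normcX (_ : w ^+ 2 = zet w ^+ 2 - (mu0 ^+ 2)%:C); last by rewrite zet_sqr addrK.
by apply: le_trans (normcB _ _) _; rewrite E normcX; nra.
Qed.

(* Maps the closed right half plane into a compact subset of the open one. *)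
Definition squeeze (d : R) (s : C) : C := (s + d%:C) / (1 + d%:C * s).

Variable d : R.
Hypotheses (d0 : 0 < d) (d1 : 2 * d <= 1).

Let dd : 2 * d ^+ 2 <= 1.
Proof. by move: d0 d1; rewrite expr2; nra. Qed.

Definition sq_den (x y : R) := (1 + d * x) ^+ 2 + (d * y) ^+ 2.

Lemma sq_den_ge1 (x y : R) : 0 <= x -> 1 + 2 * d * x + d ^+ 2 * x ^+ 2 + d ^+ 2 * y ^+ 2 = sq_den x y /\ 1 <= sq_den x y.
Proof.
move=> x0; have dx : 0 <= d * x by rewrite mulr_ge0 // ltW.
rewrite /sq_den; split; first by ring.
by have := sqr_ge0 (d * y); nra.
Qed.

Lemma normc_den s : normc (1 + d%:C * s) ^+ 2 = sq_den (complex.Re s) (complex.Im s).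
Proof. by rewrite normc_sqr ReD ImD ReM ImM /= !mul0r subr0 add0r addr0. Qed.

Lemma den_ge1 s : 0 <= complex.Re s -> 1 <= normc (1 + d%:C * s).
Proof.
move=> s0; have [_ h] := sq_den_ge1 (complex.Im s) s0.
by rewrite -(ler_pXn2r (_ : 0 < 2)%N) ?nnegrE ?normc_ge0 // normc_den expr1n.
Qed.

Lemma den_neq0 s : 0 <= complex.Re s -> 1 + d%:C * s != 0.
Proof. by move=> s0; rewrite -normc_gt0 (lt_le_trans ltr01 (den_ge1 s0)). Qed.

Lemma squeezeE s : 0 <= complex.Re s -> squeeze d s =
  ((complex.Re s * (1 + d ^+ 2) + d + d * (complex.Re s ^+ 2 + complex.Im s ^+ 2)) / sq_den (complex.Re s) (complex.Im s)) +i*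
  ((complex.Im s * (1 - d ^+ 2)) / sq_den (complex.Re s) (complex.Im s)).
Proof.
move=> s0; apply: (mulIf (den_neq0 s0)); rewrite /squeeze divfK ?den_neq0 //.
have [_] := sq_den_ge1 (complex.Im s) s0.
case: s s0 => x y /= x0; rewrite /sq_den => D1.
have D0 : (1 + d * x) ^+ 2 + (d * y) ^+ 2 != 0 by rewrite gt_eqF // (lt_le_trans ltr01 D1).
apply: complexP; rewrite !(ReD, ImD, ReM, ImM) /=; field; exact: D0.
Qed.

Lemma Re_squeeze s : 0 <= complex.Re s -> d <= complex.Re (squeeze d s).
Proof.
move=> s0; rewrite squeezeE //=; have [<- D1] := sq_den_ge1 (complex.Im s) s0.
move: (complex.Re s) (complex.Im s) s0 D1 => x y x0 _.
have q0 : 0 <= d ^+ 2 * y ^+ 2 by rewrite mulr_ge0 ?sqr_ge0.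
have dx : 0 <= d * x by rewrite mulr_ge0 // ltW.
have q1 : 0 <= d ^+ 2 * x ^+ 2 by rewrite mulr_ge0 ?sqr_ge0.
rewrite ler_pdivlMr; last by lra.
have -> : d * (1 + 2 * d * x + d ^+ 2 * x ^+ 2 + d ^+ 2 * y ^+ 2) =
  x * (1 + d ^+ 2) + d + d * (x ^+ 2 + y ^+ 2) - (1 - d ^+ 2) * (x + d * (x ^+ 2 + y ^+ 2)) by ring.
rewrite gerBl mulr_ge0 //; first by move: dd; lra.
by rewrite addr_ge0 // mulr_ge0 ?addr_ge0 ?sqr_ge0 // ltW.
Qed.

Lemma normc_squeeze s : 0 <= complex.Re s -> normc (squeeze d s) <= d^-1.
Proof.
move=> s0; rewrite /squeeze normcM normcV ler_pdivrMr ?(lt_le_trans ltr01 (den_ge1 s0)) //.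
rewrite -(ler_pM2l d0) mulrA divff ?gt_eqF // mul1r.
rewrite -(ler_pXn2r (_ : 0 < 2)%N) ?nnegrE ?mulr_ge0 ?normc_ge0 ?(ltW d0) //.
rewrite normc_den exprMn normc_sqr ReD ImD /= addr0.
have [<- _] := sq_den_ge1 (complex.Im s) s0.
move: (complex.Re s) (complex.Im s) s0 => x y x0.
have dx : 0 <= d * x by rewrite mulr_ge0 // ltW.
have -> : d ^+ 2 * ((x + d) ^+ 2 + y ^+ 2) = d ^+ 2 * d ^+ 2 + d ^+ 2 * (2 * d * x) + d ^+ 2 * x ^+ 2 + d ^+ 2 * y ^+ 2 by ring.
rewrite !lerD2r lerD //; have := sqr_ge0 d; move: dd dx; nra.
Qed.

Lemma normc_squeeze_le s : 0 <= complex.Re s -> normc (squeeze d s) <= normc s + 1.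
Proof.
move=> s0; rewrite /squeeze normcM normcV ler_pdivrMr ?(lt_le_trans ltr01 (den_ge1 s0)) //.
apply: le_trans (_ : normc s + 1 <= _).
  by apply: le_trans (le_normcD _ _) _; rewrite lerD2l normc_real gtr0_norm //; move: d1 d0; lra.
by apply: ler_peMr (den_ge1 s0); rewrite addr_ge0 ?normc_ge0.
Qed.

Lemma squeeze_close s : 0 <= complex.Re s -> normc (squeeze d s - s) <= d * (1 + normc s ^+ 2).
Proof.
move=> s0; have -> : squeeze d s - s = d%:C * (1 - s ^+ 2) / (1 + d%:C * s).
  by rewrite /squeeze; field; exact: den_neq0.
rewrite !normcM normcV ler_pdivrMr ?(lt_le_trans ltr01 (den_ge1 s0)) // normc_real gtr0_norm //.
apply: le_trans (_ : d * (1 + normc s ^+ 2) <= _).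
  by rewrite ler_pM2l //; apply: le_trans (normcB _ _) _; rewrite normc1 normcX.
by apply: ler_peMr (den_ge1 s0); rewrite mulr_ge0 ?addr_ge0 ?sqr_ge0 // ltW.
Qed.

(** The region to the right of the parabola is stable under squeezing. The growth bounds of the
    branches there thus hold at [squeeze d s] uniformly in d, which provides the majorant for the
    limit d -> 0. *)
Lemma squeeze_parabola c0 s : 0 < c0 -> 2 * c0 <= 1 -> 0 <= complex.Re s ->
  c0 * (1 + complex.Im s ^+ 2) <= complex.Re s ->
  c0 * (1 + complex.Im (squeeze d s) ^+ 2) <= complex.Re (squeeze d s).
Proof.
move=> c00 c01 s0; rewrite squeezeE //=; have [<-] := sq_den_ge1 (complex.Im s) s0.
move: (complex.Re s) (complex.Im s) s0 => x y x0.
set D := (X in 1 <= X) => D1 h.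
have D0 : 0 < D by exact: lt_le_trans D1.
have e1 : (y * (1 - d ^+ 2)) ^+ 2 <= y ^+ 2.
  rewrite exprMn -[leRHS]mulr1 ler_wpM2l ?sqr_ge0 // expr2.
  by have := sqr_ge0 d; move: dd; nra.
have e2 : (y * (1 - d ^+ 2) / D) ^+ 2 * D <= y ^+ 2.
  have -> : (y * (1 - d ^+ 2) / D) ^+ 2 * D = (y * (1 - d ^+ 2)) ^+ 2 / D by field; rewrite gt_eqF.
  rewrite ler_pdivrMr //; apply: le_trans e1 _; by apply: ler_peMr D1; exact: sqr_ge0.
rewrite ler_pdivlMr // -[c0 * _ * D]mulrA [(1 + _) * D]mulrDl mul1r.
apply: le_trans (_ : c0 * (D + y ^+ 2) <= _); first by rewrite ler_pM2l // lerD2l.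
have q1 : c0 * (d ^+ 2 * (x ^+ 2 + y ^+ 2)) <= 2^-1 * (d * (x ^+ 2 + y ^+ 2)).
  have n0 : 0 <= x ^+ 2 + y ^+ 2 by rewrite addr_ge0 ?sqr_ge0.
  apply: ler_pM; [exact: ltW | by rewrite mulr_ge0 ?sqr_ge0 | by lra |].
  by rewrite ler_wpM2r // expr2; move: d0 d1; nra.
have q2 : c0 * (2 * d * x) <= d * x.
  have -> : c0 * (2 * d * x) = (c0 * 2) * (d * x) by ring.
  apply: ler_piMl; [by rewrite mulr_ge0 // ltW | lra].
have q3 : 0 <= d * ((x - 1) ^+ 2 + 1 + y ^+ 2) by rewrite mulr_ge0 ?addr_ge0 ?sqr_ge0 // ltW.
have q4 : 0 <= x * d ^+ 2 by rewrite mulr_ge0 ?sqr_ge0.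
have -> : c0 * (D + y ^+ 2) = c0 * (1 + y ^+ 2) + c0 * (2 * d * x) + c0 * (d ^+ 2 * (x ^+ 2 + y ^+ 2)).
  by rewrite /D; ring.
move: (c0 * (1 + _)) (c0 * (2 * _ * _)) (c0 * (d ^+ 2 * _)) h q1 q2 => a1 a2 a3 h q1 q2.
nra.
Qed.

Lemma cdiff_squeeze s : 0 <= complex.Re s -> cdiff (squeeze d) s.
Proof.
move=> s0; apply: (@cdiff_div _ (fun s => s + d%:C) (fun s => 1 + d%:C * s) _ _ _ (den_neq0 s0)); first by apply: cdiff_add; [exact: cdiff_id | exact: cdiff_cst].
by apply: cdiff_add; [exact: cdiff_cst | apply: cdiff_mul; [exact: cdiff_cst | exact: cdiff_id]].
Qed.

(** Without squeezing, [zet] would be purely imaginary here with [Im^2 = y^2 - mu0^2 >= 4]; for d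
    this small the perturbation still leaves 1, uniformly in d. *)
Lemma Im_zet_squeeze (y : R) : 0 <= mu0 -> mu0 + 2 <= y -> y <= mu0 + 3 -> d * (1 + (mu0 + 3) ^+ 2) <= 8^-1 ->
  1 <= complex.Im (zet (squeeze d (0 +i* y))).
Proof.
move=> m0 y1 y2 hd; have y0 : 0 < y by lra.
have E := @squeezeE (0 +i* y) (lexx 0).
have [_ []] := zet_ReIm (squeeze d (0 +i* y)).
have w0 : 0 < complex.Re (squeeze d (0 +i* y)) by exact: lt_le_trans (Re_squeeze _).
have I0 : 0 < complex.Im (zet (squeeze d (0 +i* y))).
  rewrite -[complex.Im _]mul1r; apply: Im_zet_sign => //; rewrite mul1r E /= divr_gt0 //.
    by rewrite mulr_gt0 //; move: dd; lra.
  by rewrite (lt_le_trans ltr01) //; exact: (proj2 (sq_den_ge1 _ _)).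
move: (zet _) I0 => z I0; rewrite E /= /sq_den => E1 _.
suff : 1 <= complex.Im z ^+ 2 by move=> h; rewrite -(ler_pXn2r (_ : 0 < 2)%N) ?nnegrE ?expr1n // ltW.
have r2 := sqr_ge0 (complex.Re z).
rewrite !mul0r !mulr0 !add0r addr0 expr1n expr0n /= add0r in E1.
set D := 1 + (d * y) ^+ 2 in E1.
have D0 : 0 < D by rewrite ltr_pwDl // sqr_ge0.
pose a := d * y; pose b := d * (1 + y ^+ 2).
have b1 : b <= 8^-1 by apply: le_trans hd; rewrite ler_pM2l // lerD2l; nra.
have a0 : 0 <= a by rewrite mulr_ge0 ?ltW.
have b0 : 0 <= b by rewrite mulr_ge0 ?addr_ge0 ?sqr_ge0 ?ltW.
have ab : a <= b by rewrite /a /b ler_pM2l //; nra.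
have key : (mu0 ^+ 2 + 1) * D ^+ 2 <= (y * (1 - d ^+ 2)) ^+ 2 - b ^+ 2.
  have A : a ^+ 2 * (mu0 ^+ 2 + 1) <= b ^+ 2.
    have : a ^+ 2 * (mu0 ^+ 2 + 1) <= d ^+ 2 * (y ^+ 2 + 1) * (y ^+ 2 + 1).
      rewrite /a exprMn; apply: ler_pM.
      + by rewrite mulr_ge0 ?sqr_ge0.
      + by rewrite addr_ge0 ?sqr_ge0.
      + by rewrite ler_wpM2l ?sqr_ge0 // lerDl.
      + by rewrite lerD2r; nra.
    by move=> h; apply: (le_trans h); rewrite le_eqVlt; apply/orP; left; apply/eqP; rewrite /b; ring.
  have bb : b ^+ 2 <= 64^-1 by have := sqr_ge0 b; nra.
  have aa : a ^+ 2 <= 64^-1 by apply: le_trans bb; rewrite ler_pXn2r ?nnegrE.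
  have -> : D = 1 + a ^+ 2 by [].
  have -> : (y * (1 - d ^+ 2)) ^+ 2 = y ^+ 2 - 2 * a ^+ 2 + (d * a) ^+ 2 by rewrite /a; ring.
  have q1 : (mu0 ^+ 2 + 1) * (1 + a ^+ 2) ^+ 2 <= mu0 ^+ 2 + 1 + 3 * b ^+ 2.
    have -> : (mu0 ^+ 2 + 1) * (1 + a ^+ 2) ^+ 2 = mu0 ^+ 2 + 1 + (2 + a ^+ 2) * (a ^+ 2 * (mu0 ^+ 2 + 1)) by ring.
    have n1 := sqr_ge0 a; have n2 := sqr_ge0 mu0.
    by rewrite lerD2l; apply: ler_pM => //; [lra | rewrite mulr_ge0 //; lra | lra].
  have q2 : mu0 ^+ 2 + 4 <= y ^+ 2 by nra.
  have := sqr_ge0 (d * a); lra.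
have : complex.Im z ^+ 2 = complex.Re z ^+ 2 + ((y * (1 - d ^+ 2)) ^+ 2 - b ^+ 2) / D ^+ 2 - mu0 ^+ 2.
  have -> : ((y * (1 - d ^+ 2)) ^+ 2 - b ^+ 2) / D ^+ 2 = (y * (1 - d ^+ 2) / D) ^+ 2 - ((d + d * y ^+ 2) / D) ^+ 2.
    by rewrite /b; field; rewrite gt_eqF.
  by move: E1; lra.
move=> ->; have : mu0 ^+ 2 + 1 <= ((y * (1 - d ^+ 2)) ^+ 2 - b ^+ 2) / D ^+ 2.
  by rewrite ler_pdivlMr ?exprn_gt0.
by lra.
Qed.

End HalfPlane.

(** * The two branches N_+ and N_- of m(z) + t z *)

Section Branches.
Context {R : realType}.
Local Notation C := R[i].
Variables (omega : R -> R) (W mu0 : R).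
Hypothesis hC : regular_curve omega W.
Hypothesis hI : forall x : R, `|x| <= mu0 -> Dplus omega x%:C.
Hypothesis mu0_ge0 : 0 <= mu0.
Variables (L : nat) (m : C -> C).
Hypothesis hL : (2 <= L)%N.
Hypothesis hm : analytic_on (m_domain mu0) m.
Hypothesis hM1 : m_positivity mu0 m.
Hypothesis hM2 : m_asymptotics omega L m.
Variable t : R.
Hypothesis t0 : 0 < t.
Local Notation zet := (zet mu0).
Local Notation side := (side omega).

Definition mt (z : C) : C := m z + t%:C * z.
Definition npos (w : C) : C := mt (zet w).
Definition nneg (w : C) : C := - mt (- zet w).
Definition nsum (w : C) : C := npos w + nneg w.

Lemma cdiff_npos w : 0 < complex.Re w -> cdiff npos w.
Proof.
move=> w0; have [d1 _] := zet_dom mu0 w0; apply: (cdiff_comp (cdiff_zet _ w0)).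
apply: cdiff_add; first exact/derivable_cdiff/hm.
by apply: cdiff_mul; [exact: cdiff_cst | exact: cdiff_id].
Qed.

Lemma cdiff_nneg w : 0 < complex.Re w -> cdiff nneg w.
Proof.
move=> w0; have [_ d1] := zet_dom mu0 w0; apply: cdiff_opp.
apply: (@cdiff_comp _ mt (fun w => - zet w)); first exact/cdiff_opp/cdiff_zet.
apply: cdiff_add; first exact/derivable_cdiff/hm.
by apply: cdiff_mul; [exact: cdiff_cst | exact: cdiff_id].
Qed.

(** The multiplier [e] carries the sign of [Im w], so that both half planes are treated at once. The
    lower bound, linear in t, is what the summand t z adds to the Herglotz property. *)
Lemma Im_branches e w : 0 < complex.Re w -> 0 < e * complex.Im w ->
  t * (e * complex.Im (zet w)) <= e * complex.Im (npos w) /\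
  t * (e * complex.Im (zet w)) <= e * complex.Im (nneg w).
Proof.
move=> w0 ew; have ez := Im_zet_sign mu0 w0 ew; have rz := Re_zet_gt0 mu0 w0.
have i0 : complex.Im (zet w) != 0 by apply/eqP => E; move: ez; rewrite E mulr0 ltxx.
have H z : complex.Re z != 0 -> complex.Im z != 0 -> 0 < complex.Im (m z) * complex.Im z.
  move=> h1 h2; have := m_herglotz hM1 h1 h2; have : 0 < complex.Im z ^+ 2 by rewrite exprn_even_gt0.
  by move=> q /(mulr_gt0 q); rewrite (_ : _ * (_ / _) = complex.Im (m z) * complex.Im z) //; field.
have e0 : 0 < e ^+ 2 by rewrite exprn_even_gt0 //; apply/orP; right; apply/eqP => E; move: ew; rewrite E mul0r ltxx.
have := H (zet w) (lt0r_neq0 rz) i0; have := H (- zet w).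
rewrite ReN ImN !oppr_eq0 => /(_ (lt0r_neq0 rz) i0) h2 h1.
have -> : complex.Im (npos w) = complex.Im (m (zet w)) + t * complex.Im (zet w).
  by rewrite /npos /mt ImD ImM /= mul0r addr0.
have -> : complex.Im (nneg w) = - complex.Im (m (- zet w)) + t * complex.Im (zet w).
  by rewrite /nneg /mt ImN ImD ImM /= mul0r addr0 ImN mulrN opprB addrC.
rewrite !mulrDr.
split; rewrite [e * (t * _)]mulrCA lerDr.
  rewrite -(pmulr_lge0 _ ez); have := mulr_gt0 e0 h1; rewrite expr2; lra.
rewrite -(pmulr_lge0 _ ez); have := mulr_gt0 e0 h2; rewrite expr2; lra.
Qed.

(** Off the real axis both branches have imaginary part of the sign of [Im w]. On it [zet w] is real
    and beyond mu0, and (M.1) with t > 0 makes the real part of the sum positive. *)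
Lemma nsum_neq0 w : 0 < complex.Re w -> nsum w != 0.
Proof.
move=> w0; have [y0|y0] := eqVneq (complex.Im w) 0; last first.
  pose e := Num.sg (complex.Im w); have ew : 0 < e * complex.Im w by rewrite /e -normrEsg normr_gt0.
  have [h1 h2] := Im_branches w0 ew; have ez := mulr_gt0 t0 (Im_zet_sign mu0 w0 ew).
  apply/eqP => /(congr1 (fun z => e * complex.Im z)); rewrite /nsum ImD /= mulrDr mulr0; lra.
have rz := Re_zet_gt0 mu0 w0; have [_ [E1 E2]] := zet_ReIm mu0 w.
have z0 : complex.Im (zet w) = 0.
  by move: E2; rewrite y0 mulr0 => /eqP; rewrite mulf_eq0 (gt_eqF rz) => /eqP.
have [[_ hd] _] := zet_dom mu0 w0.
set x := complex.Re (zet w) in rz; have zE : zet w = x%:C by rewrite /x; case: (zet w) z0 => a b /= ->.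
have xm : mu0 < `|x| by rewrite ltNge; apply/negP => h; apply: hd.
have := m_real_axis hM1 xm; rewrite ltcE /= => /andP[_].
have -> : complex.Re ((m x%:C - m (- x)%:C) / x%:C) = complex.Re (m x%:C - m (- x)%:C) / x.
  by rewrite -fmorphV ReM /= mulr0 subr0.
rewrite pmulr_lgt0 ?invr_gt0 // => h.
apply/eqP => /(congr1 (@complex.Re _)); rewrite /nsum /npos /nneg /mt zE -rmorphN.
move: h; rewrite !(ReD, ReN, ReM) /=; have := mulr_gt0 t0 rz; lra.
Qed.

Definition branches_le K w := [/\ normc (npos w) <= K, normc (nneg w) <= K & normc (nsum w)^-1 <= K].

Lemma branches_bounded (A : set C) (r : R) : clset A -> (forall w, A w -> normc w <= r) ->
  (forall w, A w -> 0 < complex.Re w) -> exists2 K : R, 0 <= K & forall w, A w -> branches_le K w.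
Proof.
move=> clA hr hA.
have [|K1 K10 h1] := compact_bounded hr clA (f := npos); first by move=> w /hA /cdiff_npos /cdiff_ccont.
have [|K2 K20 h2] := compact_bounded hr clA (f := nneg); first by move=> w /hA /cdiff_nneg /cdiff_ccont.
have [|K3 K30 h3] := compact_bounded hr clA (f := fun w => (nsum w)^-1).
  move=> w /hA w0; apply/cdiff_ccont/cdiff_inv; last exact: nsum_neq0.
  by apply: cdiff_add; [exact: cdiff_npos | exact: cdiff_nneg].
exists (K1 + K2 + K3) => [|w Aw]; first by rewrite !addr_ge0.
by have := h1 w Aw; have := h2 w Aw; have := h3 w Aw; split; lra.
Qed.

(** To the right of the parabola, [|w|] large forces [Re w >= W], so that [zet w] and [- zet w] lie
    on the closed side of D_-, where m is close to the identity and both branches are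
    [(1 + t) zet w + O(1)]. The bounded part is compact and at positive distance from the imaginary
    axis. *)
Lemma branches_growth c0 : 0 < c0 -> exists2 K : R, 0 <= K &
  forall w, c0 * (1 + complex.Im w ^+ 2) <= complex.Re w ->
    [/\ normc (npos w) <= K * (1 + normc w), normc (nneg w) <= K * (1 + normc w) &
        1 + normc w <= K * normc (nsum w)].
Proof.
move=> c00; have [_ [K1 K10 hK1]] := m_sub_id_dec hC hI hL hm hM2.
have W0 : 0 < W by apply: lt_le_trans (rc_pos hC 0) (rc_le hC 0).
have Wc : 0 <= W / c0 by rewrite divr_ge0 ?ltW.
(* [W + W / c0] forces [Re w >= W] beyond r; [2 mu0 + 2 K1 + 1] gives
   [normc (nsum w) >= 1 + normc w] there. *)
pose r := 2 * mu0 + 2 * K1 + 1 + W + W / c0.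
have r0 : 0 <= r by rewrite /r; move: mu0_ge0; lra.
pose A := [set w : C | normc w <= r] `&`
  [set w : C | 0 <= complex.Re ((complex.Re w)%:C - c0%:C * (1 + (complex.Im w)%:C * (complex.Im w)%:C))].
have AE w : A w <-> normc w <= r /\ c0 * (1 + complex.Im w ^+ 2) <= complex.Re w.
  have E : complex.Re ((complex.Re w)%:C - c0%:C * (1 + (complex.Im w)%:C * (complex.Im w)%:C)) =
      complex.Re w - c0 * (1 + complex.Im w ^+ 2).
    by rewrite !(ReD, ReN, ReM) /= !mul0r !subr0 expr2.
  split=> -[h1 h2]; split=> //.
    by have : 0 <= complex.Re ((complex.Re w)%:C - c0%:C * (1 + (complex.Im w)%:C * (complex.Im w)%:C)) := h2;
      rewrite E subr_ge0.
  by rewrite -subr_ge0 -E in h2; exact: h2.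
have clA : clset A.
  apply: clsetI; first exact: clset_le_normc.
  apply: clset_ge0 => z; apply: ccont_add; first exact: ccont_Re.
  have h : ccont (fun w : C => (- c0%:C) * (1 + (complex.Im w)%:C * (complex.Im w)%:C)) z.
    apply: ccont_mul; first exact/cdiff_ccont/cdiff_cst.
    apply: ccont_add; first exact/cdiff_ccont/cdiff_cst.
    by apply: ccont_mul; exact: ccont_Im.
  by apply: ccont_ext h; [exact: ltr01 | move=> k _; rewrite mulNr].
have pos w : c0 * (1 + complex.Im w ^+ 2) <= complex.Re w -> 0 < complex.Re w.
  by apply: lt_le_trans; rewrite mulr_gt0 // ltr_pwDl // sqr_ge0.
have [|w /AE[_ /pos]//|B B0 hB] := branches_bounded clA (r := r); first by move=> w /AE[].
pose K := K1 + (1 + t) * (1 + mu0) + B + (1 + r) * B + 1.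
have tt : 0 <= (1 + t) * (1 + mu0) by rewrite mulr_ge0 ?addr_ge0 // ltW.
have rB : 0 <= (1 + r) * B by apply: mulr_ge0 => //; move: r0; lra.
have K0 : 0 <= K by rewrite /K; lra.
exists K => // w hw; have w0 := pos w hw.
have nw := normc_ge0 w.
have K1' : K <= K * (1 + normc w) by apply: ler_peMr; rewrite // lerDl.
have [wr|wr] := lerP (normc w) r.
  have /hB[b1 b2 b3] : A w by apply/AE.
  split; [apply: le_trans b1 _ | apply: le_trans b2 _ |]; try by apply: le_trans K1'; rewrite /K; lra.
  have s0 : 0 < normc (nsum w) by rewrite normc_gt0 nsum_neq0.
  have : 1 <= B * normc (nsum w) by move: b3; rewrite normcV -div1r ler_pdivrMr.
  move=> b4; apply: le_trans (_ : (1 + r) * (B * normc (nsum w)) <= _).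
    by apply: le_trans (_ : 1 + r <= _); [lra | apply: ler_peMr => //; lra].
  by rewrite mulrA ler_wpM2r ?normc_ge0 // /K; lra.
have Rw : W <= complex.Re w.
  rewrite leNgt; apply/negP => lt.
  have i1 : complex.Im w ^+ 2 < W / c0 - 1.
    rewrite ltrBrDl ltr_pdivlMr // mulrC; exact: le_lt_trans hw lt.
  have i2 : `|complex.Im w| <= 1 + complex.Im w ^+ 2.
    by rewrite -real_normK ?num_real //; have := sqr_ge0 (`|complex.Im w| - 1); have := normr_ge0 (complex.Im w); nra.
  have := normc_le_ReIm w; rewrite (gtr0_norm w0) => n1; move: wr; rewrite /r; move: mu0_ge0; lra.
have sz : side false (zet w).
  rewrite /side /=; apply: le_trans (rc_le hC _) _; apply: le_trans Rw _.
  by apply: le_trans (Re_zet mu0 w0) (ler_norm _).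
have [z1 z2] := normc_zet w mu0_ge0.
have nz := normc_ge0 (zet w).
have dif z : side false z -> normc (m z - z) <= K1.
  by move=> /hK1; rewrite expr1; apply: le_trans; apply: ler_peMr; rewrite ?normc_ge0 // lerDl normc_ge0.
have p1 : normc (npos w - (1 + t)%:C * zet w) <= K1.
  rewrite (_ : _ - _ = m (zet w) - zet w); first exact: dif.
  by rewrite /npos /mt rmorphD rmorph1; ring.
have p2 : normc (nneg w - (1 + t)%:C * zet w) <= K1.
  rewrite (_ : _ - _ = - (m (- zet w) - - zet w)); first by rewrite normcN; apply: dif; exact/(sideN hC).
  by rewrite /nneg /mt rmorphD rmorph1; ring.
have nt : normc ((1 + t)%:C * zet w) = (1 + t) * normc (zet w).
  by rewrite normcM normc_real ger0_norm // addr_ge0 // ltW.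
have up x : normc (x - (1 + t)%:C * zet w) <= K1 -> normc x <= K * (1 + normc w).
  move=> h; apply: le_trans (_ : K1 + (1 + t) * normc (zet w) <= _).
    by have := normc_tri x ((1 + t)%:C * zet w); rewrite nt; lra.
  have q1 : (1 + t) * normc (zet w) <= (1 + t) * ((1 + mu0) * (1 + normc w)).
    rewrite ler_wpM2l //; first by rewrite addr_ge0 // ltW.
    by have := mulr_ge0 mu0_ge0 nw; lra.
  have q2 : K1 <= K1 * (1 + normc w) by apply: ler_peMr; rewrite // lerDl.
  apply: le_trans (_ : (K1 + (1 + t) * (1 + mu0)) * (1 + normc w) <= _).
    by lra.
  by rewrite ler_wpM2r ?addr_ge0 // /K; lra.
split; [exact: up | exact: up |].
have s1 : normc (nsum w) >= 2 * ((1 + t) * normc (zet w)) - 2 * K1.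
  have : normc (nsum w - ((1 + t)%:C * zet w + (1 + t)%:C * zet w)) <= K1 + K1.
    by rewrite /nsum opprD addrACA; apply: le_trans (le_normcD _ _) _; exact: lerD.
  have : normc ((1 + t)%:C * zet w + (1 + t)%:C * zet w) = 2 * ((1 + t) * normc (zet w)).
    rewrite -mulrDl -rmorphD normcM normc_real ger0_norm; first by ring.
    by move: t0; lra.
  by have := normc_tri ((1 + t)%:C * zet w + (1 + t)%:C * zet w) (nsum w); rewrite normc_distC; lra.
have s2 : normc (zet w) <= (1 + t) * normc (zet w) by apply: ler_peMl => //; rewrite lerDl ltW.
apply: le_trans (_ : normc (nsum w) <= _); first by move: wr; rewrite /r; lra.
by apply: ler_peMl; rewrite ?normc_ge0 // /K; lra.
Qed.

Lemma branches_squeeze d : 0 < d -> 2 * d <= 1 -> exists2 K : R, 0 <= K &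
  forall s, 0 <= complex.Re s -> branches_le K (squeeze d s).
Proof.
move=> d0 d1; pose A := [set w : C | normc w <= d^-1] `&` [set w : C | 0 <= complex.Re (w - d%:C)].
have clA : clset A.
  apply: clsetI; first exact: clset_le_normc.
  by apply: clset_ge0 => z; apply/cdiff_ccont/cdiff_sub; [exact: cdiff_id | exact: cdiff_cst].
have AE w : A w <-> normc w <= d^-1 /\ d <= complex.Re w.
  by rewrite /A /setI /= ReD ReN /= subr_ge0; split=> -[].
have [w /AE[]//|w /AE[_]|K K0 hK] := branches_bounded clA (r := d^-1); first exact: lt_le_trans.
exists K => // s s0; apply: hK; apply/AE; split; first exact: normc_squeeze.
exact: Re_squeeze.
Qed.

(* With S = npos + nneg, alpha = y1/S and beta = y2/S, where
   y1 = a + b npos and y2 = a - b nneg, one has alpha - beta = b real, and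
   y1 y2 / S = alpha beta S has imaginary part
   - (Im nneg |alpha|^2 + Im npos |beta|^2). *)
Lemma Im_quotient (a b e c : R) (p q : C) : 0 <= c -> c <= e * complex.Im p -> c <= e * complex.Im q ->
  p + q != 0 ->
  e * complex.Im ((a%:C + b%:C * p) * (a%:C - b%:C * q) / (p + q)) <= - (c * b ^+ 2 / 2).
Proof.
move=> c0 hp hq s0; set S := p + q in s0 *.
set al := (a%:C + b%:C * p) / S.
have E1 : al * S = a%:C + b%:C * p by rewrite divfK.
have E2 : a%:C - b%:C * q = (al - b%:C) * S by rewrite mulrBl E1 /S; ring.
have -> : (a%:C + b%:C * p) * (a%:C - b%:C * q) / S = al * (al - b%:C) * S.
  by rewrite -E1 E2; field.
have E3 : complex.Im (al * (al - b%:C) * S) = - (complex.Im q * (complex.Re al ^+ 2 + complex.Im al ^+ 2) +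
   complex.Im p * ((complex.Re al - b) ^+ 2 + complex.Im al ^+ 2)).
  have := congr1 (@complex.Re _) E1; have := congr1 (@complex.Im _) E1.
  clear -S; clearbody al; case: al => u v; rewrite /S; case: p q {S} => p1 p2 [q1 q2].
  rewrite !(ReD, ImD, ReM, ImM, ReN, ImN) /= !mul0r !subr0 !add0r !addr0 => h1 h2.
  have h3 : v * (u * (p2 + q2) + v * (p1 + q1)) = v * (b * p2) by rewrite -h1; ring.
  have h4 : u * (u * (p2 + q2) + v * (p1 + q1)) = u * (b * p2) by rewrite -h1; ring.
  have h5 : v * (u * (p1 + q1) - v * (p2 + q2)) = v * (a + b * p1) by rewrite -h2; ring.
  have h6 : u * (u * (p1 + q1) - v * (p2 + q2)) = u * (a + b * p1) by rewrite -h2; ring.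
  have h7 : b * (u * (p2 + q2) + v * (p1 + q1)) = b * (b * p2) by rewrite -h1; ring.
  by lra.
rewrite E3; move: (complex.Re al) (complex.Im al) => u v.
have v0 := sqr_ge0 v; have u0 := sqr_ge0 u; have w0 := sqr_ge0 (u - b).
have k1 : c * (u ^+ 2 + v ^+ 2) <= e * complex.Im q * (u ^+ 2 + v ^+ 2) by rewrite ler_wpM2r ?addr_ge0.
have k2 : c * ((u - b) ^+ 2 + v ^+ 2) <= e * complex.Im p * ((u - b) ^+ 2 + v ^+ 2) by rewrite ler_wpM2r ?addr_ge0.
have k3 : c * (b ^+ 2 / 2) <= c * (u ^+ 2 + v ^+ 2 + ((u - b) ^+ 2 + v ^+ 2)).
  by rewrite ler_wpM2l //; have := sqr_ge0 (2 * u - b); nra.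
by lra.
Qed.

End Branches.

(** * Positive integrands, root-free parabolas and degree counts *)

Section ContourTools.
Context {R : realType}.
Local Notation C := R[i].
Local Notation leb := (@lebesgue_measure R).
Local Notation RC := (real_complex R).

Lemma Im_cint_ge0 (g : R -> C) a b : (forall y, a <= y <= b -> 0 <= complex.Im (g y)) ->
  0 <= complex.Im (cint `[a, b] g).
Proof.
by move=> h; rewrite /cint /=; apply: Rintegral_ge0 => y /=; rewrite in_itv /= => /h.
Qed.

Lemma Im_cint_ge (g : R -> C) (Y a b c : R) : - Y <= a -> a <= b -> b <= Y ->
  (forall y, pcont g y) -> (forall y, 0 <= complex.Im (g y)) ->
  (forall y, a <= y <= b -> c <= complex.Im (g y)) ->
  c * (b - a) <= complex.Im (cint `[- Y, Y] g).
Proof.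
move=> Ya ab bY cg g0 gc.
have cI u v : cintegrable `[u, v] g by apply: cintegrable_cont.
rewrite (@cint_cat _ _ (- Y) a Y) //; last exact: le_trans bY.
rewrite (@cint_cat _ _ a b Y) // !ImD.
have h1 := @Im_cint_ge0 g (- Y) a (fun y _ => g0 y); have h2 := @Im_cint_ge0 g b Y (fun y _ => g0 y).
suff : c * (b - a) <= complex.Im (cint `[a, b] g) by lra.
pose k : R -> C := fun=> 0 +i* c.
have ck y : pcont k y by exact: pcont_cst.
have kI : cintegrable `[a, b] k by apply: cintegrable_cont.
have E : cint `[a, b] k = (0 +i* c) * b%:C - (0 +i* c) * a%:C.
  apply: (cint_FTC (G := fun y => (0 +i* c) * y%:C) ab) => [y _|y _]; last exact: ck.
  apply: (pdiff_eq _ (pdiff_mul (pdiff_cst _ _) (pdiff_id _))).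
  by rewrite mul0r add0r mulr1.
have := @Im_cint_ge0 (fun y => g y - k y) a b.
rewrite (cint_sub (measurable_itv _) (cI a b) kI).
rewrite ImD ImN E ImD ImN !ImM /= !mul0r !add0r => h.
have : 0 <= complex.Im (cint `[a, b] g) - (c * b - c * a) by apply: h => y yab; rewrite ImD ImN /= subr_ge0 gc.
by rewrite -mulrBr subr_ge0.
Qed.

Lemma parabola_avoid (s : seq C) : (forall a, a \in s -> 0 <= complex.Re a -> 0 < complex.Re a) ->
  exists c0 : R, [/\ 0 < c0, 2 * c0 <= 1 & forall a, a \in s -> 0 <= complex.Re a ->
    c0 * (1 + complex.Im a ^+ 2) < complex.Re a].
Proof.
elim: s => [_|a s IH hs]; first by exists 2^-1; split=> //; rewrite mulfV ?pnatr_eq0.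
have [|c1 [c10 c12 h1]] := IH; first by move=> x xs; apply: hs; rewrite inE xs orbT.
have n0 : 0 < 1 + complex.Im a ^+ 2 by rewrite ltr_pwDl // sqr_ge0.
have [a0|a0] := lerP 0 (complex.Re a); last first.
  exists c1; split=> // x; rewrite inE => /orP[/eqP->|/h1//]; by rewrite leNgt a0.
have a1 : 0 < complex.Re a by apply: hs => //; rewrite mem_head.
pose c2 := complex.Re a / (1 + complex.Im a ^+ 2) / 2.
have c20 : 0 < c2 by rewrite !divr_gt0.
exists (Num.min c1 c2); split; first by rewrite lt_min c10.
  by apply: le_trans c12; rewrite ler_pM2l // ge_min lexx.
move=> x; rewrite inE => /orP[/eqP->|/h1 h] x0.
  apply: le_lt_trans (_ : c2 * (1 + complex.Im a ^+ 2) < _).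
    by rewrite ler_pM2r // ge_min lexx orbT.
  rewrite /c2 mulrAC divfK ?gt_eqF //; lra.
apply: le_lt_trans (h x0); rewrite ler_wpM2r ?ge_min ?lexx //.
by rewrite addr_ge0 ?sqr_ge0.
Qed.

(** Finitely many roots, none on the imaginary axis: a parabola flat enough passes to the left of
    all those in the right half plane. *)
Lemma poly_parabola (p : {poly C}) : p != 0 -> (forall a, p.[a] = 0 -> 0 <= complex.Re a -> 0 < complex.Re a) ->
  exists c0 : R, [/\ 0 < c0, 2 * c0 <= 1 & forall a, 0 <= complex.Re a ->
    complex.Re a <= c0 * (1 + complex.Im a ^+ 2) -> p.[a] != 0].
Proof.
move=> p0 hp; have [s pE] := poly_factor p.
have l0 : lead_coef p != 0 by rewrite lead_coef_eq0.
have rE a : p.[a] = 0 <-> a \in s.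
  rewrite pE hornerZ -root_prod_XsubC; split=> [/eqP|/eqP->]; last by rewrite mulr0.
  by rewrite mulf_eq0 (negbTE l0).
have [|c0 [c00 c01 hc]] := @parabola_avoid s; first by move=> a /rE; exact: hp.
exists c0; split=> // a a0 le; apply/eqP => /rE /hc /(_ a0); by rewrite ltNge le.
Qed.

Definition left_region c0 : set C :=
  [set s | 0 <= complex.Re s /\ complex.Re s <= c0 * (1 + complex.Im s ^+ 2)].

Lemma clset_left c0 : clset (left_region c0).
Proof.
have h1 : clset [set s : C | 0 <= complex.Re s] by apply: clset_ge0 => z; exact/cdiff_ccont/cdiff_id.
pose f (s : C) := c0%:C * (1 + (complex.Im s)%:C * (complex.Im s)%:C) + (- 1) * (complex.Re s)%:C.
have h2 : clset [set s | 0 <= complex.Re (f s)].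
  apply: clset_ge0 => z; apply: ccont_add; last by apply: ccont_mul; [exact/cdiff_ccont/cdiff_cst | exact: ccont_Re].
  apply: ccont_mul; first exact/cdiff_ccont/cdiff_cst.
  apply: ccont_add; first exact/cdiff_ccont/cdiff_cst.
  by apply: ccont_mul; exact: ccont_Im.
have E s : complex.Re (f s) = c0 * (1 + complex.Im s ^+ 2) - complex.Re s.
  by rewrite /f !(ReD, ReN, ReM) /= oppr0 !mul0r !subr0 expr2 mulN1r.
rewrite (_ : left_region c0 = [set s : C | 0 <= complex.Re s] `&` [set s | 0 <= complex.Re (f s)]).
  exact: clsetI.
apply/seteqP; split=> s [s0 hs]; split=> //.
  by change (0 <= complex.Re (f s)); rewrite E subr_ge0.
by have : 0 <= complex.Re (f s) := hs; rewrite E subr_ge0.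
Qed.

(** Degree count [1 + 2 (2 j) + 3 = 4 j + 4]. With bounded branches all three spare orders remain;
    with linearly growing ones two do, since the integrand is quadratic in the branches over their
    sum. *)
Lemma weight_bound (a b q : {poly C}) j : ((size a).-1 <= 2 * j)%N -> ((size b).-1 <= 2 * j)%N ->
  q != 0 -> ((size q).-1 = 4 * j + 4)%N ->
  exists K r : R, 0 <= K /\ forall s, r <= normc s -> q.[s] != 0 /\
    normc s * (normc a.[s] + normc b.[s]) ^+ 2 * (1 + normc s) ^+ 3 <= K * normc q.[s].
Proof.
move=> sa sb q0 sq; have [Ka Ka0 ha] := poly_upper a; have [Kb Kb0 hb] := poly_upper b.
have [c [r [c0 r0 hq]]] := poly_lower q0; exists ((Ka + Kb) ^+ 2 / c), r.
split; first by rewrite divr_ge0 ?sqr_ge0 // ltW.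
move=> s rs; have n0 := normc_ge0 s; set E := 1 + normc s.
have E1 : 1 <= E by rewrite /E; lra.
have E0 : 0 < E by exact: lt_le_trans E1.
have h1 : normc a.[s] <= Ka * E ^+ (2 * j).
  by apply: le_trans (ha s) _; rewrite ler_wpM2l // ler_weXn2l.
have h2 : normc b.[s] <= Kb * E ^+ (2 * j).
  by apply: le_trans (hb s) _; rewrite ler_wpM2l // ler_weXn2l.
have h3 := hq s rs; rewrite sq -/E in h3.
split; first by rewrite -normc_gt0; apply: lt_le_trans h3; rewrite mulr_gt0 // exprn_gt0.
apply: le_trans (_ : E * ((Ka + Kb) * E ^+ (2 * j)) ^+ 2 * E ^+ 3 <= _).
  rewrite ler_wpM2r ?exprn_ge0 ?(ltW E0) //; apply: ler_pM; rewrite ?sqr_ge0 //; first by rewrite /E lerDr.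
  rewrite ler_pXn2r ?nnegrE ?addr_ge0 ?mulr_ge0 ?normc_ge0 ?exprn_ge0 ?addr_ge0 ?(ltW E0) //.
  by rewrite mulrDl lerD.
apply: le_trans (_ : (Ka + Kb) ^+ 2 / c * (c * E ^+ (4 * j + 4)) <= _).
  rewrite mulrA divfK ?gt_eqF // exprMn -exprM le_eqVlt; apply/orP; left; apply/eqP.
  rewrite (_ : 4 * j + 4 = 1 + (2 * j * 2) + 3)%N; last by rewrite mulnAC; ring.
  by rewrite !exprD expr1; ring.
by rewrite ler_wpM2l // divr_ge0 ?sqr_ge0 // ltW.
Qed.

Lemma weight_left (a b q : {poly C}) j c0 : ((size a).-1 <= 2 * j)%N -> ((size b).-1 <= 2 * j)%N ->
  q != 0 -> ((size q).-1 = 4 * j + 4)%N -> (forall s, left_region c0 s -> q.[s] != 0) ->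
  exists2 K : R, 0 <= K & forall s, left_region c0 s ->
    normc s * (normc a.[s] + normc b.[s]) ^+ 2 * (1 + normc s) ^+ 3 <= K * normc q.[s].
Proof.
move=> sa sb q0 sq hq; have [K [r [K0 far]]] := weight_bound sa sb q0 sq.
pose A := left_region c0 `&` [set s : C | normc s <= r].
have clA : clset A by apply: clsetI; [exact: clset_left | exact: clset_le_normc].
have bdd (f : C -> C) : (forall s, left_region c0 s -> ccont f s) -> exists2 B : R, 0 <= B & forall s, A s -> normc (f s) <= B.
  by move=> hf; apply: (@compact_bounded _ A f r _ clA) => [s []|s [/hf]].
have cp (p : {poly C}) s : ccont (fun s => p.[s]) s by exact/cdiff_ccont/cdiff_poly.
have [Ba Ba0 ha] := bdd _ (fun s _ => cp a s).
have [Bb Bb0 hb] := bdd _ (fun s _ => cp b s).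
have [|Bq Bq0 hBq] := bdd (fun s => q.[s]^-1).
  by move=> s /hq s0; apply/cdiff_ccont/cdiff_inv => //; exact: cdiff_poly.
pose M := `|r| * (Ba + Bb) ^+ 2 * (1 + `|r|) ^+ 3.
have M0 : 0 <= M by rewrite !mulr_ge0 ?sqr_ge0 ?exprn_ge0 ?addr_ge0.
exists (K + M * Bq); first by rewrite addr_ge0 // mulr_ge0.
move=> s hs; have [sr|sr] := lerP (normc s) r; last first.
  have [_ h] := far s (ltW sr); apply: le_trans h _.
  by rewrite ler_wpM2r ?normc_ge0 // lerDl mulr_ge0.
have As : A s by split.
have q1 : 1 <= Bq * normc q.[s].
  by have := hBq s As; rewrite normcV -div1r ler_pdivrMr // normc_gt0 hq.
have sr' : normc s <= `|r| by exact: le_trans sr (ler_norm _).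
apply: le_trans (_ : M * (Bq * normc q.[s]) <= _).
  apply: le_trans (_ : M <= _); last exact: ler_peMr.
  apply: ler_pM; rewrite ?mulr_ge0 ?normc_ge0 ?sqr_ge0 ?exprn_ge0 ?addr_ge0 ?normc_ge0 //.
    apply: ler_pM; rewrite ?normc_ge0 ?sqr_ge0 //.
    by rewrite ler_pXn2r ?nnegrE ?addr_ge0 ?normc_ge0 //; apply: lerD; [exact: ha | exact: hb].
  by rewrite ler_pXn2r ?nnegrE ?addr_ge0 ?normc_ge0 // lerD2l.
by rewrite mulrA ler_wpM2r ?normc_ge0 // lerDr.
Qed.

Lemma poly_pos_left (p : {poly R}) (u : R) : 0 <= p.[0] -> 0 <= u -> (forall x, x <= u -> p.[x] != 0) ->
  forall x, x <= u -> 0 < p.[x].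
Proof.
move=> p0 u0 hp x xu; rewrite lt_neqAle eq_sym hp //= leNgt; apply/negP => neg.
have [x0|x0] := leP x 0.
  have [|z /andP[xz z0] rz] := @poly_ivt R p x 0 x0; first by rewrite (ltW neg).
  by have := hp z (le_trans z0 u0); rewrite rootE in rz; rewrite rz.
have [|z /andP[zx z0] rz] := @poly_ivt R (- p) 0 x (ltW x0).
  by rewrite !hornerN oppr_le0 p0 oppr_ge0 ltW.
by have := hp z (le_trans z0 xu); rewrite rootN rootE in rz; rewrite rz.
Qed.

Lemma poly_nonroot_itv (p : {poly R}) (a b : R) : p != 0 -> a < b -> exists2 x, a < x < b & p.[x] != 0.
Proof.
move=> p0 ab; apply: contrapT => H.
pose f (i : nat) := a + (b - a) * (i.+1)%:R^-1 / 2.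
have d0 : 0 < b - a by rewrite subr_gt0.
have fi i : a < f i < b.
  have i0 : (0 : R) < (i.+1)%:R by rewrite ltr0n.
  have i1 : (i.+1)%:R^-1 <= 1 :> R by rewrite invf_le1 // ler1n.
  have i2 : (0 : R) < (i.+1)%:R^-1 by rewrite invr_gt0.
  rewrite /f; have := mulr_gt0 d0 i2; have : (b - a) * (i.+1)%:R^-1 <= b - a by apply: ler_piMr; rewrite // ltW.
  by move: (_ / _) => v h1 h2; apply/andP; split; lra.
have rt : all (root p) [seq f i | i <- iota 0 (size p)].
  apply/allP => _ /mapP[i _ ->]; apply/negP => /negP h; apply: H; by exists (f i).
have un : uniq [seq f i | i <- iota 0 (size p)].
  rewrite map_inj_uniq ?iota_uniq // => i j.
  rewrite /f => /addrI /mulIf => /(_ _)/mulfI => /(_ _ _)/invr_inj => E.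
  have := E _ _; rewrite invr_eq0 pnatr_eq0 gt_eqF // => /(_ isT isT)/eqP.
  by rewrite eqr_nat => /eqP[].
by have := max_poly_roots p0 rt un; rewrite size_map size_iota ltnn.
Qed.

End ContourTools.

(** * The contour integral that forces B = 0 *)

Section Kernel.
Context {R : realType}.
Local Notation C := R[i].
Local Notation leb := (@lebesgue_measure R).
Local Notation RC := (real_complex R).
Variables (omega : R -> R) (W mu0 : R).
Hypothesis hC : regular_curve omega W.
Hypothesis hI : forall x : R, `|x| <= mu0 -> Dplus omega x%:C.
Hypothesis mu0_ge0 : 0 <= mu0.
Variables (L : nat) (m : C -> C).
Hypothesis hL : (2 <= L)%N.
Hypothesis hm : analytic_on (m_domain mu0) m.
Hypothesis hM1 : m_positivity mu0 m.
Hypothesis hM2 : m_asymptotics omega L m.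
Variable t : R.
Hypothesis t0 : 0 < t.
Local Notation zet := (zet mu0).
Local Notation mt := (mt m t).
Local Notation npos := (npos mu0 m t).
Local Notation nneg := (nneg mu0 m t).
Local Notation nsum := (nsum mu0 m t).
Local Notation branches_le := (branches_le mu0 m t).

Variables (j : nat) (A B Q : {poly R}) (rs : seq C) (h : C -> C).
Hypothesis sA : (size A <= j.+1)%N.
Hypothesis sB : (size B <= j.+1)%N.
Hypothesis QE : map_poly RC Q = prodX rs.
Hypothesis srs : size rs = (j.+1 + j.+1)%N.
Hypothesis rsD : forall a, a \in rs -> Dminus omega a.
Hypothesis hd : forall z, m_domain mu0 z -> cdiff h z.
Hypothesis rel : forall z, m_domain mu0 z ->
  (map_poly RC A).[z ^+ 2] + (map_poly RC B).[z ^+ 2] * mt z = (map_poly RC Q).[z] * h z.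

Definition shift_sq : {poly R} := 'X^2 + (mu0 ^+ 2)%:P.
(** The polynomial whose value at [z^2] is [Q(z) Q(-z)]. Composed with [shift_sq] it becomes a
    polynomial in s, real on the imaginary axis. *)
Definition norm_poly : {poly R} := even_poly Q ^+ 2 - 'X * odd_poly Q ^+ 2.
Let a4 : {poly C} := map_poly RC (A \Po shift_sq).
Let b4 : {poly C} := map_poly RC (B \Po shift_sq).
Let q4 : {poly C} := map_poly RC (norm_poly \Po shift_sq).

Let sizeQ : size Q = (j.+1 + j.+1).+1.
Proof. by rewrite -(size_map_poly RC) QE size_prodX srs. Qed.

Lemma norm_polyE : norm_poly \Po 'X^2 = Q * (Q \Po - 'X).
Proof.
rewrite /norm_poly (expr2 (even_poly Q)) (expr2 (odd_poly Q)) comp_polyB !comp_polyM comp_polyX.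
set e := even_poly Q \Po 'X^2; set o := odd_poly Q \Po 'X^2.
have E : Q = e + o * 'X by rewrite poly_even_odd.
have -> : Q \Po - 'X = e - o * 'X.
  rewrite {1}E rmorphD rmorphM /= comp_polyX mulrN /e /o -!comp_polyA.
  by rewrite comp_Xn_poly sqrrN.
by rewrite {1}E; ring.
Qed.

Lemma size_norm_poly : size norm_poly = (2 * j).+3.
Proof.
have Q0 : Q != 0 by rewrite -size_poly_gt0 sizeQ.
have sN : size (- 'X : {poly R}) = 2%N by rewrite size_polyN size_polyX.
have s1 : size (Q * (Q \Po - 'X)) = (4 * j + 4).+1.
  rewrite size_mul //; last by rewrite -size_poly_gt0 size_comp_poly2 // sizeQ.
  by rewrite size_comp_poly2 // sizeQ; lia.
have := size_comp_poly norm_poly 'X^2; rewrite norm_polyE s1 size_polyXn /= => E.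
have n0 : norm_poly != 0.
  by apply/eqP => n0; move: s1; rewrite -norm_polyE n0 comp_poly0 size_poly0.
by rewrite (polySpred n0); move: (size norm_poly).-1 E => x; lia.
Qed.

Let size_shift : size shift_sq = 3%N.
Proof. by rewrite /shift_sq size_XnaddC. Qed.

Let sa4 : ((size a4).-1 <= 2 * j)%N.
Proof. by rewrite size_map_poly size_comp_poly size_shift; move: (size A) sA => x; lia. Qed.
Let sb4 : ((size b4).-1 <= 2 * j)%N.
Proof. by rewrite size_map_poly size_comp_poly size_shift; move: (size B) sB => x; lia. Qed.
Let sq4 : ((size q4).-1 = 4 * j + 4)%N.
Proof. by rewrite size_map_poly size_comp_poly size_shift size_norm_poly /=; lia. Qed.
Let q40 : q4 != 0.
Proof. by apply/eqP => q0; move: sq4; rewrite q0 size_poly0; lia. Qed.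

Let horner_shift (p : {poly R}) s : (map_poly RC (p \Po shift_sq)).[s] = (map_poly RC p).[zet s ^+ 2].
Proof.
rewrite map_comp_poly horner_comp zet_sqr /shift_sq rmorphD /= map_polyXn map_polyC /=.
by rewrite hornerD hornerXn hornerC.
Qed.

Let q4E s : q4.[s] = (prodX rs).[zet s] * (prodX rs).[- zet s].
Proof.
rewrite /q4 horner_shift -QE.
have := congr1 (map_poly RC) norm_polyE; rewrite rmorphM /= !map_comp_poly /= map_polyXn rmorphN /= map_polyX.
by move=> /(congr1 (fun p => p.[zet s])); rewrite hornerM !horner_comp hornerXn hornerN hornerX.
Qed.

(** On the imaginary axis [zet s] is either imaginary, hence not in D_-, or real of modulus at most
    mu0, hence in D_+; the roots of Q lie in D_-. *)
Let q4_root s : q4.[s] = 0 -> 0 <= complex.Re s -> 0 < complex.Re s.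
Proof.
move=> q0 s0; rewrite lt_neqAle s0 andbT; apply/negP => /eqP s1.
have : Dminus omega (zet s).
  move/eqP: q0; rewrite q4E mulf_eq0 => /orP[] /eqP r0; have := prodX_root rsD r0 => //.
  by rewrite /Dminus /= ReN ImN normrN (rc_even hC).
rewrite /Dminus /= => D.
have [_ [E1 E2]] := zet_ReIm mu0 s.
have r0 : complex.Re (zet s) != 0.
  by apply/eqP => r0; move: D; rewrite r0 normr0 ltNge (ltW (rc_pos hC _)).
have i0 : complex.Im (zet s) = 0.
  by move: E2; rewrite -s1 mul0r => /eqP; rewrite mulf_eq0 (negbTE r0) => /eqP.
have le : `|complex.Re (zet s)| <= mu0.
  rewrite -(ler_pXn2r (_ : 0 < 2)%N) ?nnegrE // real_normK ?num_real //.
  by move: E1; rewrite i0 -s1 expr0n /= subr0 sub0r => ->; have := sqr_ge0 (complex.Im s); lra.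
by have := hI le; rewrite /Dplus /= => lt; move: D; rewrite i0 ltNge (ltW lt).
Qed.

Let axis (p : {poly R}) (y : R) : (map_poly RC (p \Po shift_sq)).[0 +i* y] = (p.[mu0 ^+ 2 - y ^+ 2])%:C.
Proof.
rewrite horner_shift zet_sqr (_ : _ + _ = (mu0 ^+ 2 - y ^+ 2)%:C) ?horner_map //.
by apply: complexP; rewrite !(ReD, ImD) expr2 !(ReM, ImM) /= ?expr2; ring.
Qed.

(** These x are the values [mu0^2 - y^2] on the imaginary axis, where [q4_root] excludes zeros; the
    sign is read at 0, where the value is a square. *)
Let norm_pos x : x <= mu0 ^+ 2 -> 0 < norm_poly.[x].
Proof.
apply: poly_pos_left; first 1 last.
- exact: sqr_ge0.
- move=> {}x xm; have := @q4_root (0 +i* Num.sqrt (mu0 ^+ 2 - x)).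
  rewrite /q4 axis sqr_sqrtr ?subr_ge0 // subKr => H; apply/eqP => E.
  by have := H _ (lexx 0); rewrite E /= ltxx => /(_ erefl).
- by rewrite /norm_poly hornerD hornerN horner_exp (hornerM 'X) hornerX mul0r oppr0 addr0 sqr_ge0.
Qed.

Let y1 (s w : C) := a4.[s] + b4.[s] * npos w.
Let y2 (s w : C) := a4.[s] - b4.[s] * nneg w.
(** Two arguments, because only the branches are squeezed: the polynomials stay at s and keep their
    real values on the imaginary axis. *)
Let GG (s w : C) := s * (y1 s w * y2 s w / nsum w) / q4.[s].
Let G d s := GG s (squeeze d s).
Let F (s : C) := s * (h (zet s) * h (- zet s) / nsum s).

Let FG s : 0 < complex.Re s -> q4.[s] != 0 -> GG s s = F s.
Proof.
move=> s0 q0; have [D1 D2] := zet_dom mu0 s0; have n0 := nsum_neq0 hM1 t0 s0.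
have E1 : y1 s s = (prodX rs).[zet s] * h (zet s).
  by rewrite /y1 /a4 /b4 !horner_shift -QE -(rel D1).
have E2 : y2 s s = (prodX rs).[- zet s] * h (- zet s).
  by rewrite /y2 /a4 /b4 !horner_shift -QE -(rel D2) sqrrN -[nneg s]/(- mt (- zet s)) mulrN opprK.
rewrite /GG /F E1 E2 q4E in q0 *; move: q0; rewrite mulf_eq0 negb_or => /andP[p1 p2].
move: (prodX rs).[_] (prodX rs).[_] p1 p2 (h _) (h _) (nsum s) n0 => u v u0 v0 h1 h2 n n0.
by field; rewrite n0 u0 v0.
Qed.

Let cF s : 0 < complex.Re s -> cdiff F s.
Proof.
move=> s0; have [D1 D2] := zet_dom mu0 s0.
apply: cdiff_mul; first exact: cdiff_id.
apply: cdiff_div; last exact: (nsum_neq0 hM1 t0).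
  apply: cdiff_mul; first by apply: cdiff_comp; [exact: cdiff_zet | exact: hd].
  by apply: (@cdiff_comp _ h (fun s => - zet s)); [exact/cdiff_opp/cdiff_zet | exact: hd].
by apply: cdiff_add; [exact: (cdiff_npos hm) | exact: (cdiff_nneg hm)].
Qed.

Let cGG s (w : C -> C) : cdiff w s -> 0 < complex.Re (w s) -> q4.[s] != 0 -> cdiff (fun s => GG s (w s)) s.
Proof.
move=> cw w0 q0; have cpo (p : {poly C}) := cdiff_poly p s.
have c1 : cdiff (fun s => npos (w s)) s by apply: cdiff_comp cw (cdiff_npos hm t w0).
have c2 : cdiff (fun s => nneg (w s)) s by apply: cdiff_comp cw (cdiff_nneg hm t w0).
apply: cdiff_div => //; apply: cdiff_mul; first exact: cdiff_id.
apply: cdiff_div; last exact: (nsum_neq0 hM1 t0); last exact: cdiff_add.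
apply: cdiff_mul; first by apply: cdiff_add => //; exact: cdiff_mul.
by apply: cdiff_sub => //; exact: cdiff_mul.
Qed.

Let cG d s : 0 < d -> 2 * d <= 1 -> 0 <= complex.Re s -> q4.[s] != 0 -> cdiff (G d) s.
Proof.
move=> d0 d1 s0 q0; apply: cGG => //; first exact: cdiff_squeeze.
exact: lt_le_trans (Re_squeeze d0 d1 s0).
Qed.

Let wgt s := normc s * (normc a4.[s] + normc b4.[s]) ^+ 2.

Let GG_le s w K V M : 0 <= K -> normc (npos w) <= K -> normc (nneg w) <= K -> normc (nsum w)^-1 <= V ->
  q4.[s] != 0 -> wgt s <= M * normc q4.[s] -> normc (GG s w) <= M * ((1 + K) ^+ 2 * V).
Proof.
move=> K0 k1 k2 k3 q0 hw; rewrite /GG normcM normcV ler_pdivrMr ?normc_gt0 // !normcM.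
have V0 : 0 <= V by apply: le_trans k3; exact: normc_ge0.
have Y (x : C) : normc x <= K -> normc a4.[s] + normc b4.[s] * normc x <= (normc a4.[s] + normc b4.[s]) * (1 + K).
  move=> hx; have := ler_wpM2l (normc_ge0 b4.[s]) hx.
  by have := normc_ge0 a4.[s]; have := mulr_ge0 (normc_ge0 a4.[s]) K0; have := normc_ge0 b4.[s]; lra.
have e1 : normc (y1 s w) <= (normc a4.[s] + normc b4.[s]) * (1 + K).
  by apply: le_trans (le_normcD _ _) _; rewrite normcM; exact: Y.
have e2 : normc (y2 s w) <= (normc a4.[s] + normc b4.[s]) * (1 + K).
  by apply: le_trans (normcB _ _) _; rewrite normcM; exact: Y.
have e3 : normc (y1 s w) * normc (y2 s w) * normc (nsum w)^-1 <=
    (normc a4.[s] + normc b4.[s]) * (1 + K) * ((normc a4.[s] + normc b4.[s]) * (1 + K)) * V.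
  by apply: ler_pM => //; rewrite ?mulr_ge0 ?normc_ge0 //; apply: ler_pM; rewrite ?normc_ge0.
apply: le_trans (ler_wpM2l (normc_ge0 s) e3) _.
have := ler_wpM2r (mulr_ge0 (sqr_ge0 (1 + K)) V0) hw; rewrite /wgt.
by lra.
Qed.

Section Parabola.
Variable c0 : R.
Hypothesis c00 : 0 < c0.
Hypothesis c01 : 2 * c0 <= 1.
Hypothesis hc : forall s, left_region c0 s -> q4.[s] != 0.

Let par (y : R) : C := (c0 * (1 + y ^+ 2)) +i* y.
Let par' (y : R) : C := (c0 * (2 * y)) +i* 1.

Let C1par : C1 (fun y => c0 * (1 + y ^+ 2)) (fun y => c0 * (2 * y)).
Proof.
move=> y; split.
  apply: is_derive_eq; rewrite /GRing.scale /= !(mulr0, add0r, addr0, mulr1, expr1) ?mulr_natl //.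
  by ring.
apply: continuousM; first exact: cvg_cst.
by apply: continuousM; [exact: cvg_cst | exact: cvg_id].
Qed.

Let par_left y : left_region c0 (par y).
Proof. by split=> //=; rewrite mulr_ge0 ?addr_ge0 ?sqr_ge0 // ltW. Qed.

Let par_pos s : c0 * (1 + complex.Im s ^+ 2) <= complex.Re s -> 0 < complex.Re s.
Proof. by apply: lt_le_trans; rewrite mulr_gt0 // ltr_pwDl // sqr_ge0. Qed.

Let wgtK : exists2 K : R, 0 <= K & forall s, left_region c0 s -> wgt s * (1 + normc s) ^+ 3 <= K * normc q4.[s].
Proof. exact: (weight_left sa4 sb4 q40 sq4 hc). Qed.

(* Uniform in w, to cover both w = squeeze d s and its limit w = s. *)
Let GG_dec : exists K r : R, 0 <= K /\ forall s w, c0 * (1 + complex.Im s ^+ 2) <= complex.Re s ->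
  c0 * (1 + complex.Im w ^+ 2) <= complex.Re w -> normc w <= normc s + 1 ->
  left_region c0 s \/ r <= normc s -> q4.[s] != 0 /\ normc (GG s w) <= K / (1 + normc s) ^+ 2.
Proof.
have [K1 K10 h1] := branches_growth hC hI mu0_ge0 hL hm hM1 hM2 t0 c00.
have [K2 K20 h2] := wgtK; have [K3 [r [K30 h3]]] := weight_bound sa4 sb4 q40 sq4.
pose M := K2 + K3; have M0 : 0 <= M by rewrite addr_ge0.
exists (M * ((1 + K1) ^+ 2 * K1) * 2), r; split.
  by apply: mulr_ge0 => //; apply: mulr_ge0 => //; apply: mulr_ge0 => //; exact: sqr_ge0.
move=> s w hs hw ws cs.
have [q0 wM] : q4.[s] != 0 /\ wgt s * (1 + normc s) ^+ 3 <= M * normc q4.[s].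
  have nq := normc_ge0 q4.[s]; case: cs => [cs|/h3[q0 le]].
    split; first exact: hc.
    by apply: le_trans (h2 s cs) _; rewrite ler_wpM2r // lerDl.
  by split=> //; apply: le_trans le _; rewrite ler_wpM2r // lerDr.
split=> //; have [b1 b2 b3] := h1 w hw; have w0 := par_pos hw.
have ns := normc_ge0 s; have nw := normc_ge0 w.
set E := 1 + normc s in wM *; have E1 : 1 <= E by rewrite lerDl.
have E0 : 0 < E by exact: lt_le_trans E1.
have wE : 1 + normc w <= 2 * E by rewrite /E; lra.
have w1 : 0 < 1 + normc w by rewrite ltr_pwDl.
have b3' : normc (nsum w)^-1 <= K1 / (1 + normc w).
  by rewrite normcV ler_pdivlMr // mulrC -ler_pdivlMr ?invr_gt0 ?normc_gt0 ?(nsum_neq0 hM1 t0) // invrK.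
have K1w : 0 <= K1 * (1 + normc w) by rewrite mulr_ge0 // ltW.
have wM' : wgt s <= (M / E ^+ 3) * normc q4.[s].
  by rewrite mulrAC ler_pdivlMr ?exprn_gt0.
apply: le_trans (GG_le K1w b1 b2 b3' q0 wM') _.
have ME : 0 <= M / E ^+ 3 by rewrite divr_ge0 // exprn_ge0 // ltW.
apply: le_trans (_ : M / E ^+ 3 * ((1 + K1) ^+ 2 * K1 * (2 * E)) <= _); last first.
  by rewrite le_eqVlt; apply/orP; left; apply/eqP; field; rewrite gt_eqF.
apply: ler_wpM2l => //.
apply: le_trans (_ : ((1 + K1) * (1 + normc w)) ^+ 2 * (K1 / (1 + normc w)) <= _).
  apply: ler_wpM2r; first by rewrite divr_ge0 // ltW.
  by rewrite ler_pXn2r ?nnegrE ?mulr_ge0 ?addr_ge0 ?(ltW w1) // mulrDl mul1r lerD2r lerDl.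
rewrite (_ : _ * (K1 / _) = (1 + K1) ^+ 2 * K1 * (1 + normc w)); last by field; rewrite gt_eqF.
by apply: ler_wpM2l => //; apply: mulr_ge0 => //; exact: sqr_ge0.
Qed.

Let G_dec d : 0 < d -> 2 * d <= 1 -> exists2 K : R, 0 <= K &
  forall s, left_region c0 s -> normc (G d s) <= K / (1 + normc s) ^+ 3.
Proof.
move=> d0 d1; have [K1 K10 h1] := branches_squeeze hm hM1 t0 d0 d1.
have [K2 K20 h2] := wgtK; exists (K2 * ((1 + K1) ^+ 2 * K1)).
  by apply: mulr_ge0 => //; apply: mulr_ge0 => //; exact: sqr_ge0.
move=> s hs; have [b1 b2 b3] := h1 s (proj1 hs).
have E0 : 0 < (1 + normc s) ^+ 3 by rewrite exprn_gt0 // ltr_pwDl ?normc_ge0.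
have wM : wgt s <= (K2 / (1 + normc s) ^+ 3) * normc q4.[s].
  by rewrite mulrAC ler_pdivlMr //; exact: h2.
by apply: le_trans (GG_le K10 b1 b2 b3 (hc hs) wM) _; rewrite mulrAC.
Qed.

Let axis_left y : left_region c0 (0 +i* y).
Proof. by split=> //=; rewrite mulr_ge0 ?addr_ge0 ?sqr_ge0 // ltW. Qed.

(** No zero of [q4] lies between axis and parabola. The horizontal edges have length [c0 (1 + Y^2)],
    against an integrand [O(Y^-3)]. *)
Let shift d : 0 < d -> 2 * d <= 1 -> exists2 K : R, 0 <= K & forall Y, 0 <= Y ->
  normc (cint `[- Y, Y] (fun y => G d (par y) * par' y) -
         cint `[- Y, Y] (fun y => G d (0 +i* y) * (0 +i* 1))) <= K / (1 + Y).
Proof.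
move=> d0 d1; have [K K0 hK] := G_dec d0 d1; exists (4 * K); first by rewrite mulr_ge0.
move=> Y Y0; have Y1 : 0 < 1 + Y by rewrite ltr_pwDl.
have inl u y : 0 <= u <= 1 -> left_region c0 ((u * (c0 * (1 + y ^+ 2))) +i* y).
  move=> /andP[u0 u1]; have n0 : 0 <= c0 * (1 + y ^+ 2) by rewrite mulr_ge0 ?addr_ge0 ?sqr_ge0 // ltW.
  by split=> /=; [rewrite mulr_ge0 | rewrite ler_piMl].
have M0 : 0 <= K / (1 + Y) by rewrite divr_ge0 // ltW.
have := strip_shift (t1 := 0) (t2 := 1) (F := G d) C1par ler01 Y0 _ M0.
rewrite subr0 mulr1 -mulrA => H.
rewrite (@cint_eq _ _ _ (fun y => G d ((1 * (c0 * (1 + y ^+ 2))) +i* y) * ((1 * (c0 * (2 * y))) +i* 1))); last first.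
  by move=> y _; rewrite !mul1r.
rewrite (@cint_eq _ _ (fun y => G d (0 +i* y) * (0 +i* 1)) (fun y => G d ((0 * (c0 * (1 + y ^+ 2))) +i* y) * ((0 * (c0 * (2 * y))) +i* 1))); last first.
  by move=> y _; rewrite !mul0r.
apply: H => [u y u01 _|u y u01 yY]; first by apply: cG (proj1 (inl u y u01)) (hc (inl u y u01)).
set s := (_ +i* _); have sY : Y <= normc s by rewrite -yY; exact: (ler_normIm s).
have ns : 0 < 1 + normc s by rewrite ltr_pwDl ?normc_ge0.
rewrite normcM normc_real ger0_norm; last by rewrite mulr_ge0 ?addr_ge0 ?sqr_ge0 // ltW.
have y2E : y ^+ 2 = Y ^+ 2 by rewrite -yY real_normK ?num_real.
apply: le_trans (_ : K / (1 + normc s) ^+ 3 * (1 + normc s) ^+ 2 <= _).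
  apply: ler_pM; rewrite ?normc_ge0 ?mulr_ge0 ?addr_ge0 ?sqr_ge0 ?(ltW c00) //; first exact/hK/inl.
  rewrite y2E; apply: le_trans (_ : 1 + Y ^+ 2 <= _).
    by apply: ler_piMl; [rewrite addr_ge0 ?sqr_ge0 | move: c01 c00; lra].
  by nra.
rewrite (_ : _ * _ = K / (1 + normc s)); last by field; rewrite gt_eqF.
by rewrite ler_wpM2l // lef_pV2 ?posrE // lerD2l.
Qed.

(** On the axis [s ds = - y dy] and the polynomials are real, so [Im_quotient] with [e = y] gives
    both sign and size. *)
Let ImG d y : 0 < d -> 2 * d <= 1 ->
  t * (y * complex.Im (zet (squeeze d (0 +i* y)))) * B.[mu0 ^+ 2 - y ^+ 2] ^+ 2 / 2 / norm_poly.[mu0 ^+ 2 - y ^+ 2]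
   <= complex.Im (G d (0 +i* y) * (0 +i* 1)) /\ 0 <= complex.Im (G d (0 +i* y) * (0 +i* 1)).
Proof.
move=> d0 d1; set w := squeeze d (0 +i* y).
have w0 : 0 < complex.Re w by apply: lt_le_trans (Re_squeeze d0 d1 _).
have q0 : 0 < norm_poly.[mu0 ^+ 2 - y ^+ 2] by apply: norm_pos; rewrite gerBl sqr_ge0.
have E : G d (0 +i* y) * (0 +i* 1) = (- (y / norm_poly.[mu0 ^+ 2 - y ^+ 2]))%:C *
   (((A.[mu0 ^+ 2 - y ^+ 2])%:C + (B.[mu0 ^+ 2 - y ^+ 2])%:C * npos w) *
    ((A.[mu0 ^+ 2 - y ^+ 2])%:C - (B.[mu0 ^+ 2 - y ^+ 2])%:C * nneg w) / (npos w + nneg w)).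
  rewrite /G /GG /y1 /y2 /q4 /a4 /b4 !axis -/w -[nsum w]/(npos w + nneg w).
  have n0 : (norm_poly.[mu0 ^+ 2 - y ^+ 2])%:C != 0 :> C by rewrite -normc_gt0 normc_real normr_gt0 gt_eqF.
  have -> : (- (y / norm_poly.[mu0 ^+ 2 - y ^+ 2]))%:C = (0 +i* y) * (0 +i* 1) / (norm_poly.[mu0 ^+ 2 - y ^+ 2])%:C.
    apply: (mulIf n0); rewrite divfK // -rmorphM mulNr divfK ?gt_eqF //.
    by apply: complexP; rewrite ?ReM ?ImM /=; ring.
  by move: (_ * _ / (npos w + nneg w)) => x1; ring.
have ImR (a : R) X : complex.Im (a%:C * X) = a * complex.Im X by rewrite ImM /= mul0r addr0.
rewrite E ImR.
have [y0|y0] := eqVneq y 0; first by rewrite y0 !mul0r mulr0 !mul0r oppr0 mul0r.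
have yw : 0 < y * complex.Im w.
  rewrite /w squeezeE //= mulrA divr_gt0 //; last by rewrite (lt_le_trans ltr01) //; exact: (proj2 (sq_den_ge1 _ _ (lexx 0))).
  by rewrite mulrA mulr_gt0 // -?expr2 ?exprn_even_gt0 //; move: d0 d1; nra.
have yz := Im_zet_sign mu0 w0 yw.
have [b1 b2] := Im_branches hM1 t w0 yw.
have c0' : 0 <= t * (y * complex.Im (zet w)) by rewrite mulr_ge0 // ltW.
have H := Im_quotient A.[mu0 ^+ 2 - y ^+ 2] B.[mu0 ^+ 2 - y ^+ 2] c0' b1 b2 (nsum_neq0 hM1 t0 w0).
set X := complex.Im (_ / _) in H *; set c := t * _ in H c0' *.
have -> : - (y / norm_poly.[mu0 ^+ 2 - y ^+ 2]) * X = - (y * X) / norm_poly.[mu0 ^+ 2 - y ^+ 2].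
  by move: X {H} => X; ring.
have bb : 0 <= c * B.[mu0 ^+ 2 - y ^+ 2] ^+ 2 / 2 by rewrite divr_ge0 // mulr_ge0 // sqr_ge0.
split; first by rewrite ler_pM2r ?invr_gt0 // lerNr.
by rewrite divr_ge0 ?(ltW q0) // oppr_ge0; apply: le_trans H _; rewrite oppr_le0.
Qed.

Let pcont_par' y : pcont par' y. Proof. exact: graph_pcont' C1par. Qed.
Let pcont_par y : pcont par y. Proof. exact: graph_pcont C1par. Qed.

(** Dominated by [rc_decay], as the arc speed is at least 1. *)
Let decay_int : leb.-integrable setT (EFin \o (fun y : R => (1 + y ^+ 2)^-1)).
Proof.
apply: (@integrable_le _ _ (fun y => arc_speed omega y * decay y)) (rc_decay hC).
  apply: continuous_measurable_fun => y; apply: cvgV; first by rewrite gt_eqF // ltr_pwDl // sqr_ge0.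
  by apply: cvgD; [exact: cvg_cst | exact: exprn_continuous].
move=> y; rewrite ger0_norm ?invr_ge0 ?addr_ge0 ?sqr_ge0 //.
by apply: ler_peMl; [rewrite /decay invr_ge0 addr_ge0 ?sqr_ge0 | exact: speed_ge1].
Qed.

(** On the parabola [|s|] is at least [c0 (1 + y^2)], while [|ds|] is at most [2 (1 + y^2) dy]. *)
Let par_bound K y : 0 <= K -> K / (1 + normc (par y)) ^+ 2 * normc (par' y) <= 2 * K / c0 ^+ 2 * (1 + y ^+ 2)^-1.
Proof.
move=> K0; set E := 1 + y ^+ 2; have E1 : 1 <= E by rewrite lerDl sqr_ge0.
have E0 : 0 < E by exact: lt_le_trans E1.
have n1 : c0 * E <= 1 + normc (par y).
  by apply: le_trans (_ : normc (par y) <= _); [apply: le_trans (ler_norm _) (ler_normRe (par y)) | rewrite lerDr].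
have n2 : normc (par' y) <= 2 * E.
  apply: le_trans (normc_le_ReIm _) _; rewrite /= normr1 normrM (gtr0_norm c00) normrM normr_nat.
  have := normr_ge0 y; have : y ^+ 2 = `|y| ^+ 2 by rewrite real_normK ?num_real.
  by rewrite /E => ->; move: `|y| => x x0; move: c00 c01 => a b; have := sqr_ge0 (x - 1); nra.
have cE : 0 < c0 * E by rewrite mulr_gt0.
apply: le_trans (_ : K / (c0 * E) ^+ 2 * (2 * E) <= _); last first.
  by rewrite le_eqVlt; apply/orP; left; apply/eqP; field; rewrite !gt_eqF.
apply: ler_pM; rewrite ?divr_ge0 ?exprn_ge0 ?addr_ge0 ?normc_ge0 //.
rewrite ler_wpM2l // lef_pV2 ?posrE ?exprn_gt0 ?ltr_pwDl ?normc_ge0 //.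
by rewrite ler_pXn2r ?nnegrE ?addr_ge0 ?normc_ge0 // ltW.
Qed.

Let par_img y : c0 * (1 + complex.Im (par y) ^+ 2) <= complex.Re (par y). Proof. by []. Qed.

(** The integrand is F, analytic and [O(s^-2)] to the right of the parabola, so the path can be
    pushed to infinity. *)
Let cint_G0 (K : R) : 0 <= K -> (forall y, normc (GG (par y) (par y)) <= K / (1 + normc (par y)) ^+ 2) ->
  cint setT (fun y => GG (par y) (par y) * par' y) = 0.
Proof.
move=> K0 hK; have [K1 [r [K10 dec1]]] := GG_dec.
have E y : GG (par y) (par y) * par' y = F ((1 * (c0 * (1 + y ^+ 2))) +i* y) * ((1 * (c0 * (2 * y))) +i* 1).
  by rewrite !mul1r FG //; [exact: par_pos (par_img y) | exact: hc].
rewrite (_ : (fun y => _) = fun y => F ((1 * (c0 * (1 + y ^+ 2))) +i* y) * ((1 * (c0 * (2 * y))) +i* 1)); last first.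
  by apply/funext => y; rewrite E.
have inr u y : 0 <= u -> c0 * (1 + y ^+ 2) <= 1 * (c0 * (1 + y ^+ 2) + u) by rewrite mul1r lerDl.
apply: (@half_zero _ 1 _ _ F K1 r _ C1par) => //.
- by rewrite normr1.
- by move=> y; rewrite mulr_ge0 ?addr_ge0 ?sqr_ge0 // ltW.
- by move=> u y u0; apply: cF; apply: par_pos; exact: inr.
- move=> u y u0; set s := (_ +i* _) => rs'.
  have hs : c0 * (1 + complex.Im s ^+ 2) <= complex.Re s by exact: inr.
  have [|q0 le] := dec1 s s hs hs _ (or_intror rs'); first by rewrite lerDl.
  have s0 := par_pos hs; have ns : 0 < normc s by apply: lt_le_trans s0 (le_trans (ler_norm _) (ler_normRe _)).
  rewrite -(FG s0 q0); apply: le_trans le _.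
  rewrite ler_wpM2l // lef_pV2 ?posrE ?exprn_gt0 ?ltr_pwDl ?normc_ge0 //.
  by rewrite ler_pXn2r ?nnegrE ?addr_ge0 ?normc_ge0 // lerDr.
- apply: (@pmeas_cintegrable _ _ (fun y => 2 * K / c0 ^+ 2 * (1 + y ^+ 2)^-1)).
  + apply: pmeas_cont => y; rewrite -[X in pcont X]/(fun y => _).
    apply: (@pcont_eq _ (fun y => F (par y) * par' y)) => [x|]; first by rewrite !mul1r.
    apply: pcont_mul (pcont_par' y); apply: (@pcont_comp _ F) (pcont_par y) _.
    by apply/cdiff_ccont/cF; exact: par_pos (par_img y).
  + move=> y; rewrite -E normcM; apply: le_trans (par_bound y K0).
    by rewrite ler_wpM2r ?normc_ge0.
  + exact: integrableZE.
Qed.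

(** A non-zero polynomial has a non-root with ordinate between [mu0 + 2] and [mu0 + 3], and
    continuity gives a whole interval. There [Im_zet_squeeze] makes the lower bound of [ImG]
    independent of d. *)
Let axis_lower : B != 0 -> exists a b c : R, [/\ a < b, b <= mu0 + 3, 0 < a, 0 < c &
  forall d Y, 0 < d -> 2 * d <= 1 -> d * (1 + (mu0 + 3) ^+ 2) <= 8^-1 -> mu0 + 3 <= Y ->
    c * (b - a) <= complex.Im (cint `[- Y, Y] (fun y => G d (0 +i* y) * (0 +i* 1)))].
Proof.
move=> B0; pose Bs := B \Po ((mu0 ^+ 2)%:P - 'X^2).
have BsE y : Bs.[y] = B.[mu0 ^+ 2 - y ^+ 2] by rewrite /Bs horner_comp hornerD hornerN hornerXn hornerC.
have Bs0 : Bs != 0.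
  by rewrite /Bs comp_poly_eq0 // -opprB size_polyN -polyCN size_XnaddC.
have [|y0 /andP[y01 y02] By] := poly_nonroot_itv (a := mu0 + 2) (b := mu0 + 3) Bs0; first by lra.
rewrite BsE in By.
have q0 y : 0 < norm_poly.[mu0 ^+ 2 - y ^+ 2] by apply: norm_pos; rewrite gerBl sqr_ge0.
pose v y := B.[mu0 ^+ 2 - y ^+ 2] ^+ 2 / norm_poly.[mu0 ^+ 2 - y ^+ 2].
have v0 : 0 < v y0 by rewrite divr_gt0 // exprn_even_gt0.
have fE y : b4.[0 +i* y] ^+ 2 / q4.[0 +i* y] = (v y)%:C.
  by rewrite /b4 /q4 !axis -fmorphV -rmorphXn -rmorphM.
have cf : ccont (fun s => b4.[s] ^+ 2 / q4.[s]) (0 +i* y0).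
  by apply/cdiff_ccont/cdiff_div; [apply/cdiff_exp/cdiff_poly | exact: cdiff_poly | exact/hc/axis_left].
have [|r r0 hr] := cf (v y0 / 2); first by rewrite divr_gt0.
have near y : `|y - y0| < r -> v y0 / 2 <= v y.
  move=> yr; have := hr (0 +i* (y - y0)).
  have -> : (0 +i* y0) + (0 +i* (y - y0)) = 0 +i* y :> C by apply: complexP; rewrite ?ReD ?ImD /= ?addr0 // addrC subrK.
  rewrite !fE -rmorphB normc_real => H; apply/ltW; rewrite -subr_gt0.
  have : `|v y - v y0| < v y0 / 2.
    by apply: H; rewrite (_ : _ +i* _ = 'i * (y - y0)%:C) ?normcM ?normc_real //;
      [rewrite (_ : normc 'i = 1) ?mul1r // /normc /= expr0n /= add0r expr1n sqrtr1 | apply: complexP; rewrite ?ReM ?ImM /=; ring].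
  by rewrite ltr_norml => /andP[h1 _]; lra.
pose b := Num.min (mu0 + 3) (y0 + r / 2).
have b1 : b <= mu0 + 3 by rewrite ge_min lexx.
have b2 : b <= y0 + r / 2 by rewrite ge_min lexx orbT.
exists y0, b, (t * v y0 / 4); split => //.
- by rewrite lt_min y02 ltrDl divr_gt0.
- by move: mu0_ge0; lra.
- by rewrite divr_gt0 // mulr_gt0.
move=> d Y d0 d1 d2 hY; apply: Im_cint_ge.
- by move: mu0_ge0; lra.
- by rewrite le_min (ltW y02) lerDl divr_ge0 // ltW.
- exact: le_trans hY.
- move=> y; apply: pcont_mul; last exact: pcont_cst.
  apply: (@pcont_comp _ (G d)); first exact: graph_pcont (C1_cst 0).
  by apply/cdiff_ccont; apply: cG => //; exact/hc/axis_left.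
- by move=> y; have [] := ImG y d0 d1.
move=> y /andP[ya yb]; have [h1 _] := ImG y d0 d1; apply: le_trans h1.
have I1 : 1 <= complex.Im (zet (squeeze d (0 +i* y))).
  by apply: Im_zet_squeeze => //; move: ya yb b1; lra.
have yI : 1 <= y * complex.Im (zet (squeeze d (0 +i* y))).
  have yy : 1 <= y by move: mu0_ge0; lra.
  by apply: (le_trans yy); apply: ler_peMr => //; apply: le_trans yy.
have vy : v y0 / 2 <= v y.
  by apply: near; rewrite ger0_norm ?subr_ge0 //; lra.
rewrite (_ : _ / norm_poly.[_] = t * ((y * complex.Im (zet (squeeze d (0 +i* y)))) * v y / 2)); last by rewrite /v; ring.
rewrite -mulrA ler_pM2l //; have : v y <= y * complex.Im (zet (squeeze d (0 +i* y))) * v y.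
  by apply: ler_peMl => //; lra.
by lra.
Qed.

(** If B is non-zero, the axis integrals have imaginary part at least [c (b - a)] for all small d.
    They equal the parabola integrals, which tend to the integral of F as d -> 0, and that is
    zero. *)
Lemma kernel_parabola : B = 0.
Proof.
apply: contrapT => /eqP /axis_lower[a [b [c [ab b3 a0 cc low]]]].
pose d0 := 8^-1 / (1 + (mu0 + 3) ^+ 2).
have n0 : 0 < 1 + (mu0 + 3) ^+ 2 by rewrite ltr_pwDl // sqr_ge0.
have d00 : 0 < d0 by rewrite divr_gt0.
pose d n := d0 / (n.+1)%:R.
have dn0 n : 0 < d n by rewrite divr_gt0 // ltr0n.
have dn n : d n <= d0.
  by rewrite ler_pdivrMr ?ltr0n //; apply: ler_peMr; rewrite ?(ltW d00) // ler1n.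
have dd n : d n * (1 + (mu0 + 3) ^+ 2) <= 8^-1.
  by apply: le_trans (_ : d0 * (1 + (mu0 + 3) ^+ 2) <= _); [rewrite ler_pM2r | rewrite divfK ?gt_eqF].
have dd1 n : 2 * d n <= 1.
  have : d n <= 8^-1 by apply: le_trans (dd n); apply: ler_peMr; [rewrite ltW | rewrite lerDl sqr_ge0].
  by lra.
have [K [r [K0 dec1]]] := GG_dec.
pose g n y := G (d n) (par y) * par' y; pose g0 y := GG (par y) (par y) * par' y.
have par0 y : 0 <= complex.Re (par y) by exact: (proj1 (par_left y)).
have gb n y : normc (g n y) <= 2 * K / c0 ^+ 2 * (1 + y ^+ 2)^-1.
  rewrite /g normcM; apply: le_trans (par_bound y K0); rewrite ler_wpM2r ?normc_ge0 //.
  have [||_ //] := dec1 (par y) (squeeze (d n) (par y)) (par_img y) _ _ (or_introl (par_left y)).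
    by apply: squeeze_parabola => //; exact: par_img.
  exact: normc_squeeze_le.
have bI : leb.-integrable setT (EFin \o (fun y : R => 2 * K / c0 ^+ 2 * (1 + y ^+ 2)^-1)).
  exact: integrableZE.
have gI n : cintegrable setT (g n).
  apply: (@pmeas_cintegrable _ _ (fun y => 2 * K / c0 ^+ 2 * (1 + y ^+ 2)^-1)) => //.
  apply: pmeas_cont => y; apply: pcont_mul (pcont_par' y); apply: (@pcont_comp _ (G (d n))) (pcont_par y) _.
  by apply/cdiff_ccont/cG => //; exact/hc/par_left.
have lim y : setT y -> forall e : R, 0 < e -> exists N, forall n, (N <= n)%N -> normc (g n y - g0 y) <= e.
  move=> _ e e0; have s0 := par_pos (par_img y).
  have qs := hc (par_left y).
  have cw : ccont (fun w => GG (par y) w * par' y) (par y).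
    apply: ccont_mul; last exact/cdiff_ccont/cdiff_cst.
    apply/cdiff_ccont; apply: cdiff_mul; last exact: cdiff_cst.
    apply: cdiff_mul; first exact: cdiff_cst.
    apply: cdiff_div; last exact: (nsum_neq0 hM1 t0).
      apply: cdiff_mul.
        by apply: cdiff_add; [exact: cdiff_cst | apply: cdiff_mul; [exact: cdiff_cst | exact: (cdiff_npos hm)]].
      by apply: cdiff_sub; [exact: cdiff_cst | apply: cdiff_mul; [exact: cdiff_cst | exact: (cdiff_nneg hm)]].
    by apply: cdiff_add; [exact: (cdiff_npos hm) | exact: (cdiff_nneg hm)].
  have [rr rr0 hrr] := cw e e0.
  have [N hN] := nat_above (d0 * (1 + normc (par y) ^+ 2) / rr).
  exists N => n Nn.
  have := hrr (squeeze (d n) (par y) - par y); rewrite [par y + _]addrC subrK => H; apply/ltW/H.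
  apply: le_lt_trans (squeeze_close (dn0 n) (par0 y)) _.
  rewrite /d mulrAC ltr_pdivrMr ?ltr0n // [rr * _]mulrC -ltr_pdivrMr //.
  by apply: le_lt_trans hN _; rewrite ltr_nat ltnS.
have [_ cv] := complex_DCT measurableT gI lim bI (fun n y _ => gb n y).
have g00 : cint setT g0 = 0.
  apply: (cint_G0 K0) => y.
  have [|_ //] := dec1 (par y) (par y) (par_img y) (par_img y) _ (or_introl (par_left y)).
  by rewrite lerDl.
have cba : 0 < c * (b - a) by rewrite mulr_gt0 // subr_gt0.
(* Y goes to infinity at fixed d, since the constant of [shift] depends on d; half of the lower
   bound is given up for the two errors. *)
have Imn n : c * (b - a) / 2 <= complex.Im (cint setT (g n)).
  have e0 : 0 < c * (b - a) / 4 by rewrite divr_gt0.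
  have [N1 h1] := cint_lim (gI n) e0; have [K2 K20 h2] := shift (dn0 n) (dd1 n).
  have [N2 h3] := nat_above (K2 / (c * (b - a) / 4)); have [N3 h4] := nat_above (mu0 + 3).
  pose Y := (N1 + N2 + N3)%N.
  have := h1 Y; rewrite /Y -addnA leq_addr => /(_ isT); rewrite addnA -/Y => i1.
  have Yr : 0 <= Y%:R :> R by rewrite ler0n.
  have i2 := h2 _ Yr.
  have i3 : K2 / (1 + Y%:R) <= c * (b - a) / 4.
    rewrite ler_pdivrMr ?ltr_pwDl // mulrC -ler_pdivrMr //; apply: le_trans h3 _.
    by apply: le_trans (_ : Y%:R <= _); [rewrite ler_nat /Y addnAC leq_addl | rewrite lerDr].
  have i4 : mu0 + 3 <= Y%:R by apply: le_trans h4 _; rewrite ler_nat /Y leq_addl.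
  have i5 := low (d n) _ (dn0 n) (dd1 n) (dd n) i4.
  have := le_trans (ler_normIm _) i1; have := le_trans (ler_normIm _) (le_trans i2 i3).
  rewrite !ImD !ImN -/(g n); move: (complex.Im _) (complex.Im _) (complex.Im _) i5 => x1 x2 x3 i5.
  by rewrite !ler_norml => /andP[? ?] /andP[? ?]; lra.
have e0 : 0 < c * (b - a) / 4 by rewrite divr_gt0.
have [N /(_ N (leqnn N))] := cv _ e0; rewrite g00 subr0 => le.
have := le_trans (ler_normIm _) le; have := Imn N; have := ler_norm (complex.Im (cint setT (g N))).
by lra.
Qed.

End Parabola.

Lemma kernel_eq0 : B = 0.
Proof.
have [c0 [c00 c01 hc]] := poly_parabola q40 q4_root.
by apply: (kernel_parabola c00 c01) => s [s0 s1]; exact: hc.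
Qed.

End Kernel.

(** * Nonnegative determinants and real rational functions *)

Section Positivity.
Context {R : realType}.
Local Notation C := R[i].
Local Notation RC := (real_complex R).
Variables (omega : R -> R) (W mu0 : R).
Hypothesis hC : regular_curve omega W.
Hypothesis hH : hardy_decomposition omega.
Hypothesis hI : forall x : R, `|x| <= mu0 -> Dplus omega x%:C.
Hypothesis mu0_ge0 : 0 <= mu0.
Variables (L : nat) (m : C -> C).
Hypothesis hL : (2 <= L)%N.
Hypothesis hm : analytic_on (m_domain mu0) m.
Hypothesis hM1 : m_positivity mu0 m.
Hypothesis hM2 : m_asymptotics omega L m.
Local Notation dom := (m_domain mu0).
Local Notation interpolates := (interpolates omega mu0 m).

Lemma map_evp n (u : 'rV[R]_n) : map_poly RC (evp u) = evp (map_mx RC u).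
Proof. by rewrite rmorph_sum /=; apply: eq_bigr => i _; rewrite linearZ /= map_polyXn mxE. Qed.

Lemma map_odp n (u : 'rV[R]_n) : map_poly RC (odp u) = odp (map_mx RC u).
Proof. by rewrite rmorph_sum /=; apply: eq_bigr => i _; rewrite linearZ /= map_polyXn mxE. Qed.

(** [evp] and [odp] keep the powers of z, whereas [even_poly] and [odd_poly] are polynomials in
    [z^2]. The factor z of the second identity is cancelled where z is non-zero. *)
Lemma horner_parts n (u : 'rV[R]_n) (z : C) :
  (map_poly RC (evp u)).[z] = (map_poly RC (even_poly (rVpoly u))).[z ^+ 2] /\
  z * (map_poly RC (odp u)).[z] = z * (map_poly RC (odd_poly (rVpoly u))).[z ^+ 2].
Proof.
have E w : (map_poly RC (rVpoly u)).[w] = (map_poly RC (evp u)).[w] + w * (map_poly RC (odp u)).[w].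
  by rewrite rVpoly_parts rmorphD rmorphM /= map_polyX hornerD hornerM hornerX.
have E' w : (map_poly RC (rVpoly u)).[w] = (map_poly RC (even_poly (rVpoly u))).[w ^+ 2] + (map_poly RC (odd_poly (rVpoly u))).[w ^+ 2] * w.
  rewrite -{1}[rVpoly u]poly_even_odd rmorphD rmorphM /= !map_comp_poly /= map_polyX map_polyXn.
  by rewrite hornerD hornerM !horner_comp hornerX hornerXn.
have := E z; have := E (- z); rewrite !E' sqrrN !map_evp !map_odp horner_evpN horner_odpN.
move: (_.[_]) (_.[_]) (_.[_]) (_.[_]) => x1 x2 x3 x4 h1 h2.
have n2 : (2 : C) != 0 by rewrite pnatr_eq0.
have e1 : x2 = x4.
  apply: (mulfI n2); have -> : 2 * x2 = (x2 + z * x1) + (x2 + - z * x1) by ring.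
  by rewrite -h1 -h2; ring.
by split=> //; move: h2; rewrite e1 => /addrI <-; rewrite mulrC.
Qed.

(** Adding [t U] to the eigenvalue equation makes [(1 + t) U_e + (U_o / z) (rho + t z)] divisible by
    Q, which is the relation of [kernel_eq0]. So [U_o = 0], and then [U_e], of degree below that of
    Q, equals [- t U_e]. *)
Lemma xmat_eigen k s Q rho h (t : R) (u : 'rV[R]_(k + k)) : interpolates s Q rho h -> size s = (k + k)%N -> 0 < t ->
  u *m xmat (k + k) Q rho = (- t) *: u -> u = 0.
Proof.
case: k u => [|j] u hint ss t0 uX; first by apply/rowP => -[].
have [sD QE srho mE hd] := hint.
have sQ : size Q = (j.+1 + j.+1).+1 by rewrite -(size_map_poly RC) QE size_prodX ss.
pose V := rVpoly u; pose Wd := (evp u + odp u * rho) %/ Q.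
have mod_ : (evp u + odp u * rho) %% Q = (- t) *: V by rewrite -(xmatP _ _ sQ) uX linearZ.
have key : (1 + t) *: evp u + odp u * (rho + t *: 'X) = Q * Wd.
  have := divp_eq (evp u + odp u * rho) Q; rewrite mod_ -/Wd /V rVpoly_parts => E.
  have -> : Q * Wd = evp u + odp u * rho + t *: (evp u + 'X * odp u) by rewrite E mulrC scaleNr addrNK.
  by rewrite scalerDl scale1r -!mul_polyC; ring.
have sV : (size V <= j.+1 + j.+1)%N by exact: size_poly.
have o0 : odd_poly V = 0.
  apply: (@kernel_eq0 R omega W mu0 hC hI mu0_ge0 L m hL hm hM1 hM2 t t0 j ((1 + t) *: even_poly V) (odd_poly V) Q s
    (fun z => (map_poly RC Wd).[z] + (map_poly RC (odp u)).[z] * h z)) => //.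
  - apply: leq_trans (size_scale_leq _ _) _; apply: leq_trans (size_even_poly _) _.
    by move: sV; move: (size V) => x; lia.
  - apply: leq_trans (size_odd_poly _) _.
    by move: sV; move: (size V) => x; lia.
  - move=> z dz; apply: cdiff_add; first exact: cdiff_poly.
    by apply: cdiff_mul; [exact: cdiff_poly | exact: hd].
  - move=> z dz; have z0 : z != 0 by case: dz => + _; apply: contraNneq => ->.
    have [e1 /(mulfI z0) e2] := horner_parts u z.
    rewrite linearZ /= hornerZ -/V in e1 e2 *; rewrite -e1 -e2.
    have := congr1 (fun p => (map_poly RC p).[z]) key.
    rewrite rmorphD !rmorphM /= rmorphD /= !map_polyZ /= map_polyX !(hornerD, hornerM, hornerZ) hornerX => E.
    by rewrite [RHS]mulrDr -E /mt (mE _ dz); ring.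
have odp0 : odp u = 0.
  apply: big1 => i oi; have := congr1 (fun r : {poly R} => r`_(i./2)) o0; rewrite coef_odd_poly coef0.
  have -> : (i./2.*2.+1 = i)%N by rewrite -[RHS]odd_double_half oi.
  by rewrite /V coef_rVpoly_ord => ->; rewrite scale0r.
have VE : V = evp u by rewrite /V rVpoly_parts odp0 mulr0 addr0.
move: mod_; rewrite odp0 mul0r addr0 -VE modp_small ?sQ ?ltnS // => E.
have V0 : V = 0.
  have : (1 + t) *: V = 0 by rewrite scalerDl scale1r {1}E scaleNr addNr.
  by move/eqP; rewrite scaler_eq0 gt_eqF ?addr_gt0 // => /eqP.
by rewrite -[u]rVpolyK -/V V0 linear0.
Qed.

(** The polynomial [det (x + X)] in x is monic, so a negative value at 0 forces a positive root,
    excluded by [xmat_eigen]. *)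
Lemma xmat_det_ge0 k s Q rho h : interpolates s Q rho h -> size s = (k + k)%N ->
  0 <= \det (xmat (k + k) Q rho).
Proof.
move=> hint ss; set X := xmat _ _ _; rewrite leNgt; apply/negP => neg.
pose p := char_poly (- X).
have p0 : p.[0] = \det X.
  rewrite horner_coef0 char_poly_det.
  have -> : - X = -1 *: X by rewrite scaleN1r.
  rewrite detZ mulrA -exprD addnn -mul2n exprM sqrrN !expr1n.
  by rewrite mul1r.
have pm : p \is monic by exact: char_poly_monic.
have [|x hx] := @polyrcf.poly_pinfty_gt_lc _ p; first by rewrite (monicP pm).
pose y := Num.max x 0.
have [||z /andP[z0 _] rz] := @poly_ivt R p 0 y; first by rewrite le_max lexx orbT.
  rewrite p0 (ltW neg) (monicP pm) in hx *.
  by apply: le_trans (hx y _); rewrite ?ler01 // le_max lexx.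
have z1 : 0 < z.
  by rewrite lt_neqAle z0 andbT; apply: contraTneq rz => <-; rewrite rootE p0 lt_eqF.
have : eigenvalue (- X) z by rewrite eigenvalue_root_char.
move=> /eigenvalueP[v vX /eqP v0]; apply: v0; apply: (xmat_eigen hint ss z1).
by rewrite scaleNr -vX mulmxN opprK.
Qed.

Definition conj_poly (p : {poly C}) := map_poly conjc p.

Lemma horner_conj_poly (p : {poly C}) z : (conj_poly p).[z] = conjc p.[conjc z].
Proof. by rewrite -[in LHS](conjcK z) horner_map. Qed.

Lemma conj_poly_real (p : {poly C}) : conj_poly p = p -> map_poly RC (re_poly p) = p.
Proof.
move=> E; apply/polyP => i; rewrite coef_map /= coef_re_poly.
by have := congr1 (fun r : {poly C} => r`_i) E; rewrite coef_map /=; case: (p`_i) => a b /= [] /eqP; rewrite eq_sym -addr_eq0 -mulr2n mulrn_eq0 => /eqP->.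
Qed.

Lemma prodX_opp (s : seq C) : prodX [seq - z | z <- s] = (-1) ^+ size s *: (prodX s \Po - 'X).
Proof.
elim: s => [|a s IH]; first by rewrite /prodX !big_nil comp_polyC scale1r.
rewrite /prodX /= !big_cons -/(prodX _) -/(prodX s) IH comp_polyM comp_polyB comp_polyX comp_polyC.
by rewrite rmorphN opprK exprS mulN1r scaleNr -scalerAr -scalerN; congr (_ *: _); ring.
Qed.

Section Final.
Variables p q : {poly C}.
Hypothesis pq : balanced_rat omega p q.
Hypothesis rpq : forall z, ratfun p q z = conjc (ratfun p q (conjc z)).

(** Reality of the quotient only gives the cross relation [cz] between numerator and denominator. By
    coprimality each monic factor then divides its own conjugate, which has the same degree and is
    monic, so the two are equal. *)
Lemma real_factors : exists (ps qs : seq C) (c0 : C) (P Q : {poly R}),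
  [/\ c0 != 0, size ps = size qs,
      (forall z, z \in ps -> Dminus omega z) /\ (forall z, z \in qs -> Dminus omega z),
      (forall z, ratfun p q z = c0 * ((prodX ps).[z] / (prodX qs).[z])) &
      map_poly RC P = prodX ps /\ map_poly RC Q = prodX qs].
Proof.
have [p0 q0 cpq spq rD] := pq.
have [ps pE] := poly_factor p; have [qs qE] := poly_factor q.
have lp : lead_coef p != 0 by rewrite lead_coef_eq0.
have lq : lead_coef q != 0 by rewrite lead_coef_eq0.
rewrite -/(prodX ps) in pE; rewrite -/(prodX qs) in qE.
have psD z : z \in ps -> Dminus omega z.
  by move=> zs; apply: rD; rewrite pE rootZ // root_prod_XsubC zs.
have qsD z : z \in qs -> Dminus omega z.
  by move=> zs; apply: rD; rewrite qE rootZ // root_prod_XsubC zs orbT.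
pose c0 := lead_coef p / lead_coef q.
have c00 : c0 != 0 by rewrite mulf_neq0 // invr_eq0.
have rE z : ratfun p q z = c0 * ((prodX ps).[z] / (prodX qs).[z]).
  by rewrite /ratfun {1}pE {1}qE !hornerZ invfM /c0; ring.
clearbody c0.
have cop : coprimep (prodX ps) (prodX qs).
  by move: cpq; rewrite {1}pE qE coprimepZl // coprimepZr.
have sz : size ps = size qs.
  by apply: succn_inj; rewrite -!size_prodX -(size_scale (prodX ps) lp) -pE spq {1}qE size_scale.
have cz : c0 *: (prodX ps * conj_poly (prodX qs)) = conjc c0 *: (conj_poly (prodX ps) * prodX qs).
  (* The identity is checked at points of the curve, where no denominator vanishes and conjugation
     maps the branch to itself. *)
  apply/eqP; rewrite -subr_eq0; apply/eqP; apply: (@poly_ae0 _ omega); apply: aeW => y.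
  rewrite !(hornerD, hornerN, hornerZ, hornerM) !horner_conj_poly.
  have := rpq (curve_pt omega true y); rewrite !rE.
  have q1 := prodX_curve hC true y qsD.
  have q2 := prodX_curve hC true (- y) qsD.
  have -> : conjc (curve_pt omega true y) = curve_pt omega true (- y).
    by rewrite /curve_pt (rc_even hC).
  have q3 : conjc (prodX qs).[curve_pt omega true (- y)] != 0 by rewrite conjc_eq0.
  set P1 := (prodX ps).[_]; set Q1 := (prodX qs).[curve_pt omega true y] in q1 *.
  set P2 := (prodX ps).[curve_pt omega true (- y)]; set Q2 := (prodX qs).[_] in q3 *.
  rewrite !rmorphM /= (_ : conjc Q2^-1 = (conjc Q2)^-1) => [E|]; last exact: fmorphV.
  have -> : c0 * (P1 * conjc Q2) = c0 * (P1 / Q1) * Q1 * conjc Q2 by field.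
  by rewrite E; field.
have smap (r : {poly C}) : size (conj_poly r) = size r by rewrite size_map_poly.
have mmap (r : {poly C}) : r \is monic -> conj_poly r \is monic by rewrite map_monic.
have mX (s : seq C) : prodX s \is monic by exact: monic_prod_XsubC.
have invar (r : {poly C}) : r \is monic -> r %| conj_poly r -> conj_poly r = r.
  move=> mr dr; apply/esym/eqP; rewrite -eqp_monic ?mmap // -dvdp_size_eqp // smap //.
have Pr : conj_poly (prodX ps) = prodX ps.
  apply: invar => //; rewrite -(Gauss_dvdpl _ cop).
  rewrite -(dvdpZr _ _ (_ : conjc c0 != 0)) ?conjc_eq0 // -cz dvdpZr // dvdp_mulr //.
have Qr : conj_poly (prodX qs) = prodX qs.
  apply: invar => //; rewrite -(Gauss_dvdpr _ (_ : coprimep _ (prodX ps))) 1?coprimep_sym //.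
  rewrite -(dvdpZr _ _ c00) cz dvdpZr ?conjc_eq0 // dvdp_mull //.
exists ps, qs, c0, (re_poly (prodX ps)), (re_poly (prodX qs)); split=> //.
by split; exact: conj_poly_real.
Qed.

Lemma tau_pos : exists2 t, is_tau omega L (m_symbol m) (ratfun p q) t & 0 <= t.
Proof.
have [ps [qs [c0 [P [Q [c00 sz [psD qsD] rE [PE QE]]]]]]] := real_factors.
pose ms := [seq - z | z <- ps].
have msD z : z \in ms -> Dminus omega z.
  by move=> /mapP[w /psD]; rewrite /Dminus /= => hw ->; rewrite ReN ImN normrN (rc_even hC).
have prod_cat (s1 s2 : seq C) : prodX (s1 ++ s2) = prodX s1 * prodX s2 by rewrite /prodX big_cat.
have catD (s1 : seq C) : (forall z, z \in s1 -> Dminus omega z) -> forall z, z \in s1 ++ ms -> Dminus omega z.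
  by move=> h z; rewrite mem_cat => /orP[/h|/msD].
pose M : {poly R} := (-1) ^+ size ps *: (P \Po - 'X).
have ME : map_poly RC M = prodX ms.
  by rewrite prodX_opp map_polyZ /= rmorphXn rmorphN rmorph1 map_comp_poly /= rmorphN /= map_polyX PE.
have [rhoD [hD iD]] := hermite_real hC hI hm hM1 (Q := P * M) (catD _ psD) (etrans (rmorphM _ _ _) (etrans (congr2 *%R PE ME) (esym (prod_cat _ _)))).
have [rhoQ [hQ iQ]] := hermite_real hC hI hm hM1 (Q := Q * M) (catD _ qsD) (etrans (rmorphM _ _ _) (etrans (congr2 *%R QE ME) (esym (prod_cat _ _)))).
have s1 : size (ps ++ ms) = (size ps + size ps)%N by rewrite size_cat size_map.
have s2 : size (qs ++ ms) = (size ps + size ps)%N by rewrite size_cat size_map sz.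
exact: (tau_nonneg hC hH hI hL hm hM1 hM2 c00 erefl (esym sz) psD qsD rE iD iQ (xmat_det_ge0 iD s1) (xmat_det_ge0 iQ s2)).
Qed.

End Final.
End Positivity.

Theorem theorem1 (R : realType) (lambda0 : R) (hlambda0 : lambda0 < 0)
    (n : nat) (hn : odd n) (omega : R -> R)
    (hC : curve_setup (Num.sqrt (- lambda0)) n omega)
    (hH : hardy_decomposition omega)
    (L : nat) (hL : (2 <= L)%N) (m : complex R -> complex R)
    (hm : analytic_on (m_domain (Num.sqrt (- lambda0))) m)
    (hM1 : m_positivity (Num.sqrt (- lambda0)) m)
    (hM2 : m_asymptotics omega L m) :
  vsymbol_inv_plus omega L (m_symbol m) /\
  is_mfunction omega L (m_symbol m) m.
Proof.
have [W rc] := curve_setup_regular hC; have hI := curve_interval hC.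
split; last exact: (m_mfunction rc hH hI hL hm hM2).
split; first exact: (m_vsymbol_inv rc hH hI hL hm hM1 hM2).
  exact: (m_symbol_real rc hI hM1).
move=> p q pq rpq; exact: (tau_pos rc hH hI (sqrtr_ge0 _) hL hm hM1 hM2 pq rpq).
Qed.
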